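(* Let $0<p\le q<\infty$, $0<r<1$, $\omega\in\mathcal{D}$, let $\varphi,\psi$ be holomorphic self-maps of $\mathbb{B}_n$, $u,v$ weights (Borel functions on $\mathbb{B}_n$), and $\mu$ a positive Borel measure on $\mathbb{B}_n$. If $uC_\varphi-vC_\psi:A^p_\omega\to L^q_\mu$ is bounded (respectively compact), then both measures $\eta_{\varphi,u}+\sigma_{\varphi,r}$ and $\eta_{\psi,v}+\sigma_{\psi,r}$ are $q$-Carleson measures (respectively vanishing $q$-Carleson measures) for $A^p_\omega$, where $$\eta_{\varphi,u}=(|\rho u|^qd\mu)\circ\varphi^{-1},\ \eta_{\psi,v}=(|\rho v|^qd\mu)\circ\psi^{-1},\ \sigma_{\varphi,r}=(\chi_{G_r}|u-v|^qd\mu)\circ\varphi^{-1},\ \sigma_{\psi,r}=(\chi_{G_r}|u-v|^qd\mu)\circ\psi^{-1},$$ with $\rho(z)=\rho(\varphi(z),\psi(z))$ and $G_r=\{z:\rho(z)<r\}$.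
   Context: $\mathbb{B}_n$ is the open unit ball of $\mathbb{C}^n$, $dV$ the normalized volume measure. A radial weight is a positive, measurable, integrable $\omega$ with $\omega(z)=\omega(|z|)$; $\hat\omega(r)=\int_r^1\omega(s)ds$. $\omega\in\hat{\mathcal D}$ if there is $C\ge1$ with $\hat\omega(r)\le C\hat\omega(\frac{1+r}{2})$ for all $r\in[0,1)$; $\omega\in\check{\mathcal D}$ if there are $C,K>1$ with $\hat\omega(r)\ge C\hat\omega(1-\frac{1-r}{K})$ for all $r\in[0,1)$; $\mathcal D=\hat{\mathcal D}\cap\check{\mathcal D}$. $A^p_\omega$ is the space of holomorphic $f$ with $\|f\|^p_{A^p_\omega}=\int|f|^p\omega\,dV<\infty$; $L^q_\mu$ the space of measurable $g$ with $\int|g|^qd\mu<\infty$. $(uC_\varphi f)(z)=u(z)f(\varphi(z))$. The pseudohyperbolic distance is $\rho(a,z)=|\varphi_a(z)|$ with $\varphi_a$ the involutive automorphism exchanging $a$ and $0$. $(\nu\circ\varphi^{-1})(E)=\nu(\varphi^{-1}(E))$. A positive Borel measure $\nu$ is a $q$-Carleson measure for $A^p_\omega$ if the identity $A^p_\omega\to L^q_\nu$ is bounded, vanishing if it is compact; a linear map is compact if it maps bounded sequences to sequences with a convergent subsequence. *)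

(* Defs.v *)
From HB Require Import structures.
From mathcomp Require Import all_boot all_order all_algebra.
From mathcomp Require Import all_classical all_reals all_analysis.
From mathcomp Require Import complex.

Set Implicit Arguments.
Unset Strict Implicit.
Unset Printing Implicit Defensive.
Import Order.TTheory GRing.Theory Num.Theory.
Local Open Scope classical_set_scope.
Local Open Scope ring_scope.

Section Defs.
Variable R : realType.
Variable n : nat.

Definition Cn := 'rV[R[i]]_n.
HB.instance Definition _ := Choice.on Cn.
HB.instance Definition _ := isPointed.Build Cn 0.

Definition cre (z : R[i]) : R := complex.Re z.
Definition cim (z : R[i]) : R := complex.Im z.

Definition cabs (z : R[i]) : R := Num.sqrt (cre z ^+ 2 + cim z ^+ 2).

Definition cinner (z w : Cn) : R[i] := \sum_(j < n) z 0 j * conjc (w 0 j).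
Definition cnorm (z : Cn) : R := Num.sqrt (\sum_(j < n) cabs (z 0 j) ^+ 2).

Definition ball_n : set Cn := [set z | cnorm z < 1].

(** Borel sigma-algebra of C^n = R^{2n}: generated by half-open boxes
    prod_j ([a_j,b_j[ x i[c_j,d_j[) *)
Definition box (a b c d : 'I_n -> R) : set Cn :=
  [set z | forall j, a j <= cre (z 0 j) < b j /\ c j <= cim (z 0 j) < d j].
Definition boxes : set (set Cn) :=
  [set B | exists a b c d, B = box a b c d].
Definition CnM := g_sigma_algebraType boxes.

(** dV: the volume measure normalized so that V(B_n) = 1, i.e. a constant
    multiple of Lebesgue measure on R^{2n} (characterized by its values on
    boxes) with total mass 1 on the ball. *)
Definition normalized_volume (V : {measure set CnM -> \bar R}) : Prop :=
  (exists c : R, 0 < c /\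
    forall a b c' d : 'I_n -> R, (forall j, a j <= b j /\ c' j <= d j) ->
      V (box a b c' d : set CnM) =
        (c * \prod_(j < n) ((b j - a j) * (d j - c' j)))%:E)
  /\ V (ball_n : set CnM) = 1%E.

Definition holo_at (f : Cn -> R[i]) (a : Cn) : Prop :=
  exists L : 'I_n -> R[i], forall eps : R, 0 < eps ->
    exists2 delta : R, 0 < delta & forall h : Cn, cnorm h < delta ->
      cabs (f (a + h) - f a - \sum_(j < n) L j * h 0 j) <= eps * cnorm h.
Definition holomorphic (f : Cn -> R[i]) : Prop :=
  forall a, ball_n a -> holo_at f a.

Definition holo_selfmap (phi : Cn -> Cn) : Prop :=
  (forall j : 'I_n, holomorphic (fun z => phi z 0 j)) /\
  (forall z, ball_n z -> ball_n (phi z)).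

(** involutive automorphism phi_a (Rudin):
    phi_a(z) = (a - P_a z - s_a Q_a z) / (1 - <z,a>),
    P_a z = (<z,a>/<a,a>) a  (P_0 = 0), Q_a = I - P_a, s_a = sqrt(1-|a|^2) *)
Definition Pa (a z : Cn) : Cn := (cinner z a / cinner a a) *: a.
Definition auto_ball (a z : Cn) : Cn :=
  (1 - cinner z a)^-1 *:
    (a - Pa a z - ((Num.sqrt (1 - cnorm a ^+ 2))%:C)%C *: (z - Pa a z)).

Definition pseudohyp (a z : Cn) : R := cnorm (auto_ball a z).

Definition hat (omega : R -> R) (r : R) : \bar R :=
  (\int[lebesgue_measure]_(s in `[r, 1%R[) (omega s)%:E)%E.

Definition radial_weight (V : {measure set CnM -> \bar R}) (omega : R -> R) :=
  (forall s, 0 <= s < 1 -> 0 < omega s) /\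
  measurable_fun (`[0%R, 1%R[ : set R) omega /\
  V.-integrable (ball_n : set CnM) (fun z : CnM => (omega (cnorm z))%:E).

Definition Dhat (omega : R -> R) : Prop :=
  exists C : R, 1 <= C /\
    forall r, 0 <= r < 1 -> (hat omega r <= C%:E * hat omega ((1 + r) / 2))%E.

Definition Dcheck (omega : R -> R) : Prop :=
  exists C K : R, 1 < C /\ 1 < K /\
    forall r, 0 <= r < 1 -> (hat omega r >= C%:E * hat omega (1 - (1 - r) / K))%E.

Definition Dclass omega := Dhat omega /\ Dcheck omega.

Definition Ap_int (V : {measure set CnM -> \bar R}) (omega : R -> R) (p : R)
  (f : Cn -> R[i]) : \bar R :=
  (\int[V]_(z in (ball_n : set CnM)) ((cabs (f z) `^ p) * omega (cnorm z))%:E)%E.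
Definition Ap_norm V omega p f : \bar R := (Ap_int V omega p f `^ p^-1)%E.
Definition in_Ap V omega p (f : Cn -> R[i]) : Prop :=
  holomorphic f /\ (Ap_int V omega p f < +oo)%E.

Definition Lq_int (mu : {measure set CnM -> \bar R}) (q : R) (g : Cn -> R[i])
  : \bar R :=
  (\int[mu]_(z in (ball_n : set CnM)) (cabs (g z) `^ q)%:E)%E.
Definition Lq_norm mu q g : \bar R := (Lq_int mu q g `^ q^-1)%E.
Definition Lq_measurable (g : Cn -> R[i]) : Prop :=
  measurable_fun (ball_n : set CnM) (fun z : CnM => cre (g z)) /\
  measurable_fun (ball_n : set CnM) (fun z : CnM => cim (g z)).
Definition in_Lq mu q g : Prop := Lq_measurable g /\ (Lq_int mu q g < +oo)%E.

Definition bounded_op V omega p mu q (T : (Cn -> R[i]) -> (Cn -> R[i])) :=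
  exists C : R, forall f, in_Ap V omega p f ->
    in_Lq mu q (T f) /\ (Lq_norm mu q (T f) <= C%:E * Ap_norm V omega p f)%E.

Definition compact_op V omega p mu q (T : (Cn -> R[i]) -> (Cn -> R[i])) :=
  forall (fs : nat -> Cn -> R[i]) (M : R),
    (forall k, in_Ap V omega p (fs k)) ->
    (forall k, (Ap_norm V omega p (fs k) <= M%:E)%E) ->
    exists (sigma : nat -> nat) (g : Cn -> R[i]),
      (forall k, (sigma k < sigma k.+1)%N) /\ in_Lq mu q g /\
      ((fun k => Lq_norm mu q (fun z => T (fs (sigma k)) z - g z)) @ \oo
         --> 0%E).

Definition carleson V omega p q (nu : {measure set CnM -> \bar R}) :=
  bounded_op V omega p nu q id.
Definition vanishing_carleson V omega p q (nu : {measure set CnM -> \bar R}) :=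
  compact_op V omega p nu q id.

Definition wcomp_diff (u v : Cn -> R[i]) (phi psi : Cn -> Cn)
  (f : Cn -> R[i]) : Cn -> R[i] :=
  fun z => u z * f (phi z) - v z * f (psi z).

(** the measure (w d mu) o phi^{-1}, characterized on Borel sets
    (mu is a measure on B_n, so we integrate over B_n) *)
Definition is_pushforward (mu : {measure set CnM -> \bar R}) (w : Cn -> R)
  (phi : Cn -> Cn) (nu : {measure set CnM -> \bar R}) : Prop :=
  forall E : set CnM, measurable E ->
    nu E = (\int[mu]_(z in (ball_n `&` phi @^-1` E : set CnM)) (w z)%:E)%E.

End Defs.

(* Main.v *)
(** Let W(a) = (1-|a|)^n hat(omega)(|a|).  For omega in D the functions
    f_a(z) = ((1-|a|)/(1-<z,a>))^N satisfy ||f_a||^p <= C W(a), and the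
    Carleson measures for A^p_omega can be detected on pseudohyperbolic balls D(a):
    if nu(D(a)) <= K W(a)^(q/p) for all a, then the sub-mean value property of |f|^p
    gives int |f|^q dnu <= C K ||f||^q when p <= q.

    Apply T = u C_phi - v C_psi to f_a and to f_a times each coordinate of the
    automorphism phi_a.  When phi(z) lies in D(a), the n+1 values at z control both
    rho |u| and, if rho < r, |u - v|: multiplying T f_a by phi_a(psi(z)) and
    subtracting eliminates v and leaves u f_a(phi(z)) times
    phi_a(phi(z)) - phi_a(psi(z)), whose norm is at least a multiple of rho.  So a
    bound for T on the unit ball bounds the pushforward of the weight on D(a) by a
    multiple of W(a)^(q/p).  If T is compact, the normalized f_a tend to 0 pointwise
    as |a| -> 1, hence by Fatou's lemma their images tend to 0 in L^q, and the bound
    on D(a) is o(W(a)^(q/p)).  Bounded sequences of A^p_omega are normal families, so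
    the embedding is then compact: dominated convergence handles {|z| < s}, and the
    Carleson estimate with a small constant handles the rest. *)
Require Import Defs.
From HB Require Import structures.
From mathcomp Require Import all_boot all_order all_algebra.
From mathcomp Require Import all_classical all_reals all_analysis.
From mathcomp Require Import measurable_realfun complex ring lra.
Set Implicit Arguments.
Unset Strict Implicit.
Unset Printing Implicit Defensive.
Import Order.TTheory GRing.Theory Num.Theory.
Import numFieldNormedType.Exports.
Local Open Scope classical_set_scope.
Local Open Scope ring_scope.

(** * Complex and Hermitian algebra *)

(** The obstacle is the weight: [omega] has no pointwise regularity, so a sub-mean value inequality
    cannot be integrated against it directly. The two halves of the class D remove it. The lower
    condition, with the monotonicity of the spherical means of |f|^p, gives a Hardy inequality that
    bounds the integral of |f|^p against hat(omega)(|z|)/(1-|z|) by the integral against omega. The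
    upper condition makes this new density comparable at pseudohyperbolically close points. Monotone
    spherical means and the sub-mean value inequality on a non-isotropic neighbourhood of z both
    come from one statement on means over sets invariant under unimodular scalars. It rests on the
    mean value property on circles, hence on Goursat's theorem in the coordinate log z. The exponent
    N is dictated by the doubling constant of W: it makes the dyadic pieces of the integral of
    |f_a|^p decrease geometrically. Only the pushforward along phi is studied; exchanging (u, phi)
    with (v, psi) turns T into -T and gives the other one. *)

Lemma le_of_sqr (R : realDomainType) (x y : R) :
  0 <= y -> x ^+ 2 <= y ^+ 2 -> x <= y.
Proof.
move=> y0 xy; rewrite leNgt; apply/negP => yx.
by have := lt_le_trans (ltr_pM y0 y0 yx yx) xy; rewrite -!expr2 ltxx.
Qed.

Section ComplexModulus.
Variable R : realType.
Implicit Types (x y z : R[i]) (s t : R).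

Lemma cabs_ge0 z : 0 <= cabs z. Proof. exact: sqrtr_ge0. Qed.
Hint Resolve cabs_ge0 : core.

Lemma cabsE z : cabs z = Normc.normc z. Proof. by case: z. Qed.

Lemma cabsM x y : cabs (x * y) = cabs x * cabs y.
Proof. by rewrite !cabsE Normc.normcM. Qed.

Lemma cabsD x y : cabs (x + y) <= cabs x + cabs y.
Proof. by rewrite !cabsE le_normcD. Qed.

Lemma cabsN z : cabs (- z) = cabs z.
Proof. by rewrite !cabsE normcN. Qed.

Lemma cabs0 : cabs (0 : R[i]) = 0. Proof. by rewrite cabsE Normc.normc0. Qed.

Lemma cabs1 : cabs (1 : R[i]) = 1. Proof. by rewrite cabsE Normc.normc1. Qed.

Lemma cabsV z : cabs z^-1 = (cabs z)^-1. Proof. by rewrite !cabsE Normc.normcV. Qed.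

Lemma cabsX z k : cabs (z ^+ k) = cabs z ^+ k.
Proof. by elim: k => [|k IH]; rewrite ?expr0 ?cabs1 // !exprS cabsM IH. Qed.

Lemma cabs_sq z : cabs z ^+ 2 = cre z ^+ 2 + cim z ^+ 2.
Proof. by rewrite sqr_sqrtr // addr_ge0 // sqr_ge0. Qed.

Lemma cabs_eq0 z : (cabs z == 0) = (z == 0).
Proof.
by apply/eqP/eqP => [|->]; [rewrite cabsE => /Normc.eq0_normc | rewrite cabs0].
Qed.

Lemma cabs_gt0 z : (0 < cabs z) = (z != 0).
Proof. by rewrite lt_def cabs_eq0 cabs_ge0 andbT. Qed.

Lemma cabs_real t : cabs (t%:C)%C = `|t|.
Proof. by rewrite /cabs /cre /cim /= expr0n addr0 sqrtr_sqr. Qed.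

Lemma cabs_conjc z : cabs (conjc z) = cabs z.
Proof. by case: z => a b; rewrite /cabs /cre /cim /= sqrrN. Qed.

Lemma cabsB_sym x y : cabs (x - y) = cabs (y - x).
Proof. by rewrite -cabsN opprB. Qed.

Lemma cabs_triangle x y z : cabs (x - z) <= cabs (x - y) + cabs (y - z).
Proof. by rewrite -{1}(subrK y x) -addrA; exact: cabsD. Qed.

Lemma ler_cabsB x y : cabs x - cabs y <= cabs (x - y).
Proof. by rewrite lerBlDr -{1}(subrK y x) cabsD. Qed.

Lemma ler_dist_cabs x y : `|cabs x - cabs y| <= cabs (x - y).
Proof.
by rewrite ler_norml ler_cabsB andbT lerNl opprB cabsB_sym ler_cabsB.
Qed.

Lemma creE x y : cre (x + y) = cre x + cre y. Proof. by case: x; case: y. Qed.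
Lemma cimE x y : cim (x + y) = cim x + cim y. Proof. by case: x; case: y. Qed.
Lemma creN x : cre (- x) = - cre x. Proof. by case: x. Qed.
Lemma cimN x : cim (- x) = - cim x. Proof. by case: x. Qed.
Lemma creM x y : cre (x * y) = cre x * cre y - cim x * cim y.
Proof. by case: x; case: y. Qed.
Lemma cimM x y : cim (x * y) = cre x * cim y + cim x * cre y.
Proof. by case: x => a b; case: y => c d; rewrite /cim /cre /=. Qed.
Lemma cre_real t : cre (t%:C)%C = t. Proof. by []. Qed.
Lemma cim_real t : cim (t%:C)%C = 0. Proof. by []. Qed.
Lemma cre_conjc x : cre (conjc x) = cre x. Proof. by case: x. Qed.
Lemma cim_conjc x : cim (conjc x) = - cim x. Proof. by case: x. Qed.
Lemma cre0 : cre (0 : R[i]) = 0. Proof. by []. Qed.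
Lemma cim0 : cim (0 : R[i]) = 0. Proof. by []. Qed.
Lemma cre1 : cre (1 : R[i]) = 1. Proof. by []. Qed.
Lemma cim1 : cim (1 : R[i]) = 0. Proof. by []. Qed.

Lemma cre_sum (I : Type) (s : seq I) (P : pred I) (F : I -> R[i]) :
  cre (\sum_(i <- s | P i) F i) = \sum_(i <- s | P i) cre (F i).
Proof. by elim/big_ind2: _ => // x a y b <- <-; rewrite creE. Qed.

Lemma cim_sum (I : Type) (s : seq I) (P : pred I) (F : I -> R[i]) :
  cim (\sum_(i <- s | P i) F i) = \sum_(i <- s | P i) cim (F i).
Proof. by elim/big_ind2: _ => // x a y b <- <-; rewrite cimE. Qed.

Lemma complex_eqP x y : cre x = cre y -> cim x = cim y -> x = y.
Proof. by case: x => a b; case: y => c d; rewrite /cre /cim /= => -> ->. Qed.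

Lemma cre_le_cabs z : `|cre z| <= cabs z.
Proof. by rewrite -sqrtr_sqr ler_wsqrtr // lerDl sqr_ge0. Qed.

Lemma cim_le_cabs z : `|cim z| <= cabs z.
Proof. by rewrite -sqrtr_sqr ler_wsqrtr // lerDr sqr_ge0. Qed.

Lemma cabs_le_reim z : cabs z <= `|cre z| + `|cim z|.
Proof.
apply: le_of_sqr; rewrite ?addr_ge0 //.
rewrite cabs_sq sqrrD !real_normK ?num_real //.
by rewrite lerD2r lerDl mulrn_wge0 // mulr_ge0.
Qed.

Lemma conjcM x y : conjc (x * y) = conjc x * conjc y.
Proof. exact: rmorphM. Qed.

Lemma conjcD x y : conjc (x + y) = conjc x + conjc y.
Proof. exact: rmorphD. Qed.

Lemma conjcB x y : conjc (x - y) = conjc x - conjc y.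
Proof. exact: rmorphB. Qed.

Lemma conjc_one : conjc (1 : R[i]) = 1.
Proof. exact: rmorph1. Qed.

Lemma realcM s t : (s * t)%:C%C = s%:C%C * t%:C%C :> R[i].
Proof. exact: rmorphM. Qed.

Lemma realcB s t : (s - t)%:C%C = s%:C%C - t%:C%C :> R[i].
Proof. exact: rmorphB. Qed.

Lemma realcV t : (t^-1)%:C%C = (t%:C%C)^-1 :> R[i].
Proof. exact: fmorphV. Qed.

Lemma realc1 : 1%:C%C = 1 :> R[i].
Proof. by []. Qed.

Lemma conjc_mul z : z * conjc z = (cabs z ^+ 2)%:C%C.
Proof.
apply: complex_eqP; rewrite ?creM ?cimM ?cre_conjc ?cim_conjc ?cre_real ?cim_real.
  by rewrite cabs_sq; ring.
by ring.
Qed.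

Lemma cabs_sum (I : Type) (s : seq I) (P : pred I) (F : I -> R[i]) :
  cabs (\sum_(i <- s | P i) F i) <= \sum_(i <- s | P i) cabs (F i).
Proof.
elim/big_ind2: _ => [|x a y b xa yb|//]; first by rewrite cabs0.
by apply: (le_trans (cabsD _ _)); exact: lerD.
Qed.

End ComplexModulus.
#[export] Hint Extern 0 (is_true (0 <= cabs _)) => exact: cabs_ge0 : core.

Section HermitianSpace.
Variables (R : realType) (n : nat).
Implicit Types (x y z w a : Cn R n) (c : R[i]).

Lemma cnorm_ge0 z : 0 <= cnorm z. Proof. exact: sqrtr_ge0. Qed.
Hint Resolve cnorm_ge0 : core.

Lemma cnorm_sq z : cnorm z ^+ 2 = \sum_(j < n) cabs (z 0 j) ^+ 2.
Proof. by rewrite sqr_sqrtr // sumr_ge0 // => j _; exact: sqr_ge0. Qed.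

Lemma cinnerDl x y z : cinner (x + y) z = cinner x z + cinner y z.
Proof. by rewrite /cinner -big_split /=; apply: eq_bigr => j _; rewrite mxE mulrDl. Qed.

Lemma cinnerNl x z : cinner (- x) z = - cinner x z.
Proof. by rewrite /cinner -sumrN; apply: eq_bigr => j _; rewrite mxE mulNr. Qed.

Lemma cinnerBl x y z : cinner (x - y) z = cinner x z - cinner y z.
Proof. by rewrite cinnerDl cinnerNl. Qed.

Lemma cinnerZl c x z : cinner (c *: x) z = c * cinner x z.
Proof. by rewrite /cinner mulr_sumr; apply: eq_bigr => j _; rewrite mxE mulrA. Qed.

Lemma cinnerC x z : cinner z x = conjc (cinner x z).
Proof.
rewrite /cinner rmorph_sum; apply: eq_bigr => j _.
by rewrite rmorphM /= conjcK mulrC.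
Qed.

Lemma cinnerDr x y z : cinner z (x + y) = cinner z x + cinner z y.
Proof. by rewrite cinnerC cinnerDl rmorphD /= -!cinnerC. Qed.

Lemma cinnerNr x z : cinner z (- x) = - cinner z x.
Proof. by rewrite cinnerC cinnerNl rmorphN /= -!cinnerC. Qed.

Lemma cinnerBr x y z : cinner z (x - y) = cinner z x - cinner z y.
Proof. by rewrite cinnerDr cinnerNr. Qed.

Lemma cinnerZr c x z : cinner z (c *: x) = conjc c * cinner z x.
Proof. by rewrite cinnerC cinnerZl rmorphM /= -cinnerC. Qed.

Lemma cinner0l z : cinner 0 z = 0.
Proof. by rewrite /cinner big1 // => j _; rewrite mxE mul0r. Qed.

Lemma cinner0r z : cinner z 0 = 0.
Proof. by rewrite cinnerC cinner0l conjc0. Qed.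

Lemma cinner_self z : cinner z z = (cnorm z ^+ 2)%:C%C.
Proof.
rewrite cnorm_sq rmorph_sum /=; apply: eq_bigr => j _.
by rewrite conjc_mul.
Qed.

Lemma cnorm0 : cnorm (0 : Cn R n) = 0.
Proof. by rewrite /cnorm big1 ?sqrtr0 // => j _; rewrite mxE cabs0 expr0n. Qed.

Lemma cabs_coord_le z j : cabs (z 0 j) <= cnorm z.
Proof.
apply: le_of_sqr => //; rewrite cnorm_sq.
by rewrite (bigD1 j) //= lerDl sumr_ge0 // => i _; exact: sqr_ge0.
Qed.

Lemma cnorm_eq0 z : (cnorm z == 0) = (z == 0).
Proof.
apply/eqP/eqP => [z0|->]; last exact: cnorm0.
apply/rowP => j; rewrite mxE; apply/eqP; rewrite -cabs_eq0 eq_le cabs_ge0 andbT.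
by rewrite -z0 cabs_coord_le.
Qed.

Lemma cnorm_gt0 z : (0 < cnorm z) = (z != 0).
Proof. by rewrite lt_def cnorm_eq0 cnorm_ge0 andbT. Qed.

Lemma cnormZ c z : cnorm (c *: z) = cabs c * cnorm z.
Proof.
rewrite /cnorm -[cabs c](ger0_norm (cabs_ge0 c)) -sqrtr_sqr -sqrtrM ?sqr_ge0 // mulr_sumr.
by congr Num.sqrt; apply: eq_bigr => j _; rewrite mxE cabsM exprMn.
Qed.

Lemma cnormN z : cnorm (- z) = cnorm z.
Proof. by rewrite /cnorm; congr Num.sqrt; apply: eq_bigr => j _; rewrite mxE cabsN. Qed.

Lemma cnormB_sym x y : cnorm (x - y) = cnorm (y - x).
Proof. by rewrite -cnormN opprB. Qed.

Lemma cnormD_sq x y :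
  cnorm (x + y) ^+ 2 = cnorm x ^+ 2 + cre (cinner x y) *+ 2 + cnorm y ^+ 2.
Proof.
apply: (@complexI R); rewrite -cinner_self cinnerDl !cinnerDr !cinner_self.
rewrite (cinnerC x y); apply: complex_eqP.
  by rewrite !creE cre_conjc !cre_real; ring.
by rewrite !cimE cim_conjc !cim_real; ring.
Qed.

Lemma cnormB_sq x y :
  cnorm (x - y) ^+ 2 = cnorm x ^+ 2 - cre (cinner x y) *+ 2 + cnorm y ^+ 2.
Proof. by rewrite cnormD_sq cnormN cinnerNr creN mulNrn. Qed.

Lemma cauchy_schwarz x y : cabs (cinner x y) <= cnorm x * cnorm y.
Proof.
have [->|y0] := eqVneq y 0; first by rewrite cinner0r cabs0 cnorm0 mulr0.
have ny : 0 < cnorm y by rewrite cnorm_gt0.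
have := sqr_ge0 (cnorm (x - (cinner x y * ((cnorm y ^+ 2)^-1)%:C%C) *: y)).
rewrite cnormB_sq cinnerZr cnormZ cabsM cabs_real ger0_norm ?invr_ge0 ?sqr_ge0 //.
rewrite conjcM conjc_real mulrAC mulrC [conjc _ * _]mulrC conjc_mul.
rewrite creM !cre_real !cim_real mulr0 subr0.
set A := cabs _; set B := cnorm y; set X := cnorm x => H.
apply: le_of_sqr; first by apply: mulr_ge0; exact: cnorm_ge0.
have /(mulr_ge0 (sqr_ge0 B)) := H.
have -> : B ^+ 2 * (X ^+ 2 - (B ^+ 2)^-1 * A ^+ 2 *+ 2 + (A * (B ^+ 2)^-1 * B) ^+ 2) =
  (X * B) ^+ 2 - A ^+ 2 by field; rewrite gt_eqF.
by rewrite subr_ge0.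
Qed.

Lemma cnormD x y : cnorm (x + y) <= cnorm x + cnorm y.
Proof.
apply: le_of_sqr; rewrite ?addr_ge0 //.
rewrite cnormD_sq sqrrD lerD2r lerD2l lerMn2r /=.
exact: (le_trans (le_trans (ler_norm _) (cre_le_cabs _)) (cauchy_schwarz _ _)).
Qed.

Lemma cnorm_triangle x y z : cnorm (x - z) <= cnorm (x - y) + cnorm (y - z).
Proof. by rewrite -{1}(subrK y x) -addrA; exact: cnormD. Qed.

Lemma ler_cnormB x y : cnorm x - cnorm y <= cnorm (x - y).
Proof. by rewrite lerBlDr -{1}(subrK y x) cnormD. Qed.

Lemma ler_dist_cnorm x y : `|cnorm x - cnorm y| <= cnorm (x - y).
Proof.
by rewrite ler_norml ler_cnormB andbT lerNl opprB cnormB_sym ler_cnormB.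
Qed.

Lemma cnorm_sum (I : Type) (s : seq I) (P : pred I) (F : I -> Cn R n) :
  cnorm (\sum_(i <- s | P i) F i) <= \sum_(i <- s | P i) cnorm (F i).
Proof.
elim/big_ind2: _ => [|x a y b xa yb|//]; first by rewrite cnorm0.
by apply: (le_trans (cnormD _ _)); exact: lerD.
Qed.

Lemma cnorm_delta j : cnorm (delta_mx 0 j : Cn R n) = 1.
Proof.
rewrite /cnorm (bigD1 j) //= mxE !eqxx cabs1 expr1n big1 ?addr0 ?sqrtr1 //.
by move=> i /negPf ij; rewrite mxE ij andbF cabs0 expr0n.
Qed.

Lemma cnorm_le_sum z : cnorm z <= \sum_(j < n) cabs (z 0 j).
Proof.
rewrite {1}(row_sum_delta z); apply: (le_trans (cnorm_sum _ _ _)).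
by apply: ler_sum => j _; rewrite cnormZ cnorm_delta mulr1.
Qed.

End HermitianSpace.
#[export] Hint Extern 0 (is_true (0 <= cnorm _)) => exact: cnorm_ge0 : core.

(** * Automorphisms of the ball *)

Section Moebius.
Variables (R : realType) (n : nat).
Implicit Types (a x y z w : Cn R n).

Lemma cabs_one_sub_cinner_ge x y :
  1 - cnorm x * cnorm y <= cabs (1 - cinner x y).
Proof.
rewrite -[X in X - _](cabs1 R); apply: le_trans (ler_cabsB _ _).
by rewrite lerD2l lerN2 cauchy_schwarz.
Qed.

Lemma cabs_one_sub_cinner_gt0 x y : cnorm x < 1 -> cnorm y <= 1 ->
  0 < cabs (1 - cinner x y).
Proof.
move=> x1 y1; apply: lt_le_trans (cabs_one_sub_cinner_ge x y).
rewrite subr_gt0; apply: le_lt_trans x1.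
by rewrite -[leRHS]mulr1 ler_wpM2l.
Qed.

Lemma one_sub_cinner_neq0 x y : cnorm x < 1 -> cnorm y <= 1 ->
  1 - cinner x y != 0.
Proof. by move=> x1 y1; rewrite -cabs_gt0 cabs_one_sub_cinner_gt0. Qed.

Local Notation sq1 a := (Num.sqrt (1 - cnorm a ^+ 2)).

(** With the image written as a combination of [a] and [z] alone, the identities below become field
    computations in the inner products. *)
Lemma auto_ball_numer a z : auto_ball a z = (1 - cinner z a)^-1 *:
  ((1 - (1 - (sq1 a)%:C%C) * (cinner z a / cinner a a)) *: a - (sq1 a)%:C%C *: z).
Proof.
rewrite /auto_ball; congr (_ *: _); rewrite /Pa.
apply/rowP => j; rewrite !mxE; ring.
Qed.

Lemma sq1_sq a : cnorm a < 1 ->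
  ((sq1 a)%:C ^+ 2 = 1 - cinner a a)%C.
Proof.
move=> a1; rewrite cinner_self -rmorphXn /= sqr_sqrtr ?rmorphB //.
by rewrite subr_ge0 expr_le1 // ltW.
Qed.

(** All metric facts on the automorphisms are read off this identity: its diagonal gives 1 -
    |phi_a(x)|^2, the value at [y = 0] gives the pairing with [a], and together they give the
    invariance of the pseudohyperbolic distance. *)
Lemma auto_ball_cinner a x y : cnorm a < 1 -> cnorm x < 1 -> cnorm y < 1 ->
  1 - cinner (auto_ball a x) (auto_ball a y) =
  (1 - cinner a a) * (1 - cinner x y) / ((1 - cinner x a) * (1 - cinner a y)).
Proof.
move=> a1 x1 y1.
have xa := one_sub_cinner_neq0 x1 (ltW a1).
have ay := one_sub_cinner_neq0 a1 (ltW y1).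
rewrite !auto_ball_numer !(cinnerZl, cinnerZr, cinnerDl, cinnerDr, cinnerNl, cinnerNr).
have sqE := sq1_sq a1; move: sqE; set s := (sq1 a)%:C%C => sqE.
have sC : conjc s = s by rewrite /s conjc_real.
have aaC : conjc (cinner a a) = cinner a a by rewrite -cinnerC.
have -> : conjc (1 - cinner y a)^-1 = (1 - cinner a y)^-1.
  by rewrite conjc_inv conjcB conjc_one -cinnerC.
have -> : conjc (1 - (1 - s) * (cinner y a / cinner a a)) =
          1 - (1 - s) * (cinner a y / cinner a a).
  by rewrite !(conjcB, conjcM) conjc_inv conjc_one sC -cinnerC aaC.
rewrite sC.
(* [Pa] divides by [cinner a a]; at [a = 0] the quotient is 0 by convention, and this case is
   checked apart. *)
have [a0|a0] := eqVneq a 0.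
  move: sqE; rewrite a0 !(cinner0l, cinner0r) invr0 !mulr0 !(subr0, mul0r) => sqE.
  have ss : s * (s * cinner x y) = cinner x y by rewrite mulrA -expr2 sqE mul1r.
  by rewrite !mulrN ss; field.
have aa0 : cinner a a != 0.
  by rewrite cinner_self -cabs_gt0 cabs_real normr_gt0 sqrf_eq0 cnorm_eq0.
(* Eliminating [cinner a a] in favour of [s] leaves a rational identity without side relation. *)
have aE : cinner a a = 1 - s ^+ 2 by rewrite sqE opprB addrC subrK.
by move: aa0; rewrite aE => aa0; field; rewrite aa0 xa ay.
Qed.

Lemma auto_ball_cinner_center a x : cnorm a < 1 -> cnorm x < 1 ->
  1 - cinner (auto_ball a x) a = (1 - cinner a a) / (1 - cinner x a).
Proof.
move=> a1 x1; have n0 : cnorm (0 : Cn R n) < 1 by rewrite cnorm0.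
have := auto_ball_cinner a1 x1 n0.
have -> : auto_ball a 0 = a.
  by rewrite auto_ball_numer cinner0l mul0r mulr0 !subr0 invr1 scaler0 subr0 !scale1r.
by rewrite !cinner0r !subr0 !mulr1.
Qed.

Lemma auto_ball_norm a x : cnorm a < 1 -> cnorm x < 1 ->
  1 - cnorm (auto_ball a x) ^+ 2 =
  (1 - cnorm a ^+ 2) * (1 - cnorm x ^+ 2) / cabs (1 - cinner x a) ^+ 2.
Proof.
move=> a1 x1; apply: (@complexI R).
have E (z : Cn R n) : ((1 - cnorm z ^+ 2)%:C)%C = 1 - cinner z z.
  by rewrite realcB cinner_self.
rewrite !(realcM, realcV) !E auto_ball_cinner // -realcM -expr2 -conjc_mul.
by rewrite (cinnerC x a) conjcB conjc_one.
Qed.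

Lemma auto_ball_lt1 a x : cnorm a < 1 -> cnorm x < 1 -> cnorm (auto_ball a x) < 1.
Proof.
move=> a1 x1.
have H (z : Cn R n) : cnorm z < 1 -> 0 < 1 - cnorm z ^+ 2.
  by move=> z1; rewrite subr_gt0 expr_lt1.
have : 0 < 1 - cnorm (auto_ball a x) ^+ 2.
  rewrite auto_ball_norm //; apply: divr_gt0; first by apply: mulr_gt0; exact: H.
  by apply: exprn_gt0; apply: cabs_one_sub_cinner_gt0 => //; exact: ltW.
by rewrite subr_gt0 expr_lt1.
Qed.

Lemma pseudohyp_ge0 a x : 0 <= pseudohyp a x. Proof. exact: cnorm_ge0. Qed.

Lemma pseudohyp_eq a x b y : cnorm a < 1 -> cnorm x < 1 ->
  cnorm b < 1 -> cnorm y < 1 ->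
  (1 - cnorm a ^+ 2) * (1 - cnorm x ^+ 2) / cabs (1 - cinner x a) ^+ 2 =
  (1 - cnorm b ^+ 2) * (1 - cnorm y ^+ 2) / cabs (1 - cinner y b) ^+ 2 ->
  pseudohyp a x = pseudohyp b y.
Proof.
move=> a1 x1 b1 y1; rewrite -(auto_ball_norm a1 x1) -(auto_ball_norm b1 y1).
have sq_inj (P Q : R) : 0 <= P -> 0 <= Q -> 1 - P ^+ 2 = 1 - Q ^+ 2 -> P = Q.
  move=> P0 Q0 E; have {}E : P ^+ 2 = Q ^+ 2 by lra.
  by apply/eqP; rewrite -(eqrXn2 (ltn0Sn 1)) // E.
by apply: sq_inj; apply: cnorm_ge0.
Qed.

Lemma pseudohypC a x : cnorm a < 1 -> cnorm x < 1 -> pseudohyp a x = pseudohyp x a.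
Proof.
move=> a1 x1; apply: pseudohyp_eq => //.
rewrite [X in X / _]mulrC; congr (_ / _ ^+ 2).
by rewrite -cabs_conjc conjcB conjc_one -cinnerC.
Qed.

(** By [auto_ball_norm] the distance depends only on the quotient (1-|x|^2)(1-|y|^2)/|1-<y,x>|^2,
    and the factors produced by the automorphism cancel in it. *)
Lemma pseudohyp_auto a x y : cnorm a < 1 -> cnorm x < 1 -> cnorm y < 1 ->
  pseudohyp (auto_ball a x) (auto_ball a y) = pseudohyp x y.
Proof.
move=> a1 x1 y1; apply: pseudohyp_eq => //; try exact: auto_ball_lt1.
have : forall X Y : Cn R n,
  1 - cnorm X ^+ 2 = (1 - cnorm a ^+ 2) * (1 - cnorm x ^+ 2) / cabs (1 - cinner x a) ^+ 2 ->
  1 - cnorm Y ^+ 2 = (1 - cnorm a ^+ 2) * (1 - cnorm y ^+ 2) / cabs (1 - cinner y a) ^+ 2 ->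
  1 - cinner Y X = (1 - cinner a a) * (1 - cinner y x) / ((1 - cinner y a) * (1 - cinner a x)) ->
  (1 - cnorm X ^+ 2) * (1 - cnorm Y ^+ 2) / cabs (1 - cinner Y X) ^+ 2 =
  (1 - cnorm x ^+ 2) * (1 - cnorm y ^+ 2) / cabs (1 - cinner y x) ^+ 2.
  move=> X Y -> -> ->; rewrite !cabsM cabsV cabsM.
  have E : cabs (1 - cinner a a) = 1 - cnorm a ^+ 2.
    rewrite cinner_self -realc1 -realcB cabs_real ger0_norm //.
    by rewrite subr_ge0 expr_le1 // ltW.
  have F : cabs (1 - cinner a x) = cabs (1 - cinner x a).
    by rewrite -cabs_conjc conjcB conjc_one -cinnerC.
  have c z w : cnorm z < 1 -> cnorm w < 1 -> cabs (1 - cinner z w) != 0.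
    by move=> z1 w1; rewrite gt_eqF // cabs_one_sub_cinner_gt0 // ltW.
  have := c _ _ a1 a1; rewrite E F => A0; field.
  by rewrite A0 !c.
apply.
- exact: auto_ball_norm.
- exact: auto_ball_norm.
- exact: auto_ball_cinner.
Qed.

(** Clearing the denominator in the norm identity compares the pseudohyperbolic with the Euclidean
    distance; for [x] in the half ball it yields [pseudohyp_le_cnorm]. *)
Lemma pseudohyp_dist x y : cnorm x < 1 -> cnorm y < 1 ->
  pseudohyp x y ^+ 2 * cabs (1 - cinner x y) ^+ 2 =
  (1 - cnorm x ^+ 2) * cnorm (y - x) ^+ 2 + cabs (cinner x (y - x)) ^+ 2.
Proof.
move=> x1 y1.
have : 1 - pseudohyp x y ^+ 2 =
  (1 - cnorm x ^+ 2) * (1 - cnorm y ^+ 2) / cabs (1 - cinner x y) ^+ 2.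
  rewrite /pseudohyp auto_ball_norm //; congr (_ / _ ^+ 2).
  by rewrite -cabs_conjc conjcB conjc_one -cinnerC.
have : cabs (1 - cinner x y) != 0 by rewrite gt_eqF // cabs_one_sub_cinner_gt0 // ltW.
move=> c0 /(congr1 (fun t => t * cabs (1 - cinner x y) ^+ 2)).
rewrite divfK ?expf_neq0 // => H.
have -> : pseudohyp x y ^+ 2 * cabs (1 - cinner x y) ^+ 2 =
  cabs (1 - cinner x y) ^+ 2 - (1 - cnorm x ^+ 2) * (1 - cnorm y ^+ 2).
  by rewrite -H; ring.
have -> : cabs (1 - cinner x y) ^+ 2 =
  1 - cre (cinner x y) *+ 2 + cabs (cinner x y) ^+ 2.
  by rewrite !cabs_sq creE cimE creN cimN cre1 cim1; ring.
rewrite cnormB_sq cinnerBr cinner_self (cinnerC y x).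
rewrite !cabs_sq !(creE, cimE, creN, cimN, cre_conjc, cim_conjc, cre_real, cim_real).
by ring.
Qed.

End Moebius.

(** * The volume measure of C^n *)

Section SigmaFiniteVersion.
Context d (T : measurableType d) (R : realType) (m : {measure set T -> \bar R}).
(** A copy of [m] that carries its sigma-finiteness as a structure, the form in which Fubini-Tonelli
    takes it; here sigma-finiteness is only available as a proof. *)
Definition sigma_finite_version of sigma_finite setT m : set T -> \bar R := m.
Hypothesis sm : sigma_finite setT m.
HB.instance Definition _ := Measure.copy (sigma_finite_version sm) m.
HB.instance Definition _ :=
  @Measure_isSigmaFinite.Build d T R (sigma_finite_version sm) sm.
End SigmaFiniteVersion.

Section MeasureGeneralities.
Context d1 d2 (T1 : measurableType d1) (T2 : measurableType d2) (R : realType).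

Lemma tonelli_sigma_finite (m1 : {measure set T1 -> \bar R})
    (m2 : {measure set T2 -> \bar R}) (f : T1 * T2 -> \bar R) :
  sigma_finite setT m1 -> sigma_finite setT m2 ->
  measurable_fun setT f -> (forall x, 0 <= f x)%E ->
  (\int[m1]_x \int[m2]_y f (x, y) = \int[m2]_y \int[m1]_x f (x, y))%E.
Proof.
move=> s1 s2 mf f0.
exact: (@fubini_tonelli _ _ T1 T2 R (sigma_finite_version s1) (sigma_finite_version s2)).
Qed.

Lemma measurable_inner_integral (m2 : {measure set T2 -> \bar R})
    (f : T1 * T2 -> \bar R) :
  sigma_finite setT m2 -> measurable_fun setT f -> (forall x, 0 <= f x)%E ->
  measurable_fun setT (fun x => \int[m2]_y f (x, y))%E.
Proof.
move=> s2 mf f0.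
exact: (@measurable_fun_fubini_tonelli_F _ _ T1 T2 R (sigma_finite_version s2)).
Qed.

Lemma pushforward_measureP (m : {measure set T1 -> \bar R}) (f : T1 -> T2) :
  measurable_fun setT f ->
  exists W : {measure set T2 -> \bar R},
    (forall A, W A = m (f @^-1` A)) /\
    forall g : T2 -> \bar R, measurable_fun setT g -> (forall x, 0 <= g x)%E ->
      (\int[W]_x g x = \int[m]_x g (f x))%E.
Proof.
move=> mf; unshelve eexists; first exact: (pushforward m f).
split=> // g mg g0; exact: ge0_integral_pushforward.
Qed.

Lemma eq_measure_ge0_integral (m m' : {measure set T1 -> \bar R}) (g : T1 -> \bar R) :
  (forall A, measurable A -> m A = m' A) ->
  measurable_fun setT g -> (forall x, 0 <= g x)%E ->
  (\int[m]_x g x = \int[m']_x g x)%E.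
Proof. by move=> mm' mg g0; apply: eq_measure_integral => A mA _; exact: mm'. Qed.

End MeasureGeneralities.

(** Nonnegativity makes [h] monotone, and comparing [k * s] with the neighbouring integers gives k
    |h s - s h 1| <= h 1 for every natural number [k]; the Archimedean property concludes. *)
Lemma additive_ge0_linear (R : realType) (h : R -> R) :
  (forall s t, 0 <= s -> 0 <= t -> h (s + t) = h s + h t) ->
  (forall s, 0 <= s -> 0 <= h s) ->
  forall s, 0 <= s -> h s = s * h 1.
Proof.
move=> hD h0 s s0.
have hle x y : 0 <= x -> x <= y -> h x <= h y.
  by move=> x0 xy; rewrite -(subrK x y) addrC hD ?subr_ge0 // lerDl h0 // subr_ge0.
have hn x k : 0 <= x -> h (k%:R * x) = k%:R * h x.
  move=> x0; elim: k => [|k IH].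
    by rewrite !mul0r; have := hD 0 0 (lexx _) (lexx _); rewrite addr0; lra.
  by rewrite -natr1 !mulrDl !mul1r hD ?IH // mulr_ge0.
apply/eqP; rewrite -subr_eq0; apply/negPn/negP => d0.
have e0 : 0 < `|h s - s * h 1| by rewrite normr_gt0.
have H k : k%:R * `|h s - s * h 1| <= h 1.
  have ks0 : 0 <= k%:R * s by rewrite mulr_ge0.
  have /andP[m1 m2] := truncn_itv ks0; set m := Num.truncn _ in m1 m2.
  have a1 : m%:R * h 1 <= k%:R * h s by rewrite -!hn // mulr1 hle.
  have a2 : k%:R * h s <= m.+1%:R * h 1.
    by rewrite -!hn // mulr1 hle // ltW.
  have h10 : 0 <= h 1 by rewrite h0.
  rewrite -(ger0_norm (_ : 0 <= k%:R :> R)) // -normrM ler_norml.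
  move: a2 m2; rewrite -natr1 => a2 m2; apply/andP; split; nra.
have := H (Num.truncn (h 1 / `|h s - s * h 1|)).+1.
apply/negP; rewrite -ltNge -ltr_pdivrMr //.
by have /andP[] := truncn_itv (divr_ge0 (h0 1 ler01) (ltW e0)).
Qed.

Section BorelCn.
Variables (R : realType) (n : nat).
Implicit Types (z w : Cn R n).

Lemma box_measurable (a b c d : 'I_n -> R) :
  measurable (box a b c d : set (CnM R n)).
Proof. by apply: sub_sigma_algebra; exists a, b, c, d. Qed.

Lemma boxI (a b c d a' b' c' d' : 'I_n -> R) :
  box a b c d `&` box a' b' c' d' =
  box (fun j => Num.max (a j) (a' j)) (fun j => Num.min (b j) (b' j))
      (fun j => Num.max (c j) (c' j)) (fun j => Num.min (d j) (d' j)).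
Proof.
apply/seteqP; split=> z /=.
  move=> [H H'] j; have [/andP[? ?] /andP[? ?]] := H j.
  have [/andP[? ?] /andP[? ?]] := H' j.
  by rewrite !ge_max !lt_min; split; apply/and3P; split=> //; apply/andP.
move=> H; split=> j; have := H j; rewrite !ge_max !lt_min.
  by move=> [/andP[/andP[-> _] /andP[-> _]] /andP[/andP[-> _] /andP[-> _]]].
by move=> [/andP[/andP[_ ->] /andP[_ ->]] /andP[/andP[_ ->] /andP[_ ->]]].
Qed.

Let cube (N : nat) : set (Cn R n) :=
  box (fun=> - N%:R) (fun=> N%:R) (fun=> - N%:R) (fun=> N%:R).

Let cube_cover : \bigcup_N (cube N : set (CnM R n)) = setT.
Proof.
apply/seteqP; split=> // z _; exists (Num.truncn (cnorm (z : Cn R n))).+1 => // j.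
have /andP[_ zN] := truncn_itv (cnorm_ge0 (z : Cn R n)).
have H (x : R) : `|x| <= cabs (z 0 j) ->
    - (Num.truncn (cnorm (z : Cn R n))).+1%:R <= x < (Num.truncn (cnorm (z : Cn R n))).+1%:R.
  move=> xz; have : `|x| < (Num.truncn (cnorm (z : Cn R n))).+1%:R.
    by apply: le_lt_trans zN; exact: le_trans xz (cabs_coord_le _ _).
  by rewrite ltr_norml => /andP[/ltW -> ->].
by split; apply: H; [exact: cre_le_cabs | exact: cim_le_cabs].
Qed.

(** Boxes are stable under intersection and the cubes exhaust the space with finite measure. The
    hypothesis can be limited to ordered bounds because a box with a reversed pair of bounds is
    empty. *)
Lemma eq_on_boxes (m1 m2 : {measure set (CnM R n) -> \bar R}) :
  (forall a b c d : 'I_n -> R, (forall j, a j <= b j /\ c j <= d j) ->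
     m1 (box a b c d) = m2 (box a b c d) /\ (m1 (box a b c d) < +oo)%E) ->
  forall A, measurable A -> m1 A = m2 A.
Proof.
move=> H; apply: (@measure_unique _ R (CnM R n) (@boxes R n) cube) => //.
- move=> A B [a [b [c [d ->]]]] [a' [b' [c' [d' ->]]]].
  by rewrite boxI; do 4 eexists; reflexivity.
- by move=> i; do 4 eexists; reflexivity.
- move=> _ [a [b [c [d ->]]]].
  have [abcd|] := pselect (forall j, a j <= b j /\ c j <= d j).
    by have [] := H a b c d abcd.
  move=> /existsNP[j nj].
  have -> : box a b c d = set0 :> set (CnM R n).
    apply/seteqP; split=> // z /(_ j) [/andP[z1 z2] /andP[z3 z4]].
    apply: nj; split; apply: ltW; exact: le_lt_trans z1 z2 || exact: le_lt_trans z3 z4.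
  by rewrite !measure0.
- by move=> k; have [] := H (fun=> - k%:R) (fun=> k%:R) (fun=> - k%:R) (fun=> k%:R);
     rewrite // => j; split; rewrite ge0_cp.
Qed.

Lemma measurable_cre j : measurable_fun setT (fun z : CnM R n => cre (z 0 j)).
Proof.
apply: (measurability (@RGenCInfty.G R)).
  exact: RGenCInfty.measurableE.
move=> _ [_ [x ->] <-]; rewrite setTI.
rewrite (_ : _ @^-1` _ = \bigcup_N (cube N `&`
   box (fun i => if i == j then x else - N%:R) (fun=> N%:R) (fun=> - N%:R) (fun=> N%:R))).
  by apply: bigcupT_measurable => N; apply: measurableI; exact: box_measurable.
apply/seteqP; split=> z /=; rewrite in_itv /= andbT.
  have : setT z by []. rewrite -cube_cover => -[N _ zN] xz; exists N => //.
  split=> // i; have [h1 ?] := zN i; split=> //.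
  by case: eqP => // ->; case/andP: (zN j).1 => _ ->; rewrite andbT.
by move=> [N _ [_ /(_ j)]]; rewrite eqxx => -[/andP[]].
Qed.

Lemma measurable_cim j : measurable_fun setT (fun z : CnM R n => cim (z 0 j)).
Proof.
apply: (measurability (@RGenCInfty.G R)).
  exact: RGenCInfty.measurableE.
move=> _ [_ [x ->] <-]; rewrite setTI.
rewrite (_ : _ @^-1` _ = \bigcup_N (cube N `&`
   box (fun=> - N%:R) (fun=> N%:R) (fun i => if i == j then x else - N%:R) (fun=> N%:R))).
  by apply: bigcupT_measurable => N; apply: measurableI; exact: box_measurable.
apply/seteqP; split=> z /=; rewrite in_itv /= andbT.
  have : setT z by []. rewrite -cube_cover => -[N _ zN] xz; exists N => //.
  split=> // i; have [? h1] := zN i; split=> //.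
  by case: eqP => // ->; case/andP: (zN j).2 => _ ->; rewrite andbT.
by move=> [N _ [_ /(_ j)]]; rewrite eqxx => -[_ /andP[]].
Qed.

Lemma measurable_CnP d (T : measurableType d) (F : T -> CnM R n) :
  (forall j, measurable_fun setT (fun x => cre (F x 0 j))) ->
  (forall j, measurable_fun setT (fun x => cim (F x 0 j))) ->
  measurable_fun setT F.
Proof.
move=> Fre Fim; apply: (@measurability _ _ T (CnM R n) setT F (@boxes R n) erefl).
move=> _ [_ [a [b [c [e ->]]]] <-]; rewrite setTI.
rewrite (_ : _ @^-1` _ = \bigcap_(j in [set: 'I_n])
  ((fun x => cre (F x 0 j)) @^-1` `[a j, b j[ `&`
   (fun x => cim (F x 0 j)) @^-1` `[c j, e j[)).
  apply: fin_bigcap_measurable; first exact: finite_finset.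
  move=> j _; apply: measurableI.
    by rewrite -[X in measurable X]setTI; exact: Fre.
  by rewrite -[X in measurable X]setTI; exact: Fim.
apply/seteqP; split=> x /=.
  by move=> H j _; rewrite /= !in_itv /=; have [-> ->] := H j.
by move=> H j; have := H j I; rewrite /= !in_itv /= => -[-> ->].
Qed.

Definition copen (U : set (Cn R n)) :=
  forall z, U z -> exists2 e, 0 < e & forall w, cnorm (w - z) < e -> U w.

Definition ccontinuous_at (f : Cn R n -> R) z := forall e, 0 < e ->
  exists2 d, 0 < d & forall w, cnorm (w - z) < d -> `|f w - f z| < e.

(** The sigma-algebra is generated by boxes, so the link with the topology has to be made: an open
    set is the union of the countably many boxes with rational bounds that it contains. *)
Lemma copen_measurable (U : set (Cn R n)) : copen U ->
  measurable (U : set (CnM R n)).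
Proof.
move=> oU.
pose rbox (f : {ffun 'I_n -> (rat * rat) * (rat * rat)}) : set (CnM R n) :=
  box (fun j => ratr (f j).1.1) (fun j => ratr (f j).1.2)
      (fun j => ratr (f j).2.1) (fun j => ratr (f j).2.2).
rewrite (_ : U = \bigcup_f (if `[< rbox f `<=` U >] then rbox f else set0)).
  apply: countable_bigcupT_measurable; first exact: countableP.
  by move=> f; case: ifP => // _; exact: box_measurable.
apply/seteqP; split=> z /=; last first.
  by move=> [f _]; case: ifPn => // /asboolP; apply.
move=> /[dup] Uz /oU[e e0 eU].
(* The factor 2 accounts for real and imaginary parts; [n.+1] instead of [n] makes the final
   estimate strict and keeps the division meaningful for every [n]. *)
pose dl := e / (2 * n.+1%:R).
have dl0 : 0 < dl by rewrite divr_gt0 // mulr_gt0.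
have /choice [f fP] : forall j : 'I_n, exists q : (rat * rat) * (rat * rat),
    [/\ ratr q.1.1 \in `]cre (z 0 j) - dl, cre (z 0 j)[,
        ratr q.1.2 \in `]cre (z 0 j), cre (z 0 j) + dl[,
        ratr q.2.1 \in `]cim (z 0 j) - dl, cim (z 0 j)[ &
        ratr q.2.2 \in `]cim (z 0 j), cim (z 0 j) + dl[].
  move=> j.
  have L (x : R) : x - dl < x by rewrite gtrBl.
  have L' (x : R) : x < x + dl by rewrite ltrDl.
  have [q1 ?] := rat_in_itvoo (L (cre (z 0 j))).
  have [q2 ?] := rat_in_itvoo (L' (cre (z 0 j))).
  have [q3 ?] := rat_in_itvoo (L (cim (z 0 j))).
  have [q4 ?] := rat_in_itvoo (L' (cim (z 0 j))).
  by exists ((q1, q2), (q3, q4)).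
have zf : rbox (finfun f) z.
  move=> j; rewrite ffunE; have := fP j; rewrite !in_itv /=.
  by move=> [/andP[_ h1] /andP[h2 _] /andP[_ h3] /andP[h4 _]]; rewrite h2 h4 !ltW.
exists (finfun f) => //; rewrite ifT //; apply/asboolP => w wf; apply: eU.
apply: (le_lt_trans (cnorm_le_sum _)).
have : \sum_(j < n) cabs ((w - z) 0 j) <= \sum_(j < n) (2 * dl).
  apply: ler_sum => j _; apply: le_trans (cabs_le_reim _) _.
  have := wf j; rewrite ffunE; have := fP j; rewrite !in_itv /= !mxE.
  rewrite creE cimE creN cimN.
  move=> [/andP[h1 h2] /andP[h3 h4] /andP[h5 h6] /andP[h7 h8]] [/andP[h9 h10] /andP[h11 h12]].
  rewrite mulr_natl mulr2n; apply: lerD; rewrite ler_norml; lra.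
move/le_lt_trans; apply; rewrite sumr_const card_ord /dl.
have n1 : (0 : R) < n.+1%:R by [].
have n2 : (n%:R : R) < n.+1%:R by rewrite ltr_nat.
have -> : 2 * (e / (2 * n.+1%:R)) *+ n = e * (n%:R / n.+1%:R).
  by rewrite -mulr_natr; field; rewrite ?gt_eqF.
by rewrite gtr_pMr // ltr_pdivrMr // mul1r.
Qed.

Lemma ccontinuous_measurable (U : set (Cn R n)) (f : Cn R n -> R) :
  copen U -> (forall z, U z -> ccontinuous_at f z) ->
  measurable_fun (U : set (CnM R n)) (f : CnM R n -> R).
Proof.
move=> oU cf; apply: (measurability (@RGenOInfty.G R)).
  exact: RGenOInfty.measurableE.
move=> _ [_ [x ->] <-]; apply: copen_measurable => z [Uz].
rewrite /= in_itv /= andbT => xz.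
have [e e0 eU] := oU z Uz.
have [d d0 dU] := cf z Uz (f z - x) (ltac:(by rewrite subr_gt0)).
exists (Num.min e d); first by rewrite lt_min e0.
move=> w; rewrite lt_min => /andP[we wd]; split; first exact: eU.
rewrite /= in_itv /= andbT; have := dU w wd; rewrite ltr_norml => /andP[]; lra.
Qed.

Lemma copen_ball : copen (@ball_n R n).
Proof.
move=> z; rewrite /ball_n /= => z1; exists (1 - cnorm z); first by rewrite subr_gt0.
move=> w wz; have := cnormD (w - z) z; rewrite subrK; move: wz; lra.
Qed.

Lemma cnorm_continuous z : ccontinuous_at (@cnorm R n) z.
Proof.
move=> e e0; exists e => // w we; exact: le_lt_trans (ler_dist_cnorm _ _) we.
Qed.

Lemma measurable_cnorm : measurable_fun setT (@cnorm R n : CnM R n -> R).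
Proof.
apply: ccontinuous_measurable; first by move=> z _; exists 1.
by move=> z _; exact: cnorm_continuous.
Qed.

Lemma measurable_ball : measurable (@ball_n R n : set (CnM R n)).
Proof. exact: copen_measurable copen_ball. Qed.

End BorelCn.

(** * Translation-invariant measures on boxes *)

Section HaarBoxes.
Variables (R : realType) (n : nat) (W : {measure set (CnM R n) -> \bar R}).
Hypothesis W_trans : forall (h : Cn R n) (A : set (CnM R n)), measurable A ->
  W ((fun z : CnM R n => (z : Cn R n) + h) @^-1` A) = W A.
Hypothesis W_fin : forall a b c d : 'I_n -> R, (W (box a b c d) < +oo)%E.

Let side : finType := ('I_n * bool)%type.

Let sbox (o f : side -> R) : set (CnM R n) :=
  box (fun j => o (j, true)) (fun j => o (j, true) + f (j, true))
      (fun j => o (j, false)) (fun j => o (j, false) + f (j, false)).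

Let sbox_trans o f : W (sbox o f) = W (sbox (fun=> 0) f).
Proof.
pose h : Cn R n := \row_j (o (j, true) +i* o (j, false))%C.
rewrite -(W_trans h); last exact: box_measurable.
congr (W _); apply/seteqP; split=> z /= H j; have := H j;
  rewrite mxE creE cimE mxE /cre /cim /=; lra.
Qed.

Let g f := fine (W (sbox (fun=> 0) f)).

Let upd (f : side -> R) k t : side -> R := fun i => if i == k then t else f i.

Let Wg o f : W (sbox o f) = (g f)%:E.
Proof. by rewrite sbox_trans /g fineK // ge0_fin_numE // W_fin. Qed.

Let g_add f k s t : (forall i, 0 <= f i) -> 0 <= s -> 0 <= t ->
  g (upd f k (s + t)) = g (upd f k s) + g (upd f k t).
Proof.
move=> f0 s0 t0; apply: EFin_inj; rewrite EFinD -!(Wg (fun=> 0)).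
rewrite -(sbox_trans (fun i => if i == k then s else 0) (upd f k t)).
rewrite -measureU; [|exact: box_measurable|exact: box_measurable|].
  congr (W _); apply/seteqP; split=> z /=; rewrite /upd.
    move=> H; case: k H => j []; rewrite /sbox /upd => H.
      have [zs|zs] := ltP (cre (z 0 j)) s; [left|right] => i; have := H i;
        rewrite /= !xpair_eqE /= ?andbT ?andbF; case: eqP => [->|_]; lra.
    have [zs|zs] := ltP (cim (z 0 j)) s; [left|right] => i; have := H i;
      rewrite /= !xpair_eqE /= ?andbT ?andbF; case: eqP => [->|_]; lra.
  case: k => j [] [] H i; have := H i; rewrite /= !xpair_eqE /= ?andbT ?andbF;
    case: eqP => [->|_]; lra.
apply/seteqP; split=> // z [] /=; rewrite /upd.
by case: k => j [] H H'; have := H j; have := H' j;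
  rewrite /= !xpair_eqE /= ?eqxx /=; lra.
Qed.

Let g_lin f k t : (forall i, 0 <= f i) -> 0 <= t ->
  g (upd f k t) = t * g (upd f k 1).
Proof.
move=> f0 t0; apply: (@additive_ge0_linear R (fun t => g (upd f k t))) => //.
  by move=> s t' s0 t'0; exact: g_add.
by move=> s _; rewrite fine_ge0.
Qed.

Let g_prod f (s : seq side) : (forall i, 0 <= f i) -> uniq s ->
  g (fun k => if k \in s then f k else 1) = \prod_(k <- s) f k * g (fun=> 1).
Proof.
move=> f0; elim: s => [_|k s IH /= /andP[ks us]]; first by rewrite big_nil mul1r.
set F := fun i => if i \in s then f i else 1 in IH.
have F0 i : 0 <= F i by rewrite /F; case: ifP.
have -> : (fun i => if i \in k :: s then f i else 1) = upd F k (f k).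
  apply/funext => i; rewrite /upd inE /F; by case: eqP => [->|].
rewrite g_lin // big_cons -mulrA -IH //; congr (_ * g _).
by apply/funext => i; rewrite /upd; case: eqP => // ->; rewrite /F (negPf ks).
Qed.

(** By invariance the measure of a box depends only on its 2n side lengths, indexed by [side] with
    [true] for the real and [false] for the imaginary direction. Cutting a box shows additivity in
    each length, hence linearity by [additive_ge0_linear]; the lengths are then pulled out one at a
    time, down to the unit box. *)
Lemma haar_box : exists2 k : R, 0 <= k & forall a b c d : 'I_n -> R,
  (forall j, a j <= b j /\ c j <= d j) ->
  W (box a b c d) = (k * \prod_(j < n) ((b j - a j) * (d j - c j)))%:E.
Proof.
exists (g (fun=> 1)); first by rewrite fine_ge0.
move=> a b c d abcd.
pose o (i : side) := if i.2 then a i.1 else c i.1.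
pose f (i : side) := if i.2 then b i.1 - a i.1 else d i.1 - c i.1.
have f0 i : 0 <= f i by rewrite /f; case: i => j [] /=; rewrite subr_ge0; have [] := abcd j.
have -> : box a b c d = sbox o f.
  by rewrite /sbox /o /f /=; congr box; apply/funext => j; rewrite addrC subrK.
rewrite Wg; congr EFin.
have := g_prod f0 (index_enum_uniq side).
have -> : (fun k => if k \in index_enum side then f k else 1) = f.
  by apply/funext => i; rewrite mem_index_enum.
move=> ->; rewrite mulrC; congr (_ * _).
rewrite -(pair_bigA _ (fun i b => f (i, b))) /=; apply: eq_bigr => j _.
by rewrite big_bool.
Qed.

End HaarBoxes.

Section NormalizedVolume.
Variables (R : realType) (n : nat) (V : {measure set (CnM R n) -> \bar R}).
Hypothesis HV : normalized_volume V.
Implicit Types (A : set (CnM R n)) (h : Cn R n).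

Let T := CnM R n.

Lemma measurable_translate h : measurable_fun setT (fun z : T => (z : Cn R n) + h : T).
Proof.
apply: measurable_CnP => j.
  apply: (eq_measurable_fun (fun z : T => cre (z 0 j) + cre (h 0 j))).
    by move=> z _; rewrite mxE creE.
  by apply: measurable_funD => //; exact: measurable_cre.
apply: (eq_measurable_fun (fun z : T => cim (z 0 j) + cim (h 0 j))).
  by move=> z _; rewrite mxE cimE.
by apply: measurable_funD => //; exact: measurable_cim.
Qed.

Lemma measurable_scale (c : R[i]) : measurable_fun setT (fun z : T => c *: (z : Cn R n) : T).
Proof.
apply: measurable_CnP => j.
  apply: (eq_measurable_fun (fun z : T => cre c * cre (z 0 j) - cim c * cim (z 0 j))).
    by move=> z _; rewrite mxE creM.
  by apply: measurable_funB; apply: measurable_funM => //;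
    [exact: measurable_cre|exact: measurable_cim].
apply: (eq_measurable_fun (fun z : T => cre c * cim (z 0 j) + cim c * cre (z 0 j))).
  by move=> z _; rewrite mxE cimM.
by apply: measurable_funD; apply: measurable_funM => //;
  [exact: measurable_cim|exact: measurable_cre].
Qed.

Let preimage_measurable (F : T -> T) A : measurable_fun setT F -> measurable A ->
  measurable (F @^-1` A).
Proof. by move=> mF mA; rewrite -[X in measurable X]setTI; exact: mF. Qed.

Lemma volume_translate h A : measurable A ->
  V ((fun z : T => (z : Cn R n) + h) @^-1` A) = V A.
Proof.
have [W [WE _]] := pushforward_measureP V (measurable_translate h).
move=> mA; rewrite -WE; apply: eq_on_boxes mA => a b c d abcd.
have [[k [k0 Vk]] _] := HV.
rewrite WE (_ : _ @^-1` _ = box (fun j => a j - cre (h 0 j)) (fun j => b j - cre (h 0 j))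
     (fun j => c j - cim (h 0 j)) (fun j => d j - cim (h 0 j))).
  rewrite !Vk ?ltry //; last first.
    by move=> j; have [? ?] := abcd j; rewrite !lerD2r.
  split=> //; congr (_ * _)%:E; apply: eq_bigr => j _; congr (_ * _); ring.
by apply/seteqP; split=> z /= H j; have := H j; rewrite mxE creE cimE; lra.
Qed.

Lemma volume_dilate (t : R) A : 0 < t -> measurable A ->
  V ((fun z : T => t%:C%C *: (z : Cn R n)) @^-1` A) = ((t ^- (2 * n))%:E * V A)%E.
Proof.
move=> t0 mA.
have [W [WE _]] := pushforward_measureP V (measurable_scale t%:C%C).
have tn0 : 0 <= t ^- (2 * n) by rewrite invr_ge0 exprn_ge0 // ltW.
rewrite -WE -[RHS]/(mscale (NngNum tn0) V A).
apply: (@eq_on_boxes _ _ _ (mscale (NngNum tn0) V)) mA => a b c d abcd.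
have [[k [k0 Vk]] _] := HV.
rewrite WE /= /mscale /= (_ : _ @^-1` _ = box (fun j => t^-1 * a j) (fun j => t^-1 * b j)
     (fun j => t^-1 * c j) (fun j => t^-1 * d j)).
  have ti0 : 0 < t^-1 by rewrite invr_gt0.
  rewrite !Vk ?ltry //; last first.
    by move=> j; have [? ?] := abcd j; rewrite !ler_pM2l.
  split=> //; rewrite -EFinM; congr EFin; rewrite mulrCA; congr (_ * _).
  rewrite -exprVn exprM -[X in _ ^+ X](card_ord n) -prodr_const -big_split /=.
  by apply: eq_bigr => j _; ring.
have E (x y : R) : (t^-1 * x <= y) = (x <= t * y) by rewrite ler_pdivrMl.
have E' (x y : R) : (y < t^-1 * x) = (t * y < x) by rewrite ltr_pdivlMl.
apply/seteqP; split=> z /= H j; have := H j; rewrite mxE creM cimM cre_real cim_real;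
  rewrite !mul0r ?subr0 ?addr0 !E !E' //.
Qed.

Lemma volume_ball c (r : R) : 0 < r ->
  V [set z : T | cnorm ((z : Cn R n) - c) < r] = (r ^+ (2 * n))%:E.
Proof.
move=> r0.
have mb : measurable (@ball_n R n : set T) := @measurable_ball R n.
have -> : [set z : T | cnorm ((z : Cn R n) - c) < r] =
  (fun z : T => (z : Cn R n) + (- c)) @^-1` ((fun z : T => r^-1%:C%C *: (z : Cn R n)) @^-1` @ball_n R n).
  apply/seteqP; split=> z; rewrite /ball_n /= cnormZ cabs_real ger0_norm ?invr_ge0 ?ltW //;
  by rewrite ltr_pdivrMl ?mulr1.
rewrite volume_translate; last exact: preimage_measurable (measurable_scale _) mb.
rewrite volume_dilate ?invr_gt0 //.
by have [_ ->] := HV; rewrite mule1 exprVn invrK.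
Qed.

(** The image measure is again translation invariant, hence a multiple of [V] by [haar_box]. Since
    [U] preserves the unit ball, the factor is 1. *)
Lemma volume_isometry (U U' : Cn R n -> Cn R n) A :
  measurable_fun setT (U : T -> T) -> (forall z h, U (z + h) = U z + U h) ->
  cancel U' U -> (forall z, cnorm (U z) = cnorm z) -> measurable A ->
  V ((U : T -> T) @^-1` A) = V A.
Proof.
move=> mU UD UK Un mA.
have [W [WE _]] := pushforward_measureP V mU.
have Wt (h : Cn R n) (B : set T) : measurable B -> W ((fun z : T => (z : Cn R n) + h) @^-1` B) = W B.
  move=> mB; rewrite !WE.
  have mcB := preimage_measurable mU mB.
  rewrite -(volume_translate (U' h) mcB); congr (V _).
  by apply/seteqP; split=> z /=; rewrite UD UK.
have Wf (a b e d : 'I_n -> R) : (W (box a b e d) < +oo)%E.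
  rewrite WE.
  (* [M] bounds the norm on the box; as [U] preserves norms, the preimage lies in a ball of finite
     volume. *)
  pose M := \sum_(j < n) ((`|a j| + `|b j| + `|e j| + `|d j|) *+ 2 + 1).
  have M0 : 0 <= M.
    by apply: sumr_ge0 => j _; rewrite addr_ge0 // mulrn_wge0 // !addr_ge0.
  apply: (@le_lt_trans _ _ (V [set z : T | cnorm ((z : Cn R n) - 0) < M + 1])); last first.
    by rewrite volume_ball ?ltry // ltr_wpDl.
  apply: le_measure; rewrite ?inE.
  - exact: preimage_measurable mU (box_measurable _ _ _ _).
  - rewrite (_ : [set z : T | _] = [set z : T | cnorm (z : Cn R n) < M + 1]); last first.
      by apply/seteqP; split=> z /=; rewrite subr0.
    apply: copen_measurable => z /= zN; exists (M + 1 - cnorm z); first by rewrite subr_gt0.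
    by move=> w wz; have := cnormD (w - z) z; rewrite subrK; move: wz; lra.
  move=> z /= H; rewrite subr0 -Un ltr_pwDr //.
  apply: (le_trans (cnorm_le_sum (U z))); apply: ler_sum => j _.
  have := H j; move: (U z 0 j) => y [y1 y2].
  apply: (le_trans (cabs_le_reim y)); rewrite mulr2n.
  move: y1 y2 => /andP[y1 y2] /andP[y3 y4].
  have B (x s t : R) : s <= x -> x < t -> `|x| <= `|s| + `|t|.
    move=> sx xt; rewrite ler_norml; have := ler_norm t; have := ler_norm (- s).
    have := normr_ge0 t; have := normr_ge0 s; rewrite normrN; lra.
  have := B _ _ _ y1 y2; have := B _ _ _ y3 y4.
  have := normr_ge0 (a j); have := normr_ge0 (b j).
  have := normr_ge0 (e j); have := normr_ge0 (d j); lra.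
have [k k0 Wk] := haar_box Wt Wf.
have [[m [m0 Vm]] V1] := HV.
have km0 : 0 <= k / m by rewrite divr_ge0 // ltW.
have WV (B : set T) : measurable B -> W B = mscale (NngNum km0) V B.
  apply: (@eq_on_boxes _ _ _ (mscale (NngNum km0) V)) => a b e d abed.
  by rewrite /= /mscale /= Wk // Vm // -EFinM ltry mulrA divfK // gt_eqF.
have mb : measurable (@ball_n R n : set T) := @measurable_ball R n.
have := WV _ mb; rewrite WE /= /mscale /= V1 mule1.
have -> : (U : T -> T) @^-1` @ball_n R n = @ball_n R n.
  by apply/seteqP; split=> z; rewrite /ball_n /= Un.
rewrite V1 => -[km1].
by rewrite -WE WV //= /mscale /= -km1 mul1e.
Qed.

Lemma volume_rotate (c : R[i]) A : cabs c = 1 -> measurable A ->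
  V ((fun z : T => c *: (z : Cn R n)) @^-1` A) = V A.
Proof.
move=> c1; have c0 : c != 0 by rewrite -cabs_gt0 c1.
apply: (@volume_isometry (fun z => c *: z) (fun z => c^-1 *: z)).
- exact: measurable_scale.
- exact: scalerDr.
- by move=> z; rewrite scalerA mulfV // scale1r.
- by move=> z; rewrite cnormZ c1 mul1r.
Qed.

Lemma volume_sigma_finite : sigma_finite setT V.
Proof.
exists (fun N => [set z : T | cnorm ((z : Cn R n) - 0) < N.+1%:R]).
  apply/seteqP; split=> // z _; exists (Num.truncn (cnorm (z : Cn R n))) => //=.
  by rewrite subr0; have /andP[] := truncn_itv (cnorm_ge0 (z : Cn R n)).
move=> N; split; last by rewrite volume_ball ?ltry.
have -> : [set z : T | cnorm ((z : Cn R n) - 0) < N.+1%:R] =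
   [set z : T | cnorm (z : Cn R n) < N.+1%:R] by apply/seteqP; split=> z /=; rewrite subr0.
apply: copen_measurable => z /= zN; exists (N.+1%:R - cnorm z); first by rewrite subr_gt0.
by move=> w wz; have := cnormD (w - z) z; rewrite subrK; move: wz; lra.
Qed.

Section Integrals.
Variable g : T -> \bar R.
Hypotheses (mg : measurable_fun setT g) (g0 : forall z, (0 <= g z)%E).

Lemma integral_translate h : (\int[V]_z g ((z : Cn R n) + h)%R = \int[V]_z g z)%E.
Proof.
have [W [WE WI]] := pushforward_measureP V (measurable_translate h).
rewrite -(WI g mg g0); apply: eq_measure_ge0_integral => // A mA.
by rewrite WE volume_translate.
Qed.

Lemma integral_rotate (c : R[i]) : cabs c = 1 ->
  (\int[V]_z g (c *: (z : Cn R n))%R = \int[V]_z g z)%E.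
Proof.
move=> c1; have [W [WE WI]] := pushforward_measureP V (measurable_scale c).
rewrite -(WI g mg g0); apply: eq_measure_ge0_integral => // A mA.
by rewrite WE volume_rotate.
Qed.

Lemma integral_dilate (t : R) : 0 < t ->
  (\int[V]_z g (t%:C%C *: (z : Cn R n))%R = (t ^- (2 * n))%:E * \int[V]_z g z)%E.
Proof.
move=> t0; have [W [WE WI]] := pushforward_measureP V (measurable_scale t%:C%C).
have tn0 : 0 <= t ^- (2 * n) by rewrite invr_ge0 exprn_ge0 // ltW.
rewrite -(WI g mg g0) -(@ge0_integral_mscale _ _ _ V setT measurableT (NngNum tn0)) //.
apply: eq_measure_ge0_integral => // A mA.
by rewrite WE volume_dilate.
Qed.

End Integrals.
End NormalizedVolume.

(** * Goursat's theorem and the mean value property *)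

Section SegmentIntegral.
Variable R : realType.
Implicit Types (f g : R -> R) (a b c : R).

Lemma continuous_epsP f :
  (forall x e, 0 < e -> exists2 d, 0 < d & forall y, `|y - x| < d -> `|f y - f x| < e) ->
  continuous f.
Proof.
move=> H x; apply/cvgrPdist_lt => e e0; have [d d0 dP] := H x e e0.
apply/nbhs_ballP; exists d => //= y; rewrite /ball /= => xy.
by rewrite distrC; apply: dP; rewrite distrC.
Qed.

Lemma continuous_eps f x e : continuous f -> 0 < e ->
  exists2 d, 0 < d & forall y, `|y - x| < d -> `|f y - f x| < e.
Proof.
move=> cf e0; have /cvgrPdist_lt /(_ e e0) := cf x.
move=> /nbhs_ballP[d /= d0 dP]; exists d => // y yx.
by rewrite distrC; apply: dP; rewrite /ball /= distrC.
Qed.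

Definition segint f a b : R := \int[lebesgue_measure]_(x in `[a, b]) f x.

Lemma segint_integrable f a b : continuous f ->
  lebesgue_measure.-integrable `[a, b] (EFin \o f).
Proof.
move=> cf; apply: continuous_compact_integrable; first exact: segment_compact.
exact: continuous_subspaceT.
Qed.

Lemma segintD f g a b : continuous f -> continuous g ->
  segint (fun x => f x + g x) a b = segint f a b + segint g a b.
Proof. by move=> cf cg; apply: RintegralD => //; exact: segint_integrable. Qed.

Lemma segintB f g a b : continuous f -> continuous g ->
  segint (fun x => f x - g x) a b = segint f a b - segint g a b.
Proof. by move=> cf cg; apply: RintegralB => //; exact: segint_integrable. Qed.

Lemma segintZ f a b c : continuous f ->
  segint (fun x => c * f x) a b = c * segint f a b.
Proof. by move=> cf; apply: RintegralZl => //; exact: segint_integrable. Qed.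

Lemma segint_cst a b c : a <= b -> segint (fun=> c) a b = c * (b - a).
Proof.
move=> ab; rewrite /segint Rintegral_cst //; congr (_ * _).
have E : lebesgue_measure `[a, b]%classic = (b - a)%:E :> \bar R.
  rewrite lebesgue_measure_itv /= lte_fin.
  by case: ltgtP ab => // -> _; rewrite subrr.
exact: (congr1 fine E).
Qed.

Lemma le_segint f g a b : continuous f -> continuous g ->
  (forall x, a <= x <= b -> f x <= g x) -> segint f a b <= segint g a b.
Proof.
move=> cf cg fg; apply: le_Rintegral => //; try exact: segint_integrable.
Qed.

Lemma eq_segint f g a b : (forall x, a <= x <= b -> f x = g x) ->
  segint f a b = segint g a b.
Proof.
by move=> fg; apply: eq_Rintegral => x; rewrite inE /= in_itv /=; exact: fg.
Qed.

Lemma segint_bound f a b c : a <= b -> continuous f ->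
  (forall x, a <= x <= b -> `|f x| <= c) -> `|segint f a b| <= c * (b - a).
Proof.
move=> ab cf fc.
have cst (t : R) : continuous (fun _ : R => t) by move=> x; exact: cvg_cst.
rewrite ler_norml -mulNr -!segint_cst //.
by apply/andP; split; apply: le_segint => // x /fc; rewrite ler_norml => /andP[].
Qed.

Lemma segint_split f a b c : continuous f -> a <= b -> b <= c ->
  segint f a c = segint f a b + segint f b c.
Proof.
move=> cf ab bc; rewrite /segint.
have io : lebesgue_measure.-integrable `]b, c] (EFin \o f).
  apply: integrableS (segint_integrable b c cf) => //.
  by apply: subset_itvr; rewrite bnd_simp.
rewrite -(Rintegral_itv_obnd_cbnd io).
rewrite -(@Rintegral_itvB R f (BLeft a) (BRight c) b) ?bnd_simp //.
  by rewrite addrC subrK.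
exact: segint_integrable.
Qed.

End SegmentIntegral.

(** * Nested rectangles *)

Section NestedBoxes.
Variables (R : realType) (B : nat -> R * R -> Prop) (w h : nat -> R).
Hypotheses (w0 : forall k, 0 <= w k) (h0 : forall k, 0 <= h k).
Hypothesis step : forall k p, B k p -> exists2 p', B k.+1 p' &
  [/\ p.1 <= p'.1, p'.1 + w k.+1 <= p.1 + w k,
      p.2 <= p'.2 & p'.2 + h k.+1 <= p.2 + h k].

Let nested_limit (x v : nat -> R) : (forall k, 0 <= v k) ->
  (forall k, x k <= x k.+1) -> (forall k, x k.+1 + v k.+1 <= x k + v k) ->
  exists a, forall k, x k <= a <= x k + v k.
Proof.
move=> v0 xS vS.
have xm i j : x i <= x (i + j)%N.
  by elim: j => [|j IH]; rewrite ?addn0 // addnS; exact: le_trans IH (xS _).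
have vm i j : x (i + j)%N + v (i + j)%N <= x i + v i.
  by elim: j => [|j IH]; rewrite ?addn0 // addnS; exact: le_trans (vS _) IH.
have xv i j : x i <= x j + v j.
  apply: le_trans (xm i j) _; rewrite addnC; apply: le_trans (vm j i).
  by rewrite lerDl.
have hs : has_sup (range x).
  by split; [exists (x 0), 0%N | exists (x 0 + v 0) => _ [i _ <-]].
exists (sup (range x)) => k; apply/andP; split.
  by apply: (sup_upper_bound hs); exists k.
by apply: (ge_sup hs.1) => _ [i _ <-].
Qed.

(** A rectangle of size [w k] by [h k] is represented by its lower left corner. The common point is
    found coordinatewise as the supremum of the corners. *)
Lemma nested_boxes p0 : B 0 p0 -> exists a b, forall k, exists2 p, B k p &
  p.1 <= a <= p.1 + w k /\ p.2 <= b <= p.2 + h k.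
Proof.
move=> Bp0.
have /choice[nx nxP] : forall kp : nat * (R * R), exists p', B kp.1 kp.2 ->
    B kp.1.+1 p' /\ [/\ kp.2.1 <= p'.1, p'.1 + w kp.1.+1 <= kp.2.1 + w kp.1,
      kp.2.2 <= p'.2 & p'.2 + h kp.1.+1 <= kp.2.2 + h kp.1].
  move=> [k p] /=; have [/step[p' ? ?]|] := pselect (B k p); first by exists p'.
  by move=> nB; exists p.
pose S := fix S k := if k is k'.+1 then nx (k', S k') else p0.
have BS k : B k (S k) by elim: k => //= k IH; have [] := nxP (k, S k) IH.
have SS k := (nxP (k, S k) (BS k)).2.
have [a aP] : exists a, forall k, (S k).1 <= a <= (S k).1 + w k.
  by apply: nested_limit => // k; have [] := SS k.
have [b bP] : exists a, forall k, (S k).2 <= a <= (S k).2 + h k.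
  by apply: nested_limit => // k; have [] := SS k.
by exists a, b => k; exists (S k).
Qed.

End NestedBoxes.

Lemma le_of_sum4 (R : realDomainType) (m a b c d : R) : m * 4 <= a + b + c + d ->
  a <= m -> b <= m -> c <= m -> m <= d.
Proof. lra. Qed.

(** * Goursat's theorem on rectangles *)

Section Goursat.
Variables (R : realType) (P Q : R -> R -> R) (X1 X2 : R).

(** The shared coefficient [A] encodes dQ/dx = dP/dy, that is, the closedness of P dx + Q dy at (a,
    b). Only [x] is confined to an interval: in the application [x] is the logarithm of a modulus
    and [y] an angle. *)
Definition cauchy_riemann_at (a b : R) := exists A B C : R, forall e, 0 < e ->
  exists2 d, 0 < d & forall x y, X1 <= x <= X2 -> `|x - a| < d -> `|y - b| < d ->
    `|Q x y - Q a b - (A * (x - a) + B * (y - b))| <= e * (`|x - a| + `|y - b|) /\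
    `|P x y - P a b - (C * (x - a) + A * (y - b))| <= e * (`|x - a| + `|y - b|).

Hypothesis cP : forall y, continuous (fun x => P x y).
Hypothesis cQ : forall x, X1 <= x <= X2 -> continuous (Q x).
Hypothesis CR : forall a b, X1 <= a <= X2 -> cauchy_riemann_at a b.

Let circ x y w h := segint (fun t => Q (x + w) t - Q x t) y (y + h)
  - segint (fun t => P t (y + h) - P t y) x (x + w).

Let cB (f g : R -> R) : continuous f -> continuous g -> continuous (fun t => f t - g t).
Proof. by move=> cf cg t; apply: cvgB; [exact: cf | exact: cg]. Qed.

(** Each of the two integrals of the linear approximation equals A w h, so they cancel in the
    circulation; the error terms contribute at most 2 e (w + h) h and 2 e (w + h) w. *)
Let circ_small a b e : X1 <= a <= X2 -> 0 < e -> exists2 d, 0 < d &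
  forall x y w h, 0 <= w -> 0 <= h -> X1 <= x -> x + w <= X2 ->
    x <= a <= x + w -> y <= b <= y + h -> w + h < d ->
    `|circ x y w h| <= 2 * e * (w + h) ^+ 2.
Proof.
move=> aX e0; have [A [B [C H]]] := CR b aX.
have [d d0 dP] := H e e0; exists d => // x y w h w0 h0 xX wX /andP[xa ax] /andP[yb bY] whd.
have cst (t : R) : continuous (fun _ : R => t) by move=> u; exact: cvg_cst.
have cQ1 : continuous (fun t => Q (x + w) t - Q x t).
  by apply: cB; apply: cQ; lra.
have cP1 : continuous (fun t => P t (y + h) - P t y) by apply: cB; apply: cP.
have D s t : x <= s <= x + w -> y <= t <= y + h ->
    e * (`|s - a| + `|t - b|) <= e * (w + h).
  move=> /andP[? ?] /andP[? ?]; rewrite ler_pM2l //; apply: lerD; rewrite ler_norml; lra.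
have near s t : x <= s <= x + w -> y <= t <= y + h ->
    [/\ X1 <= s <= X2, `|s - a| < d & `|t - b| < d].
  move=> /andP[? ?] /andP[? ?]; split; first by lra.
    by rewrite ltr_norml; lra.
  by rewrite ltr_norml; lra.
have E1 : `|segint (fun t => Q (x + w) t - Q x t - A * w) y (y + h)| <= 2 * e * (w + h) * h.
  apply: (le_trans (segint_bound _ (cB cQ1 (cst _)) _)); [by lra| |by rewrite (addrC y) addrK; exact: lexx].
  move=> t ty.
  have l1 : x <= x + w <= x + w by lra.
  have l2 : x <= x <= x + w by lra.
  have [h1 h2 h3] := near _ _ l1 ty; have [k1 k2 k3] := near _ _ l2 ty.
  have [q1 _] := dP _ _ h1 h2 h3; have [q2 _] := dP _ _ k1 k2 k3.
  move: (le_trans q1 (D _ _ l1 ty)) (le_trans q2 (D _ _ l2 ty)) => {q1 q2 l1 l2 h1 h2 h3 k1 k2 k3 ty}.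
  by rewrite !ler_norml => /andP[? ?] /andP[? ?]; apply/andP; split; lra.
have E2 : `|segint (fun t => P t (y + h) - P t y - A * h) x (x + w)| <= 2 * e * (w + h) * w.
  apply: (le_trans (segint_bound _ (cB cP1 (cst _)) _)); [by lra| |by rewrite (addrC x) addrK; exact: lexx].
  move=> s sx.
  have l1 : y <= y + h <= y + h by lra.
  have l2 : y <= y <= y + h by lra.
  have [h1 h2 h3] := near _ _ sx l1; have [k1 k2 k3] := near _ _ sx l2.
  have [_ q1] := dP _ _ h1 h2 h3; have [_ q2] := dP _ _ k1 k2 k3.
  move: (le_trans q1 (D _ _ sx l1)) (le_trans q2 (D _ _ sx l2)) => {q1 q2 l1 l2 h1 h2 h3 k1 k2 k3 sx}.
  by rewrite !ler_norml => /andP[? ?] /andP[? ?]; apply/andP; split; lra.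
move: E1 E2; rewrite (segintB _ _ cQ1 (cst _)) (segintB _ _ cP1 (cst _)).
rewrite !segint_cst ?lerDl // /circ; move: (segint _ _ _) (segint _ _ _) => a1 a2.
rewrite (addrC y) addrK (addrC x) addrK !ler_norml => /andP[? ?] /andP[? ?].
have E : 2 * e * (w + h) ^+ 2 = 2 * e * (w + h) * h + 2 * e * (w + h) * w by ring.
by rewrite E; apply/andP; split; lra.
Qed.

Let circ_split x y w h : 0 <= w -> 0 <= h -> X1 <= x -> x + w <= X2 ->
  circ x y w h = circ x y (w / 2) (h / 2) + circ (x + w / 2) y (w / 2) (h / 2)
   + circ x (y + h / 2) (w / 2) (h / 2) + circ (x + w / 2) (y + h / 2) (w / 2) (h / 2).
Proof.
move=> w0 h0 xX wX; rewrite /circ.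
have E (z t : R) : z + t / 2 + t / 2 = z + t by lra.
rewrite !E !segintB; try (apply: cQ; lra); try exact: cP.
have sx z : segint (P^~ z) x (x + w) = segint (P^~ z) x (x + w / 2) + segint (P^~ z) (x + w / 2) (x + w).
  by apply: segint_split; [exact: cP|lra|lra].
have sy z : X1 <= z <= X2 ->
    segint (Q z) y (y + h) = segint (Q z) y (y + h / 2) + segint (Q z) (y + h / 2) (y + h).
  by move=> zX; apply: segint_split; [exact: cQ|lra|lra].
rewrite !sx !sy; lra.
Qed.

Lemma goursat_rectangle y0 h : X1 <= X2 -> 0 <= h ->
  segint (fun t => Q X2 t - Q X1 t) y0 (y0 + h) =
  segint (fun t => P t (y0 + h) - P t y0) X1 X2.
Proof.
move=> X12 h0; apply/eqP; rewrite -subr_eq0; apply/negPn/negP => m0.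
pose w := X2 - X1; have w0 : 0 <= w by rewrite /w; lra.
pose m := `|circ X1 y0 w h|.
have {}m0 : 0 < m.
  by rewrite /m /circ /w (addrC X1) subrK normr_gt0.
pose wk k := w / 2 ^+ k; pose hk k := h / 2 ^+ k.
have p2 k : 0 < 2 ^+ k :> R by rewrite exprn_gt0.
have wk0 k : 0 <= wk k by rewrite divr_ge0 // ltW.
have hk0 k : 0 <= hk k by rewrite divr_ge0 // ltW.
have wS k : wk k.+1 = wk k / 2 by rewrite /wk exprS invfM mulrA mulrAC.
have hS k : hk k.+1 = hk k / 2 by rewrite /hk exprS invfM mulrA mulrAC.
pose B k (p : R * R) := [/\ X1 <= p.1, p.1 + wk k <= X2 &
   m / 4 ^+ k <= `|circ p.1 p.2 (wk k) (hk k)|].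
have step k p : B k p -> exists2 p', B k.+1 p' &
  [/\ p.1 <= p'.1, p'.1 + wk k.+1 <= p.1 + wk k,
      p.2 <= p'.2 & p'.2 + hk k.+1 <= p.2 + hk k].
  move: p => [x y] [/= xX wX]; rewrite circ_split // -!hS -!wS => mc.
  have {}mc : m / 4 ^+ k.+1 * 4 <= `|circ x y (wk k.+1) (hk k.+1)|
     + `|circ (x + wk k.+1) y (wk k.+1) (hk k.+1)|
     + `|circ x (y + hk k.+1) (wk k.+1) (hk k.+1)|
     + `|circ (x + wk k.+1) (y + hk k.+1) (wk k.+1) (hk k.+1)|.
    have -> : m / 4 ^+ k.+1 * 4 = m / 4 ^+ k by rewrite exprS; field; rewrite expf_neq0.
    apply: le_trans mc _; do 3 (apply: le_trans (ler_normD _ _) _; rewrite lerD2r).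
    exact: lexx.
  have wk1 := wS k; have hk1 := hS k; have wk2 := wk0 k; have hk2 := hk0 k.
  have [c1|c1] := leP (m / 4 ^+ k.+1) `|circ x y (wk k.+1) (hk k.+1)|.
    by move: mc => _; exists (x, y); split=> //=; lra.
  have [c2|c2] := leP (m / 4 ^+ k.+1) `|circ (x + wk k.+1) y (wk k.+1) (hk k.+1)|.
    by move: mc c1 => _ _; exists (x + wk k.+1, y); split=> //=; lra.
  have [c3|c3] := leP (m / 4 ^+ k.+1) `|circ x (y + hk k.+1) (wk k.+1) (hk k.+1)|.
    by move: mc c1 c2 => _ _ _; exists (x, y + hk k.+1); split=> //=; lra.
  have c4 := le_of_sum4 mc (ltW c1) (ltW c2) (ltW c3).
  by move: mc c1 c2 c3 => _ _ _ _; exists (x + wk k.+1, y + hk k.+1); split=> //=; lra.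
have B0 : B 0%N (X1, y0).
  by rewrite /B /wk /hk !expr0 !divr1; split=> //=; rewrite /w; lra.
have [a [b abP]] := nested_boxes wk0 hk0 step B0.
have aX : X1 <= a <= X2 by have [p [? ? _] [/andP[? ?] _]] := abP 0%N; lra.
(* After [k] subdivisions the circulation is at least m / 4^k, while [circ_small] bounds it by 2 e
   (w + h)^2 / 4^k. This [e] makes the two contradict each other, and the added 1 keeps it defined
   for a degenerate rectangle. *)
pose e := m / (4 * ((w + h) ^+ 2 + 1)).
have wh1 : 0 < (w + h) ^+ 2 + 1 by rewrite ltr_wpDl // sqr_ge0.
have e0 : 0 < e by rewrite divr_gt0 // mulr_gt0.
have [d d0 dP] := circ_small b aX e0.
have [k kP] : exists k, (w + h) / 2 ^+ k < d.
  exists (Num.truncn ((w + h) / d)).+1.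
  have /andP[_ kk] := truncn_itv (divr_ge0 (addr_ge0 w0 h0) (ltW d0)).
  rewrite ltr_pdivrMr // mulrC -ltr_pdivrMr //; apply: lt_le_trans kk _.
  by rewrite -natrX ler_nat ltnW // ltn_expl.
have [[x y] [/= x1 x2 xm] [/= ax bY]] := abP k.
have := dP x y (wk k) (hk k) (wk0 k) (hk0 k) x1 x2 ax bY.
rewrite /wk /hk -mulrDl => /(_ kP); apply/negP; rewrite -ltNge.
apply: lt_le_trans xm; rewrite expr_div_n -exprM mulnC exprM.
have -> : (2 : R) ^+ 2 = 4 by ring.
rewrite mulrA ltr_pM2r ?invr_gt0 ?exprn_gt0 // /e.
rewrite [X in X < _](_ : _ = m * ((w + h) ^+ 2 / (2 * ((w + h) ^+ 2 + 1)))); last first.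
  by field; rewrite gt_eqF.
rewrite gtr_pMr // ltr_pdivrMr ?mulr_gt0 // mul1r.
have := sqr_ge0 (w + h); lra.
Qed.

End Goursat.

Lemma clamp_lipschitz (R : realDomainType) (a b x y : R) :
  `|Num.max a (Num.min x b) - Num.max a (Num.min y b)| <= `|x - y|.
Proof.
move: (ler_norm (x - y)) (ler_norm (- (x - y))); rewrite normrN.
by case: (leP x b) => ?; case: (leP y b) => ?; case: (leP a x) => ?;
  case: (leP a y) => ?; case: (leP a b) => ?; rewrite ler_norml; lra.
Qed.

(** * The exponential and the unit circle *)

Section CircleExp.
Variable R : realType.
Implicit Types (s t x y : R).

Lemma mvt_bound (f df : R -> R) t K : (forall x, is_derive x 1 f (df x)) ->
  (forall c, `|c| <= `|t| -> `|df c| <= K) -> `|f t - f 0| <= K * `|t|.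
Proof.
move=> fd dfK.
have cf a b : {within `[a, b], continuous f}.
  apply: continuous_subspaceT => x.
  by apply/differentiable_continuous/derivable1_diffP; have [] := fd x.
have [t0|t0] := leP 0 t.
  have [c ct ->] := @MVT_segment _ f df 0 t t0 (fun x _ => fd x) (cf _ _).
  rewrite normrM subr0 ler_wpM2r // dfK // !ger0_norm //; move: ct; rewrite in_itv /=; lra.
have [c ct E] := @MVT_segment _ f df t 0 (ltW t0) (fun x _ => fd x) (cf _ _).
rewrite distrC E normrM sub0r normrN ler_wpM2r // dfK //.
by move: ct; rewrite in_itv /= => /andP[tc c0]; rewrite !ler0_norm //; lra.
Qed.

Lemma abs_sin_le t : `|sin t| <= `|t|.
Proof.
have := @mvt_bound sin cos t 1 (fun x => is_derive_sin x).
by rewrite sin0 subr0 mul1r; apply=> c _; exact: cos_max.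
Qed.

Lemma abs_cos_sub1_le t : `|cos t - 1| <= `|t| ^+ 2.
Proof.
have := @mvt_bound cos (fun x => - sin x) t `|t| (fun x => is_derive_cos x).
rewrite cos0 expr2; apply=> c ct; rewrite normrN; exact: le_trans (abs_sin_le _) ct.
Qed.

Lemma abs_cos_sub1_lip t : `|cos t - 1| <= `|t|.
Proof.
have := @mvt_bound cos (fun x => - sin x) t 1 (fun x => is_derive_cos x).
by rewrite cos0 mul1r; apply=> c _; rewrite normrN; exact: sin_max.
Qed.

Lemma abs_sin_sub_le t : `|sin t - t| <= `|t| ^+ 3.
Proof.
have := @mvt_bound (fun x => sin x - x) (fun x => cos x - 1) t (`|t| ^+ 2)
  (fun x => is_deriveB (is_derive_sin x) (is_derive_id x 1)).
rewrite /= sin0 !subr0 (exprSr _ 2); apply=> c ct.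
by apply: (le_trans (abs_cos_sub1_le _)); rewrite ler_pXn2r ?nnegrE.
Qed.

Lemma expR_sub1_bound s : `|s| <= 1 / 2 -> 0 <= expR s - 1 - s <= 2 * s ^+ 2.
Proof.
rewrite ler_norml => /andP[s1 s2]; apply/andP; split.
  by rewrite -addrA -opprD subr_ge0 expR_ge1Dx.
have := expR_ge1Dx (- s); rewrite expRN => h.
have e0 := expR_gt0 s.
have : (1 - s) * expR s <= 1 by rewrite -ler_pdivlMr // div1r.
have := expR_ge1Dx s; nra.
Qed.

Definition cis t : R[i] := (cos t +i* sin t)%C.

Lemma cis0 : cis 0 = 1. Proof. by rewrite /cis cos0 sin0. Qed.

Lemma cisD s t : cis (s + t) = cis s * cis t.
Proof.
apply: complex_eqP; rewrite ?creM ?cimM /cis /cre /cim /=; first exact: cosD.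
by rewrite sinD addrC.
Qed.

Lemma cis2pi : cis (pi *+ 2) = 1.
Proof. by rewrite /cis cos2pi sin2pi. Qed.

Lemma cabs_cis t : cabs (cis t) = 1.
Proof.
by apply/eqP; rewrite -(eqrXn2 (ltn0Sn 1)) // cabs_sq /cis /cre /cim /= cos2Dsin2 expr1n.
Qed.

Lemma cis_lip s t : cabs (cis s - cis t) <= 2 * `|s - t|.
Proof.
rewrite -{1}(subrK t s) cisD -{2}[cis t]mul1r -mulrBl cabsM cabs_cis mulr1.
apply: (le_trans (cabs_le_reim _)); rewrite creE cimE creN cimN cre1 cim1 subr0.
have := abs_cos_sub1_lip (s - t); have := abs_sin_le (s - t).
rewrite /cis /cre /cim /=; lra.
Qed.

(** The first-order expansion of exp(s + it) at 0 with an explicit quadratic remainder. It supplies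
    the chain rule for the substitution z = exp(x + iy). *)
Lemma cexp_expansion s t : `|s| <= 1 / 2 -> `|t| <= 1 / 2 ->
  cabs ((expR s)%:C%C * cis t - 1 - (s +i* t)%C) <= 4 * (`|s| + `|t|) ^+ 2.
Proof.
move=> s1 t1; have := expR_sub1_bound s1; set E := expR s => /andP[E1 E2].
have E0 : 0 < E by exact: expR_gt0.
apply: le_trans (cabs_le_reim _) _.
rewrite !(creE, cimE, creN, cimN, creM, cimM, cre_real, cim_real, cre1, cim1).
rewrite /cis /cre /cim /= !mul0r !subr0 addr0.
have c2 := abs_cos_sub1_le t; have s3 := abs_sin_sub_le t.
move: (normr_ge0 s) (normr_ge0 t) c2 s3 E2 s1 t1; rewrite -(real_normK (num_real s)).
set S := `|s|; set T := `|t| => S0 T0 c2 s3 E2 s1 t1.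
have sS : s <= S by exact: ler_norm.
have sS' : - S <= s by have := ler_norm (- s); rewrite normrN -/S; lra.
have El2 : E <= 2 by nra.
have e1 : `|E * cos t - 1 - s| <= 2 * T ^+ 2 + 2 * S ^+ 2.
  have -> : E * cos t - 1 - s = E * (cos t - 1) + (E - 1 - s) by ring.
  apply: (le_trans (ler_normD _ _)); rewrite normrM (gtr0_norm E0) (ger0_norm E1).
  by apply: lerD => //; apply: ler_pM => //; exact: ltW.
have e2 : `|E * sin t - t| <= 2 * T ^+ 3 + (S + 2 * S ^+ 2) * T.
  have -> : E * sin t - t = E * (sin t - t) + (E - 1) * t by ring.
  apply: (le_trans (ler_normD _ _)); rewrite !normrM (gtr0_norm E0).
  apply: lerD; first by apply: ler_pM => //; exact: ltW.
  by apply: ler_pM => //; rewrite ler_norml; lra.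
have T3 : T ^+ 3 <= T ^+ 2 / 2 by rewrite exprSr; nra.
have S2 : S ^+ 2 <= S / 2 by nra.
apply: (le_trans (lerD e1 e2)); nra.
Qed.

End CircleExp.

(** * The mean value property on circles *)

Section MeanValue.
Variable R : realType.
Implicit Types (g : R[i] -> R[i]) (z h : R[i]).

Definition cdiff_at g z := exists L : R[i], forall e : R, 0 < e ->
  exists2 d : R, 0 < d & forall h, cabs h < d ->
    cabs (g (z + h) - g z - L * h) <= e * cabs h.

Definition pcontinuous (x : R -> R[i]) := forall t e, 0 < e ->
  exists2 d, 0 < d & forall u, `|u - t| < d -> cabs (x u - x t) < e.

Lemma cdiff_continuous g z e : cdiff_at g z -> 0 < e ->
  exists2 d, 0 < d & forall w, cabs (w - z) < d -> cabs (g w - g z) < e.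
Proof.
move=> [L H] e0; have [d d0 dP] := H 1 ltr01.
have L0 : 0 < cabs L + 1 by rewrite ltr_wpDl.
exists (Num.min d (e / (cabs L + 1))); first by rewrite lt_min d0 divr_gt0.
move=> w; rewrite lt_min ltr_pdivlMr // => /andP[wd we].
have := dP _ wd; rewrite (addrC z) subrK => H1.
have := cabsD (g w - g z - L * (w - z)) (L * (w - z)); rewrite subrK cabsM => H2.
by apply: le_lt_trans we; lra.
Qed.

Lemma pcontinuous_comp g (x : R -> R[i]) :
  (forall t, cdiff_at g (x t)) -> pcontinuous x -> pcontinuous (g \o x).
Proof.
move=> gx cx t e e0; have [d d0 dP] := cdiff_continuous (gx t) e0.
by have [d' d'0 d'P] := cx t d d0; exists d' => // u /d'P /dP.
Qed.

Lemma pcontinuous_cre (x : R -> R[i]) : pcontinuous x -> continuous (fun t => cre (x t)).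
Proof.
move=> cx; apply: continuous_epsP => t e /(cx t)[d d0 dP]; exists d => // u /dP.
by apply: le_lt_trans; rewrite -creN -creE; exact: cre_le_cabs.
Qed.

Lemma pcontinuous_cim (x : R -> R[i]) : pcontinuous x -> continuous (fun t => cim (x t)).
Proof.
move=> cx; apply: continuous_epsP => t e /(cx t)[d d0 dP]; exists d => // u /dP.
by apply: le_lt_trans; rewrite -cimN -cimE; exact: cim_le_cabs.
Qed.

Lemma pcontinuous_cis (c : R[i]) : pcontinuous (fun t => c * cis t).
Proof.
move=> t e e0.
have c0 : 0 < 2 * (cabs c + 1) by rewrite mulr_gt0 // ltr_wpDl.
exists (e / (2 * (cabs c + 1))); first by rewrite divr_gt0.
move=> u; rewrite ltr_pdivlMr // => ut; rewrite -mulrBr cabsM.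
apply: le_lt_trans ut.
apply: (@le_trans _ _ (cabs c * (2 * `|u - t|))); first by rewrite ler_wpM2l // cis_lip.
have := normr_ge0 (u - t); have := cabs_ge0 c; nra.
Qed.

(** In the coordinates z = exp(x + iy) the annulus becomes the rectangle [ln r, ln s] x [0, 2 pi].
    With Q = Re g and P = Im g, the form P dx + Q dy is the imaginary part of g(exp w) dw, hence
    closed; its integrals along the sides y = 0 and y = 2 pi cancel by periodicity. *)
Let circle_mean_eq g (r s : R) : 0 < r -> r <= s ->
  (forall z, cabs z <= s -> cdiff_at g z) ->
  segint (fun t => cre (g (s%:C%C * cis t))) 0 (pi *+ 2) =
  segint (fun t => cre (g (r%:C%C * cis t))) 0 (pi *+ 2).
Proof.
move=> r0 rs gs; have s0 : 0 < s := lt_le_trans r0 rs.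
pose X1 := ln r; pose X2 := ln s.
have X12 : X1 <= X2 by rewrite ler_ln.
pose cl (x : R) := Num.max X1 (Num.min x X2).
have clP x : X1 <= cl x <= X2.
  by rewrite le_max lexx ge_max X12 ge_min lexx orbT.
have clE x : X1 <= x <= X2 -> cl x = x.
  by move=> /andP[x1 x2]; rewrite /cl min_l // max_r.
have cl_lip x y : `|cl x - cl y| <= `|x - y|.
  exact: clamp_lipschitz.
have eb x y : X1 <= x <= X2 -> cabs ((expR x)%:C%C * cis y) <= s.
  move=> /andP[_ x2]; rewrite cabsM cabs_cis mulr1 cabs_real gtr0_norm ?expR_gt0 //.
  by rewrite -(@lnK _ s) // ler_expR.
pose Q x y := cre (g ((expR x)%:C%C * cis y)).
(* [goursat_rectangle] asks for continuity of [P] in [x] on the whole line, whereas [g] is only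
   controlled on the closed disc of radius [s]; clamping [x] reconciles the two. *)
pose P x y := cim (g ((expR (cl x))%:C%C * cis y)).
have cQ x : X1 <= x <= X2 -> continuous (Q x).
  move=> xX; apply: pcontinuous_cre; apply: (@pcontinuous_comp g); last exact: pcontinuous_cis.
  by move=> t; apply: gs; exact: eb.
have cP y : continuous (fun x => P x y).
  apply: pcontinuous_cim; apply: (@pcontinuous_comp g) => [t|].
    by apply: gs; exact: eb.
  move=> x e e0; have [d d0 dP] := continuous_eps (cl x) (@continuous_expR R) e0.
  exists d => // u /(le_lt_trans (cl_lip _ _))/dP.
  by rewrite -mulrBl cabsM cabs_cis mulr1 -realcB cabs_real.
have CR a b : X1 <= a <= X2 -> cauchy_riemann_at P Q X1 X2 a b.
  move=> aX; pose z := (expR a)%:C%C * cis b.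
  have [L LP] := gs z (eb _ _ aX).
  pose D := L * z.
  exists (cre D), (- cim D), (cim D) => e e0.
  have z1 : 0 < cabs z + 1 by rewrite ltr_wpDl.
  have k0 : 0 < e / (6 * (cabs z + 1)) by rewrite divr_gt0 // mulr_gt0.
  have [d d0 dP] := LP _ k0.
  have M0 : 0 < 8 * cabs D + 1 by rewrite ltr_wpDl // mulr_ge0.
  (* The first bound brings [x - a] and [y - b] into the range of [cexp_expansion], the second
     absorbs the quadratic remainder of the exponential, and the third keeps the increment [dl]
     within the range [d] of differentiability of [g]. *)
  pose d' := Num.min (1 / 4) (Num.min (e / (8 * cabs D + 1) / 2) (d / (3 * (cabs z + 1)) / 2)).
  have d'0 : 0 < d' by rewrite !lt_min !divr_gt0 ?mulr_gt0.
  exists d' => // x y xX; rewrite !lt_min => /and3P[xa1 xa2 xa3] /and3P[yb1 yb2 yb3].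
  rewrite /P /Q !clE //.
  set dl := (expR x)%:C%C * cis y - z.
  have wE : (expR x)%:C%C * cis y = z + dl by rewrite addrC subrK.
  pose ze := ((x - a) +i* (y - b))%C.
  set N := `|x - a| + `|y - b|.
  have N0 : 0 <= N by rewrite addr_ge0.
  have N1 : N < 1 / 2 by rewrite /N; lra.
  have N2 : N * (8 * cabs D + 1) < e.
    by rewrite -ltr_pdivlMr //; rewrite /N; lra.
  have N3 : N * (3 * (cabs z + 1)) < d.
    by rewrite -ltr_pdivlMr ?mulr_gt0 //; rewrite /N; lra.
  have dlE : cabs (dl - z * ze) <= cabs z * (4 * N ^+ 2).
    have -> : dl - z * ze = z * ((expR (x - a))%:C%C * cis (y - b) - 1 - ze).
      have zE : (expR x)%:C%C * cis y = z * ((expR (x - a))%:C%C * cis (y - b)).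
        rewrite /z mulrACA -realcM -expRD -cisD.
        by congr ((expR _)%:C%C * cis _); rewrite addrC subrK.
      rewrite /dl zE; ring.
    rewrite cabsM ler_wpM2l //; apply: cexp_expansion; lra.
  have zeN : cabs ze <= N by exact: cabs_le_reim.
  have dlN : cabs dl <= cabs z * (3 * N).
    have := cabsD (dl - z * ze) (z * ze); rewrite subrK cabsM => H.
    have h1 : cabs z * cabs ze <= cabs z * N by rewrite ler_wpM2l.
    have h2 : cabs z * (4 * N ^+ 2) <= cabs z * (2 * N).
      by rewrite ler_wpM2l //; nra.
    have -> : cabs z * (3 * N) = cabs z * (2 * N) + cabs z * N by ring.
    lra.
  have dld : cabs dl < d.
    apply: le_lt_trans dlN _; apply: le_lt_trans N3.
    have := cabs_ge0 z; nra.
  have key : cabs (g (z + dl) - g z - D * ze) <= e * N.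
    have -> : g (z + dl) - g z - D * ze =
      (g (z + dl) - g z - L * dl) + L * (dl - z * ze) by rewrite /D; ring.
    apply: (le_trans (cabsD _ _)); rewrite cabsM.
    have h1 := dP dl dld.
    have h2 : e / (6 * (cabs z + 1)) * cabs dl <= e / 2 * N.
      have : e / (6 * (cabs z + 1)) * cabs dl <= e / (6 * (cabs z + 1)) * ((cabs z + 1) * (3 * N)).
        rewrite ler_wpM2l ?(ltW k0) //; apply: le_trans dlN _.
        by rewrite ler_wpM2r ?mulr_ge0 // lerDl.
      have -> : e / (6 * (cabs z + 1)) * ((cabs z + 1) * (3 * N)) = e / 2 * N.
        by field; rewrite gt_eqF.
      by [].
    have h3 : cabs L * cabs (dl - z * ze) <= e / 2 * N.
      have : cabs L * cabs (dl - z * ze) <= cabs L * (cabs z * (4 * N ^+ 2)).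
        by rewrite ler_wpM2l.
      have -> : cabs L * (cabs z * (4 * N ^+ 2)) = cabs D * (4 * N ^+ 2).
        by rewrite /D cabsM mulrA.
      have : cabs D * (4 * N ^+ 2) = N * (8 * cabs D) / 2 * N by field.
      move=> ->; move=> h4; apply: le_trans h4 _; rewrite ler_wpM2r // ler_pM2r ?invr_gt0 //.
      lra.
    lra.
  have E : D * ze = ((cre D * (x - a) + - cim D * (y - b)) +i*
                     (cim D * (x - a) + cre D * (y - b)))%C.
    by case: (D) => d1 d2; apply: complex_eqP; rewrite /ze /cre /cim /=; ring.
  rewrite wE; split; apply: le_trans key; rewrite E.
    by apply: le_trans (cre_le_cabs _); rewrite !creE !creN.
  by apply: le_trans (cim_le_cabs _); rewrite !cimE !cimN.
have pi0 : 0 <= pi *+ 2 :> R by rewrite mulrn_wge0 // pi_ge0.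
have := goursat_rectangle cP cQ CR 0 X12 pi0; rewrite !add0r.
have -> : segint (fun t => P t (pi *+ 2) - P t 0) X1 X2 = 0.
  rewrite (@eq_segint _ _ (fun=> 0)) ?segint_cst ?mul0r // => t _.
  by rewrite /P cis2pi cis0 subrr.
rewrite segintB; [|by apply: cQ; rewrite X12 lexx|by apply: cQ; rewrite X12 lexx].
move=> /eqP; rewrite subr_eq0 => /eqP.
by rewrite /Q /X1 /X2 !lnK ?posrE.
Qed.

(** The circle is shrunk: its mean agrees with the mean over a circle of radius [r], which differs
    from the value at 0 by less than half of the supposed defect once [r] is small. *)
Lemma mean_value_circle g (s : R) : 0 < s ->
  (forall z, cabs z <= s -> cdiff_at g z) ->
  segint (fun t => cre (g (s%:C%C * cis t))) 0 (pi *+ 2) = (pi *+ 2) * cre (g 0).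
Proof.
move=> s0 gs; apply/eqP; rewrite -subr_eq0; apply/negPn/negP => m0.
set m := _ - _ in m0; have {}m0 : 0 < `|m| by rewrite normr_gt0.
have pi0 : 0 < pi *+ 2 :> R by rewrite mulrn_wgt0 // pi_gt0.
have e0 : 0 < `|m| / (pi *+ 2) / 2 by rewrite !divr_gt0.
have z0 : cabs (0 : R[i]) <= s by rewrite cabs0 ltW.
have [d d0 dP] := cdiff_continuous (gs 0 z0) e0.
pose r := Num.min s (d / 2).
have r0 : 0 < r by rewrite lt_min s0 divr_gt0.
have rs : r <= s by rewrite ge_min lexx.
have rd : r < d.
  by apply: (@le_lt_trans _ _ (d / 2)); [rewrite ge_min lexx orbT | lra].
have rc t : cabs (r%:C%C * cis t) = r by rewrite cabsM cabs_cis mulr1 cabs_real gtr0_norm.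
have cg : continuous (fun t => cre (g (r%:C%C * cis t))).
  apply: pcontinuous_cre; apply: (@pcontinuous_comp g); last exact: pcontinuous_cis.
  by move=> t; apply: gs; rewrite rc.
have cst (u : R) : continuous (fun _ : R => u) by move=> v; exact: cvg_cst.
have : `|m| <= `|m| / (pi *+ 2) / 2 * (pi *+ 2 - 0).
  rewrite {1}/m (circle_mean_eq r0 rs gs).
  rewrite -[X in _ - X * _]subr0 mulrC -(segint_cst _ (ltW pi0)) -segintB //.
  apply: segint_bound; [exact: ltW| |].
    by move=> t; apply: cvgB; [exact: cg | exact: cst].
  move=> t _; apply: ltW; apply: le_lt_trans (dP (r%:C%C * cis t) _).
    by rewrite -creN -creE; exact: cre_le_cabs.
  by rewrite subr0 rc.
have -> : `|m| / (pi *+ 2) / 2 * (pi *+ 2 - 0) = `|m| / 2.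
  by rewrite subr0 mulrAC divfK ?gt_eqF.
lra.
Qed.

End MeanValue.

(** * Calculus of holomorphic functions and subharmonicity *)

Section HolomorphicCalculus.
Variables (R : realType) (n : nat).
Implicit Types (f g : Cn R n -> R[i]) (a z w h : Cn R n).

Definition little_o (r : Cn R n -> R) := forall e : R, 0 < e ->
  exists2 d : R, 0 < d & forall h, cnorm h < d -> r h <= e * cnorm h.

Let lform (L : 'I_n -> R[i]) h := \sum_(j < n) L j * h 0 j.

Lemma little_oD (r s : Cn R n -> R) : little_o r -> little_o s ->
  little_o (fun h => r h + s h).
Proof.
move=> ro so e e0; have e2 : 0 < e / 2 by lra.
have [d d0 dP] := ro _ e2; have [d' d'0 d'P] := so _ e2.
exists (Num.min d d'); first by rewrite lt_min d0.
by move=> h; rewrite lt_min => /andP[/dP h1 /d'P h2]; apply: (le_trans (lerD h1 h2)); lra.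
Qed.

Lemma little_oZ (r : Cn R n -> R) c : 0 <= c -> little_o r -> little_o (fun h => c * r h).
Proof.
move=> c0 ro e e0; have c1 : 0 < c + 1 by lra.
have [d d0 dP] := ro (e / (c + 1)) (divr_gt0 e0 c1).
exists d => // h /dP hd; apply: (le_trans (ler_wpM2l c0 hd)).
rewrite mulrA ler_wpM2r // mulrCA -[leRHS]mulr1 ler_wpM2l ?(ltW e0) //.
by rewrite ler_pdivrMr // mul1r lerDl.
Qed.

Lemma little_o_le (r s : Cn R n -> R) d : 0 < d ->
  (forall h, cnorm h < d -> r h <= s h) -> little_o s -> little_o r.
Proof.
move=> d0 rs so e /so[d' d'0 d'P]; exists (Num.min d d'); first by rewrite lt_min d0.
by move=> h; rewrite lt_min => /andP[/rs h1 /d'P]; exact: le_trans.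
Qed.

Lemma little_o_sq K : 0 <= K -> little_o (fun h => K * cnorm h ^+ 2).
Proof.
move=> K0 e e0; have K1 : 0 < K + 1 by lra.
exists (e / (K + 1)); first by rewrite divr_gt0.
move=> h; rewrite ltr_pdivlMr // => he; rewrite expr2 mulrA ler_wpM2r //.
have := cnorm_ge0 h; lra.
Qed.

Lemma holo_atP f a : holo_at f a <-> exists L : 'I_n -> R[i],
  little_o (fun h => cabs (f (a + h) - f a - lform L h)).
Proof. by []. Qed.

Let lform_le L : exists2 K, 0 <= K & forall h, cabs (lform L h) <= K * cnorm h.
Proof.
exists (\sum_(j < n) cabs (L j)); first by rewrite sumr_ge0.
move=> h; apply: (le_trans (cabs_sum _ _ _)); rewrite mulr_suml.
by apply: ler_sum => j _; rewrite cabsM ler_wpM2l // cabs_coord_le.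
Qed.

Lemma holo_at_lip f a : holo_at f a -> exists K d, [/\ 0 <= K, 0 < d &
  forall h, cnorm h < d -> cabs (f (a + h) - f a) <= K * cnorm h].
Proof.
move=> [L LP]; have [K K0 KP] := lform_le L; have [d d0 dP] := LP 1 ltr01.
exists (K + 1), d; split=> //; first by lra.
move=> h /dP hd; have := cabsD (f (a + h) - f a - lform L h) (lform L h).
by rewrite subrK; have := KP h; move: hd; rewrite /lform mulrDl; lra.
Qed.

Lemma holo_at_continuous f a e : holo_at f a -> 0 < e ->
  exists2 d, 0 < d & forall w, cnorm (w - a) < d -> cabs (f w - f a) < e.
Proof.
move=> /holo_at_lip[K [d [K0 d0 dP]]] e0; have K1 : 0 < K + 1 by lra.
exists (Num.min d (e / (K + 1))); first by rewrite lt_min d0 divr_gt0.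
move=> w; rewrite lt_min ltr_pdivlMr // => /andP[/dP]; rewrite (addrC a) subrK.
move=> H we; apply: (le_lt_trans H); apply: le_lt_trans we.
by rewrite mulrC ler_wpM2l // lerDl.
Qed.

Lemma holo_cst c a : holo_at (fun _ : Cn R n => c) a.
Proof.
exists (fun=> 0) => e e0; exists 1 => // h _.
rewrite subrr sub0r cabsN big1 ?cabs0; first by rewrite mulr_ge0 // ltW.
by move=> j _; rewrite mul0r.
Qed.

Lemma holo_coord (i : 'I_n) a : holo_at (fun z : Cn R n => z 0 i) a.
Proof.
exists (fun j => (j == i)%:R) => e e0; exists 1 => // h _.
rewrite (bigD1 i) //= eqxx mul1r big1 ?addr0; last first.
  by move=> j /negPf ->; rewrite mul0r.
by rewrite mxE (addrC (a 0 i)) addrK subrr cabs0 mulr_ge0 // ltW.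
Qed.

Lemma holoD f g a : holo_at f a -> holo_at g a -> holo_at (fun z => f z + g z) a.
Proof.
move=> [L LP] [M MP]; apply/holo_atP; exists (fun j => L j + M j).
apply: (little_o_le ltr01 _ (little_oD LP MP)) => h _.
apply: le_trans (cabsD _ _); rewrite le_eqVlt; apply/orP; left; apply/eqP; congr cabs.
have -> : lform (fun j => L j + M j) h = lform L h + lform M h.
  by rewrite /lform -big_split /=; apply: eq_bigr => j _; rewrite mulrDl.
by rewrite /lform; ring.
Qed.

Lemma holoM f g a : holo_at f a -> holo_at g a -> holo_at (fun z => f z * g z) a.
Proof.
move=> hf hg; have [K [d [K0 d0 KP]]] := holo_at_lip hf.
have [K' [d' [K'0 d'0 K'P]]] := holo_at_lip hg.
move: hf hg => [L LP] [M MP]; apply/holo_atP.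
exists (fun j => f a * M j + g a * L j).
apply: (@little_o_le _ (fun h => K * K' * cnorm h ^+ 2 +
   (cabs (f a) * cabs (g (a + h) - g a - lform M h) +
    cabs (g a) * cabs (f (a + h) - f a - lform L h))) (Num.min d d')).
- by rewrite lt_min d0.
- move=> h; rewrite lt_min => /andP[/KP h1 /K'P h2].
  have -> : lform (fun j => f a * M j + g a * L j) h = f a * lform M h + g a * lform L h.
    rewrite /lform !mulr_sumr -big_split /=; apply: eq_bigr => j _; ring.
  have -> : f (a + h) * g (a + h) - f a * g a - (f a * lform M h + g a * lform L h) =
    (f (a + h) - f a) * (g (a + h) - g a) +
    (f a * (g (a + h) - g a - lform M h) + g a * (f (a + h) - f a - lform L h)) by ring.
  apply: (le_trans (cabsD _ _)); apply: lerD.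
    by rewrite cabsM expr2 mulrACA ler_pM.
  by apply: (le_trans (cabsD _ _)); rewrite !cabsM.
- apply: little_oD; first by apply: little_o_sq; rewrite mulr_ge0.
  by apply: little_oD; apply: little_oZ.
Qed.

Lemma holoZ c f a : holo_at f a -> holo_at (fun z => c * f z) a.
Proof. by move=> hf; apply: holoM => //; exact: holo_cst. Qed.

Lemma holoX f a k : holo_at f a -> holo_at (fun z => f z ^+ k) a.
Proof.
move=> hf; elim: k => [|k IH]; first exact: holo_cst.
have -> : (fun z => f z ^+ k.+1) = (fun z => f z * f z ^+ k).
  by apply/funext => z; rewrite exprS.
exact: holoM.
Qed.

Lemma holo_sum (I : Type) (s : seq I) (F : I -> Cn R n -> R[i]) a :
  (forall i, holo_at (F i) a) -> holo_at (fun z => \sum_(i <- s) F i z) a.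
Proof.
move=> hF; elim: s => [|i s IH].
  have -> : (fun z => \sum_(i <- [::]) F i z) = (fun=> 0).
    by apply/funext => z; rewrite big_nil.
  exact: holo_cst.
have -> : (fun z => \sum_(j <- i :: s) F j z) = (fun z => F i z + \sum_(j <- s) F j z).
  by apply/funext => z; rewrite big_cons.
exact: holoD.
Qed.

Lemma holoV f a : holo_at f a -> f a != 0 -> holo_at (fun z => (f z)^-1) a.
Proof.
move=> hf f0; have fa0 : 0 < cabs (f a) by rewrite cabs_gt0.
have [d1 d10 P1] := holo_at_continuous hf (divr_gt0 fa0 (ltr0Sn R 1)).
have [K [d [K0 d0 KP]]] := holo_at_lip hf.
move: hf => [L LP]; apply/holo_atP; exists (fun j => - (f a ^- 2) * L j).
apply: (@little_o_le _ (fun h => 2 * K ^+ 2 / cabs (f a) ^+ 3 * cnorm h ^+ 2 +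
   cabs (f a) ^- 2 * cabs (f (a + h) - f a - lform L h)) (Num.min d d1)).
- by rewrite lt_min d0.
- move=> h; rewrite lt_min => /andP[/KP h1 h2].
  have {}h2 : cabs (f (a + h) - f a) < cabs (f a) / 2.
    by apply: P1; rewrite addrC addKr.
  have fh : cabs (f a) / 2 < cabs (f (a + h)).
    have := cabs_triangle (f a) (f (a + h)) 0; rewrite !subr0 cabsB_sym; lra.
  have fh0 : f (a + h) != 0 by rewrite -cabs_gt0; lra.
  have -> : lform (fun j => - (f a ^- 2) * L j) h = - (f a ^- 2) * lform L h.
    by rewrite /lform mulr_sumr; apply: eq_bigr => j _; rewrite mulrA.
  have -> : (f (a + h))^-1 - (f a)^-1 - - (f a ^- 2) * lform L h =
    (f (a + h) - f a) ^+ 2 / (f (a + h) * f a ^+ 2)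
    - f a ^- 2 * (f (a + h) - f a - lform L h) by field; rewrite f0 fh0.
  apply: (le_trans (cabsD _ _)); rewrite cabsN (cabsM (f a ^- 2)).
  rewrite (cabsM _ (f (a + h) * f a ^+ 2)^-1) !cabsV (cabsM (f (a + h))) !cabsX.
  apply: lerD => //.
  have -> : 2 * K ^+ 2 / cabs (f a) ^+ 3 * cnorm h ^+ 2 =
    (K * cnorm h) ^+ 2 / (cabs (f a) / 2 * cabs (f a) ^+ 2) by field; rewrite gt_eqF.
  apply: ler_pM; rewrite ?sqr_ge0 ?invr_ge0 ?mulr_ge0 ?sqr_ge0 //.
    by rewrite ler_pXn2r ?nnegrE ?mulr_ge0.
  rewrite lef_pV2 ?posrE ?mulr_gt0 ?exprn_gt0 //; last by lra.
    by rewrite ler_pM2r ?exprn_gt0 // ltW.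
- by apply: little_oD; [apply: little_o_sq; rewrite divr_ge0 ?mulr_ge0 ?exprn_ge0 ?sqr_ge0|
     apply: little_oZ => //; rewrite invr_ge0 exprn_ge0].
Qed.

Lemma holo_line f c w (z : R[i]) : holo_at f (c + z *: w) ->
  cdiff_at (fun x => f (c + x *: w)) z.
Proof.
move=> [L LP]; exists (lform L w) => e e0.
have w1 : 0 < cnorm w + 1 by rewrite ltr_wpDl.
have [d d0 dP] := LP _ (divr_gt0 e0 w1).
exists (d / (cnorm w + 1)); first by rewrite divr_gt0.
move=> h; rewrite ltr_pdivlMr // => hd.
have hw : cnorm (h *: w) < d.
  by rewrite cnormZ; apply: le_lt_trans hd; rewrite ler_wpM2l // lerDl.
have := dP _ hw.
have -> : c + (z + h) *: w = c + z *: w + h *: w by rewrite scalerDl addrA.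
have -> : \sum_(j < n) L j * (h *: w) 0 j = lform L w * h.
  by rewrite /lform mulr_suml; apply: eq_bigr => j _; rewrite mxE; ring.
move/le_trans; apply; rewrite cnormZ -mulrA ler_wpM2l ?(ltW e0) //.
by rewrite mulrCA ler_piMr // mulrC ler_pdivrMr // mul1r lerDl.
Qed.

Lemma mean_value_line f c w (s : R) : 0 < s ->
  (forall z : R[i], cabs z <= s -> holo_at f (c + z *: w)) ->
  segint (fun t => cre (f (c + (s%:C%C * cis t) *: w))) 0 (pi *+ 2) =
  (pi *+ 2) * cre (f c).
Proof.
move=> s0 fs; have := @mean_value_circle R (fun x => f (c + x *: w)) s s0.
by rewrite scale0r addr0; apply=> z zs; apply: holo_line; exact: fs.
Qed.

End HolomorphicCalculus.

(** * A holomorphic minorant of a power of the modulus *)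

Section PowerInequality.
Variable R : realType.

Let expR_third (s : R) : `|s| <= 1 / 2 -> `|expR s - 1 - s - s ^+ 2 / 2| <= 2 * `|s| ^+ 3.
Proof.
move=> s1.
have der (x : R) : is_derive x 1 (fun x : R => expR x - 1 - x - x ^+ 2 / 2) (expR x - 1 - x).
  by apply: is_derive_eq; rewrite /GRing.scale /=; field.
have := @mvt_bound R _ _ s (2 * `|s| ^+ 2) der.
have -> : 2 * `|s| ^+ 3 = 2 * `|s| ^+ 2 * `|s| by ring.
have -> : expR 0 - 1 - 0 - 0 ^+ 2 / 2 = 0 :> R by rewrite expR0; field.
rewrite subr0; apply=> c cs.
have := expR_sub1_bound (le_trans cs s1) => /andP[h1 h2]; rewrite ger0_norm //.
apply: (le_trans h2); rewrite -real_normK ?num_real // ler_pM2l //.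
by rewrite ler_pXn2r ?nnegrE.
Qed.

Let ln1D_abs (t : R) : `|t| <= 1 / 2 -> `|ln (1 + t)| <= 2 * `|t|.
Proof.
rewrite ler_norml => /andP[t1 t2].
have t0 : 0 < 1 + t by lra.
have l1 : ln (1 + t) <= t by apply: le_ln1Dx; lra.
have l2 : ln (1 + t)^-1 <= (1 + t)^-1 - 1.
  have := @le_ln1Dx R ((1 + t)^-1 - 1).
  have -> : 1 + ((1 + t)^-1 - 1) = (1 + t)^-1 by ring.
  apply.
  by have := invr_gt0 (1 + t); rewrite t0; lra.
rewrite lnV ?posrE // in l2.
have l3 : (1 + t)^-1 - 1 <= 2 * `|t|.
  have -> : (1 + t)^-1 - 1 = - t / (1 + t) by field; rewrite gt_eqF.
  rewrite ler_pdivrMr //; have := ler_norm (- t); have := normr_ge0 t; rewrite normrN; nra.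
have := ler_norm t; have := normr_ge0 t; rewrite ler_norml; lra.
Qed.

(** Here a = p / 2, e = x + iy and t = |1 + e|^2 - 1. To second order the right side exceeds the
    left one by a^2 |e|^2, and this surplus pays for all errors: part of it is given up in [c],
    which is the binomial coefficient a (a - 1) / 2 lowered by a^2 / 8, to absorb the cubic terms in
    s = ln(1 + t); the rest absorbs the cubic and quartic terms in [x] and [y]. The radii [k0] and
    [k] are what these absorptions require. *)
Let rpow_lower (a : R) : 0 < a -> exists2 k, 0 < k & forall x y : R,
  x ^+ 2 + y ^+ 2 <= k ^+ 2 -> 1 + 2 * a * x + a * (a - 1) * (x ^+ 2 - y ^+ 2)
    <= expR (a * ln (1 + (2 * x + (x ^+ 2 + y ^+ 2)))).
Proof.
move=> a0; pose c := a * (a - 1) / 2 - a ^+ 2 / 8.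
pose C := 2 * a ^+ 3 + 2 * a + 6 * `|c|.
have a3 : 0 < a ^+ 3 by rewrite exprn_gt0.
have C0 : 0 < C by rewrite /C; have := normr_ge0 c; lra.
pose k0 := Num.min (1 / 2) (Num.min (1 / 2 / a) (a ^+ 2 / (8 * C))).
have k00 : 0 < k0 by rewrite !lt_min !divr_gt0 ?mulr_gt0 ?exprn_gt0.
pose k := Num.min (k0 / 6) (Num.min (1 / 6) (a ^+ 2 / (10 * (`|c| + 1)))).
have c1 : 0 < `|c| + 1 by rewrite ltr_wpDl.
have k1 : 0 < k by rewrite !lt_min !divr_gt0 ?mulr_gt0 ?exprn_gt0.
exists k => // x y; set r2 := x ^+ 2 + y ^+ 2 => xyk.
have kk0 : k <= k0 / 6 by rewrite ge_min lexx.
have k6 : k <= 1 / 6 by rewrite !ge_min lexx orbT.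
have kc : k * (10 * (`|c| + 1)) <= a ^+ 2.
  by rewrite -ler_pdivlMr ?mulr_gt0 // !ge_min lexx !orbT.
have r20 : 0 <= r2 by rewrite addr_ge0 ?sqr_ge0.
have xk : `|x| <= k.
  apply: le_of_sqr; first exact: ltW.
  by rewrite real_normK ?num_real //; apply: le_trans xyk; rewrite lerDl sqr_ge0.
have r2k : r2 <= k / 6 by apply: le_trans xyk _; rewrite expr2; nra.
set t := 2 * x + r2.
have tk : `|t| <= 3 * k.
  by apply: (le_trans (ler_normD _ _)); rewrite normrM (ger0_norm r20) gtr0_norm //; lra.
have t2 : `|t| <= 1 / 2 by lra.
set s := ln (1 + t).
have sk : `|s| <= k0 by apply: (le_trans (ln1D_abs t2)); lra.
have s2 : `|s| <= 1 / 2 by apply: (le_trans sk); rewrite ge_min lexx.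
have as2 : `|a * s| <= 1 / 2.
  rewrite normrM (gtr0_norm a0) mulrC -ler_pdivlMr //; apply: (le_trans sk).
  by rewrite !ge_min lexx orbT.
have sC : `|s| * (8 * C) <= a ^+ 2.
  rewrite -ler_pdivlMr ?mulr_gt0 //; apply: (le_trans sk).
  by rewrite !ge_min lexx !orbT.
have t0 : 0 < 1 + t by move: t2; rewrite ler_norml; lra.
have tE : t = expR s - 1 by rewrite /s lnK ?posrE //; lra.
have e1 := expR_third s2; have e2 := expR_third as2.
set S := `|s| in sk s2 sC e1.
have S0 : 0 <= S by exact: normr_ge0.
have SS : s ^+ 2 = S ^+ 2 by rewrite real_normK ?num_real.
have e2' : `|expR (a * s) - 1 - a * s - (a * s) ^+ 2 / 2| <= 2 * (a ^+ 3 * S ^+ 3).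
  by have -> : a ^+ 3 * S ^+ 3 = `|a * s| ^+ 3 by rewrite normrM (gtr0_norm a0) -/S; ring.
have r1 : `|t - s - s ^+ 2 / 2| <= 2 * S ^+ 3.
  by rewrite tE (_ : _ - s - _ = expR s - 1 - s - s ^+ 2 / 2) //; ring.
have S3 : S ^+ 3 <= S ^+ 2 / 2 by rewrite exprSr; have := sqr_ge0 S; nra.
have ts : `|t - s| <= 2 * S ^+ 2.
  have -> : t - s = (t - s - s ^+ 2 / 2) + s ^+ 2 / 2 by ring.
  apply: (le_trans (ler_normD _ _)); rewrite SS [X in _ + X]ger0_norm ?divr_ge0 ?sqr_ge0 //.
  by have := sqr_ge0 S; rewrite SS in r1; lra.
have tps : `|t + s| <= 3 * S.
  have -> : t + s = (t - s) + 2 * s by ring.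
  apply: (le_trans (ler_normD _ _)); rewrite normrM gtr0_norm // -/S.
  have : S ^+ 2 <= S / 2 by nra.
  lra.
have q1 : `|t ^+ 2 - s ^+ 2| <= 6 * S ^+ 3.
  rewrite subr_sqr normrM (_ : 6 * S ^+ 3 = 2 * S ^+ 2 * (3 * S)); last by ring.
  exact: ler_pM.
have q2 : c * (t ^+ 2 - s ^+ 2) <= `|c| * (6 * S ^+ 3).
  by apply: (le_trans (ler_norm _)); rewrite normrM ler_wpM2l.
have q3 : a * (t - s - s ^+ 2 / 2) <= a * (2 * S ^+ 3).
  by rewrite ler_wpM2l ?(ltW a0) //; exact: le_trans (ler_norm _) r1.
have main1 : 1 + a * t + c * t ^+ 2 <= expR (a * s).
  have : - (2 * (a ^+ 3 * S ^+ 3)) <= expR (a * s) - 1 - a * s - (a * s) ^+ 2 / 2.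
    by move: e2'; rewrite ler_norml => /andP[].
  have : C * S ^+ 3 <= a ^+ 2 / 8 * S ^+ 2.
    rewrite (_ : C * S ^+ 3 = S * C * S ^+ 2); last by ring.
    by rewrite ler_wpM2r ?sqr_ge0 //; lra.
  rewrite /C -SS; move: q2 q3.
  have -> : c * t ^+ 2 = c * (t ^+ 2 - s ^+ 2) + c * s ^+ 2 by ring.
  have -> : c * s ^+ 2 = a ^+ 2 * s ^+ 2 / 2 - a * s ^+ 2 / 2 - a ^+ 2 * s ^+ 2 / 8.
    by rewrite /c; field.
  move: (c * _) (`|c|) (S ^+ 3) => u v w; lra.
apply: le_trans main1; rewrite /t.
have q4 : - (`|c| * (5 * k * r2)) <= c * (4 * x * r2 + r2 ^+ 2).
  have : `|c * (4 * x * r2 + r2 ^+ 2)| <= `|c| * (5 * k * r2).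
    rewrite normrM ler_wpM2l // (_ : _ + _ = (4 * x + r2) * r2); last by ring.
    rewrite normrM (ger0_norm r20) ler_wpM2r //.
    by apply: (le_trans (ler_normD _ _)); rewrite normrM (ger0_norm r20) gtr0_norm //; lra.
  by rewrite ler_norml => /andP[].
have q5 : `|c| * (5 * k * r2) <= a ^+ 2 / 2 * r2.
  rewrite (_ : `|c| * (5 * k * r2) = (k * (10 * `|c|)) / 2 * r2); last by field.
  rewrite ler_wpM2r // ler_pM2r ?invr_gt0 //; apply: le_trans kc.
  by rewrite ler_pM2l // ler_pM2l // lerDl.
have q6 : a ^+ 2 * x ^+ 2 <= a ^+ 2 * r2.
  by rewrite ler_wpM2l ?sqr_ge0 // lerDl sqr_ge0.
rewrite -subr_ge0.
have -> : 1 + a * (2 * x + r2) + c * (2 * x + r2) ^+ 2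
   - (1 + 2 * a * x + a * (a - 1) * (x ^+ 2 - y ^+ 2)) =
   a ^+ 2 * r2 - a ^+ 2 * x ^+ 2 / 2 + c * (4 * x * r2 + r2 ^+ 2).
  by rewrite /c /r2; field.
lra.
Qed.

(* To second order [|1 + e|^p] is [1 + Re (p e + p (p - 2) / 4 e^2) + p^2 / 4 |e|^2],
   so it dominates the real part of a holomorphic polynomial in [e]. *)
Lemma powR_cabs_lower (p : R) : 0 < p -> exists2 k, 0 < k & forall e : R[i],
  cabs e <= k ->
  1 + cre (p%:C%C * e + (p * (p - 2) / 4)%:C%C * e ^+ 2) <= cabs (1 + e) `^ p.
Proof.
move=> p0; have [k k0 kP] := rpow_lower (divr_gt0 p0 (ltr0Sn R 1)).
exists (Num.min k (1 / 2)); first by rewrite lt_min k0 divr_gt0.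
move=> e; rewrite le_min => /andP[ek e2].
have e1 : 0 < cabs (1 + e).
  by have := ler_cabsB 1 (- e); rewrite cabs1 cabsN opprK; lra.
rewrite /powR gt_eqF //.
have := kP (cre e) (cim e); rewrite -cabs_sq ler_pXn2r ?nnegrE ?(ltW k0) // => /(_ ek).
have -> : 1 + (2 * cre e + cabs e ^+ 2) = cabs (1 + e) ^+ 2.
  by rewrite !cabs_sq creE cimE cre1 cim1; ring.
have -> : p / 2 * ln (cabs (1 + e) ^+ 2) = p * ln (cabs (1 + e)) by rewrite lnXn //; field.
move/(le_trans _); apply; rewrite expr2 !(creE, creM, cimM, cre_real, cim_real).
by rewrite le_eqVlt; apply/orP; left; apply/eqP; field.
Qed.

End PowerInequality.

Section RectangleTonelli.
Context d1 d2 (T1 : measurableType d1) (T2 : measurableType d2) (R : realType).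

Lemma tonelli_rect (m1 : {measure set T1 -> \bar R}) (m2 : {measure set T2 -> \bar R})
    (A : set T1) (B : set T2) (f : T1 * T2 -> \bar R) :
  sigma_finite setT m1 -> sigma_finite setT m2 -> measurable A -> measurable B ->
  measurable_fun setT f -> (forall x, 0 <= f x)%E ->
  (\int[m1]_(x in A) \int[m2]_(y in B) f (x, y) =
   \int[m2]_(y in B) \int[m1]_(x in A) f (x, y))%E.
Proof.
move=> s1 s2 mA mB mf f0; pose g := f \_ (A `*` B).
have g0 x : (0 <= g x)%E by rewrite /g patchE; case: ifP.
have mg : measurable_fun setT g.
  apply/measurable_restrict => //; first exact: measurableX.
  by rewrite setTI; exact: measurable_funTS.
have gE x y : g (x, y) = if x \in A then if y \in B then f (x, y) else 0%E else 0%E.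
  rewrite /g patchE; case: ifPn => [|H].
    by rewrite inE => -[/= xA yB]; rewrite !mem_set.
  case: ifP => // xA; case: ifP => // yB; case/negP: H.
  by rewrite inE; split; [exact: set_mem xA | exact: set_mem yB].
transitivity (\int[m1]_x \int[m2]_y g (x, y))%E.
  rewrite integral_mkcond; apply: eq_integral => x _; rewrite patchE.
  case: ifPn => xA.
    by rewrite integral_mkcond; apply: eq_integral => y _; rewrite gE xA patchE.
  by rewrite integral0_eq // => y _; rewrite gE (negPf xA).
rewrite (tonelli_sigma_finite s1 s2 mg g0).
rewrite [RHS]integral_mkcond; apply: eq_integral => y _; rewrite patchE.
case: ifPn => yB.
  by rewrite [RHS]integral_mkcond; apply: eq_integral => x _; rewrite gE yB patchE.
by rewrite integral0_eq // => x _; rewrite gE (negPf yB); case: ifP.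
Qed.

Lemma measurable_inner_integral_rect (m2 : {measure set T2 -> \bar R}) (B : set T2)
    (f : T1 * T2 -> \bar R) :
  sigma_finite setT m2 -> measurable B ->
  measurable_fun setT f -> (forall x, 0 <= f x)%E ->
  measurable_fun setT (fun x => \int[m2]_(y in B) f (x, y))%E.
Proof.
move=> s2 mB mf f0; pose g := f \_ (setT `*` B).
have mg : measurable_fun setT g.
  apply/measurable_restrict => //; first exact: measurableX.
  by rewrite setTI; exact: measurable_funTS.
have g0 x : (0 <= g x)%E by rewrite /g patchE; case: ifP.
apply: eq_measurable_fun (measurable_inner_integral s2 mg g0) => x _.
rewrite [RHS]integral_mkcond; apply: eq_integral => y _; rewrite /g !patchE.
congr (if _ then _ else _); apply/idP/idP; rewrite !inE; last by split.
by case.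
Qed.

End RectangleTonelli.

(** * Compactness through ultrafilters *)

Section UltrafilterLimits.
Variables (R : realType) (n : nat) (U : set_system nat).
Hypothesis UU : UltraFilter U.

Let UP : ProperFilter U := @ultra_proper _ _ UU.
Existing Instance UP.

(** The limit is the supremum of the levels that [x] exceeds on a set of the ultrafilter. One free
    ultrafilter selects limits of all bounded sequences at once, in place of repeated extraction of
    subsequences. *)
Lemma ultra_real_limit (x : nat -> R) (M : R) : (forall k, `|x k| <= M) ->
  exists l, forall e, 0 < e -> U [set k | `|x k - l| < e].
Proof.
move=> xM; pose S := [set t | U [set k | t <= x k]].
have S1 : S (- M).
  apply: (filterS _ (@filterT _ U _)) => k _ /=.
  by have := xM k; rewrite ler_norml => /andP[].
have Sub t : S t -> t <= M.
  move=> St; rewrite leNgt; apply/negP => Mt.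
  apply: (@filter_not_empty _ U _); apply: filterS St => k /= tx.
  by have := xM k; rewrite ler_norml => /andP[_]; lra.
have hS : has_sup S by split; [exists (- M) | exists M => t /Sub].
exists (sup S) => e e0.
have [t St te] := sup_adherent e0 hS.
have nS : ~ S (sup S + e).
  by move=> /(sup_upper_bound hS); lra.
have {}nS : U [set k | x k < sup S + e].
  have [//|] := @in_ultra_setVsetC _ U [set k | sup S + e <= x k] UU.
  by apply: filterS => k /= /negP; rewrite -ltNge.
apply: filterS (filterI St nS) => k /= [h1 h2].
by rewrite ltr_norml; lra.
Qed.

Lemma ultra_complex_limit (x : nat -> R[i]) (M : R) : (forall k, cabs (x k) <= M) ->
  exists l, forall e, 0 < e -> U [set k | cabs (x k - l) < e].
Proof.
move=> xM.
have [a aP] := @ultra_real_limit (fun k => cre (x k)) M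
  (fun k => le_trans (cre_le_cabs _) (xM k)).
have [b bP] := @ultra_real_limit (fun k => cim (x k)) M
  (fun k => le_trans (cim_le_cabs _) (xM k)).
exists (a +i* b)%C => e e0; have e2 : 0 < e / 2 by lra.
apply: filterS (filterI (aP _ e2) (bP _ e2)) => k /= [h1 h2].
apply: (le_lt_trans (cabs_le_reim _)); rewrite creE cimE creN cimN /=.
by move: h1 h2; lra.
Qed.

Lemma ultra_Cn_limit (z : nat -> Cn R n) (M : R) : (forall k, cnorm (z k) <= M) ->
  exists l : Cn R n, forall e, 0 < e -> U [set k | cnorm (z k - l) < e].
Proof.
move=> zM.
have /choice[l lP] : forall j : 'I_n, exists l, forall e, 0 < e ->
    U [set k | cabs (z k 0 j - l) < e].
  by move=> j; apply: (@ultra_complex_limit _ M) => k; exact: le_trans (cabs_coord_le _ _) (zM k).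
exists (\row_j l j) => e e0.
have d0 : 0 < e / n.+1%:R by rewrite divr_gt0.
have : U [set k | forall j, cabs (z k 0 j - l j) < e / n.+1%:R].
  by apply: (@filter_forall _ _ (fun j k => cabs (z k 0 j - l j) < e / n.+1%:R)) => j; exact: lP.
apply: filterS => k /= H; apply: (le_lt_trans (cnorm_le_sum _)).
apply: (@le_lt_trans _ _ (\sum_(j < n) (e / n.+1%:R))).
  by apply: ler_sum => j _; rewrite !mxE; apply: ltW.
rewrite sumr_const card_ord -[_ *+ n]mulr_natr mulrAC ltr_pdivrMr //.
by rewrite ltr_pM2l // ltr_nat.
Qed.

End UltrafilterLimits.

Lemma ex_free_ultrafilter : exists U : set_system nat, UltraFilter U /\
  forall N, U [set k | (N <= k)%N].
Proof.
have [U [UU UF]] := ultraFilterLemma eventually_filter.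
by exists U; split=> // N; apply: UF; exists N.
Qed.

Section UniformContinuity.
Variables (R : realType) (n : nat).
Implicit Types (f : Cn R n -> R) (z w : Cn R n).

Lemma ccontinuous_comp f (phi : R -> R) z : {for f z, continuous phi} ->
  ccontinuous_at f z -> ccontinuous_at (phi \o f) z.
Proof.
move=> cp cf e e0; have /cvgrPdist_lt /(_ e e0) /nbhs_ballP[d /= d0 dP] := cp.
have [d' d'0 d'P] := cf d d0; exists d' => // w /d'P wd /=.
by rewrite distrC; apply: dP; rewrite /ball /= distrC.
Qed.

Variables (f : Cn R n -> R) (s : R).
Hypothesis cf : forall z, cnorm z <= s -> ccontinuous_at f z.

Let limit_in (U : set_system nat) (UU : UltraFilter U) (z : nat -> Cn R n) :
  (forall k, cnorm (z k) <= s) -> exists l, cnorm l <= s /\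
    forall e, 0 < e -> U [set k | cnorm (z k - l) < e].
Proof.
move=> zs; have [l lP] := ultra_Cn_limit UU zs; exists l; split=> //.
have UP : ProperFilter U := @ultra_proper _ _ UU.
apply/ler_addgt0Pr => e e0; rewrite leNgt; apply/negP => sl.
apply: (@filter_not_empty _ U _); apply: filterS (lP e e0) => k /= H.
by have := ler_cnormB l (z k); rewrite cnormB_sym; have := zs k; lra.
Qed.

(** If it fails, there are pairs of points at distance below 1/(k+1) with values at least [e] apart;
    the limit of the pairs along a free ultrafilter contradicts continuity there. *)
Lemma ball_uniform_continuity e : 0 < e -> exists2 d, 0 < d & forall z w,
  cnorm z <= s -> cnorm w <= s -> cnorm (z - w) < d -> `|f z - f w| < e.
Proof.
move=> e0; apply: contrapT => H.
have /choice[zw zwP] : forall k : nat, exists zw : Cn R n * Cn R n,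
   [/\ cnorm zw.1 <= s, cnorm zw.2 <= s, cnorm (zw.1 - zw.2) < k.+1%:R^-1 &
     e <= `|f zw.1 - f zw.2| ].
  move=> k; apply: contrapT => H'; apply: H; exists k.+1%:R^-1 => // z w zs ws zw.
  by rewrite ltNge; apply/negP => E; apply: H'; exists (z, w).
have [U [UU Uinf]] := ex_free_ultrafilter.
have UP : ProperFilter U := @ultra_proper _ _ UU.
have zs k : cnorm (zw k).1 <= s by have [] := zwP k.
have [l [ls lP]] := limit_in UU zs.
have e2 : 0 < e / 2 by lra.
have [d d0 dP] := cf ls e2; have d2 : 0 < d / 2 by lra.
apply: (@filter_not_empty _ U _).
apply: filterS (filterI (lP _ d2) (Uinf (Num.truncn (d / 2)^-1))) => k /= [h1 h2].
have [_ _ h3 h4] := zwP k.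
have h5 : k.+1%:R^-1 < d / 2.
  rewrite -[X in _ < X]invrK ltf_pV2 ?posrE ?invr_gt0 //.
  have i0 : 0 <= (d / 2)^-1 by rewrite invr_ge0 ltW.
  have /andP[_ h5] := truncn_itv i0; apply: lt_le_trans h5 _.
  by rewrite ler_nat.
have q1 : `|f (zw k).1 - f l| < e / 2 by apply: dP; lra.
have q2 : `|f (zw k).2 - f l| < e / 2.
  apply: dP; apply: (le_lt_trans (cnorm_triangle _ (zw k).1 _)).
  by rewrite [d]splitr ltrD // cnormB_sym; exact: lt_trans h3 h5.
move: h4; apply/negP; rewrite -ltNge.
apply: (le_lt_trans (ler_distD (f l) _ _)); rewrite (distrC (f l)); lra.
Qed.

Lemma ball_bounded : exists2 M, 0 <= M & forall z, cnorm z <= s -> `|f z| <= M.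
Proof.
apply: contrapT => H.
have /choice[z zP] : forall k : nat, exists z, cnorm z <= s /\ k%:R < `|f z|.
  move=> k; apply: contrapT => H'; apply: H; exists k%:R => // z zs.
  by rewrite leNgt; apply/negP => E; apply: H'; exists z.
have [U [UU Uinf]] := ex_free_ultrafilter.
have UP : ProperFilter U := @ultra_proper _ _ UU.
have [l [ls lP]] := limit_in UU (fun k => (zP k).1).
have [d d0 dP] := cf ls ltr01.
apply: (@filter_not_empty _ U _).
apply: filterS (filterI (lP _ d0) (Uinf (Num.truncn (`|f l| + 1)).+1)) => k /= [/dP h1 h2].
have [_ h3] := zP k.
have f0 : 0 <= `|f l| + 1 by rewrite addr_ge0.
have /andP[_ h4] := truncn_itv f0.
have h5 : (Num.truncn (`|f l| + 1)).+1%:R <= k%:R :> R by rewrite ler_nat.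
have := ler_normD (f (z k) - f l) (f l); rewrite subrK; lra.
Qed.

End UniformContinuity.

Lemma powR_le (R : realType) (q x y : R) : 0 <= q -> 0 <= x -> x <= y -> x `^ q <= y `^ q.
Proof.
move=> q0 x0 xy; apply: ge0_ler_powR => //; rewrite nnegrE //.
exact: le_trans xy.
Qed.

(** * The local sub-mean value inequality *)

Section LocalSubmean.
Variables (R : realType) (n : nat) (f : Cn R n -> R[i]) (p : R).
Hypotheses (hf : holomorphic f) (p0 : 0 < p).

Lemma ccontinuous_cabs z : ball_n z -> ccontinuous_at (fun z => cabs (f z)) z.
Proof.
move=> /hf fz e e0; have [d d0 dP] := holo_at_continuous fz e0.
by exists d => // w /dP; apply: le_lt_trans; exact: ler_dist_cabs.
Qed.

(* Truncating [|f|] from below makes the radius in the local sub-mean value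
   property uniform; near a zero of [f] it would not be. *)
Definition truncated_pow (d : R) z := Num.max (cabs (f z)) d `^ p.

Lemma truncated_pow_ge0 d z : 0 <= truncated_pow d z.
Proof. exact: powR_ge0. Qed.

Lemma ccontinuous_truncated_pow d z : 0 < d -> ball_n z ->
  ccontinuous_at (truncated_pow d) z.
Proof.
move=> d0 zb.
have -> : truncated_pow d = (fun t => expR (p * ln t)) \o (fun z => Num.max (cabs (f z)) d).
  apply/funext => w /=; rewrite /truncated_pow /powR gt_eqF //.
  by rewrite lt_max d0 orbT.
apply: ccontinuous_comp.
  have m0 : 0 < Num.max (cabs (f z)) d by rewrite lt_max d0 orbT.
  apply: (@continuous_comp _ _ _ (fun t => p * ln t) expR); last exact: continuous_expR.
  by apply: cvgM; [exact: cvg_cst | exact: continuous_ln].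
move=> e /(ccontinuous_cabs zb)[d' d'0 d'P]; exists d' => // w /d'P.
apply: le_lt_trans; have := ler_norm (cabs (f w) - cabs (f z)).
have := ler_norm (- (cabs (f w) - cabs (f z))); rewrite normrN.
by case: (leP (cabs (f w)) d) => ?; case: (leP (cabs (f z)) d) => ?; rewrite ler_norml; lra.
Qed.

(** Where |f(c)| > d, the quotient f / f(c) is close to 1 on small circles, uniformly in [c], and
    [powR_cabs_lower] gives |f|^p >= |f(c)|^p (1 + Re P) with [P] holomorphic and P(c) = 0; the mean
    value property removes Re P. *)
Lemma local_submean (r d : R) : r < 1 -> 0 < d -> exists2 dl, 0 < dl &
  forall c w e, 0 < e -> (forall x : R[i], cabs x <= e -> cnorm (c + x *: w) <= r) ->
    e * cnorm w < dl ->
    continuous (fun t => truncated_pow d (c + (e%:C%C * cis t) *: w)) /\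
    (pi *+ 2) * truncated_pow d c <=
    segint (fun t => truncated_pow d (c + (e%:C%C * cis t) *: w)) 0 (pi *+ 2).
Proof.
move=> r1 d0; have [k k0 kP] := powR_cabs_lower p0.
have cre_c z : cnorm z <= r -> ccontinuous_at (fun z => cre (f z)) z.
  move=> zr e e0; have [d' d'0 d'P] := holo_at_continuous (hf (le_lt_trans zr r1)) e0.
  exists d' => // w /d'P; apply: le_lt_trans.
  by rewrite -creN -creE; exact: cre_le_cabs.
have cim_c z : cnorm z <= r -> ccontinuous_at (fun z => cim (f z)) z.
  move=> zr e e0; have [d' d'0 d'P] := holo_at_continuous (hf (le_lt_trans zr r1)) e0.
  exists d' => // w /d'P; apply: le_lt_trans.
  by rewrite -cimN -cimE; exact: cim_le_cabs.
have kd : 0 < k * d / 2 by rewrite divr_gt0 // mulr_gt0.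
have [d1 d10 d1P] := ball_uniform_continuity cre_c kd.
have [d2 d20 d2P] := ball_uniform_continuity cim_c kd.
exists (Num.min d1 d2); first by rewrite lt_min d10.
move=> c w e e0 cw; rewrite lt_min => /andP[ew1 ew2].
have ec t : cabs (e%:C%C * cis t) = e.
  by rewrite cabsM cabs_cis mulr1 cabs_real gtr0_norm.
have inr t : cnorm (c + (e%:C%C * cis t) *: w) <= r by apply: cw; rewrite ec.
have cc : continuous (fun t => truncated_pow d (c + (e%:C%C * cis t) *: w)).
  apply: continuous_epsP => t eps eps0.
  have [d' d'0 d'P] := ccontinuous_truncated_pow d0 (le_lt_trans (inr t) r1) eps0.
  have w1 : 0 < cnorm w + 1 by rewrite ltr_wpDl.
  have [d3 d30 d3P] := pcontinuous_cis e%:C%C t (divr_gt0 d'0 w1).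
  exists d3 => // u /d3P; rewrite ltr_pdivlMr // => h; apply: d'P.
  rewrite (_ : _ - _ = (e%:C%C * cis u - e%:C%C * cis t) *: w); last first.
    by rewrite scalerBl opprD addrACA subrr add0r.
  by rewrite cnormZ; apply: le_lt_trans h; rewrite ler_wpM2l // lerDl.
split=> //.
have pi0 : 0 <= pi *+ 2 :> R by rewrite mulrn_wge0 // pi_ge0.
have cst (t : R) : continuous (fun _ : R => t) by move=> x; exact: cvg_cst.
(* When |f(c)| <= d, the truncated power takes its smallest possible value d^p at [c], and the
   inequality is immediate. *)
have [fcd|fcd] := leP (cabs (f c)) d.
  rewrite mulrC -[X in _ * X]subr0 -(segint_cst _ pi0).
  apply: le_segint; [exact: cst | exact: cc | move=> t _].
  by apply: powR_le; [exact: ltW | rewrite le_max cabs_ge0 | rewrite max_r // le_max lexx orbT].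
have g0 : f c != 0 by rewrite -cabs_gt0; exact: lt_trans fcd.
pose E z := (f c)^-1 * f z + - 1.
have hE z : cnorm z < 1 -> holo_at E z.
  by move=> z1; apply: holoD; [apply: holoZ; exact: hf | exact: holo_cst].
pose P z := p%:C%C * E z + (p * (p - 2) / 4)%:C%C * E z ^+ 2.
have hP z : cnorm z < 1 -> holo_at P z.
  by move=> z1; apply: holoD; apply: holoZ; [exact: hE | apply: holoX; exact: hE].
have := @mean_value_line R n P c w e e0 (fun x xe => hP _ (le_lt_trans (cw x xe) r1)).
have -> : P c = 0 by rewrite /P /E mulVf // subrr expr0n /= !mulr0 addr0.
rewrite cre0 mulr0 => PE.
pose A := cabs (f c) `^ p.
have cP : continuous (fun t => cre (P (c + (e%:C%C * cis t) *: w))).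
  apply: (@pcontinuous_cre _ (fun t => P (c + (e%:C%C * cis t) *: w))).
  apply: (@pcontinuous_comp _ (fun x => P (c + x *: w))); last exact: pcontinuous_cis.
  by move=> t; apply: holo_line; apply: hP; exact: le_lt_trans (inr t) r1.
have A0 : 0 <= A by exact: powR_ge0.
have cAP : continuous (fun t => A * cre (P (c + (e%:C%C * cis t) *: w))).
  by move=> t; apply: cvgM; [exact: cvg_cst | exact: cP].
have -> : truncated_pow d c = A by rewrite /truncated_pow max_l // ltW.
have -> : (pi *+ 2) * A = segint (fun t => A + A * cre (P (c + (e%:C%C * cis t) *: w))) 0 (pi *+ 2).
  by rewrite (segintD _ _ (cst A) cAP) segint_cst // (segintZ _ _ _ cP) PE mulr0 addr0 subr0 mulrC.
apply: le_segint => // [t|t _].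
  by apply: cvgD; [exact: cvg_cst | exact: cAP].
set z := c + _; have zr : cnorm z <= r by exact: inr.
have cr : cnorm c <= r by have := cw 0; rewrite scale0r addr0 cabs0; apply; exact: ltW.
have zc : cnorm (z - c) = e * cnorm w by rewrite /z addrC addKr cnormZ ec.
have Ek : cabs (E z) <= k.
  have -> : E z = (f z - f c) / f c by rewrite /E; field.
  rewrite cabsM cabsV ler_pdivrMr ?cabs_gt0 //.
  apply: (@le_trans _ _ (k * d)); last by rewrite ler_wpM2l ?(ltW k0) // ltW.
  apply: (le_trans (cabs_le_reim _)); rewrite creE cimE creN cimN.
  have := d1P z c zr cr; have := d2P z c zr cr; rewrite zc => /(_ ew2) h1 /(_ ew1) h2.
  lra.
have := kP _ Ek; rewrite -/(P z) => h.
have fz : cabs (f z) = cabs (f c) * cabs (1 + E z).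
  by rewrite -cabsM /E addrC subrK mulVKf.
apply: (@le_trans _ _ (cabs (f z) `^ p)).
  by rewrite fz powRM // -/A -{1}[A]mulr1 -mulrDr ler_wpM2l.
by apply: powR_le; [exact: ltW | exact: cabs_ge0 | rewrite le_max lexx].
Qed.

End LocalSubmean.

(** * Monotone means over rotation-invariant sets *)

Section RotationMeans.
Variables (R : realType) (n : nat) (V : {measure set (CnM R n) -> \bar R}).
Hypothesis V_sf : sigma_finite setT V.
Hypothesis V_rot : forall (g : CnM R n -> \bar R) (u : R[i]),
  measurable_fun setT g -> (forall z, 0 <= g z)%E -> cabs u = 1 ->
  (\int[V]_z g (u *: (z : Cn R n))%R = \int[V]_z g z)%E.
Variables (f : Cn R n -> R[i]) (p : R).
Hypotheses (hf : holomorphic f) (p0 : 0 < p).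
Variables (Om : set (CnM R n)) (c : Cn R n) (K r S : R).
Hypotheses (mOm : measurable Om) (K0 : 0 < K) (r1 : r < 1).
Hypothesis Om_rot : forall (u : R[i]) (w : Cn R n), cabs u = 1 -> Om w -> Om (u *: w).
Hypothesis Om_bnd : forall w : Cn R n, Om w -> cnorm w <= K.
Hypothesis VOm_fin : (V Om < +oo)%E.
Hypothesis Om_in : forall (w : Cn R n) (x : R[i]), Om w -> cabs x <= S ->
  cnorm (c + x *: w) <= r.

Let T := CnM R n.

Let v := fine (V Om).

Let vE : V Om = v%:E.
Proof. by rewrite /v fineK // ge0_fin_numE. Qed.

Let v0 : 0 <= v. Proof. exact: fine_ge0. Qed.

Section Truncated.
Variable d : R.
Hypothesis d0 : 0 < d.

Variable h : T -> R.
Hypothesis h0 : forall z, 0 <= h z.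
Hypothesis hE : forall z : Cn R n, cnorm z < 1 -> h z = truncated_pow f p d z.
Hypothesis mh : measurable_fun setT h.

Let aff (x : R[i]) (w : T) : T := c + x *: (w : Cn R n).

Let m_aff x : measurable_fun setT (aff x).
Proof.
apply: (eq_measurable_fun ((fun z : T => (z : Cn R n) + c : T) \o
    (fun w : T => x *: (w : Cn R n) : T))).
  by move=> w _; rewrite /aff /= addrC.
exact: measurableT_comp (measurable_translate c) (measurable_scale x).
Qed.

Let I (x : R[i]) : \bar R := (\int[V]_(w in Om) (h (aff x w))%:E)%E.

Let m_int x : measurable_fun setT (fun w => (h (aff x w))%:E).
Proof. by apply/measurable_EFinP; exact: measurableT_comp. Qed.

(** The phase of [x] can be moved to [w], and both the measure and [Om] are invariant under it. *)
Let I_rot x : I x = I (cabs x)%:C%C.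
Proof.
have [x0|x0] := eqVneq x 0; first by rewrite x0 cabs0.
pose u := x / (cabs x)%:C%C.
have cx : (cabs x)%:C%C != 0 :> R[i].
  by rewrite -cabs_gt0 cabs_real gtr0_norm cabs_gt0.
have u1 : cabs u = 1.
  by rewrite /u cabsM cabsV cabs_real ger0_norm // mulfV // cabs_eq0.
have Om_u (w : Cn R n) : Om (u *: w) <-> Om w.
  split; last exact: Om_rot.
  have u0 : u != 0 by rewrite -cabs_gt0 u1.
  by move=> /(@Om_rot u^-1); rewrite scalerA mulVf // scale1r cabsV u1 invr1; apply.
pose g := (fun w : T => (h (aff (cabs x)%:C%C w))%:E) \_ Om.
have mg : measurable_fun setT g.
  by apply/measurable_restrict => //; rewrite setTI; exact: measurable_funTS.
have g0 w : (0 <= g w)%E by rewrite /g /patch; case: ifP => // _; rewrite lee_fin.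
rewrite /I [RHS]integral_mkcond -/g -(V_rot mg g0 u1) integral_mkcond.
have gE w : g w = if w \in Om then (h (aff (cabs x)%:C%C w))%:E else 0%E by [].
apply: eq_integral => w _; rewrite gE patchE.
have -> : (u *: (w : Cn R n) \in Om) = (w \in Om).
  by apply/idP/idP; rewrite !inE => /Om_u.
have -> : aff (cabs x)%:C%C (u *: (w : Cn R n)) = aff x w.
  by rewrite /aff scalerA; congr (_ + _ *: _); rewrite /u mulrC divfK.
by [].
Qed.

Let realc_le s : 0 <= s <= S -> cabs (s%:C%C : R[i]) <= S.
Proof. by move=> /andP[s0 sS]; rewrite cabs_real ger0_norm. Qed.

Let in_ball x w : cabs x <= S -> Om w -> cnorm (aff x w) < 1.
Proof. by move=> xS Ow; apply: le_lt_trans r1; exact: Om_in. Qed.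

Let tc z : cnorm z <= r -> ccontinuous_at (truncated_pow f p d) z.
Proof. by move=> zr; apply: ccontinuous_truncated_pow => //; exact: le_lt_trans r1. Qed.

Lemma truncated_integral_fin x : cabs x <= S -> (I x < +oo)%E.
Proof.
move=> xS; have [M M0 MP] := ball_bounded tc.
apply: (@le_lt_trans _ _ (\int[V]_(w in Om) M%:E)%E).
  apply: ge0_le_integral => //.
  - by move=> w _; rewrite lee_fin.
  - exact: measurable_funTS.
  - move=> w Ow; rewrite lee_fin hE; last exact: in_ball.
    by apply: (le_trans (ler_norm _)); apply: MP; exact: Om_in.
by rewrite integral_cst // vE -EFinM ltry.
Qed.

Variable N : R -> R.
Hypothesis IN : forall s, 0 <= s <= S -> I s%:C%C = (N s)%:E.

Let N_cont e : 0 < e -> exists2 dl, 0 < dl & forall s t, 0 <= s <= S -> 0 <= t <= S ->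
  `|s - t| < dl -> N s <= N t + e.
Proof.
move=> e0; have v1 : 0 < v + 1 by rewrite ltr_wpDl.
have [dl dl0 dlP] := ball_uniform_continuity tc (divr_gt0 e0 v1).
exists (dl / K); first by rewrite divr_gt0.
move=> s t sS tS; rewrite ltr_pdivlMr // => st.
rewrite -lee_fin EFinD -(IN sS) -(IN tS).
apply: (@le_trans _ _ (\int[V]_(w in Om) ((h (aff t%:C%C w))%:E + (e / (v + 1))%:E))%E).
  apply: ge0_le_integral => //.
  - by move=> w _; rewrite lee_fin.
  - exact: measurable_funTS.
  - by apply: emeasurable_funD; [exact: measurable_funTS | exact: measurable_cst].
  - move=> w Ow; rewrite -EFinD lee_fin !hE; [|exact: (in_ball (realc_le tS) Ow)|exact: (in_ball (realc_le sS) Ow)].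
    have := dlP (aff s%:C%C w) (aff t%:C%C w) (Om_in Ow (realc_le sS)) (Om_in Ow (realc_le tS)).
    have -> : (aff s%:C%C w : Cn R n) - aff t%:C%C w = (s - t)%:C%C *: (w : Cn R n).
      by rewrite /aff opprD addrACA subrr add0r -scalerBl realcB.
    rewrite cnormZ cabs_real ltr_norml => H.
    have : `|s - t| * cnorm (w : Cn R n) < dl.
      by apply: le_lt_trans st; rewrite ler_wpM2l // Om_bnd.
    by move=> /H /andP[_]; rewrite ltrBlDl => /ltW.
rewrite ge0_integralD //; last first.
- by move=> w _; rewrite lee_fin divr_ge0 // ltW.
- exact: measurable_funTS.
- by move=> w _; rewrite lee_fin.
rewrite leeD2l // integral_cst // vE -EFinM lee_fin mulrAC ler_pdivrMr //.
by rewrite ler_pM2l // lerDl.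
Qed.

Let m_circle (s e : R) : measurable_fun setT (fun tw : R * T =>
  (h (aff (s%:C%C + e%:C%C * cis tw.1) tw.2))%:E).
Proof.
apply/measurable_EFinP; apply: (measurableT_comp mh).
have mc : measurable_fun setT (fun tw : R * T => cos tw.1).
  exact: (measurableT_comp (continuous_measurable_fun (@continuous_cos R)) measurable_fst).
have ms : measurable_fun setT (fun tw : R * T => sin tw.1).
  exact: (measurableT_comp (continuous_measurable_fun (@continuous_sin R)) measurable_fst).
have mre j : measurable_fun setT (fun tw : R * T => cre (tw.2 0 j)).
  exact: (measurableT_comp (@measurable_cre R n j) measurable_snd).
have mim j : measurable_fun setT (fun tw : R * T => cim (tw.2 0 j)).
  exact: (measurableT_comp (@measurable_cim R n j) measurable_snd).
apply: measurable_CnP => j.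
  apply: (eq_measurable_fun (fun tw : R * T => cre (c 0 j) +
    ((s + e * cos tw.1) * cre (tw.2 0 j) - (e * sin tw.1) * cim (tw.2 0 j)))).
    move=> [t w] _ /=; rewrite /aff !mxE creE creM creE cimE creM cimM !cre_real !cim_real.
    by rewrite /cis /cre /cim /=; ring.
  apply: measurable_funD => //; apply: measurable_funB; apply: measurable_funM => //.
    by apply: measurable_funD => //; apply: measurable_funM.
  by apply: measurable_funM.
apply: (eq_measurable_fun (fun tw : R * T => cim (c 0 j) +
    ((s + e * cos tw.1) * cim (tw.2 0 j) + (e * sin tw.1) * cre (tw.2 0 j)))).
  move=> [t w] _ /=; rewrite /aff !mxE cimE cimM creE cimE creM cimM !cre_real !cim_real.
  by rewrite /cis /cre /cim /=; ring.
apply: measurable_funD => //; apply: measurable_funD; apply: measurable_funM => //.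
  by apply: measurable_funD => //; apply: measurable_funM.
by apply: measurable_funM.
Qed.

Let N_submean : exists2 dl, 0 < dl & forall s e, 0 <= s -> 0 < e -> s + e <= S ->
  e < dl -> (((pi *+ 2) * N s)%:E <=
    \int[lebesgue_measure]_(t in `[0%R, (pi *+ 2)%R]) I (s%:C%C + e%:C%C * cis t)%R)%E.
Proof.
have [dl dl0 dlP] := local_submean hf p0 r1 d0.
exists (dl / K); first by rewrite divr_gt0.
move=> s e s0 e0 seS; rewrite ltr_pdivlMr // => edl.
have pi0 : 0 <= pi *+ 2 :> R by rewrite mulrn_wge0 // pi_ge0.
have sS : 0 <= s <= S by lra.
rewrite EFinM -(IN sS) /I.
rewrite (@tonelli_rect _ _ _ _ _ lebesgue_measure V _ Om
  (fun tw : R * T => (h (aff (s%:C%C + e%:C%C * cis tw.1) tw.2))%:E)) //; last 3 first.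
- exact: sigma_finiteT.
- exact: m_circle.
- by move=> x; rewrite lee_fin.
rewrite -ge0_integralZl_EFin //; last 2 first.
- by move=> w _; rewrite lee_fin.
- exact: measurable_funTS.
have mI := m_circle s e.
apply: ge0_le_integral => //.
- by move=> w _; rewrite -EFinM lee_fin mulr_ge0.
- by apply: measurable_funTS; apply: emeasurable_funM => //; exact: measurable_cst.
- apply: measurable_funTS.
  apply: (@measurable_inner_integral_rect _ _ T (measurableTypeR R) R lebesgue_measure `[0, pi *+ 2]%classic
    (fun wt : T * R => (h (aff (s%:C%C + e%:C%C * cis wt.2) wt.1))%:E)) => //.
  + exact: sigma_finiteT.
  + exact: (measurableT_comp mI (measurable_fun_pair measurable_snd measurable_fst)).
  + by move=> x; rewrite lee_fin.
move=> w Ow.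
have cabs_se (x : R[i]) : cabs x <= e -> cabs (s%:C%C + x) <= S.
  by move=> xe; apply: (le_trans (cabsD _ _)); rewrite cabs_real ger0_norm //; lra.
have E x : aff (s%:C%C + x) w = aff s%:C%C w + x *: (w : Cn R n).
  by rewrite /aff scalerDl addrA.
have [|] := dlP (aff s%:C%C w) w e e0 _ (le_lt_trans (ler_wpM2l (ltW e0) (Om_bnd Ow)) edl).
  by move=> x xe; rewrite -E; apply: Om_in => //; exact: cabs_se.
move=> cc; rewrite -lee_fin => /le_trans; rewrite -hE; last exact: (in_ball (realc_le sS) Ow).
apply; rewrite /segint /Rintegral fineK; last exact/integrable_fin_num/segint_integrable.
rewrite le_eqVlt; apply/orP; left; apply/eqP; apply: eq_integral => t _ /=.
rewrite -E hE //; apply: in_ball => //; apply: cabs_se.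
by rewrite cabsM cabs_cis mulr1 cabs_real gtr0_norm.
Qed.

(** As a function of the complex scalar x, the integral [I] is subharmonic, being an average of
    subharmonic functions, and radial by [I_rot]; such a function increases with |x|. The proof is
    the maximum principle with a strictly subharmonic perturbation: if N s1 > N s2, then N s + b s^2
    has a maximum on [0, s2] at some s0 < s2, against the sub-mean value inequality on a small
    circle around s0. *)
Lemma truncated_mean_le s1 s2 : 0 <= s1 -> s1 <= s2 -> s2 <= S -> N s1 <= N s2.
Proof.
move=> s10 s12 s2S; rewrite leNgt; apply/negP => N21.
have s20 : 0 <= s2 by exact: le_trans s12.
(* With this [b] the perturbation at [s2] is less than the gap N s1 - N s2, so the maximum is not
   attained at [s2]. *)
pose b := (N s1 - N s2) / (2 * (s2 ^+ 2 + 1)).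
have q1 : 0 < 2 * (s2 ^+ 2 + 1) by rewrite mulr_gt0 // ltr_wpDl // sqr_ge0.
have b0 : 0 < b by rewrite divr_gt0 // subr_gt0.
have bE : b * (2 * (s2 ^+ 2 + 1)) = N s1 - N s2 by rewrite divfK // gt_eqF.
pose cl (x : R) := Num.max 0 (Num.min x s2).
have clP x : 0 <= cl x <= s2.
  by rewrite le_max lexx ge_max s20 ge_min lexx orbT.
have clS x : 0 <= cl x <= S by have := clP x; lra.
have clE x : 0 <= x <= s2 -> cl x = x.
  by move=> /andP[x1 x2]; rewrite /cl min_l // max_r.
have cl_lip x y : `|cl x - cl y| <= `|x - y|.
  exact: clamp_lipschitz.
pose F x := N (cl x) + b * cl x ^+ 2.
have cF : continuous F.
  apply: continuous_epsP => x e e0; have e4 : 0 < e / 4 by lra.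
  have [dl dl0 dlP] := N_cont e4.
  pose d' := e / (4 * b * (2 * s2 + 1)).
  have q : 0 < 4 * b * (2 * s2 + 1).
    by apply: mulr_gt0; [exact: mulr_gt0 | rewrite ltr_wpDl // mulr_ge0].
  have d'0 : 0 < d' by rewrite divr_gt0.
  exists (Num.min dl d'); first by rewrite lt_min dl0.
  move=> y; rewrite lt_min => /andP[h1 h2].
  have h3 := le_lt_trans (cl_lip y x) h1; have h4 := le_lt_trans (cl_lip y x) h2.
  have n1 := dlP _ _ (clS y) (clS x) h3; rewrite distrC in h3.
  have n2 := dlP _ _ (clS x) (clS y) h3.
  have h5 : `|b * cl y ^+ 2 - b * cl x ^+ 2| <= e / 4.
    have -> : b * cl y ^+ 2 - b * cl x ^+ 2 = b * ((cl y - cl x) * (cl y + cl x)) by ring.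
    rewrite normrM (gtr0_norm b0) normrM.
    move: h4; rewrite /d' ltr_pdivlMr // => h4.
    have h6 : `|cl y + cl x| <= 2 * s2 + 1.
      have := clP x; have := clP y; rewrite ler_norml; lra.
    have h7 : `|cl y - cl x| * `|cl y + cl x| <= `|cl y - cl x| * (2 * s2 + 1).
      by rewrite ler_wpM2l.
    have : b * (`|cl y - cl x| * `|cl y + cl x|) <= b * (`|cl y - cl x| * (2 * s2 + 1)).
      by rewrite ler_pM2l.
    have h8 : `|cl y - cl x| * (4 * b * (2 * s2 + 1)) = 4 * (b * (`|cl y - cl x| * (2 * s2 + 1))).
      by ring.
    rewrite h8 in h4; move: h4.
    by move: (b * (_ * _)) (b * (_ * _)) => u1 u2 ? ?; lra.
  by rewrite /F; move: h5; rewrite ler_norml ltr_norml => /andP[? ?]; lra.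
have [s0 s0s FM] := EVT_max s20 (continuous_subspaceT cF).
rewrite in_itv /= in s0s.
have s0lt : s0 < s2.
  rewrite lt_neqAle; have /andP[_ ->] := s0s; rewrite andbT; apply/eqP => E.
  have := FM s1; rewrite in_itv /= s10 s12 => /(_ isT).
  rewrite /F E !clE ?s10 ?s12 ?s20 ?lexx //.
  have := sqr_ge0 s1; nra.
have [dl dl0 dlP] := N_submean.
pose e := Num.min (s2 - s0) (dl / 2).
have e0 : 0 < e by rewrite lt_min subr_gt0 s0lt divr_gt0.
have e1 : s0 + e <= s2 by have : e <= s2 - s0 by [rewrite ge_min lexx]; lra.
have e2 : e < dl by apply: (@le_lt_trans _ _ (dl / 2)); [rewrite ge_min lexx orbT | lra].
have s00 : 0 <= s0 by case/andP: s0s.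
have := dlP s0 e s00 e0 (le_trans e1 s2S) e2; apply/negP; rewrite -ltNge.
have pi0 : 0 < pi *+ 2 :> R by rewrite mulrn_wgt0 // pi_gt0.
(* [G] is the bound on the circle of radius [e] around [s0] that follows from F <= F s0. Its cosine
   term has mean zero, and what remains lies below N s0 by b e^2. *)
pose G t := F s0 - b * (s0 ^+ 2 + e ^+ 2) - b * (2 * s0 * e) * cos t.
have cst (t : R) : continuous (fun _ : R => t) by move=> x; exact: cvg_cst.
have ccos : continuous (fun t => b * (2 * s0 * e) * cos t).
  by move=> t; apply: cvgM; [exact: cvg_cst | exact: continuous_cos].
have cG : continuous G by move=> t; apply: cvgB; [exact: cvg_cst | exact: ccos].
have cs (t : R) : cabs (s0%:C%C + e%:C%C * cis t) ^+ 2 = s0 ^+ 2 + 2 * s0 * e * cos t + e ^+ 2.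
  rewrite cabs_sq creE cimE creM cimM !cre_real !cim_real /cis /cre /cim /=.
  have := @cos2Dsin2 R t; move: (cos t) (sin t) => x y xy.
  have -> : e ^+ 2 = e ^+ 2 * (x ^+ 2 + y ^+ 2) by rewrite xy mulr1.
  ring.
have cs2 (t : R) : cabs (s0%:C%C + e%:C%C * cis t) <= s2.
  apply: (le_trans (cabsD _ _)); rewrite cabsM cabs_cis mulr1 !cabs_real.
  by rewrite !ger0_norm // ltW.
have IG (t : R) : (I (s0%:C%C + e%:C%C * cis t)%R <= (G t)%:E)%E.
  rewrite I_rot; set s := cabs _; have sin : 0 <= s <= s2 by rewrite cabs_ge0 cs2.
  rewrite IN ?lee_fin; last by move: sin; lra.
  have := FM s; rewrite in_itv /= => /(_ sin); rewrite /F clE // cs => hh.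
  by rewrite /G /F; lra.
apply: (@le_lt_trans _ _ (\int[lebesgue_measure]_(t in `[0%R, (pi *+ 2)%R]) (G t)%:E)%E).
  apply: ge0_le_integral => //.
  - by move=> t _; apply: integral_ge0 => w _; rewrite lee_fin.
  - apply: measurable_funTS.
    apply: (@measurable_inner_integral_rect _ _ (measurableTypeR R) T R V Om
      (fun tw : R * T => (h (aff (s0%:C%C + e%:C%C * cis tw.1) tw.2))%:E)) => //.
    + exact: m_circle.
    + by move=> x; rewrite lee_fin.
  - by apply: measurable_funTS; apply/measurable_EFinP; exact: continuous_measurable_fun.
have -> : (\int[lebesgue_measure]_(t in `[0%R, (pi *+ 2)%R]) (G t)%:E = (segint G 0 (pi *+ 2))%:E)%E.
  by rewrite /segint /Rintegral fineK //; exact/integrable_fin_num/segint_integrable.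
have cos0 : segint cos 0 (pi *+ 2) = 0 :> R.
  have H : forall z : R[i], cabs z <= 1 -> cdiff_at id z.
    move=> z _; exists 1 => e' e'0; exists 1 => // w _.
    by have -> : z + w - z - 1 * w = 0 by [ring]; rewrite cabs0 mulr_ge0 // ltW.
  have := @mean_value_circle R id 1 ltr01 H; rewrite cre0 mulr0; apply: eq_trans.
  by apply: eq_segint => t _; rewrite creM cre_real cim_real mul0r subr0 mul1r.
rewrite /G (segintB _ _ (cst _) ccos) segint_cst ?(ltW pi0) // (segintZ _ _ _ (@continuous_cos R)).
rewrite cos0 mulr0 !subr0 lte_fin mulrC ltr_pM2l //.
have s0in : 0 <= s0 <= s2 by lra.
rewrite /F clE //.
have : 0 < b * e ^+ 2 by rewrite mulr_gt0 // exprn_gt0.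
lra.
Qed.

End Truncated.

Lemma truncated_integral_le d s1 s2 : 0 < d -> 0 <= s1 -> s1 <= s2 -> s2 <= S ->
  (\int[V]_(w in Om) (truncated_pow f p d (c + s1%:C%C *: (w : Cn R n)))%:E <=
   \int[V]_(w in Om) (truncated_pow f p d (c + s2%:C%C *: (w : Cn R n)))%:E)%E.
Proof.
move=> d0 s10 s12 s2S.
pose h : T -> R := (truncated_pow f p d : T -> R) \_ (@ball_n R n : set T).
have h0 z : 0 <= h z by rewrite /h patchE; case: ifP => // _; exact: truncated_pow_ge0.
have hE (z : Cn R n) : cnorm z < 1 -> h z = truncated_pow f p d z.
  by move=> z1; rewrite /h patchE mem_set.
have mh : measurable_fun setT h.
  apply/measurable_restrict => //; first exact: measurable_ball.
  rewrite setTI; apply: ccontinuous_measurable; first exact: copen_ball.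
  by move=> z zb; exact: ccontinuous_truncated_pow.
pose I0 s := (\int[V]_(w in Om) (h (c + s%:C%C *: (w : Cn R n))%R)%:E)%E.
have E s : 0 <= s <= S ->
    (\int[V]_(w in Om) (truncated_pow f p d (c + s%:C%C *: (w : Cn R n)))%:E = I0 s)%E.
  move=> /andP[s0 sS]; apply: eq_integral => w; rewrite inE => Ow.
  rewrite hE //; apply: le_lt_trans r1; apply: Om_in => //.
  by rewrite cabs_real ger0_norm.
have NE s : 0 <= s <= S -> I0 s = (fine (I0 s))%:E.
  move=> /andP[s0 sS]; apply/esym/fineK; rewrite ge0_fin_numE; last first.
    by apply: integral_ge0 => w _; rewrite lee_fin h0.
  apply: (truncated_integral_fin d0 h0 hE mh).
  by rewrite cabs_real ger0_norm.
have S1 : 0 <= s1 <= S by rewrite s10 (le_trans s12).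
have S2 : 0 <= s2 <= S by rewrite s2S (le_trans s10).
suff H : (I0 s1 <= I0 s2)%E.
  by apply: (le_trans _ (le_trans H _)); rewrite le_eqVlt; apply/orP; left; apply/eqP;
    [exact: E | exact/esym/E].
rewrite (NE _ S1) (NE _ S2) lee_fin.
exact: (truncated_mean_le d0 h0 hE mh NE s10 s12 s2S).
Qed.

Let m_pow s : 0 <= s <= S -> measurable_fun Om
    (fun w : T => (cabs (f (c + s%:C%C *: (w : Cn R n))) `^ p)%:E).
Proof.
move=> /andP[s0 sS].
pose h : T -> R := (fun z : T => cabs (f z)) \_ (@ball_n R n : set T).
have mh : measurable_fun setT h.
  apply/measurable_restrict => //; first exact: measurable_ball.
  rewrite setTI; apply: ccontinuous_measurable; first exact: copen_ball.
  by move=> z zb; exact: ccontinuous_cabs.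
apply/measurable_EFinP.
apply: (eq_measurable_fun (fun w : T => h ((s%:C%C *: (w : Cn R n)) + c) `^ p)).
  move=> w; rewrite inE => Ow; rewrite /h patchE mem_set; first by rewrite addrC.
  apply: le_lt_trans r1; rewrite addrC; apply: Om_in => //.
  by rewrite cabs_real ger0_norm.
apply: measurable_funTS; apply: (measurableT_comp (measurable_powR p)).
apply: (measurableT_comp mh).
exact: measurableT_comp (measurable_translate c) (measurable_scale s%:C%C).
Qed.

(** The truncation level is sent to 0. Two uses follow: on the sphere this is the monotonicity of
    the spherical means, and with [s1 = 0] it is the sub-mean value inequality over the translate of
    [Om] by [c]. *)
Lemma rotation_mean_le s1 s2 : 0 <= s1 -> s1 <= s2 -> s2 <= S ->
  (\int[V]_(w in Om) (cabs (f (c + s1%:C%C *: (w : Cn R n))) `^ p)%:E <=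
   \int[V]_(w in Om) (cabs (f (c + s2%:C%C *: (w : Cn R n))) `^ p)%:E)%E.
Proof.
move=> s10 s12 s2S.
have S1 : 0 <= s1 <= S by rewrite s10 (le_trans s12).
have S2 : 0 <= s2 <= S by rewrite s2S (le_trans s10).
apply/lee_addgt0Pr => e e0.
have v1 : 0 < v + 1 by rewrite ltr_wpDl.
(* Truncating at [d] adds at most d^p to the integrand, hence at most [e] to an integral over a set
   of measure [v]. *)
pose d := (e / (v + 1)) `^ p^-1.
have d0 : 0 < d by rewrite powR_gt0 // divr_gt0.
have dp : d `^ p = e / (v + 1).
  by rewrite /d -powRrM mulVf ?gt_eqF // powRr1 // divr_ge0 // ltW.
have m_tr s : 0 <= s <= S -> measurable_fun Om
    (fun w : T => (truncated_pow f p d (c + s%:C%C *: (w : Cn R n)))%:E).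
  move=> sS; apply/measurable_EFinP.
  apply: (eq_measurable_fun (fun w : T =>
     Num.max (cabs (f (c + s%:C%C *: (w : Cn R n))) `^ p) (d `^ p))).
    move=> w _; rewrite /truncated_pow.
    by case: (leP _ d) => h; [rewrite max_r | rewrite max_l] => //;
      apply: powR_le => //; exact: ltW.
  by apply: measurable_maxr => //; apply/measurable_EFinP; exact: m_pow.
apply: (@le_trans _ _ (\int[V]_(w in Om) (truncated_pow f p d (c + s1%:C%C *: (w : Cn R n)))%:E)%E).
  apply: ge0_le_integral => //; [by move=> w _; rewrite lee_fin powR_ge0| exact: m_pow | exact: m_tr |].
  move=> w _; rewrite lee_fin; apply: powR_le; [exact: ltW | exact: cabs_ge0|].
  by rewrite le_max lexx.
apply: (le_trans (truncated_integral_le d0 s10 s12 s2S)).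
apply: (@le_trans _ _ (\int[V]_(w in Om)
   ((cabs (f (c + s2%:C%C *: (w : Cn R n))) `^ p)%:E + (d `^ p)%:E))%E).
  apply: ge0_le_integral => //.
  - by move=> w _; rewrite lee_fin truncated_pow_ge0.
  - exact: m_tr.
  - by apply: emeasurable_funD; [exact: m_pow | exact: measurable_cst].
  - move=> w _; rewrite -EFinD lee_fin /truncated_pow.
    move: (cabs (f _)) => y; have := powR_ge0 y p; have := powR_ge0 d p.
    by case: (leP y d) => _; lra.
rewrite ge0_integralD //; last 2 first.
- exact: m_pow.
- by move=> w _; rewrite lee_fin powR_ge0.
rewrite leeD2l // integral_cst // vE -EFinM lee_fin dp mulrAC ler_pdivrMr //.
by rewrite ler_pM2l // lerDl.
by move=> w _; rewrite lee_fin powR_ge0.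
Qed.

End RotationMeans.

(** * Polar coordinates *)

Section UnitaryMaps.
Variables (R : realType) (n : nat).

Let T := CnM R n.

Lemma isometry_measurable (U : Cn R n -> Cn R n) :
  (forall z w, cnorm (U z - U w) = cnorm (z - w)) -> measurable_fun setT (U : T -> T).
Proof.
move=> Ui; have oT : copen (setT : set (Cn R n)) by move=> z _; exists 1.
have C (f : R[i] -> R) (j : 'I_n) : (forall x y, `|f x - f y| <= cabs (x - y)) ->
    measurable_fun setT (fun z : T => f (U z 0 j)).
  move=> fl; apply: (ccontinuous_measurable oT) => z _ e e0; exists e => // w.
  rewrite -Ui; apply: le_lt_trans; apply: (le_trans (fl _ _)).
  by have := cabs_coord_le (U w - U z) j; rewrite !mxE.
apply: measurable_CnP => j; apply: C => x y.
  by rewrite -creN -creE; exact: cre_le_cabs.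
by rewrite -cimN -cimE; exact: cim_le_cabs.
Qed.

(* For a <> 0 this is the Householder reflection exchanging a and a unimodular multiple of
   |a| e_j, the multiple being chosen so that <a, b> is real. *)
Lemma householder (a : Cn R n) (j : 'I_n) : exists (U : Cn R n -> Cn R n) (k : R[i]),
  [/\ forall z h, U (z + h) = U z + U h, cancel U U,
      forall z, cnorm (U z) = cnorm z, cabs k = cnorm a &
      forall z, cinner z a = k * U z 0 j].
Proof.
pose alpha := a 0 j.
pose t := if alpha == 0 then 1 else alpha / (cabs alpha)%:C%C : R[i].
have t1 : cabs t = 1.
  rewrite /t; case: eqVneq => [_|h]; first by rewrite cabs1.
  by rewrite cabsM cabsV cabs_real ger0_norm // mulfV // cabs_eq0.
have ta : conjc t * alpha = (cabs alpha)%:C%C.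
  rewrite /t; case: eqVneq => [->|h]; first by rewrite cabs0 mulr0.
  have ha : (cabs alpha)%:C%C != 0 :> R[i] by rewrite -cabs_gt0 cabs_real gtr0_norm cabs_gt0.
  rewrite -realcV conjcM conjc_real realcV mulrAC [conjc alpha * _]mulrC conjc_mul.
  by rewrite expr2 realcM mulfK.
pose m := cnorm a.
pose b : Cn R n := (m%:C%C * t) *: delta_mx 0 j.
have zb z : cinner z b = conjc (m%:C%C * t) * z 0 j.
  rewrite /b cinnerZr; congr (_ * _); rewrite /cinner (bigD1 j) //= mxE !eqxx conjc_one mulr1.
  by rewrite big1 ?addr0 // => i /negPf ij; rewrite mxE ij andbF conjc0 mulr0.
have kE : cabs (conjc (m%:C%C * t)) = cnorm a.
  by rewrite cabs_conjc cabsM t1 mulr1 cabs_real ger0_norm // cnorm_ge0.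
have [h0|h0] := eqVneq (a - b) 0.
  exists id, (conjc (m%:C%C * t)); split => // z.
  by rewrite -zb; move/eqP: h0; rewrite subr_eq0 => /eqP <-.
pose h := a - b; pose N := cnorm h ^+ 2.
have N0 : (N%:C%C : R[i]) != 0.
  by rewrite -cabs_gt0 cabs_real gtr0_norm // exprn_gt0 // cnorm_gt0.
have hh : cinner h h = N%:C%C by rewrite cinner_self.
have ab : cinner a b = (m * cabs alpha)%:C%C.
  by rewrite zb conjcM conjc_real -mulrA ta realcM.
have ba : cinner b a = (m * cabs alpha)%:C%C by rewrite cinnerC ab conjc_real.
have bb : cinner b b = cinner a a.
  by rewrite !cinner_self /b cnormZ cnorm_delta mulr1 cabsM t1 mulr1 cabs_real ger0_norm // cnorm_ge0.
have key : 2 * cinner h a = N%:C%C.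
  by rewrite -hh /h cinnerBl !cinnerBr !cinnerBl ab ba bb; ring.
pose U z := z - (2 * cinner z h / N%:C%C) *: h.
have Nc : conjc (N%:C%C : R[i]) = N%:C%C by rewrite conjc_real.
exists U, (conjc (m%:C%C * t)); split=> //.
- move=> z w; rewrite /U cinnerDl mulrDr mulrDl scalerDl opprD addrACA //.
- move=> z; rewrite {1}/U {2}/U cinnerBl cinnerZl hh divfK //.
  rewrite /U -addrA -opprD -scalerDl -mulrDl -mulrDr.
  have -> : cinner z h + (cinner z h - 2 * cinner z h) = 0 by ring.
  by rewrite mulr0 mul0r scale0r subr0.
- move=> z; have E (c : R[i]) (g : Cn R n) : cinner (z - c *: g) (z - c *: g) =
      cinner z z - conjc c * cinner z g - c * conjc (cinner z g) + c * conjc c * cinner g g.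
    by rewrite -cinnerC cinnerBl !cinnerBr !cinnerZl !cinnerZr; ring.
  have : cinner (U z) (U z) = cinner z z.
    rewrite /U E hh; move: (cinner z h) => x.
    have -> : conjc (2 * x / N%:C%C) = 2 * conjc x / N%:C%C.
      by rewrite !conjcM -realcV conjc_real realcV [X in X * _ / _]conjcD conjc_one.
    by field.
  by rewrite !cinner_self => /complexI /eqP; rewrite eqrXn2 // => /eqP.
- move=> z; rewrite -zb /U.
  have -> : b = a - h by rewrite /h opprB addrC subrK.
  have E (c : R[i]) (g : Cn R n) : cinner (z - c *: g) (a - g) =
      cinner z a - cinner z g - c * (cinner g a - cinner g g).
    by rewrite cinnerBr !cinnerBl !cinnerZl; ring.
  rewrite E hh; have -> : cinner h a = N%:C%C / 2 by rewrite -key mulrC mulKf // pnatr_eq0.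
  by field.
Qed.

End UnitaryMaps.

(** * Volumes of Koranyi regions and non-isotropic neighbourhoods *)

Section SlabVolumes.
Variables (R : realType) (n : nat) (V : {measure set (CnM R n) -> \bar R}).
Hypotheses (HV : normalized_volume V) (n0 : (0 < n)%N).

Let T := CnM R n.

Definition cbox (j : 'I_n) (c : R[i]) (s t : R) : set T :=
  let h i := if i == j then s else t in
  let x i := if i == j then cre c else 0 in
  let y i := if i == j then cim c else 0 in
  box (fun i => x i - h i) (fun i => x i + h i) (fun i => y i - h i) (fun i => y i + h i).

Lemma volume_cbox : exists2 m : R, 0 < m & forall j c s t, 0 <= s -> 0 <= t ->
  V (cbox j c s t) = (m * (s ^+ 2 * (t ^+ 2) ^+ n.-1))%:E.
Proof.
have [[m [m0 Vm]] _] := HV.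
exists (4 ^+ n * m); first by rewrite mulr_gt0 // exprn_gt0.
move=> j c s t s0 t0; rewrite Vm; last by move=> i; case: eqP => _; split; lra.
congr EFin; rewrite [4 ^+ n * m]mulrC -mulrA; congr (_ * _).
rewrite (bigD1 j) //= eqxx (eq_bigr (fun=> 4 * t ^+ 2)); last first.
  by move=> i /negPf ->; ring.
have -> : (4 : R) ^+ n = 4 * 4 ^+ n.-1 by rewrite -exprS prednK.
by rewrite prodr_const cardC1 card_ord (exprMn _ 4); ring.
Qed.

Lemma cbox_measurable j c s t : measurable (cbox j c s t).
Proof. exact: box_measurable. Qed.

Lemma cball_measurable (r : R) : measurable [set z : T | cnorm (z : Cn R n) < r].
Proof.
apply: copen_measurable => z /= zr; exists (r - cnorm z); first by rewrite subr_gt0.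
by move=> w wz; have := cnormD (w - z) z; rewrite subrK; move: wz; lra.
Qed.

Lemma volume_isometry_preimage (U : Cn R n -> Cn R n) A :
  (forall z h, U (z + h) = U z + U h) -> cancel U U -> (forall z, cnorm (U z) = cnorm z) ->
  measurable A -> measurable ((U : T -> T) @^-1` A) /\ V ((U : T -> T) @^-1` A) = V A.
Proof.
move=> UD UK Un mA.
have mU : measurable_fun setT (U : T -> T).
  apply: isometry_measurable => z w; rewrite -[in RHS]Un; congr cnorm.
  by apply/eqP; rewrite subr_eq -UD subrK.
split; first by rewrite -[X in measurable X]setTI; exact: mU.
exact: (volume_isometry HV mU UD UK Un).
Qed.

Definition koranyi (a : Cn R n) (t : R) : set T :=
  [set z : T | cnorm (z : Cn R n) < 1 /\ cabs (1 - cinner (z : Cn R n) a) < t].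

Lemma measurable_cinner_lt a (c : R[i]) (t : R) :
  measurable [set z : T | cabs (c - cinner (z : Cn R n) a) < t].
Proof.
apply: copen_measurable => z /= zt.
exists ((t - cabs (c - cinner z a)) / (cnorm a + 1)).
  by rewrite divr_gt0 ?subr_gt0 // ltr_wpDl // cnorm_ge0.
have A1 : 0 < cnorm a + 1 by rewrite ltr_wpDl // cnorm_ge0.
move=> w; rewrite ltr_pdivlMr // => wz.
have -> : c - cinner w a = (c - cinner z a) + cinner (z - w) a by rewrite cinnerBl; ring.
apply: (le_lt_trans (cabsD _ _)).
have := cauchy_schwarz (z - w) a; rewrite (cnormB_sym z w) => h.
have := cnorm_ge0 (w - z); move: wz h; nra.
Qed.

Lemma koranyi_measurable a t : measurable (koranyi a t).
Proof. by apply: measurableI; [exact: cball_measurable | exact: measurable_cinner_lt]. Qed.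

(** After a Householder reflection, <z,a> is a multiple of one coordinate, which then lies within 2t
    of 1/k. That coordinate has modulus above 1 - t while |z| < 1, so the others are of order
    sqrt(t). The volume is at most of order t^2 t^(n-1). *)
Lemma volume_koranyi_le : exists2 C : R, 0 < C & forall a t, cnorm a < 1 -> 0 < t ->
  (V (koranyi a t) <= (C * t ^+ n.+1)%:E)%E.
Proof.
have [m m0 Vm] := volume_cbox; pose j := Ordinal n0.
exists (Num.max (4 ^+ n.+1) (m * 4 ^+ n.+1)); first by rewrite lt_max exprn_gt0.
move=> a t a1 t0; have tn : 0 < t ^+ n.+1 by rewrite exprn_gt0.
(* For t >= 1/4 the volume 1 of the whole ball is good enough, with constant 4^(n+1). Smaller [t]
   forces |a| > 3/4 as soon as the region is nonempty, which makes division by [k] safe. *)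
have [t4|t4] := leP (4^-1) t.
  apply: (@le_trans _ _ 1%E).
    have [_ <-] := HV; apply: le_measure; rewrite ?inE; [exact: koranyi_measurable|exact: measurable_ball|].
    by move=> z [].
  rewrite lee_fin; apply: (@le_trans _ _ (4 ^+ n.+1 * t ^+ n.+1)).
    by rewrite -exprMn exprn_ege1 // -ler_pdivrMl // mulr1.
  by rewrite ler_pM2r // le_max lexx.
have [U [k [UD UK Un ka Uk]]] := householder a j.
have [[z0 Kz0]|K0] := pselect (exists z, koranyi a t z); last first.
  rewrite (_ : koranyi a t = set0) ?measure0 ?lee_fin ?mulr_ge0 ?ltW ?lt_max ?exprn_gt0 //.
  by apply/seteqP; split=> z // Kz; case: K0; exists z.
have ip z : koranyi a t z -> 1 - t < cabs (cinner (z : Cn R n) a).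
  by move=> [_ h]; have := ler_cabsB 1 (cinner (z : Cn R n) a); rewrite cabs1; lra.
have a34 : 3 / 4 < cnorm a.
  have := ip _ Kz0; have := cauchy_schwarz (z0 : Cn R n) a; have := Kz0.1.
  by have := cnorm_ge0 (z0 : Cn R n); have := cnorm_ge0 a; nra.
have k0 : k != 0 by rewrite -cabs_gt0 ka; lra.
pose s := Num.sqrt (4 * t).
have s0 : 0 < s by rewrite sqrtr_gt0 mulr_gt0.
have ss : s ^+ 2 = 4 * t by rewrite sqr_sqrtr // mulr_ge0 // ltW.
have [mU VU] := volume_isometry_preimage UD UK Un (cbox_measurable j k^-1 (2 * t) s).
apply: (@le_trans _ _ (V (cbox j k^-1 (2 * t) s))); last first.
  rewrite Vm ?mulr_ge0 ?(ltW t0) ?(ltW s0) // lee_fin ss.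
  have -> : m * ((2 * t) ^+ 2 * (4 * t) ^+ n.-1) = (m * 4 ^+ n) * t ^+ n.+1.
    rewrite -(prednK n0) /= !exprMn !exprS; ring.
  rewrite ler_pM2r // le_max; apply/orP; right.
  by rewrite ler_pM2l // exprS ler_peMl ?exprn_ge0 //; lra.
rewrite -VU; apply: le_measure; rewrite ?inE //; first exact: koranyi_measurable.
move=> z Kz /= i.
have bnd (x : R[i]) (y : R) : cabs x < y -> (- y <= cre x < y) /\ (- y <= cim x < y).
  move=> xy; have := cre_le_cabs x; have := cim_le_cabs x; rewrite !ler_norml; lra.
case: eqVneq => [->|ij].
  have H : cabs (U z 0 j - k^-1) < 2 * t.
    have ck : 0 < cabs k by rewrite cabs_gt0.
    rewrite -(ltr_pM2l ck) -cabsM mulrBr divff // -Uk cabsB_sym.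
    apply: (lt_trans Kz.2); rewrite ka; nra.
  have := bnd _ _ H; rewrite creE cimE creN cimN; lra.
suff H : cabs (U z 0 i) < s by have := bnd _ _ H; lra.
rewrite ltNge; apply/negP => H.
have : cnorm (U z) ^+ 2 < 1.
  by rewrite Un; have := Kz.1; have := cnorm_ge0 (z : Cn R n); nra.
rewrite cnorm_sq (bigD1 j) //= (bigD1 i) //=.
have S0 : 0 <= \sum_(i0 < n | (i0 != j) && (i0 != i)) cabs (U z 0 i0) ^+ 2.
  by apply: sumr_ge0 => ? _; exact: sqr_ge0.
have H2 : s ^+ 2 <= cabs (U z 0 i) ^+ 2 by have := ltW s0; nra.
have H3 : 1 - t < cabs (U z 0 j).
  have := ip _ Kz; rewrite Uk cabsM ka; have := cabs_ge0 (U z 0 j); nra.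
have H4 : (1 - t) ^+ 2 < cabs (U z 0 j) ^+ 2 by nra.
have := sqr_ge0 t; lra.
Qed.

(** The shape of a pseudohyperbolic ball around [a], moved to the origin: size [d] in the direction
    of [a] and sqrt(d) in the complex orthogonal directions. It is stable under multiplication by
    scalars of modulus at most 1, as the means over rotation-invariant sets require. *)
Definition small_polydisc (a : Cn R n) (d : R) : set T :=
  [set w : T | cnorm (w : Cn R n) ^+ 2 < d /\ cabs (cinner (w : Cn R n) a) < d].

Lemma small_polydisc_measurable a d : 0 <= d -> measurable (small_polydisc a d).
Proof.
move=> d0; rewrite (_ : small_polydisc a d = [set z : T | cnorm (z : Cn R n) < Num.sqrt d] `&`
   [set z : T | cabs (0 - cinner (z : Cn R n) a) < d]).
  by apply: measurableI; [exact: cball_measurable | exact: measurable_cinner_lt].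
have E (z : Cn R n) : (cnorm z ^+ 2 < d) = (cnorm z < Num.sqrt d).
  by rewrite -{1}(sqr_sqrtr d0) ltr_pXn2r ?nnegrE ?sqrtr_ge0 ?cnorm_ge0.
by apply/seteqP; split=> z; rewrite /small_polydisc /= E add0r cabsN.
Qed.

Lemma volume_small_polydisc_ge : exists2 C : R, 0 < C & forall a d, cnorm a < 1 ->
  0 < d <= 1 -> ((C * d ^+ n.+1)%:E <= V (small_polydisc a d))%E.
Proof.
have [m m0 Vm] := volume_cbox; pose j := Ordinal n0.
have nR : (0 : R) < n%:R by rewrite ltr0n.
exists (m * (4 * n%:R) ^- n.+1); first by rewrite mulr_gt0 // invr_gt0 exprn_gt0 // mulr_gt0.
move=> a d a1 /andP[d0 d1].
have [U [k [UD UK Un ka Uk]]] := householder a j.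
(* Each of the [n] coordinates contributes at most 2x to |w|^2, in total d / 2. *)
pose x := d / (4 * n%:R).
have x0 : 0 < x by rewrite divr_gt0 // mulr_gt0.
have x1 : x <= d / 4.
  by rewrite /x ler_pM2l // lef_pV2 ?posrE ?mulr_gt0 // ler_pMr // ler1n.
pose s := Num.sqrt x.
have s0 : 0 <= s := sqrtr_ge0 _.
have ss : s ^+ 2 = x by rewrite sqr_sqrtr // ltW.
have [mU VU] := volume_isometry_preimage UD UK Un (cbox_measurable j 0 x s).
apply: (@le_trans _ _ (V (cbox j 0 x s))).
  rewrite Vm ?(ltW x0) // lee_fin ss le_eqVlt; apply/orP; left; apply/eqP.
  rewrite -exprD addnC addn2 prednK // /x expr_div_n; ring.
rewrite -VU; apply: le_measure; rewrite ?inE //; first exact: small_polydisc_measurable (ltW d0).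
move=> w /= H.
have Hj : cabs (U w 0 j) <= 2 * x.
  have := H j; rewrite eqxx !cre0 !cim0 !add0r => -[/andP[h1 h2] /andP[h3 h4]].
  apply: (le_trans (cabs_le_reim _)); rewrite mulrDl mul1r; apply: lerD; rewrite ler_norml; lra.
have Hi i : cabs (U w 0 i) ^+ 2 <= 2 * x.
  have S (y e : R) : - e <= y -> y < e -> y ^+ 2 <= e ^+ 2 by nra.
  rewrite cabs_sq; have := H i; case: eqVneq => [_|_]; rewrite ?cre0 ?cim0 !add0r
    => -[/andP[/S h1 /h1 h2] /andP[/S h3 /h3 h4]]; last by rewrite ss in h2 h4; lra.
  have : x ^+ 2 <= x by nra.
  lra.
split; last by rewrite Uk cabsM ka; have := cabs_ge0 (U w 0 j); have := cnorm_ge0 a; nra.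
rewrite -Un cnorm_sq; apply: (@le_lt_trans _ _ (\sum_(i < n) (2 * x))).
  by apply: ler_sum => i _; exact: Hi.
rewrite sumr_const card_ord -[_ *+ n]mulr_natr.
have -> : 2 * x * n%:R = d / 2 by rewrite /x; field; rewrite gt_eqF.
lra.
Qed.

End SlabVolumes.

Lemma restriction_measureP d (T : measurableType d) (R : realType)
    (m : {measure set T -> \bar R}) (S : set T) : measurable S ->
  exists W : {measure set T -> \bar R}, (forall A, measurable A -> W A = m (A `&` S)) /\
    forall g : T -> \bar R, measurable_fun setT g -> (forall x, 0 <= g x)%E ->
      (\int[W]_x g x = \int[m]_(x in S) g x)%E.
Proof.
move=> mS; have mC : measurable (~` S) by exact: measurableC.
unshelve eexists; first exact: (mrestr m mS).
split=> // g mg g0.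
have gS0 x : (0 <= (g \_ S) x)%E by rewrite patchE; case: ifP.
have mgS : measurable_fun setT (g \_ S).
  by apply/measurable_restrict => //; rewrite setTI; exact: measurable_funTS.
have E : (\int[m]_x (g \_ S) x = \int[measure_add (mrestr m mS) (mrestr m mC)]_x (g \_ S) x)%E.
  apply: eq_measure_ge0_integral => // A mA.
  rewrite /= /msum 2!big_ord_recr big_ord0 /= add0e /mrestr -measureU ?setIUr ?setUCr -?setIUr ?setUv ?setIT //.
  - exact: measurableI.
  - exact: measurableI.
  - by rewrite setIACA setICr setI0.
rewrite [RHS]integral_mkcond E ge0_integral_measure_add //.
rewrite [X in (_ = _ + X)%E](_ : _ = 0%E) ?adde0; last first.
  rewrite (@ge0_negligible_integral _ _ _ _ _ S) //; last by rewrite /= /mrestr setICr measure0.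
  by rewrite integral0_eq // => x [_ xS]; rewrite patchE memNset.
rewrite -integral_mkcond (@ge0_negligible_integral _ _ _ _ _ (~` S)) //.
  by rewrite setDE setTI setCK.
by rewrite /= /mrestr setICl measure0.
Qed.

Lemma lebesgue_measure_oc (R : realType) (x y : R) :
  lebesgue_measure (`]x, y]%classic : set R) = (if x < y then y - x else 0)%:E.
Proof. by rewrite lebesgue_measure_itv /= lte_fin; case: ifP => // _; rewrite EFinB. Qed.

(** * Integration over radii and directions *)

Section PolarCoordinates.
Variables (R : realType) (n : nat) (V : {measure set (CnM R n) -> \bar R}).
Hypotheses (HV : normalized_volume V) (n0 : (0 < n)%N).

Let T := CnM R n.

Lemma integral_scale (g : R -> \bar R) (c : R) : 0 < c ->
  measurable_fun setT g -> (forall x, 0 <= g x)%E ->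
  (\int[lebesgue_measure]_x g (c * x)%R = c^-1%:E * \int[lebesgue_measure]_x g x)%E.
Proof.
move=> c0 mg g0; have ci : 0 <= c^-1 by rewrite invr_ge0 ltW.
have mc : measurable_fun setT (fun x : measurableTypeR R => c * x : measurableTypeR R).
  by apply: measurable_funM.
have [W [WE WI]] := pushforward_measureP (@lebesgue_measure R) mc.
rewrite -(WI g mg g0).
have ci' : 0 <= c by exact: ltW.
have H : forall A, measurable A -> (lebesgue_measure A = mscale (NngNum ci') W A)%E.
  apply: lebesgue_measure_unique => X [[a b] _ <-] /=.
  rewrite /mscale /= WE (_ : _ @^-1` _ = `]c^-1 * a, c^-1 * b]%classic); last first.
    by apply/seteqP; split=> x /=; rewrite !in_itv /= ltr_pdivrMl // ler_pdivlMl.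
  rewrite [LHS]lebesgue_measure_oc [X in (_ * X)%E]lebesgue_measure_oc ltr_pM2l ?invr_gt0 //.
  case: ifP => _; last by rewrite mule0.
  by rewrite -EFinM; congr EFin; field; rewrite gt_eqF.
rewrite (eq_measure_ge0_integral H mg g0) (@ge0_integral_mscale _ _ _ W setT measurableT (NngNum ci')) //=.
by rewrite muleA -EFinM mulVf ?gt_eqF // mul1e.
Qed.

Definition direction (z : Cn R n) : Cn R n := ((cnorm z)^-1)%:C%C *: z.

Lemma measurable_cnormV : measurable_fun setT (fun z : T => (cnorm (z : Cn R n))^-1).
Proof.
apply: (eq_measurable_fun (fun z : T => cnorm (z : Cn R n) `^ (-1))).
  by move=> z _; rewrite powR_inv1 // cnorm_ge0.
exact: (measurableT_comp (measurable_powR (-1)) (@measurable_cnorm R n)).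
Qed.

Lemma measurable_scale2 d (X : measurableType d) (a : X -> R) (F : X -> T) :
  measurable_fun setT a -> measurable_fun setT F ->
  measurable_fun setT (fun x => (a x)%:C%C *: (F x : Cn R n) : T).
Proof.
move=> ma mF; apply: measurable_CnP => j.
  apply: (eq_measurable_fun (fun x => a x * cre (F x 0 j))).
    by move=> x _; rewrite mxE creM cre_real cim_real mul0r subr0.
  by apply: measurable_funM => //; exact: (measurableT_comp (@measurable_cre R n j) mF).
apply: (eq_measurable_fun (fun x => a x * cim (F x 0 j))).
  by move=> x _; rewrite mxE cimM cre_real cim_real mul0r addr0.
by apply: measurable_funM => //; exact: (measurableT_comp (@measurable_cim R n j) mF).
Qed.

Lemma measurable_direction : measurable_fun setT (direction : T -> T).
Proof. by apply: measurable_scale2; [exact: measurable_cnormV | exact: measurable_id]. Qed.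

Definition shell : set T := [set z : T | 1 / 2 <= cnorm (z : Cn R n) < 1].

Lemma measurable_shell : measurable shell.
Proof.
have mc := @measurable_cnorm R n.
rewrite (_ : shell = (fun z : T => cnorm (z : Cn R n)) @^-1` `[1 / 2, 1[%classic).
  by rewrite -[X in measurable X]setTI; exact: mc.
by apply/seteqP; split=> z; rewrite /shell /= in_itv.
Qed.

Lemma cnorm_direction z : z != 0 -> cnorm (direction z) = 1.
Proof.
move=> z0; have nz : cnorm z != 0 by rewrite cnorm_eq0.
by rewrite /direction cnormZ cabs_real ger0_norm ?invr_ge0 ?cnorm_ge0 // mulVf.
Qed.

Lemma shell_neq0 z : shell z -> z != 0.
Proof. by move=> /andP[h _]; rewrite -cnorm_gt0; lra. Qed.

Lemma volume_shell_fin : (V shell < +oo)%E.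
Proof.
apply: (@le_lt_trans _ _ (V (@ball_n R n : set T))); last by have [_ ->] := HV; rewrite ltry.
apply: le_measure; rewrite ?inE; [exact: measurable_shell | exact: measurable_ball|].
by move=> z /andP[].
Qed.

(* The surface measure of the unit sphere, realized up to a density bounded above and
   below as the image of the volume of a shell. *)
Lemma sphere_measureP : exists W : {measure set T -> \bar R},
  [/\ sigma_finite setT W, (W setT < +oo)%E,
   forall (g : T -> \bar R) (u : R[i]), measurable_fun setT g -> (forall z, 0 <= g z)%E ->
     cabs u = 1 -> (\int[W]_z g (u *: (z : Cn R n))%R = \int[W]_z g z)%E &
   forall g : T -> \bar R, measurable_fun setT g -> (forall z, 0 <= g z)%E ->
     (\int[W]_z g z = \int[V]_(z in shell) g (direction z))%E].
Proof.
have mS := measurable_shell.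
have [W1 [W1E W1I]] := restriction_measureP V mS.
have [W [WE WI]] := pushforward_measureP W1 measurable_direction.
have WT : (W setT < +oo)%E by rewrite WE preimage_setT W1E // setTI volume_shell_fin.
have WP (g : T -> \bar R) : measurable_fun setT g -> (forall z, 0 <= g z)%E ->
    (\int[W]_z g z = \int[V]_(z in shell) g (direction z))%E.
  move=> mg g0; rewrite WI // W1I //.
  exact: measurableT_comp mg measurable_direction.
exists W; split=> //; first by exists (fun=> setT); [rewrite bigcup_const //; exists 0%N | move=> _; split].
move=> g u mg g0 u1; rewrite (WP g) // (WP (fun z => g (u *: (z : Cn R n)))) //; last first.
  exact: measurableT_comp mg (measurable_scale u).
pose h := (fun z : T => g (direction z)) \_ shell.
have mh : measurable_fun setT h.
  apply/measurable_restrict => //; rewrite setTI; apply: measurable_funTS.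
  exact: measurableT_comp mg measurable_direction.
have h0 z : (0 <= h z)%E by rewrite /h patchE; case: ifP.
rewrite [RHS]integral_mkcond -/h -(integral_rotate HV mh h0 u1) integral_mkcond.
apply: eq_integral => z _; rewrite /h !patchE.
have -> : (u *: (z : Cn R n) \in shell) = (z \in shell).
  have E : shell (u *: (z : Cn R n)) <-> shell z by rewrite /shell /= cnormZ u1 (mul1r (cnorm _)).
  by apply/idP/idP => /set_mem/E/mem_set.
by rewrite /direction cnormZ u1 mul1r !scalerA mulrC.
Qed.

Section Polar.
Variable k : T -> R.
Hypotheses (mk : measurable_fun setT k) (k0 : forall z, 0 <= k z).

Let kB (z : T) := if cnorm (z : Cn R n) < 1 then k z else 0.

Let kB0 z : 0 <= kB z. Proof. by rewrite /kB; case: ifP. Qed.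

Let mcn : measurable_fun setT (fun z : T => cnorm (z : Cn R n)).
Proof. exact: measurable_cnorm. Qed.

Let mkB : measurable_fun setT kB.
Proof.
apply: measurable_fun_ifT => //.
by apply: measurable_fun_ltr => //; exact: measurable_cst.
Qed.

Let scl (x : R * T) : T := x.1%:C%C *: (x.2 : Cn R n).

Let m_scl : measurable_fun setT scl.
Proof. by apply: measurable_scale2; [exact: measurable_fst | exact: measurable_snd]. Qed.

Let mn1 : measurable_fun setT (fun x : R * T => cnorm (x.2 : Cn R n)).
Proof. exact: measurableT_comp mcn measurable_snd. Qed.

Let mn2 : measurable_fun setT (fun x : R * T => (cnorm (x.2 : Cn R n))^-1).
Proof. exact: measurableT_comp measurable_cnormV measurable_snd. Qed.

(** For fixed z different from 0, the admissible radii s form the interval ]|z|, 2|z|], of length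
    |z|, so that integrating [F] over s returns [kB]. The dilation by s turns the constraint into
    membership of z in [shell]. *)
Let F (x : R * T) : R := if (cnorm (x.2 : Cn R n) < x.1) && (x.1 <= 2 * cnorm (x.2 : Cn R n))
  then kB x.2 * (cnorm (x.2 : Cn R n))^-1 else 0.

Let mF : measurable_fun setT (EFin \o F).
Proof.
apply/measurable_EFinP; apply: measurable_fun_ifT => //.
- apply: measurable_and.
    by apply: measurable_fun_ltr => //; exact: measurable_fst.
  apply: measurable_fun_ler; first exact: measurable_fst.
  by apply: measurable_funM => //; exact: measurable_cst.
- by apply: measurable_funM => //; exact: measurableT_comp mkB measurable_snd.
Qed.

Let F0 x : (0 <= (EFin \o F) x)%E.
Proof. by rewrite /F lee_fin; case: ifP => // _; rewrite mulr_ge0 // invr_ge0 cnorm_ge0. Qed.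

Let G (x : R * T) : R := if (0 < x.1) && (1 / 2 <= cnorm (x.2 : Cn R n) < 1)
  then x.1 ^+ (2 * n).-1 * (cnorm (x.2 : Cn R n))^-1 * kB (scl x) else 0.

Let mG : measurable_fun setT (EFin \o G).
Proof.
apply/measurable_EFinP; apply: measurable_fun_ifT => //.
- apply: measurable_and; last apply: measurable_and.
  + by apply: measurable_fun_ltr; [exact: measurable_cst | exact: measurable_fst].
  + by apply: measurable_fun_ler => //; exact: measurable_cst.
  + by apply: measurable_fun_ltr => //; exact: measurable_cst.
- apply: measurable_funM; last exact: measurableT_comp mkB m_scl.
  by apply: measurable_funM => //; apply: measurable_funX; exact: measurable_fst.
Qed.

Let G0 x : (0 <= (EFin \o G) x)%E.
Proof.
rewrite lee_fin /G; case: ifP => // /andP[x0 _].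
by rewrite !mulr_ge0 ?exprn_ge0 ?invr_ge0 ?cnorm_ge0 // ltW.
Qed.

Let H (x : R * T) : R := if 0 < x.1 < 1
  then x.1 ^+ (2 * n).-1 * k (x.1%:C%C *: direction (x.2 : Cn R n)) else 0.

Let mH : measurable_fun setT (EFin \o H).
Proof.
apply/measurable_EFinP; apply: measurable_fun_ifT => //.
- apply: measurable_and.
  + by apply: measurable_fun_ltr; [exact: measurable_cst | exact: measurable_fst].
  + by apply: measurable_fun_ltr; [exact: measurable_fst | exact: measurable_cst].
- apply: measurable_funM; first by apply: measurable_funX; exact: measurable_fst.
  apply: (measurableT_comp mk); apply: measurable_scale2; first exact: measurable_fst.
  exact: measurableT_comp measurable_direction measurable_snd.
Qed.

Let H0 x : (0 <= (EFin \o H) x)%E.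
Proof. by rewrite lee_fin /H; case: ifP => // /andP[/ltW x0 _]; rewrite mulr_ge0 // exprn_ge0. Qed.

Let F_int z : z != 0 -> (\int[lebesgue_measure]_s (EFin \o F) (s, z) = (kB z)%:E)%E.
Proof.
move=> z0; have nz : 0 < cnorm (z : Cn R n) by rewrite cnorm_gt0.
pose I := `]cnorm (z : Cn R n), 2 * cnorm (z : Cn R n)]%classic : set R.
transitivity (\int[lebesgue_measure]_(s in I) (kB z * (cnorm (z : Cn R n))^-1)%:E)%E.
  rewrite [RHS]integral_mkcond; apply: eq_integral => s _; rewrite /F /= patchE.
  rewrite (_ : (s \in I) = (cnorm (z : Cn R n) < s <= 2 * cnorm (z : Cn R n))).
    by case: ifP.
  by apply/idP/idP => [/set_mem|h]; last apply/mem_set; rewrite /I /= in_itv.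
rewrite /I integral_cst //= lebesgue_measure_oc ltr_pMl // ltr1n -EFinM.
by congr EFin; field; rewrite gt_eqF.
Qed.

Let FG s : 0 < s -> (\int[V]_z (EFin \o F) (s, z) = \int[V]_z (EFin \o G) (s, z))%E.
Proof.
move=> s0; have mFs : measurable_fun setT (fun z => (EFin \o F) (s, z)).
  by apply: (measurableT_comp mF); exact: measurable_pair1.
have Fs0 z : (0 <= (EFin \o F) (s, z))%E by exact: F0.
have sn : 0 <= s ^+ (2 * n) by rewrite exprn_ge0 // ltW.
have := integral_dilate HV mFs Fs0 s0.
move/(congr1 (mule (s ^+ (2 * n))%:E)).
rewrite muleA -EFinM mulfV ?gt_eqF ?exprn_gt0 // mul1e => <-.
rewrite -ge0_integralZl_EFin //; last first.
  exact: measurableT_comp mFs (measurable_scale s%:C%C).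
apply: eq_integral => z _; rewrite -EFinM; congr EFin; rewrite /F /G /= s0 /=.
rewrite cnormZ cabs_real gtr0_norm //.
have -> : (s * cnorm (z : Cn R n) < s) = (cnorm (z : Cn R n) < 1) by rewrite gtr_pMr.
have -> : (s <= 2 * (s * cnorm (z : Cn R n))) = (1 / 2 <= cnorm (z : Cn R n)).
  by rewrite mulrCA ler_pMr //; apply/idP/idP; lra.
rewrite andbC; case: ifP => // ; last by rewrite mulr0.
move=> /andP[z1 _]; have nz : cnorm (z : Cn R n) != 0 by rewrite gt_eqF //; lra.
have -> : (2 * n = (2 * n).-1.+1)%N by rewrite prednK // muln_gt0.
by rewrite exprS /=; field; rewrite nz gt_eqF.
Qed.

Let GH z : shell z -> (\int[lebesgue_measure]_s (EFin \o G) (s, z) =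
  ((cnorm (z : Cn R n)) ^- (2 * n).+1)%:E * \int[lebesgue_measure]_s (EFin \o H) (s, z))%E.
Proof.
move=> Sz; have z0 := shell_neq0 Sz; set c := cnorm (z : Cn R n).
have nz : 0 < c by rewrite cnorm_gt0.
have mHz : measurable_fun setT (fun s => (EFin \o H) (s, z)).
  by apply: (measurableT_comp mH); exact: measurable_pair2.
have Hz0 s : (0 <= (EFin \o H) (s, z))%E by exact: H0.
rewrite exprS invfM mulrC EFinM -muleA -(integral_scale nz mHz Hz0).
have mHc : measurable_fun setT (fun s : R => (EFin \o H) (c * s, z)).
  by apply: (measurableT_comp mHz); apply: measurable_funM => //; exact: measurable_cst.
have cn0 : 0 <= (c ^+ (2 * n))^-1 by rewrite invr_ge0 exprn_ge0 // ltW.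
rewrite -ge0_integralZl_EFin; [|exact: measurableT|by move=> s _; exact: Hz0|exact: mHc|exact: cn0].
apply: eq_integral => s _; rewrite -EFinM; congr EFin; rewrite /G /H /=.
rewrite (Sz : 1 / 2 <= c < 1) andbT pmulr_rgt0 //.
case: (ltP 0 s) => s0 /=; last by rewrite mulr0.
rewrite /kB /scl /= cnormZ cabs_real gtr0_norm // [s * _]mulrC.
case: (_ < 1); last by rewrite !mulr0.
have -> : (c * s)%:C%C *: direction (z : Cn R n) = s%:C%C *: (z : Cn R n).
  by rewrite /direction scalerA -realcM; congr (_%:C%C *: _); rewrite -/c; field; rewrite gt_eqF.
have -> : (2 * n = (2 * n).-1.+1)%N by rewrite prednK // muln_gt0.
move: (k _) => K; rewrite -/c; move: (2 * n).-1 => m; rewrite -[m.+1.-1]/m exprMn exprS.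
by field; rewrite !gt_eqF // exprn_gt0.
Qed.

Let origin_negligible : V [set (0 : Cn R n) : T] = 0%E.
Proof.
have m0 : measurable [set (0 : Cn R n) : T].
  rewrite (_ : [set _] = (fun z : T => cnorm (z : Cn R n)) @^-1` [set 0]).
    by rewrite -[X in measurable X]setTI; exact: mcn.
  apply/seteqP; split=> z /= => [->|/eqP]; first exact: cnorm0.
  by rewrite cnorm_eq0 => /eqP.
apply/eqP; rewrite eq_le measure_ge0 andbT; apply/lee_addgt0Pr => e e0; rewrite add0e.
pose r := Num.min 1 e.
have r0 : 0 < r by rewrite lt_min ltr01.
apply: (@le_trans _ _ (V [set z : T | cnorm ((z : Cn R n) - 0) < r])).
  apply: le_measure; rewrite ?inE //.
    rewrite (_ : [set z : T | _] = [set z : T | cnorm (z : Cn R n) < r]).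
      exact: cball_measurable.
    by apply/seteqP; split=> z /=; rewrite subr0.
  by move=> z /= ->; rewrite subr0 cnorm0.
rewrite (volume_ball HV) // lee_fin.
have r1 : r <= 1 by rewrite ge_min lexx.
apply: (@le_trans _ _ r); last by rewrite ge_min lexx orbT.
rewrite -{2}[r]expr1; apply: ler_wiXn2l => //; first exact: ltW.
by rewrite muln_gt0.
Qed.

(** The radius is introduced through [F_int]; after Tonelli, a dilation by s moves z to the shell
    ([FG]), and after a second Tonelli the substitution of |z| s for s leaves only the direction of
    z ([GH]). The remaining power of |z| lies between 1 and 2^(2n+1) on the shell, which gives the
    two inequalities [polar_ge] and [polar_le]. *)
Lemma polar_formula : (\int[V]_(z in (@ball_n R n : set T)) (k z)%:E =
  \int[V]_(z in shell) (((cnorm (z : Cn R n)) ^- (2 * n).+1)%:E *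
     \int[lebesgue_measure]_s (EFin \o H) (s, z)))%E.
Proof.
have sV := volume_sigma_finite HV.
have sL : sigma_finite setT (@lebesgue_measure R) by exact: sigma_finiteT.
have m0 : measurable [set (0 : Cn R n) : T].
  rewrite (_ : [set _] = (fun z : T => cnorm (z : Cn R n)) @^-1` [set 0]).
    by rewrite -[X in measurable X]setTI; exact: mcn.
  apply/seteqP; split=> z /= => [->|/eqP]; first exact: cnorm0.
  by rewrite cnorm_eq0 => /eqP.
transitivity (\int[V]_z (kB z)%:E)%E.
  rewrite integral_mkcond; apply: eq_integral => z _; rewrite patchE /kB.
  case: ifPn => [/set_mem -> //|zB]; rewrite ifN //.
  by apply: contra zB => zB; rewrite mem_set.
rewrite (@ge0_negligible_integral _ _ _ _ _ [set (0 : Cn R n) : T]) //; last 2 first.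
- by apply/measurable_EFinP.
- by move=> z _; rewrite lee_fin.
rewrite (eq_integral (fun z : T => (\int[lebesgue_measure]_s (EFin \o F) (s, z))%E)); last first.
  by move=> z; rewrite inE => -[_ /eqP z0]; rewrite F_int.
rewrite -(@ge0_negligible_integral _ _ _ _ _ [set (0 : Cn R n) : T]) //; last 2 first.
- have mF' : measurable_fun setT (fun x : T * R => (EFin \o F) (x.2, x.1)).
    by apply: (measurableT_comp mF); exact: measurable_swap.
  exact: (@measurable_inner_integral _ _ T (measurableTypeR R) R lebesgue_measure
    _ sL mF' (fun x => F0 _)).
- by move=> z _; apply: integral_ge0 => s _; exact: F0.
rewrite -(@tonelli_sigma_finite _ _ (measurableTypeR R) T R lebesgue_measure V _ sL sV mF F0).
transitivity (\int[lebesgue_measure]_s \int[V]_z (EFin \o G) (s, z))%E.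
  apply: eq_integral => s _; have [s0|s0] := ltP 0 s; first exact: FG.
  rewrite !integral0_eq // => z _; first by rewrite /= /G /= ltNge s0.
  rewrite /= /F /= ifF //; apply/negP => /andP[h _].
  by have := cnorm_ge0 (z : Cn R n); lra.
rewrite (@tonelli_sigma_finite _ _ (measurableTypeR R) T R lebesgue_measure V _ sL sV mG G0).
rewrite [RHS]integral_mkcond; apply: eq_integral => z _; rewrite patchE.
case: ifPn => [/set_mem|] zS; first exact: GH.
rewrite integral0_eq // => s _; rewrite /= /G /= ifF //; apply/negP => /andP[_ h].
by move/negP: zS; apply; apply/mem_set.
Qed.

Variable W : {measure set T -> \bar R}.
Hypothesis WP : forall g : T -> \bar R, measurable_fun setT g -> (forall z, 0 <= g z)%E ->
  (\int[W]_z g z = \int[V]_(z in shell) g (direction z))%E.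

Let shell_H : (\int[V]_(z in shell) \int[lebesgue_measure]_s (EFin \o H) (s, z) =
  \int[lebesgue_measure]_(s in `]0%R, 1%R[)
    ((s ^+ (2 * n).-1)%:E * \int[W]_z (k (s%:C%C *: (z : Cn R n)))%:E))%E.
Proof.
have sV := volume_sigma_finite HV.
have sL : sigma_finite setT (@lebesgue_measure R) by exact: sigma_finiteT.
have := @tonelli_rect _ _ (measurableTypeR R) T R lebesgue_measure V setT shell
  _ sL sV measurableT measurable_shell mH H0.
move=> <-; rewrite [RHS]integral_mkcond; apply: eq_integral => s _; rewrite patchE.
have mks : measurable_fun setT (fun z : T => (k (s%:C%C *: (z : Cn R n)))%:E).
  by apply/measurable_EFinP; apply: (measurableT_comp mk); exact: measurable_scale.
case: ifPn => [/set_mem|]; rewrite /= ?in_itv /= => s01.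
  have sn : 0 <= s ^+ (2 * n).-1 by case/andP: s01 => s0 _; rewrite exprn_ge0 // ltW.
  rewrite WP //; last by move=> z; rewrite lee_fin.
  rewrite -ge0_integralZl_EFin //; last 3 first.
  - exact: measurable_shell.
  - by move=> z _; rewrite lee_fin.
  - by apply: measurable_funTS; exact: (measurableT_comp mks measurable_direction).
  by apply: eq_integral => z _; rewrite /= /H /= s01 EFinM.
rewrite integral0_eq // => z _; rewrite /= /H /= ifF //; apply/negP => h.
by move/negP: s01; apply; apply/mem_set; rewrite /= in_itv.
Qed.

Let mHint : measurable_fun setT (fun z => \int[lebesgue_measure]_s (EFin \o H) (s, z))%E.
Proof.
have sL : sigma_finite setT (@lebesgue_measure R) by exact: sigma_finiteT.
have mH' : measurable_fun setT (fun x : T * R => (EFin \o H) (x.2, x.1)).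
  by apply: (measurableT_comp mH); exact: measurable_swap.
exact: (@measurable_inner_integral _ _ T (measurableTypeR R) R lebesgue_measure
  _ sL mH' (fun x => H0 _)).
Qed.

Let Hint0 z : (0 <= \int[lebesgue_measure]_s (EFin \o H) (s, z))%E.
Proof. by apply: integral_ge0 => s _; exact: H0. Qed.

Let mweight : measurable_fun setT (fun z : T =>
  (((cnorm (z : Cn R n)) ^- (2 * n).+1)%:E * \int[lebesgue_measure]_s (EFin \o H) (s, z))%E).
Proof.
apply: emeasurable_funM => //; apply/measurable_EFinP.
apply: (eq_measurable_fun (fun z : T => (cnorm (z : Cn R n))^-1 ^+ (2 * n).+1)).
  by move=> z _; rewrite exprVn.
by apply: measurable_funX; exact: measurable_cnormV.
Qed.

Lemma polar_ge : (\int[lebesgue_measure]_(s in `]0%R, 1%R[)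
    ((s ^+ (2 * n).-1)%:E * \int[W]_z (k (s%:C%C *: (z : Cn R n)))%:E) <=
  \int[V]_(z in (@ball_n R n : set T)) (k z)%:E)%E.
Proof.
rewrite polar_formula -shell_H; apply: ge0_le_integral.
- exact: measurable_shell.
- by move=> z _; exact: Hint0.
- exact: measurable_funTS.
- exact: measurable_funTS.
- move=> z zS; rewrite -[leLHS]mul1e; apply: lee_wpmul2r; first exact: Hint0.
  rewrite lee_fin -exprVn; apply: exprn_ege1.
  have z0 := shell_neq0 zS; case/andP: zS => _ z1.
  by rewrite invf_ge1 ?cnorm_gt0 // ltW.
Qed.

Lemma polar_le : (\int[V]_(z in (@ball_n R n : set T)) (k z)%:E <=
  (2 ^+ (2 * n).+1)%:E * \int[lebesgue_measure]_(s in `]0%R, 1%R[)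
    ((s ^+ (2 * n).-1)%:E * \int[W]_z (k (s%:C%C *: (z : Cn R n)))%:E))%E.
Proof.
have mS := measurable_shell.
rewrite polar_formula -shell_H -ge0_integralZl_EFin //; last exact: measurable_funTS.
apply: ge0_le_integral => //.
- move=> z _; apply: mule_ge0; last exact: Hint0.
  by rewrite lee_fin invr_ge0 exprn_ge0 // cnorm_ge0.
- exact: measurable_funTS.
- by apply: measurable_funTS; apply: emeasurable_funM => //; exact: measurable_cst.
- move=> z zS; apply: lee_wpmul2r; first exact: Hint0.
  rewrite lee_fin -exprVn; have z0 := shell_neq0 zS; case/andP: zS => z2 _.
  apply: lerXn2r; rewrite ?nnegrE ?invr_ge0 ?cnorm_ge0 //.
  by rewrite -[2]invrK lef_pV2 ?posrE ?cnorm_gt0 //; lra.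
Qed.

End Polar.

End PolarCoordinates.

(** * Radial weights *)

Section RadialWeights.
Variables (R : realType) (n : nat) (V : {measure set (CnM R n) -> \bar R}).
Hypotheses (HV : normalized_volume V) (n0 : (0 < n)%N).
Variable omega : R -> R.
Hypotheses (Homega : radial_weight V omega) (HD : Dclass omega).

Let T := CnM R n.

(** [omega] is unconstrained outside [0, 1[; extended by zero it is measurable and nonnegative on
    the whole line. *)
Definition weight_ext (s : R) : R := if 0 <= s < 1 then omega s else 0.

Lemma weight_ext_ge0 s : 0 <= weight_ext s.
Proof.
by rewrite /weight_ext; case: ifP => // s01; have [/(_ _ s01) /ltW] := Homega.
Qed.

Lemma weight_extE s : 0 <= s < 1 -> weight_ext s = omega s.
Proof. by rewrite /weight_ext => ->. Qed.

Lemma measurable_weight_ext : measurable_fun setT weight_ext.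
Proof.
have [_ [mo _]] := Homega.
apply: (eq_measurable_fun (omega \_ `[0%R, 1%R[)).
  move=> s _; rewrite patchE /weight_ext; congr (if _ then _ else _).
  by apply/idP/idP => [/set_mem|h]; last apply/mem_set; rewrite /= in_itv.
by apply/measurable_restrict => //; rewrite setTI.
Qed.

Lemma hat_ext r : 0 <= r -> hat omega r = (\int[lebesgue_measure]_(s in `[r, 1%R[) (weight_ext s)%:E)%E.
Proof.
move=> r0; apply: eq_integral => s /set_mem; rewrite /= in_itv /= => /andP[rs s1].
by rewrite weight_extE // s1 andbT (le_trans r0).
Qed.

Let mw (D : set R) : measurable_fun D (EFin \o weight_ext).
Proof. by apply/measurable_EFinP; apply: measurable_funTS; exact: measurable_weight_ext. Qed.

Lemma weight_ext_int_le (A B : set R) : measurable A -> measurable B -> A `<=` B ->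
  (\int[lebesgue_measure]_(s in A) (weight_ext s)%:E <=
   \int[lebesgue_measure]_(s in B) (weight_ext s)%:E)%E.
Proof.
move=> mA mB AB; apply: ge0_subset_integral => //; first exact: mw.
by move=> s _; rewrite lee_fin weight_ext_ge0.
Qed.

Lemma hat_le r s : 0 <= r -> r <= s -> (hat omega s <= hat omega r)%E.
Proof.
move=> r0 rs; rewrite !hat_ext ?(le_trans r0) //; apply: weight_ext_int_le => //.
by move=> x /=; rewrite !in_itv /= => /andP[h ->]; rewrite (le_trans rs).
Qed.

Lemma hat_ge0 r : 0 <= r -> (0 <= hat omega r)%E.
Proof.
by move=> r0; rewrite hat_ext //; apply: integral_ge0 => s _; rewrite lee_fin weight_ext_ge0.
Qed.

Let k (z : T) : R := weight_ext (cnorm (z : Cn R n)).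

Let mk : measurable_fun setT k.
Proof. exact: measurableT_comp measurable_weight_ext (@measurable_cnorm R n). Qed.

Lemma sphere_concentrated (W : {measure set T -> \bar R}) :
  (forall g : T -> \bar R, measurable_fun setT g -> (forall z, 0 <= g z)%E ->
    (\int[W]_z g z = \int[V]_(z in @shell R n) g (direction z))%E) ->
  forall g : T -> \bar R, measurable_fun setT g -> (forall z, 0 <= g z)%E ->
    (\int[W]_z g z = \int[W]_(z in [set z : T | cnorm (z : Cn R n) = 1%R]) g z)%E.
Proof.
move=> WP g mg g0; rewrite [RHS]integral_mkcond.
have mS : measurable [set z : T | cnorm (z : Cn R n) = 1].
  rewrite (_ : [set z : T | _] = (fun z : T => cnorm (z : Cn R n)) @^-1` [set 1]) //.
  by rewrite -[X in measurable X]setTI; exact: (@measurable_cnorm R n).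
rewrite !WP //; last 2 first.
- by apply/measurable_restrict => //; rewrite setTI; exact: measurable_funTS.
- by move=> z; rewrite patchE; case: ifP.
apply: eq_integral => z /set_mem zS; rewrite patchE ifT //.
by apply/mem_set => /=; apply: cnorm_direction; exact: shell_neq0 zS.
Qed.

Lemma sphere_measure_gt0 (W : {measure set T -> \bar R}) :
  (forall g : T -> \bar R, measurable_fun setT g -> (forall z, 0 <= g z)%E ->
    (\int[W]_z g z = \int[V]_(z in @shell R n) g (direction z))%E) ->
  (0 < W setT)%E.
Proof.
move=> WP; have := WP (cst 1%E) (measurable_cst _) (fun=> lee01).
rewrite !integral_cst ?mul1e //; last exact: measurable_shell.
move=> ->; rewrite lt_neqAle measure_ge0 andbT eq_sym; apply/eqP => V0.
have mS := @measurable_shell R n.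
have mB : measurable (@ball_n R n : set T) := @measurable_ball R n.
have mb := @cball_measurable R n (1 / 2).
have U : @shell R n `|` [set z : T | cnorm (z : Cn R n) < 1 / 2] = (@ball_n R n : set T).
  apply/seteqP; split=> z; rewrite /shell /ball_n /=.
    by move=> [/andP[]|] // h; lra.
  by move=> z1; have [?|?] := ltP (cnorm (z : Cn R n)) (1 / 2); [right | left].
have := measureU2 V mS mb; rewrite U => h0.
have : (V (@ball_n R n : set T) <= V (@shell R n) +
   V [set z : T | (cnorm (z : Cn R n) < 1 / 2)%R])%E := h0.
have [_ V1] := HV; rewrite V1 V0 add0e.
rewrite (_ : [set z : T | _] = [set z : T | cnorm ((z : Cn R n) - 0) < 1 / 2]); last first.
  by apply/seteqP; split=> z /=; rewrite subr0.
rewrite (volume_ball HV) ?divr_gt0 // lee_fin => h.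
have : (1 / 2 : R) ^+ (2 * n) <= (1 / 2) ^+ 1.
  by apply: ler_wiXn2l; rewrite ?muln_gt0 //; lra.
rewrite expr1; lra.
Qed.

(** Integrability over the ball controls [omega] only away from 0, because the polar density
    s^(2n-1) vanishes there. It gives hat(omega)(1/2) < oo, and the doubling condition at r = 0 does
    the rest. *)
Lemma hat0_fin : (hat omega 0 < +oo)%E.
Proof.
have [_ [_ io]] := Homega.
have [[C [C1 CP]] _] := HD.
have H0 := CP 0 (ltac:(by rewrite lexx ltr01)); apply: (le_lt_trans H0).
have [W [sW WT _ WP]] := sphere_measureP HV.
suff h : (hat omega (1 / 2) < +oo)%E.
  apply: lte_mul_pinfty => //; rewrite ?lee_fin ?addr0 //; first exact: le_trans C1.
have W0 := sphere_measure_gt0 WP.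
have WE : W setT = (fine (W setT))%:E by rewrite fineK // ge0_fin_numE.
have W0' : 0 < fine (W setT) by rewrite -lte_fin -WE.
have H := polar_ge HV n0 mk (fun z => weight_ext_ge0 _) WP.
have fin : (\int[V]_(z in (@ball_n R n : set T)) (k z)%:E < +oo)%E.
  rewrite (eq_integral (fun z : T => `|(omega (cnorm (z : Cn R n)))%:E|%E)); last first.
    move=> z /set_mem zB; have z01 : 0 <= cnorm (z : Cn R n) < 1 by rewrite cnorm_ge0.
    by rewrite /k weight_extE //= ger0_norm //; have [/(_ _ z01) /ltW] := Homega.
  by case/integrableP: io.
set c := (1 / 2) ^+ (2 * n).-1 * fine (W setT).
have c0 : 0 < c by rewrite mulr_gt0 // exprn_gt0 // divr_gt0.
have : (c%:E * hat omega (1 / 2) < +oo)%E.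
  apply: le_lt_trans (le_lt_trans H fin).
  rewrite hat_ext ?divr_ge0 // -ge0_integralZl_EFin //; last 3 first.
  - by move=> s _; rewrite lee_fin weight_ext_ge0.
  - exact: mw.
  - exact: ltW.
  have mks : measurable_fun setT (fun x : R => (x ^+ (2 * n).-1)%:E * \int[W]_z (k (x%:C%C *: (z : Cn R n)))%:E)%E.
    apply: emeasurable_funM.
      by apply/measurable_EFinP; apply: measurable_funX; exact: measurable_id.
    apply: (@measurable_inner_integral _ _ (measurableTypeR R) T R W
      (fun x => (k (x.1%:C%C *: (x.2 : Cn R n)))%:E) sW).
    - apply/measurable_EFinP; apply: (measurableT_comp mk).
      by apply: measurable_scale2; [exact: measurable_fst | exact: measurable_snd].
    - by move=> x; rewrite lee_fin weight_ext_ge0.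
  have F0 x : 0 <= x -> (0 <= (x ^+ (2 * n).-1)%:E * \int[W]_z (k (x%:C%C *: (z : Cn R n)))%:E)%E.
    move=> x0; apply: mule_ge0; first by rewrite lee_fin exprn_ge0.
    by apply: integral_ge0 => z _; rewrite lee_fin weight_ext_ge0.
  apply: (@le_trans _ _ (\int[lebesgue_measure]_(s in `[(1 / 2)%R, 1%R[)
      ((s ^+ (2 * n).-1)%:E * \int[W]_z (k (s%:C%C *: (z : Cn R n)))%:E))%E); last first.
    apply: ge0_subset_integral => //.
    - exact: measurable_funTS.
    - by move=> s /=; rewrite in_itv /= => /andP[s0 _]; apply: F0; exact: ltW.
    - move=> s /=; rewrite !in_itv /= => /andP[s0 ->]; rewrite andbT; lra.
  apply: ge0_le_integral => //.
  - by move=> s _; rewrite -EFinM lee_fin mulr_ge0 ?weight_ext_ge0 // ltW.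
  - by apply: emeasurable_funM; [exact: measurable_cst | exact: mw].
  - exact: measurable_funTS.
  move=> s; rewrite /= in_itv /= => /andP[s0 s1].
  rewrite (sphere_concentrated WP) //; last 2 first.
  - by apply/measurable_EFinP; apply: (measurableT_comp mk); exact: measurable_scale.
  - by move=> z; rewrite lee_fin weight_ext_ge0.
  rewrite (eq_integral (cst (weight_ext s)%:E)); last first.
    move=> z /set_mem /= z1; rewrite /k cnormZ z1 mulr1 cabs_real ger0_norm //; lra.
  have mS : measurable [set z : T | cnorm (z : Cn R n) = 1].
    rewrite (_ : [set z : T | _] = (fun z : T => cnorm (z : Cn R n)) @^-1` [set 1]) //.
    by rewrite -[X in measurable X]setTI; exact: (@measurable_cnorm R n).
  rewrite integral_cst //.
  have <- : W setT = W [set z : T | cnorm (z : Cn R n) = 1].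
    have := sphere_concentrated WP (measurable_cst 1%E) (fun=> lee01).
    by rewrite !integral_cst ?mul1e.
  rewrite WE -!EFinM lee_fin /c -mulrA [fine _ * _]mulrC.
  apply: ler_wpM2r; first by rewrite mulr_ge0 ?weight_ext_ge0 // ltW.
  by apply: lerXn2r; rewrite ?nnegrE; lra.
rewrite ltNge; move=> /negP h; rewrite ltNge; apply/negP; rewrite leye_eq => /eqP h2.
by apply: h; rewrite h2 gt0_muley ?lte_fin.
Qed.

Lemma hat_fin r : 0 <= r -> hat omega r = (fine (hat omega r))%:E.
Proof.
move=> r0; rewrite fineK // ge0_fin_numE; last exact: hat_ge0.
by apply: le_lt_trans hat0_fin; exact: hat_le.
Qed.

Lemma hat_gt0 r : 0 <= r < 1 -> (0 < hat omega r)%E.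
Proof.
move=> /andP[r0 r1]; rewrite lt_neqAle hat_ge0 // andbT eq_sym; apply/eqP.
rewrite hat_ext // => h.
have mI : measurable (`[r, 1%R[ : set (measurableTypeR R)) by exact: measurable_itv.
have := (ae_eq_integral_abs lebesgue_measure mI (@mw `[r, 1[%classic)).1.
have {}h : (\int[lebesgue_measure]_(s in `[r, 1%R[) `|(EFin \o weight_ext) s| = 0)%E.
  by rewrite -[RHS]h; apply: eq_integral => s _; rewrite /= ger0_norm // weight_ext_ge0.
move=> /(_ h) [N [mN N0 IN]].
have : (lebesgue_measure (`[r, 1%R[ : set R) <= lebesgue_measure N)%E.
  apply: le_measure; rewrite ?inE // => s sI; apply: IN => /= /(_ sI) /eqP.
  move: sI; rewrite /= in_itv /= => /andP[rs s1].
  have s01 : 0 <= s < 1 by rewrite s1 (le_trans r0).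
  by rewrite eqe weight_extE // gt_eqF //; have [/(_ _ s01)] := Homega.
rewrite lebesgue_measure_itv /= lte_fin r1 => h1.
have : ((1 - r)%:E <= 0)%E by apply: le_trans h1 _; rewrite N0.
by rewrite lee_fin; lra.
Qed.

(** hat(omega) as a function of the distance t = 1 - r to the sphere, constant for t >= 1. In this
    variable the upper condition of the class D is the usual doubling property. *)
Definition tail_weight (t : R) : R := fine (hat omega (Num.max 0 (1 - t))).

Let max0 t : 0 <= Num.max 0 (1 - t) :> R.
Proof. by rewrite le_max lexx. Qed.

Lemma tail_weightE t : (tail_weight t)%:E = hat omega (Num.max 0 (1 - t)).
Proof. by rewrite -hat_fin. Qed.

Lemma tail_weight_ge0 t : 0 <= tail_weight t.
Proof. by rewrite -lee_fin tail_weightE hat_ge0. Qed.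

Lemma tail_weight_gt0 t : 0 < t -> 0 < tail_weight t.
Proof.
move=> t0; rewrite -lte_fin tail_weightE hat_gt0 // max0 /= gt_max ltr01 /=; lra.
Qed.

Lemma tail_weight_le s t : s <= t -> tail_weight s <= tail_weight t.
Proof.
move=> st; rewrite -lee_fin !tail_weightE hat_le // ge_max max0 /=.
by rewrite le_max; apply/orP; right; lra.
Qed.

Lemma measurable_tail_weight : measurable_fun setT tail_weight.
Proof. by apply: nondecreasing_measurable => // s t; exact: tail_weight_le. Qed.

Lemma tail_weight_double : exists2 C : R, 1 <= C & forall t, 0 < t ->
  tail_weight (2 * t) <= C * tail_weight t.
Proof.
have [[C [C1 CP]] _] := HD; exists C => // t t0; have C0 : 0 <= C by exact: le_trans C1.
have [t1|t1] := leP t 1; last first.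
  apply: (@le_trans _ _ (tail_weight t)); last by rewrite ler_peMl // tail_weight_ge0.
  by rewrite /tail_weight !max_l //; lra.
rewrite -lee_fin EFinM !tail_weightE.
have h : 0 <= Num.max 0 (1 - 2 * t) < 1 by rewrite max0 gt_max ltr01; lra.
apply: (le_trans (CP _ h)); apply: lee_wpmul2l; first by rewrite lee_fin.
apply: hat_le => //; rewrite ge_max; apply/andP; split; first by case/andP: h; lra.
by rewrite maxEle; case: ifP; lra.
Qed.

(** The lower condition says that the tail beyond r' = 1 - (1 - r) / K is at most 1/C of the tail
    beyond r; hence the part between r and r' carries at least the fraction (C - 1) / C. *)
Lemma hat_le_annulus : exists C K : R, [/\ 0 < C, 1 < K & forall r, 0 <= r < 1 ->
  (hat omega r <= C%:E *
    \int[lebesgue_measure]_(s in `[r, (1 - (1 - r) / K)%R[) (weight_ext s)%:E)%E].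
Proof.
have [_ [C [K [C1 [K1 CP]]]]] := HD.
exists (C / (C - 1)), K; split => //; first by rewrite divr_gt0 ?subr_gt0 //; lra.
move=> r r01; have [r0 r1] := andP r01.
pose r' := 1 - (1 - r) / K.
have K0 : 0 < K by lra.
have rr' : r <= r'.
  have : (1 - r) / K <= 1 - r by rewrite ler_pdivrMr //; nra.
  by rewrite /r'; lra.
have r'1 : r' <= 1 by rewrite /r' gerBl divr_ge0 ?subr_ge0 ?ltW.
have r'0 : 0 <= r' by lra.
have := CP r r01; rewrite -/r'.
have E : hat omega r = (\int[lebesgue_measure]_(s in `[r, r'[) (weight_ext s)%:E + hat omega r')%E.
  rewrite !hat_ext // -ge0_integral_setU //.
  - by rewrite -itv_bndbnd_setU // bnd_simp.
  - exact: mw.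
  - by move=> s _; rewrite lee_fin weight_ext_ge0.
  - apply/disj_setPS => s /= []; rewrite !in_itv /= => /andP[_ h1] /andP[h2 _].
    by have := lt_le_trans h1 h2; rewrite ltxx.
have fA : (\int[lebesgue_measure]_(s in `[r, r'[) (weight_ext s)%:E)%E \is a fin_num.
  rewrite ge0_fin_numE; last by apply: integral_ge0 => s _; rewrite lee_fin weight_ext_ge0.
  apply: le_lt_trans hat0_fin; apply: (@le_trans _ _ (hat omega r)); last exact: hat_le.
  by rewrite E leeDl // hat_ge0.
move: E; rewrite (hat_fin r0) (hat_fin r'0) -(fineK fA) -!EFinM -!EFinD => -[E].
have C10 : 0 < C - 1 by lra.
rewrite !lee_fin => h; rewrite mulrAC ler_pdivlMr //.
by move: E h; set x := fine _; set y := fine _; set z := fine _; nra.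
Qed.

(* Hardy's inequality: averaging the tail of the weight costs only a constant on
   nondecreasing functions. *)
Lemma hardy : exists2 C : R, 0 < C & forall N : R -> \bar R,
  measurable_fun setT N -> (forall s, 0 <= N s)%E ->
  (forall s x, (0 < s)%R -> (s <= x)%R -> (x < 1)%R -> N s <= N x)%E ->
  (\int[lebesgue_measure]_(s in `]0%R, 1%R[) ((tail_weight (1 - s) / (1 - s))%:E * N s) <=
   C%:E * \int[lebesgue_measure]_(s in `]0%R, 1%R[) ((weight_ext s)%:E * N s))%E.
Proof.
have [C [K [C0 K1 CK]]] := hat_le_annulus.
exists (C * (K - 1)); first by rewrite mulr_gt0 // subr_gt0.
move=> N mN N0 Nle; have sL : sigma_finite setT (@lebesgue_measure R) by exact: sigma_finiteT.
have K0 : 0 < K by lra.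
pose D : set (measurableTypeR R) := `]0, 1[%classic.
have mD : measurable D by exact: measurable_itv.
(* [q] pairs s with the points x of its annulus. There 1 / (1 - s) <= 1 / (1 - x) and N s <= N x, so
   s may be replaced by x in the integrand. For fixed x the admissible s fill an interval of length
   at most (K - 1)(1 - x), which cancels 1 / (1 - x). *)
pose q (x : R * R) := [&& 0 < x.1, x.1 < 1, x.1 <= x.2 & x.2 < 1 - (1 - x.1) / K].
pose Q (x : R * R) : \bar R := ((if q x then weight_ext x.2 * (1 - x.1) `^ (-1) else 0)%:E * N x.1)%E.
pose P (x : R * R) : \bar R := ((if q x then weight_ext x.2 * (1 - x.2) `^ (-1) else 0)%:E * N x.2)%E.
have m1 : measurable_fun setT (fun x : measurableTypeR R * measurableTypeR R => x.1 : R).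
  exact: measurable_fst.
have m2 : measurable_fun setT (fun x : measurableTypeR R * measurableTypeR R => x.2 : R).
  exact: measurable_snd.
have cst (a : R) : measurable_fun setT (fun x : measurableTypeR R * measurableTypeR R => a).
  exact: measurable_cst.
have mq : measurable_fun setT (q : measurableTypeR R * measurableTypeR R -> bool).
  apply: measurable_and; first exact: measurable_fun_ltr (cst 0) m1.
  apply: measurable_and; first exact: measurable_fun_ltr m1 (cst 1).
  apply: measurable_and; first exact: measurable_fun_ler m1 m2.
  apply: measurable_fun_ltr; first exact: m2.
  apply: measurable_funB; first exact: cst.
  by apply: measurable_funM; [exact: measurable_funB (cst 1) m1 | exact: cst].
have mw2 : measurable_fun setT (fun x : measurableTypeR R * measurableTypeR R => weight_ext x.2).
  exact: measurableT_comp measurable_weight_ext m2.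
have mQ : measurable_fun setT (Q : measurableTypeR R * measurableTypeR R -> \bar R).
  apply: emeasurable_funM; last exact: measurableT_comp mN m1.
  apply/measurable_EFinP; apply: measurable_fun_ifT => //.
  apply: measurable_funM => //; apply: (measurableT_comp (measurable_powR (-1))).
  exact: measurable_funB (cst 1) m1.
have mP : measurable_fun setT (P : measurableTypeR R * measurableTypeR R -> \bar R).
  apply: emeasurable_funM; last exact: measurableT_comp mN m2.
  apply/measurable_EFinP; apply: measurable_fun_ifT => //.
  apply: measurable_funM => //; apply: (measurableT_comp (measurable_powR (-1))).
  exact: measurable_funB (cst 1) m2.
have Q0 x : (0 <= Q x)%E.
  apply: mule_ge0 => //; case: ifP => _ //.
  by rewrite lee_fin mulr_ge0 ?weight_ext_ge0 ?powR_ge0.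
have P0 x : (0 <= P x)%E.
  apply: mule_ge0 => //; case: ifP => _ //.
  by rewrite lee_fin mulr_ge0 ?weight_ext_ge0 ?powR_ge0.
have QP x : (Q x <= P x)%E.
  rewrite /Q /P; case: ifP => [/and4P[a1 a2 a3 a4]|_]; last by rewrite !mul0e.
  have x1 : x.2 < 1 by apply: (lt_le_trans a4); rewrite gerBl divr_ge0 ?subr_ge0 ?ltW.
  apply: lee_pmul => //; rewrite ?lee_fin ?mulr_ge0 ?weight_ext_ge0 ?powR_ge0 //.
    apply: ler_wpM2l; first exact: weight_ext_ge0.
    have y1 : 0 < 1 - x.1 by lra.
    have y2 : 0 < 1 - x.2 by lra.
    rewrite (powR_inv1 (ltW y1)) (powR_inv1 (ltW y2)) lef_pV2 ?posrE //; lra.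
  exact: Nle.
have mQi : measurable_fun setT (fun s => \int[lebesgue_measure]_x Q (s, x))%E.
  exact: (@measurable_inner_integral _ _ (measurableTypeR R) (measurableTypeR R) R
    lebesgue_measure Q sL mQ Q0).
have Qi0 s : (0 <= \int[lebesgue_measure]_x Q (s, x))%E by exact: integral_ge0.
apply: (@le_trans _ _ (\int[lebesgue_measure]_(s in D) (C%:E * \int[lebesgue_measure]_x Q (s, x)))%E).
  apply: ge0_le_integral => //.
  - move=> s; rewrite /D /= in_itv /= => /andP[s0 s1]; apply: mule_ge0 => //.
    by rewrite lee_fin divr_ge0 ?tail_weight_ge0 // subr_ge0 ltW.
  - apply: emeasurable_funM; last exact: measurable_funTS.
    apply/measurable_EFinP; apply: (eq_measurable_fun (fun s : R => tail_weight (1 - s) * (1 - s) `^ (-1))).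
      move=> s /set_mem; rewrite /D /= in_itv /= => /andP[s0 s1].
      by rewrite powR_inv1 // subr_ge0 ltW.
    have ms : measurable_fun setT (fun s : R => 1 - s) by exact: measurable_funB.
    apply: measurable_funTS; apply: measurable_funM.
      exact: measurableT_comp measurable_tail_weight ms.
    exact: measurableT_comp (measurable_powR (-1)) ms.
  - by apply: measurable_funTS; apply: emeasurable_funM => //; exact: measurable_cst.
  move=> s; rewrite /D /= in_itv /= => /andP[s0 s1].
  have s01 : 0 <= s < 1 by rewrite ltW.
  pose I : set (measurableTypeR R) := `[s, 1 - (1 - s) / K[%classic.
  have mI : measurable I by exact: measurable_itv.
  have IE (x : R) : (x \in I) = q (s, x).
    rewrite /q /= s0 s1 /=.
    by apply/idP/idP => [/set_mem|h]; last apply/mem_set; rewrite /I /= in_itv.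
  have -> : (\int[lebesgue_measure]_x Q (s, x) =
     \int[lebesgue_measure]_(x in I) ((weight_ext x)%:E * ((1 - s)^-1%:E * N s)))%E.
    rewrite [RHS]integral_mkcond; apply: eq_integral => x _; rewrite patchE IE /Q /=.
    case: ifP => _; last by rewrite mul0e.
    by rewrite powR_inv1 ?subr_ge0 ?(ltW s1) // EFinM muleA.
  rewrite ge0_integralZr //; last 3 first.
  - exact: mw.
  - by move=> x _; rewrite lee_fin weight_ext_ge0.
  - by apply: mule_ge0 => //; rewrite lee_fin invr_ge0 subr_ge0 ltW.
  rewrite [(_ / _)%:E]EFinM -muleA [leRHS]muleA; apply: lee_wpmul2r.
    by apply: mule_ge0 => //; rewrite lee_fin invr_ge0 subr_ge0 ltW.
  by rewrite tail_weightE subKr max_r ?(ltW s0) //; exact: CK.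
rewrite ge0_integralZl_EFin //; last 2 first.
- exact: measurable_funTS.
- exact: ltW.
rewrite [(C * _)%:E]EFinM -muleA; apply: lee_wpmul2l; first by rewrite lee_fin ltW.
apply: (@le_trans _ _ (\int[lebesgue_measure]_s \int[lebesgue_measure]_x Q (s, x))%E).
  by apply: ge0_subset_integral.
rewrite (@tonelli_sigma_finite _ _ (measurableTypeR R) (measurableTypeR R) R lebesgue_measure
  lebesgue_measure Q sL sL mQ Q0).
rewrite -ge0_integralZl_EFin //; last 3 first.
- by move=> s _; apply: mule_ge0 => //; rewrite lee_fin weight_ext_ge0.
- by apply: measurable_funTS; apply: emeasurable_funM => //; exact: mw.
- by rewrite subr_ge0 ltW.
rewrite [leRHS]integral_mkcond; apply: ge0_le_integral.
- exact: measurableT.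
- by move=> x _; apply: integral_ge0 => s _; exact: Q0.
- have mQ' : measurable_fun setT (fun x : measurableTypeR R * measurableTypeR R => Q (x.2, x.1)).
    by apply: (measurableT_comp mQ); exact: measurable_swap.
  exact: (@measurable_inner_integral _ _ (measurableTypeR R) (measurableTypeR R) R
    lebesgue_measure _ sL mQ' (fun x => Q0 _)).
- apply/measurable_restrict => //; rewrite setTI; apply: measurable_funTS.
  by apply: emeasurable_funM; [exact: measurable_cst | apply: emeasurable_funM => //; exact: mw].
move=> x _; apply: (@le_trans _ _ (\int[lebesgue_measure]_s P (s, x))%E).
  apply: ge0_le_integral => //.
  - by apply: (measurableT_comp mQ); exact: measurable_pair2.
  - by apply: (measurableT_comp mP); exact: measurable_pair2.
pose I : set (measurableTypeR R) := `]1 - K * (1 - x), x]%classic.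
rewrite patchE; case: ifPn => xD; last first.
  rewrite integral0_eq // => s _; rewrite /P ifF ?mul0e //; apply/negP => /and4P[/= a1 a2 a3 a4].
  move/negP: xD; apply; apply/mem_set; rewrite /D /= in_itv /= (lt_le_trans a1 a3) /=.
  by apply: (lt_le_trans a4); rewrite gerBl divr_ge0 ?subr_ge0 ?ltW.
move/set_mem: xD; rewrite /D /= in_itv /= => /andP[x0 x1].
pose c : \bar R := ((weight_ext x * (1 - x)^-1)%:E * N x)%E.
have mI : measurable I by exact: measurable_itv.
have c0 : (0 <= c)%E.
  by apply: mule_ge0 => //; rewrite lee_fin mulr_ge0 ?weight_ext_ge0 // invr_ge0 subr_ge0 ltW.
apply: (@le_trans _ _ (\int[lebesgue_measure]_(s in I) c)%E).
  rewrite [leRHS]integral_mkcond; apply: ge0_le_integral => //.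
  - by apply: (measurableT_comp mP); exact: measurable_pair2.
  - apply/measurable_restrict => //; rewrite setTI; exact: measurable_cst.
  move=> s _; rewrite patchE /P /=.
  case: ifP => [/and4P[/= a1 a2 a3 a4]|_]; last by rewrite mul0e; case: ifP.
  rewrite mem_set; first by rewrite /c powR_inv1 // subr_ge0 ltW.
  rewrite /I /= in_itv /= a3 andbT.
  move: a4; rewrite ltrBrDl -ltrBrDr ltr_pdivrMr //; lra.
rewrite integral_cst // [X in (_ * X)%E]lebesgue_measure_oc.
have -> : 1 - K * (1 - x) < x by nra.
rewrite /c [leLHS]muleAC -EFinM muleA -EFinM; apply: lee_wpmul2r => //.
rewrite lee_fin le_eqVlt; apply/orP; left; apply/eqP; field.
by rewrite gt_eqF // subr_gt0.
Qed.

End RadialWeights.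

(** * Test functions in the weighted Bergman space *)

Section WeightedEstimates.
Variables (R : realType) (n : nat) (V : {measure set (CnM R n) -> \bar R}).
Hypotheses (HV : normalized_volume V) (n0 : (0 < n)%N).
Variable omega : R -> R.
Hypotheses (Homega : radial_weight V omega) (HD : Dclass omega).

Let T := CnM R n.
Let w := weight_ext omega.
Let tw := tail_weight omega.
Let w0 := weight_ext_ge0 Homega.
Let mw := measurable_weight_ext Homega.
Let mcn : measurable_fun setT (fun z : T => cnorm (z : Cn R n)) := @measurable_cnorm R n.

Lemma weight_intE (g : T -> R) :
  (\int[V]_(z in (@ball_n R n : set T)) (g z * omega (cnorm (z : Cn R n)))%:E =
   \int[V]_(z in (@ball_n R n : set T)) (g z * w (cnorm (z : Cn R n)))%:E)%E.
Proof.
apply: eq_integral => z /set_mem zB.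
by rewrite /w weight_extE // cnorm_ge0.
Qed.

Section Sphere.
Variable W : {measure set T -> \bar R}.
Hypotheses (W_sf : sigma_finite setT W) (W_fin : (W setT < +oo)%E).
Hypothesis W_rot : forall (g : T -> \bar R) (u : R[i]),
  measurable_fun setT g -> (forall z, 0 <= g z)%E -> cabs u = 1 ->
  (\int[W]_z g (u *: (z : Cn R n))%R = \int[W]_z g z)%E.
Hypothesis WP : forall g : T -> \bar R, measurable_fun setT g -> (forall z, 0 <= g z)%E ->
  (\int[W]_z g z = \int[V]_(z in @shell R n) g (direction z))%E.

Let Sph : set T := [set z : T | cnorm (z : Cn R n) = 1%R].

Let mSph : measurable Sph.
Proof.
rewrite (_ : Sph = (fun z : T => cnorm (z : Cn R n)) @^-1` [set 1]) //.
by rewrite -[X in measurable X]setTI; exact: mcn.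
Qed.

Let m_scale2 (g : T -> R) : measurable_fun setT g ->
  measurable_fun setT (fun x : R * T => (g (x.1%:C%C *: (x.2 : Cn R n)))%:E).
Proof.
move=> mg; apply/measurable_EFinP; apply: (measurableT_comp mg).
by apply: measurable_scale2; [exact: measurable_fst | exact: measurable_snd].
Qed.

Let m_scale (g : T -> R) s : measurable_fun setT g ->
  measurable_fun setT (fun z : T => (g (s%:C%C *: (z : Cn R n)))%:E).
Proof. by move=> mg; apply/measurable_EFinP; apply: (measurableT_comp mg); exact: measurable_scale. Qed.

Lemma sphere_radial (g : T -> R) (h : R -> R) s : 0 <= s ->
  measurable_fun setT g -> (forall z, 0 <= g z) -> measurable_fun setT h -> (forall x, 0 <= h x) ->
  (\int[W]_z (g (s%:C%C *: (z : Cn R n)) * h (cnorm (s%:C%C *: (z : Cn R n))))%:E =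
   (h s)%:E * \int[W]_z (g (s%:C%C *: (z : Cn R n)))%:E)%E.
Proof.
move=> s0 mg g0 mh h0; have mgs := m_scale s mg.
rewrite (sphere_concentrated WP) //; last 2 first.
- have mk : measurable_fun setT (fun z : T => g z * h (cnorm (z : Cn R n))).
    by apply: measurable_funM => //; exact: measurableT_comp mh mcn.
  exact: m_scale mk.
- by move=> z; rewrite lee_fin mulr_ge0.
rewrite (sphere_concentrated WP mgs); last by move=> z; rewrite lee_fin.
rewrite -ge0_integralZl_EFin //; last 2 first.
- by move=> z _; rewrite lee_fin.
- exact: measurable_funTS.
apply: eq_integral => z /set_mem z1; rewrite -EFinM; congr EFin; rewrite mulrC.
by rewrite cnormZ z1 mulr1 cabs_real ger0_norm.
Qed.

Lemma measurable_sphere_int (g : T -> R) : measurable_fun setT g -> (forall z, 0 <= g z) ->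
  measurable_fun setT (fun s : R => \int[W]_z (g (s%:C%C *: (z : Cn R n)))%:E)%E.
Proof.
move=> mg g0; apply: (@measurable_inner_integral _ _ (measurableTypeR R) T R W
  (fun x => (g (x.1%:C%C *: (x.2 : Cn R n)))%:E) W_sf (m_scale2 mg)) => x.
by rewrite lee_fin.
Qed.

Let K := 2 ^+ (2 * n).+1 : R.

Lemma polar_radial_le (g : T -> R) (h : R -> R) :
  measurable_fun setT g -> (forall z, 0 <= g z) -> measurable_fun setT h -> (forall x, 0 <= h x) ->
  (\int[V]_(z in (@ball_n R n : set T)) (g z * h (cnorm (z : Cn R n)))%:E <=
   K%:E * \int[lebesgue_measure]_(s in `]0%R, 1%R[) ((h s)%:E * ((s ^+ (2 * n).-1)%:E *
     \int[W]_z (g (s%:C%C *: (z : Cn R n)))%:E)))%E.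
Proof.
move=> mg g0 mh h0.
have mk : measurable_fun setT (fun z : T => g z * h (cnorm (z : Cn R n))).
  by apply: measurable_funM => //; exact: measurableT_comp mh mcn.
have k0 z : 0 <= g z * h (cnorm (z : Cn R n)) by rewrite mulr_ge0.
apply: (le_trans (polar_le HV n0 mk k0 WP)); apply: lee_wpmul2l; first by rewrite lee_fin exprn_ge0.
rewrite le_eqVlt; apply/orP; left; apply/eqP; apply: eq_integral => s /set_mem.
by rewrite /= in_itv /= => /andP[s0 _]; rewrite sphere_radial ?(ltW s0) // muleCA.
Qed.

Lemma polar_radial_ge (g : T -> R) (h : R -> R) :
  measurable_fun setT g -> (forall z, 0 <= g z) -> measurable_fun setT h -> (forall x, 0 <= h x) ->
  (\int[lebesgue_measure]_(s in `]0%R, 1%R[) ((h s)%:E * ((s ^+ (2 * n).-1)%:E *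
     \int[W]_z (g (s%:C%C *: (z : Cn R n)))%:E)) <=
  \int[V]_(z in (@ball_n R n : set T)) (g z * h (cnorm (z : Cn R n)))%:E)%E.
Proof.
move=> mg g0 mh h0.
have mk : measurable_fun setT (fun z : T => g z * h (cnorm (z : Cn R n))).
  by apply: measurable_funM => //; exact: measurableT_comp mh mcn.
have k0 z : 0 <= g z * h (cnorm (z : Cn R n)) by rewrite mulr_ge0.
apply: le_trans (polar_ge HV n0 mk k0 WP).
rewrite le_eqVlt; apply/orP; left; apply/eqP; apply: eq_integral => s /set_mem.
by rewrite /= in_itv /= => /andP[s0 _]; rewrite sphere_radial ?(ltW s0) // muleCA.
Qed.

Lemma measurable_ball_pow (f : Cn R n -> R[i]) p : holomorphic f ->
  measurable_fun setT (fun z : T => if cnorm (z : Cn R n) < 1 then cabs (f z) `^ p else 0).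
Proof.
move=> hf; pose h : T -> R := (fun z : T => cabs (f z)) \_ (@ball_n R n : set T).
have mh : measurable_fun setT h.
  apply/measurable_restrict => //; first exact: measurable_ball.
  rewrite setTI; apply: ccontinuous_measurable; first exact: copen_ball.
  by move=> z zb; exact: ccontinuous_cabs.
apply: (eq_measurable_fun (fun z : T => if cnorm (z : Cn R n) < 1 then h z `^ p else 0)).
  by move=> z _; case: ifP => // z1; rewrite /h patchE mem_set.
apply: measurable_fun_ifT => //.
  by apply: measurable_fun_ltr => //; exact: measurable_cst.
exact: (measurableT_comp (measurable_powR p)).
Qed.

(** This is [rotation_mean_le] for the spherical measure, centred at 0. It supplies the monotone
    function to which Hardy's inequality applies. *)
Lemma sphere_mean_le (f : Cn R n -> R[i]) p s x : holomorphic f -> 0 < p ->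
  0 < s -> s <= x -> x < 1 ->
  (\int[W]_z (if (cnorm (s%:C%C *: (z : Cn R n)) < 1)%R then cabs (f (s%:C%C *: (z : Cn R n))) `^ p else 0)%:E <=
   \int[W]_z (if (cnorm (x%:C%C *: (z : Cn R n)) < 1)%R then cabs (f (x%:C%C *: (z : Cn R n))) `^ p else 0)%:E)%E.
Proof.
move=> hf p0 s0 sx x1; have x0 : 0 < x by exact: lt_le_trans sx.
have mg := measurable_ball_pow p hf.
have E y : 0 < y -> y < 1 ->
   (\int[W]_z (if (cnorm (y%:C%C *: (z : Cn R n)) < 1)%R then cabs (f (y%:C%C *: (z : Cn R n))) `^ p else 0)%:E =
    \int[W]_(z in Sph) (cabs (f (0 + y%:C%C *: (z : Cn R n))) `^ p)%:E)%E.
  move=> y0 y1; rewrite (sphere_concentrated WP); last 2 first.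
  - exact: (m_scale y mg).
  - by move=> z; rewrite lee_fin; case: ifP => // _; exact: powR_ge0.
  apply: eq_integral => z /set_mem z1; rewrite add0r ifT //.
  by rewrite cnormZ z1 mulr1 cabs_real gtr0_norm.
suff H : (\int[W]_(z in Sph) (cabs (f (0 + s%:C%C *: (z : Cn R n))) `^ p)%:E <=
    \int[W]_(z in Sph) (cabs (f (0 + x%:C%C *: (z : Cn R n))) `^ p)%:E)%E.
  apply: (le_trans _ (le_trans H _)); rewrite le_eqVlt; apply/orP; left; apply/eqP.
    exact: E s0 (le_lt_trans sx x1).
  exact/esym/(E x x0 x1).
apply: (@rotation_mean_le _ _ W W_sf W_rot f p hf p0 Sph 0 1 x x mSph ltr01 x1) => //.
- by move=> u z u1; rewrite /Sph /= cnormZ u1 mul1r.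
- by move=> z ->.
- by apply: le_lt_trans W_fin; apply: le_measure; rewrite ?inE.
- by move=> z y z1 yx; rewrite add0r cnormZ z1 mulr1.
- exact: ltW.
Qed.

(** If z lies in the cap of width t, then s z lies in the Koranyi region of width 2t for 1 - t/2 < s
    < 1. That region has volume of order t^(n+1), and dividing by the length t/2 leaves t^n. *)
Lemma sphere_cap_le : exists2 C : R, 0 < C & forall b t, cnorm b < 1 -> 0 < t ->
  (\int[W]_z (\1_[set z : T | (cabs (1 - cinner (z : Cn R n) b) < t)%R] z)%:E <= (C * t ^+ n)%:E)%E.
Proof.
have [C C0 CP] := volume_koranyi_le HV n0.
have WE : W setT = (fine (W setT))%:E by rewrite fineK // ge0_fin_numE.
set c := fine (W setT) in WE.
have c0 : 0 <= c by rewrite /c fine_ge0.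
(* The three exponents come from (2t)^(n+1), from s >= 1/2 in the density s^(2n-1), and from the
   length t/2. *)
pose A := C * 2 ^+ (n.+1 + (2 * n).-1 + 1).
have A0 : 0 < A by rewrite mulr_gt0 // exprn_gt0.
exists (Num.max (c + 1) A); first by rewrite lt_max A0 orbT.
move=> b t b1 t0; have tn : 0 < t ^+ n by rewrite exprn_gt0.
set cap : set T := [set z : T | _].
have mcap : measurable cap := measurable_cinner_lt b 1 t.
have capW : (\int[W]_z (\1_cap z)%:E = W cap)%E by rewrite integral_indic // setIT.
have [t1|t1] := leP 1 t.
  rewrite capW; apply: (@le_trans _ _ (W setT)); first by apply: le_measure; rewrite ?inE.
  rewrite WE lee_fin; apply: (@le_trans _ _ ((c + 1) * t ^+ n)).
    by have := exprn_ege1 n t1; nra.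
  by rewrite ler_pM2r // le_max lexx.
have WcapE : W cap = (fine (W cap))%:E.
  rewrite fineK // ge0_fin_numE //; apply: le_lt_trans W_fin.
  by apply: le_measure; rewrite ?inE.
have t20 : 0 < 2 * t by rewrite mulr_gt0.
have mk := measurable_indic (koranyi_measurable b (2 * t)) : measurable_fun setT (\1_(koranyi b (2 * t)) : T -> R).
have k0 z : 0 <= (\1_(koranyi b (2 * t)) z : R) by rewrite indicE.
have := polar_ge HV n0 mk k0 WP; rewrite integral_indic; last 2 first.
- exact: measurable_ball.
- exact: koranyi_measurable.
rewrite (_ : koranyi b (2 * t) `&` _ = koranyi b (2 * t)); last first.
  by apply/seteqP; split=> [z []//|z kz]; split=> //; case: kz.
move=> /le_trans /(_ (CP b (2 * t) b1 t20)).
pose I : set (measurableTypeR R) := `]1 - t / 2, 1[%classic.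
have mI : measurable I by exact: measurable_itv.
have mM := measurable_sphere_int mk k0.
have mN : measurable_fun setT (fun s : R => (s ^+ (2 * n).-1)%:E *
    \int[W]_z (\1_(koranyi b (2 * t)) (s%:C%C *: (z : Cn R n)))%:E)%E.
  apply: emeasurable_funM => //; apply/measurable_EFinP.
  by apply: measurable_funX; exact: measurable_id.
have N0 s : 0 <= s -> (0 <= (s ^+ (2 * n).-1)%:E *
    \int[W]_z (\1_(koranyi b (2 * t)) (s%:C%C *: (z : Cn R n)))%:E)%E.
  move=> s0; apply: mule_ge0; first by rewrite lee_fin exprn_ge0.
  by apply: integral_ge0 => z _; rewrite lee_fin.
have LB : ((t / 2 * (2 ^- (2 * n).-1 * fine (W cap)))%:E <=
    \int[lebesgue_measure]_(s in `]0%R, 1%R[) ((s ^+ (2 * n).-1)%:E *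
    \int[W]_z (\1_(koranyi b (2 * t)) (s%:C%C *: (z : Cn R n)))%:E))%E.
  apply: (@le_trans _ _ (\int[lebesgue_measure]_(s in I) ((s ^+ (2 * n).-1)%:E *
    \int[W]_z (\1_(koranyi b (2 * t)) (s%:C%C *: (z : Cn R n)))%:E))%E); last first.
    apply: ge0_subset_integral => //.
    - exact: measurable_funTS.
    - by move=> s /=; rewrite in_itv /= => /andP[s0 _]; apply: N0; exact: ltW.
    - move=> s; rewrite /I /= !in_itv /= => /andP[s0 ->]; rewrite andbT; lra.
  apply: (@le_trans _ _ (\int[lebesgue_measure]_(s in I) (2 ^- (2 * n).-1 * fine (W cap))%:E)%E).
    rewrite integral_cst //= lebesgue_measure_itv /= lte_fin.
    rewrite (_ : 1 - t / 2 < 1); last by lra.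
    by rewrite -EFinB -EFinM lee_fin mulrC; apply: ler_wpM2l; [rewrite mulr_ge0 ?invr_ge0 ?exprn_ge0 ?fine_ge0 | lra].
  apply: ge0_le_integral => //.
  - exact: measurable_funTS.
  move=> s; rewrite /I /= in_itv /= => /andP[s0 s1].
  rewrite EFinM -WcapE -capW; apply: lee_pmul => //.
  - by apply: integral_ge0 => z _; rewrite lee_fin.
  - rewrite lee_fin -exprVn; apply: lerXn2r; rewrite ?nnegrE; lra.
  have m1 : measurable_fun setT (EFin \o (\1_cap : T -> R)).
    by apply/measurable_EFinP; exact: measurable_indic.
  have m2 := m_scale s mk.
  rewrite (sphere_concentrated WP m1); last by move=> z; rewrite lee_fin.
  rewrite (sphere_concentrated WP m2); last by move=> z; rewrite lee_fin.
  apply: ge0_le_integral => //; try exact: measurable_funTS.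
    by move=> z _; rewrite lee_fin.
  move=> z z1; rewrite lee_fin !indicE.
  have [/set_mem zc|_] := boolP (z \in cap); last by rewrite /= ler0n.
  rewrite mem_set //; split.
    by rewrite cnormZ z1 mulr1 cabs_real gtr0_norm //; lra.
  have -> : 1 - cinner (s%:C%C *: (z : Cn R n)) b =
      (1 - cinner (z : Cn R n) b) + (1 - s)%:C%C * cinner (z : Cn R n) b.
    by rewrite cinnerZl realcB realc1; ring.
  apply: (le_lt_trans (cabsD _ _)); rewrite cabsM cabs_real gtr0_norm ?subr_gt0 //.
  have := cauchy_schwarz (z : Cn R n) b; rewrite z1 mul1r => cs.
  move: zc; rewrite /cap /= => zc.
  have := cabs_ge0 (cinner (z : Cn R n) b); nra.
move=> /(le_trans LB); rewrite lee_fin => h.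
rewrite capW WcapE lee_fin; apply: (@le_trans _ _ (A * t ^+ n)); last first.
  by rewrite ler_pM2r // le_max lexx orbT.
have t2 : 0 < t / 2 by rewrite divr_gt0.
rewrite -(ler_pM2l t2) -(ler_pM2l (_ : 0 < 2 ^- (2 * n).-1)) ?invr_gt0 ?exprn_gt0 //.
rewrite mulrCA; apply: (le_trans h); rewrite /A le_eqVlt; apply/orP; left; apply/eqP.
rewrite !exprD exprMn expr1 [t ^+ n.+1]exprS; field.
by rewrite expf_neq0 // pnatr_eq0.
Qed.

(** The weight is replaced by one that varies slowly at the scale 1 - |z|. In polar coordinates this
    is Hardy's inequality for the spherical means of |f|^p multiplied by s^(2n-1), both factors
    being nondecreasing. *)
Lemma weighted_embedding : exists2 C : R, 0 < C & forall (f : Cn R n -> R[i]) p,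
  holomorphic f -> 0 < p ->
  (\int[V]_(z in (@ball_n R n : set T)) (cabs (f z) `^ p *
     (tw (1 - cnorm (z : Cn R n)) / (1 - cnorm (z : Cn R n))))%:E <=
   C%:E * Ap_int V omega p f)%E.
Proof.
have [C C0 CP] := hardy HV n0 Homega HD.
exists (K * C); first by rewrite mulr_gt0 // exprn_gt0.
move=> f p hf p0.
pose g (z : T) : R := if cnorm (z : Cn R n) < 1 then cabs (f z) `^ p else 0.
have mg : measurable_fun setT g := measurable_ball_pow p hf.
have g0 z : 0 <= g z by rewrite /g; case: ifP => // _; exact: powR_ge0.
pose h (x : R) := tw (1 - x) * (1 - x) `^ (-1).
have mh : measurable_fun setT h.
  have ms : measurable_fun setT (fun s : R => 1 - s) by exact: measurable_funB.
  apply: measurable_funM.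
    exact: measurableT_comp (measurable_tail_weight HV n0 Homega HD) ms.
  exact: measurableT_comp (measurable_powR (-1)) ms.
have h0 x : 0 <= h x by rewrite mulr_ge0 ?powR_ge0 // (tail_weight_ge0 HV n0 Homega HD).
rewrite (eq_integral (fun z : T => (g z * h (cnorm (z : Cn R n)))%:E)); last first.
  move=> z /set_mem zB; rewrite /g (zB : cnorm (z : Cn R n) < 1) /h powR_inv1 // subr_ge0.
  exact: ltW.
apply: (le_trans (polar_radial_le mg g0 mh h0)).
rewrite EFinM -muleA; apply: lee_wpmul2l; first by rewrite lee_fin exprn_ge0.
pose N (s : R) : \bar R := ((if 0 < s then s ^+ (2 * n).-1 else 0)%:E *
   \int[W]_z (g (s%:C%C *: (z : Cn R n)))%:E)%E.
have I0 s : (0 <= \int[W]_z (g (s%:C%C *: (z : Cn R n)))%:E)%E.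
  by apply: integral_ge0 => z _; rewrite lee_fin.
have mN : measurable_fun setT N.
  apply: emeasurable_funM; last exact: measurable_sphere_int.
  apply/measurable_EFinP; apply: measurable_fun_ifT => //.
  by apply: measurable_fun_ltr; [exact: measurable_cst | exact: measurable_id].
have N0 s : (0 <= N s)%E.
  by apply: mule_ge0 => //; case: ifP => // s0; rewrite lee_fin exprn_ge0 // ltW.
have NE s : 0 < s -> N s = ((s ^+ (2 * n).-1)%:E * \int[W]_z (g (s%:C%C *: (z : Cn R n)))%:E)%E.
  by rewrite /N => ->.
have Nle s x : 0 < s -> s <= x -> x < 1 -> (N s <= N x)%E.
  move=> s0 sx x1; have x0 := lt_le_trans s0 sx; rewrite (NE s s0) (NE x x0); apply: lee_pmul.
  - by rewrite lee_fin exprn_ge0 // ltW.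
  - exact: I0.
  - by rewrite lee_fin; apply: lerXn2r; rewrite ?nnegrE ?(ltW s0) ?(ltW x0).
  - exact: sphere_mean_le.
apply: (le_trans _ (le_trans (CP N mN N0 Nle) _)).
  rewrite le_eqVlt; apply/orP; left; apply/eqP; apply: eq_integral.
  move=> s /set_mem; rewrite /= in_itv /= => /andP[s0 s1]; rewrite (NE s s0) /h powR_inv1 //.
  by rewrite subr_ge0 ltW.
apply: lee_wpmul2l; first by rewrite lee_fin ltW.
apply: (@le_trans _ _ (\int[lebesgue_measure]_(s in `]0%R, 1%R[) ((w s)%:E *
     ((s ^+ (2 * n).-1)%:E * \int[W]_z (g (s%:C%C *: (z : Cn R n)))%:E)))%E).
  rewrite le_eqVlt; apply/orP; left; apply/eqP; apply: eq_integral.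
  by move=> s /set_mem; rewrite /= in_itv /= => /andP[s0 s1]; rewrite (NE s s0).
apply: (le_trans (polar_radial_ge mg g0 mw w0)).
rewrite /Ap_int weight_intE le_eqVlt; apply/orP; left; apply/eqP.
by apply: eq_integral => z /set_mem zB; rewrite /g (zB : cnorm (z : Cn R n) < 1).
Qed.

(** The slice of the region at radius s is contained in the cap of width t around s a, of measure of
    order t^n, and it is empty for s < 1 - t. What remains of the radial integral is the tail of the
    weight beyond 1 - t. *)
Lemma weighted_koranyi_le : exists2 C : R, 0 < C & forall a t, cnorm a < 1 -> 0 < t ->
  (\int[V]_(z in (@ball_n R n : set T)) (\1_(koranyi a t) z * w (cnorm (z : Cn R n)))%:E <=
   (C * (t ^+ n * tw t))%:E)%E.
Proof.
have [C C0 CP] := sphere_cap_le.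
exists (K * C); first by rewrite mulr_gt0 // exprn_gt0.
move=> a t a1 t0; have tn : 0 <= t ^+ n by rewrite exprn_ge0 // ltW.
have mk := measurable_indic (koranyi_measurable a t) : measurable_fun setT (\1_(koranyi a t) : T -> R).
have k0 z : 0 <= (\1_(koranyi a t) z : R) by rewrite indicE.
apply: (le_trans (polar_radial_le mk k0 mw w0)).
rewrite -mulrA EFinM; apply: lee_wpmul2l; first by rewrite lee_fin exprn_ge0.
pose r := Num.max 0 (1 - t).
have r0 : 0 <= r by rewrite le_max lexx.
have I0 s : (0 <= \int[W]_z (\1_(koranyi a t) (s%:C%C *: (z : Cn R n)))%:E)%E.
  by apply: integral_ge0 => z _; rewrite lee_fin.
have mD : measurable (`]0%R, 1%R[%classic : set (measurableTypeR R)) by exact: measurable_itv.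
apply: (@le_trans _ _ (\int[lebesgue_measure]_(s in `]0%R, 1%R[)
   ((C * t ^+ n)%:E * ((fun s => (w s)%:E) \_ `[r, 1%R[) s))%E).
  have mww : measurable_fun setT (fun s : R => (w s)%:E) by apply/measurable_EFinP.
  apply: ge0_le_integral => //.
  - move=> s; rewrite /= in_itv /= => /andP[s0 _].
    by rewrite !mule_ge0 // lee_fin ?w0 // exprn_ge0 // ltW.
  - apply: measurable_funTS; apply: emeasurable_funM => //; apply: emeasurable_funM.
      by apply/measurable_EFinP; apply: measurable_funX; exact: measurable_id.
    exact: measurable_sphere_int.
  - apply: measurable_funTS; apply: emeasurable_funM; first exact: measurable_cst.
    by apply/measurable_restrict => //; rewrite setTI; exact: measurable_funTS.
  move=> s; rewrite /= in_itv /= => /andP[s0 s1]; rewrite patchE.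
  have capE z : Sph z -> koranyi a t (s%:C%C *: (z : Cn R n)) ->
      cabs (1 - cinner (z : Cn R n) (s%:C%C *: a)) < t.
    by move=> z1 [_]; rewrite cinnerZl cinnerZr conjc_real.
  case: ifPn => [_|sI].
    rewrite [leRHS]muleC; apply: lee_wpmul2l; first by rewrite lee_fin w0.
    apply: (@le_trans _ _ (\int[W]_z (\1_(koranyi a t) (s%:C%C *: (z : Cn R n)))%:E)%E).
      rewrite -[leRHS]mul1e; apply: lee_wpmul2r => //; rewrite lee_fin exprn_ile1 // ltW //.
    have m2 := m_scale s mk.
    have sa1 : cnorm (s%:C%C *: a) < 1.
      by rewrite cnormZ cabs_real gtr0_norm //; have := cnorm_ge0 a; nra.
    apply: le_trans (CP (s%:C%C *: a) t sa1 t0).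
    have m1 : measurable_fun setT (EFin \o (\1_[set z : T | (cabs (1 - cinner (z : Cn R n) (s%:C%C *: a)) < t)%R] : T -> R)).
      apply/measurable_EFinP; apply: measurable_indic; exact: measurable_cinner_lt.
    rewrite (sphere_concentrated WP m1); last by move=> z; rewrite lee_fin.
    rewrite (sphere_concentrated WP m2); last by move=> z; rewrite lee_fin.
    apply: ge0_le_integral => //; try exact: measurable_funTS.
    move=> z z1; rewrite lee_fin !indicE.
    have [/set_mem zc|_] := boolP (_ \in koranyi a t); last by rewrite /= ler0n.
    by rewrite mem_set //; apply: capE.
  rewrite mule0 (_ : (\int[W]_z _)%E = 0%E) ?mule0 //.
  rewrite (sphere_concentrated WP (m_scale s mk)); last by move=> z; rewrite lee_fin.
  rewrite integral0_eq // => z z1; rewrite indicE memNset // => -[_].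
  apply/negP; rewrite -leNgt; move: sI; rewrite notin_setE /= in_itv /= s1 andbT => /negP.
  rewrite -ltNge /r lt_max ltNge (ltW s0) /= => st.
  apply: le_trans (ler_cabsB _ _); rewrite cabs1.
  have := cauchy_schwarz (s%:C%C *: (z : Cn R n)) a.
  rewrite cnormZ cabs_real gtr0_norm // z1 mulr1; have := cnorm_ge0 a; nra.
rewrite mulrA [(_ * tw t)%:E]EFinM /tw (tail_weightE HV n0 Homega HD) (hat_ext _ r0).
rewrite ge0_integralZl_EFin //; last 3 first.
- by move=> s _; rewrite patchE; case: ifP => // _; rewrite lee_fin w0.
- apply: measurable_funTS; apply/measurable_restrict => //; rewrite setTI.
  by apply: measurable_funTS; apply/measurable_EFinP.
- by rewrite mulr_ge0 // ltW.
apply: lee_wpmul2l; first by rewrite lee_fin mulr_ge0 // ltW.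
rewrite [leRHS]integral_mkcond; apply: ge0_subset_integral => //.
- apply/measurable_restrict => //; rewrite setTI.
  by apply: measurable_funTS; apply/measurable_EFinP.
- by move=> s _; rewrite patchE; case: ifP => // _; rewrite lee_fin w0.
Qed.

End Sphere.

Lemma weighted_embeddingP : exists2 C : R, 0 < C & forall (f : Cn R n -> R[i]) p,
  holomorphic f -> 0 < p ->
  (\int[V]_(z in (@ball_n R n : set T)) (cabs (f z) `^ p *
     (tw (1 - cnorm (z : Cn R n)) / (1 - cnorm (z : Cn R n))))%:E <=
   C%:E * Ap_int V omega p f)%E.
Proof.
have [W [W_sf W_fin W_rot WP]] := sphere_measureP HV.
exact: (weighted_embedding W_sf W_fin W_rot WP).
Qed.

(** The quantity W of the overview as a function of t = 1 - |a|. By [weighted_koranyi_le] it bounds,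
    up to a constant, the weighted volume of a Koranyi region of width t. *)
Definition box_weight (t : R) : R := t ^+ n * tw t.

Lemma box_weight_ge0 t : 0 <= t -> 0 <= box_weight t.
Proof. by move=> t0; rewrite mulr_ge0 ?exprn_ge0 // (tail_weight_ge0 HV n0 Homega HD). Qed.

Lemma box_weight_gt0 t : 0 < t -> 0 < box_weight t.
Proof. by move=> t0; rewrite mulr_gt0 ?exprn_gt0 // (tail_weight_gt0 HV n0 Homega HD). Qed.

Lemma box_weight_le s t : 0 <= s -> s <= t -> box_weight s <= box_weight t.
Proof.
move=> s0 st; apply: ler_pM; rewrite ?exprn_ge0 ?(tail_weight_ge0 HV n0 Homega HD) //.
  by apply: lerXn2r; rewrite ?nnegrE // (le_trans s0).
exact: (tail_weight_le HV n0 Homega HD).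
Qed.

Lemma box_weight_double : exists2 C : R, 1 <= C & forall t, 0 < t ->
  box_weight (2 * t) <= C * box_weight t.
Proof.
have [C C1 CP] := tail_weight_double HV n0 Homega HD.
have e1 : 1 <= (2 : R) ^+ n by rewrite exprn_ege1 // ler1n.
exists (2 ^+ n * C); first by nra.
move=> t t0; rewrite /box_weight exprMn.
apply: (@le_trans _ _ (2 ^+ n * t ^+ n * (C * tw t))).
  by apply: ler_wpM2l; [rewrite mulr_ge0 ?exprn_ge0 // ltW | exact: CP].
by rewrite le_eqVlt; apply/orP; left; apply/eqP; ring.
Qed.

Lemma powR_exp (a p : R) j : 0 <= a -> (a ^+ j) `^ p = (a `^ p) ^+ j.
Proof. move=> a0; elim: j => [|j IH]; first by rewrite !expr0 powR1.
by rewrite !exprS powRM ?exprn_ge0 // IH. Qed.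

Definition test_fun (N : nat) (a z : Cn R n) : R[i] :=
  ((1 - cnorm a)%:C%C / (1 - cinner z a)) ^+ N.

Lemma test_fun_holomorphic N a : cnorm a < 1 -> holomorphic (test_fun N a).
Proof.
move=> a1 z z1; apply: holoX; apply: holoM; first exact: holo_cst.
apply: holoV; last exact: one_sub_cinner_neq0 z1 (ltW a1).
apply: holoD; first exact: holo_cst.
have E : (fun z => - cinner z a) = (fun z => \sum_(j < n) (- conjc (a 0 j)) * z 0 j).
  apply/funext => y; rewrite /cinner -sumrN; apply: eq_bigr => j _; ring.
by rewrite E; apply: holo_sum => j; apply: holoZ; exact: holo_coord.
Qed.

Lemma cabs_test_fun N a z : cnorm a < 1 ->
  cabs (test_fun N a z) = ((1 - cnorm a) / cabs (1 - cinner z a)) ^+ N.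
Proof. by move=> a1; rewrite /test_fun cabsX cabsM cabsV cabs_real gtr0_norm // subr_gt0. Qed.

Lemma half_sum_le J : \sum_(j < J) (1 / 2 : R) ^+ j <= 2.
Proof.
suff -> : \sum_(j < J) (1 / 2 : R) ^+ j = 2 - 2 * (1 / 2) ^+ J.
  by rewrite gerBl mulr_ge0 // exprn_ge0 // divr_ge0.
elim: J => [|J IH]; first by rewrite big_ord0 expr0 mulr1 subrr.
by rewrite big_ord_recr /= IH exprS; field.
Qed.

Lemma dyadic (x : R) : 1 <= x -> exists j, 2 ^+ j <= x < 2 ^+ j.+1.
Proof.
move=> x1; have x0 : 0 <= x by exact: le_trans x1.
have /andP[t1 t2] := truncn_itv x0.
have tr : (0 < Num.truncn x)%N.
  by rewrite lt0n; apply/eqP => h; rewrite h in t2; move: x1; rewrite leNgt t2.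
have /andP[h1 h2] := trunc_log_bounds (leqnn 2) tr.
exists (trunc_log 2 (Num.truncn x)); apply/andP; split.
  by apply: le_trans t1; rewrite -natrX ler_nat.
by apply: (lt_le_trans t2); rewrite -natrX ler_nat.
Qed.

Lemma exists_pow_ge (x : R) : exists j, x <= 2 ^+ j.
Proof.
exists (Num.truncn x).+1; have [x0|x0] := leP 0 x; last by apply: (le_trans (ltW x0)); rewrite exprn_ge0.
have /andP[_ /ltW t2] := truncn_itv x0; apply: (le_trans t2).
by rewrite -natrX ler_nat ltnW // ltn_expl.
Qed.

(** * Norms and decay of the test functions *)

Section TestFunctions.
Variable p : R.
Hypothesis p0 : 0 < p.

Lemma test_exponent (c : R) : 0 < c -> exists N : nat, ((1 / 2) ^+ N) `^ p * c <= 1.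
Proof.
move=> c0; pose x := (1 / 2 : R) `^ p.
have x0 : 0 <= x by exact: powR_ge0.
have x1 : x < 1.
  have e1 : 1 = 1 `^ p :> R by rewrite powR1.
  rewrite /x [ltRHS]e1; have := @gt0_ltr_powR R p p0 (1 / 2) 1.
  by rewrite !nnegrE; apply; lra.
have : `|x| < 1 by rewrite ger0_norm.
move=> /cvg_expr /cvgrPdist_lt /(_ c^-1); rewrite invr_gt0 => /(_ c0) [N _ /(_ N (leqnn N))].
rewrite sub0r normrN ger0_norm ?exprn_ge0 // => h; exists N.
by rewrite powR_exp ?divr_ge0 // -ler_pdivlMr // (div1r c) ltW.
Qed.

(** The ball is cut according to the dyadic size of |1 - <z,a>| / (1 - |a|): on the piece at scale
    2^j the function |f_a|^p is at most b^j, while the weighted volume grows at most like D^(j+1).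
    The last conclusion, with its extra factor t, is what makes the normalized test functions tend
    to 0 pointwise. *)
Lemma test_fun_integral : exists (N : nat) (C : R), [/\ 0 < C,
  forall a, cnorm a < 1 ->
    (Ap_int V omega p (test_fun N a) <= (C * box_weight (1 - cnorm a))%:E)%E &
  forall t, 0 < t <= 1 -> (t ^+ N) `^ p <= C * (t * box_weight t)].
Proof.
have [W [W_sf W_fin W_rot WP]] := sphere_measureP HV.
have [C0 C00 C0P] := weighted_koranyi_le W_sf W_fin WP.
have [D D1 DP] := box_weight_double; have D0 : 0 < D by exact: lt_le_trans D1.
(* b D <= 1/2 already makes the dyadic sum converge; in the induction for the last conclusion the
   same bound in the form 2 b D <= 1 absorbs the extra factor t as well. *)
have [N NP] := test_exponent (mulr_gt0 (ltr0Sn R 1) D0 : 0 < 2 * D).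
set b := ((1 / 2) ^+ N) `^ p in NP.
have b0 : 0 <= b by exact: powR_ge0.
have bD : b * D <= 1 / 2 by lra.
have twh : 0 < box_weight (1 / 2) by apply: box_weight_gt0; rewrite divr_gt0.
pose A := 2 / box_weight (1 / 2).
have A0 : 0 < A by rewrite divr_gt0.
exists N, (Num.max (2 * (C0 * D)) A); split.
- by rewrite lt_max A0 orbT.
- move=> a a1; set d := 1 - cnorm a.
  have d0 : 0 < d by rewrite subr_gt0.
  (* Since |1 - <z,a>| < 2 on the ball, the scales below [J] suffice. *)
  have [J JP] := exists_pow_ge (2 / d).
  pose t j : R := 2 ^+ j.+1 * d.
  have t0 j : 0 < t j by rewrite mulr_gt0 // exprn_gt0.
  have bt j : box_weight (t j) <= D ^+ j.+1 * box_weight d.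
    elim: j => [|j IH]; first by rewrite /t !expr1 DP.
    rewrite /t exprS -mulrA; apply: (le_trans (DP _ _)); first exact: t0.
    by rewrite [D ^+ j.+2]exprS -mulrA ler_pM2l.
  rewrite /Ap_int weight_intE.
  have g0 j z : 0 <= b ^+ j * (\1_(koranyi a (t j)) (z : T) * w (cnorm (z : Cn R n))).
    by rewrite mulr_ge0 ?exprn_ge0 // mulr_ge0 // w0.
  have mg0 j : measurable_fun setT (fun z : T => \1_(koranyi a (t j)) (z : T) * w (cnorm (z : Cn R n))).
    apply: measurable_funM; last exact: measurableT_comp mw mcn.
    by apply: measurable_indic; exact: koranyi_measurable.
  have mg j : measurable_fun (@ball_n R n : set T)
      (fun z : T => (b ^+ j * (\1_(koranyi a (t j)) (z : T) * w (cnorm (z : Cn R n))))%:E).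
    by apply/measurable_EFinP; apply: measurable_funTS; apply: measurable_funM; [exact: measurable_cst|].
  have mB : measurable (@ball_n R n : set T) := @measurable_ball R n.
  apply: (@le_trans _ _ (\int[V]_(z in (@ball_n R n : set T))
      (\sum_(j < J) (b ^+ j * (\1_(koranyi a (t j)) (z : T) * w (cnorm (z : Cn R n))))%:E))%E).
    apply: ge0_le_integral => //.
    + by move=> z _; rewrite lee_fin mulr_ge0 ?powR_ge0 // w0.
    + apply/measurable_EFinP; apply: measurable_funM; last first.
        by apply: measurable_funTS; exact: measurableT_comp mw mcn.
      apply: (eq_measurable_fun (fun z : T => if cnorm (z : Cn R n) < 1 then
         cabs (test_fun N a z) `^ p else 0)).
        by move=> z /set_mem zB; rewrite (zB : cnorm (z : Cn R n) < 1).
      by apply: measurable_funTS; apply: measurable_ball_pow; exact: test_fun_holomorphic.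
    + by apply: emeasurable_fun_sum => j; exact: mg.
    move=> z zB; set m := cabs (1 - cinner (z : Cn R n) a).
    have md : d <= m.
      rewrite /m /d; apply: le_trans (ler_cabsB _ _); rewrite cabs1 lerD2l lerN2.
      apply: (le_trans (cauchy_schwarz _ _)); have := cnorm_ge0 a.
      by have : cnorm (z : Cn R n) < 1 := zB; nra.
    have m2 : m < 2.
      rewrite /m; apply: (le_lt_trans (cabsD _ _)); rewrite cabs1 cabsN.
      have := cauchy_schwarz (z : Cn R n) a; have := cnorm_ge0 a.
      by have := cnorm_ge0 (z : Cn R n); have : cnorm (z : Cn R n) < 1 := zB; nra.
    have m0 : 0 < m by exact: lt_le_trans md.
    have [|j /andP[j1 j2]] := @dyadic (m / d); first by rewrite ler_pdivlMr // mul1r.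
    have jJ : (j < J)%N.
      have : (2 : R) ^+ j < 2 ^+ J.
        apply: (le_lt_trans j1); apply: lt_le_trans JP; by rewrite ltr_pM2r // invr_gt0.
      by rewrite -!natrX ltr_nat ltn_exp2l.
    rewrite sumEFin lee_fin (bigD1 (Ordinal jJ)) //=.
    apply: (@le_trans _ _ (b ^+ j * (\1_(koranyi a (t j)) (z : T) * w (cnorm (z : Cn R n))))); last first.
      by rewrite lerDl; apply: sumr_ge0 => i _; exact: g0.
    have -> : (\1_(koranyi a (t j)) (z : T) : R) = 1.
      rewrite indicE mem_set //; split; first exact: zB.
      by rewrite /t -ltr_pdivrMr.
    rewrite mul1r; apply: ler_wpM2r; first exact: w0.
    rewrite cabs_test_fun // -/d -/m /b -powR_exp ?exprn_ge0 ?divr_ge0 //.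
    apply: powR_le; [exact: ltW | by rewrite exprn_ge0 // divr_ge0 ?ltW |].
    rewrite -exprM mulnC exprM; have dm0 : 0 <= d / m by rewrite divr_ge0 // ltW.
    apply: lerXn2r; rewrite ?nnegrE ?dm0 ?exprn_ge0 ?divr_ge0 //.
    rewrite expr_div_n expr1n div1r -[d / m]invrK lef_pV2 ?posrE ?exprn_gt0 ?invr_gt0 ?divr_gt0 //.
    by rewrite invf_div.
  rewrite ge0_integral_sum //; last by move=> j z _; rewrite lee_fin g0.
  apply: (@le_trans _ _ (\sum_(j < J) (C0 * D * box_weight d * (1 / 2) ^+ j)%:E)%E).
    apply: lee_sum => j _.
    under eq_integral do rewrite EFinM.
    rewrite ge0_integralZl_EFin //; last 3 first.
    + by move=> z _; rewrite lee_fin mulr_ge0 // w0.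
    + by apply/measurable_EFinP; apply: measurable_funTS; exact: mg0.
    + by rewrite exprn_ge0.
    apply: (@le_trans _ _ ((b ^+ j)%:E * (C0 * (D ^+ j.+1 * box_weight d))%:E)%E).
      apply: lee_wpmul2l; first by rewrite lee_fin exprn_ge0.
      apply: (le_trans (C0P a (t j) a1 (t0 j))); rewrite lee_fin ler_pM2l //; exact: bt.
    rewrite -EFinM lee_fin.
    have -> : b ^+ j * (C0 * (D ^+ j.+1 * box_weight d)) = C0 * D * box_weight d * (b * D) ^+ j.
      by rewrite exprS exprMn; ring.
    apply: ler_wpM2l; first by rewrite mulr_ge0 ?box_weight_ge0 ?(ltW d0) // mulr_ge0 // ltW.
    by apply: lerXn2r; rewrite ?nnegrE ?divr_ge0 // mulr_ge0 // ltW.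
  rewrite sumEFin lee_fin -mulr_sumr.
  have P0 : 0 <= C0 * D * box_weight d by rewrite mulr_ge0 ?box_weight_ge0 ?(ltW d0) // mulr_ge0 // ltW.
  apply: (@le_trans _ _ (2 * (C0 * D) * box_weight d)).
    by have := half_sum_le J; nra.
  by apply: ler_wpM2r; [exact: box_weight_ge0 (ltW d0) | rewrite le_max lexx].
(* Induction on the number of doublings that bring t to [1/2, 1]. There [A] is chosen so that the
   right side is at least 1; halving t multiplies the left side by b and divides the right side by
   at most 2 D. *)
- suff H j t : 0 < t -> t <= 1 -> 1 / 2 <= 2 ^+ j * t -> (t ^+ N) `^ p <= A * (t * box_weight t).
    move=> t /andP[t0 t1]; have [j jP] := exists_pow_ge t^-1.
    apply: (@le_trans _ _ (A * (t * box_weight t))).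
      apply: (H j) => //; apply: (@le_trans _ _ 1); first lra.
      by rewrite -ler_pdivrMr // div1r.
    apply: ler_wpM2r; first by rewrite mulr_ge0 ?box_weight_ge0 ?ltW.
    by rewrite le_max lexx orbT.
  elim: j t => [|j IH] t t0 t1 ht.
    rewrite expr0 (mul1r t) in ht.
    apply: (@le_trans _ _ 1).
      have e1 : 1 = 1 `^ p :> R by rewrite powR1.
      rewrite [leRHS]e1; apply: powR_le; rewrite ?exprn_ge0 ?exprn_ile1 ?(ltW t0) ?(ltW p0) //.
    have hb : box_weight (1 / 2) <= box_weight t by apply: box_weight_le => //; rewrite divr_ge0.
    rewrite /A mulrAC ler_pdivlMr // (mul1r (box_weight _)).
    have y0 : 0 <= box_weight t by exact: le_trans (ltW twh) hb.
    have h1 : 0 <= (2 * t - 1) * box_weight t by rewrite mulr_ge0 //; lra.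
    have -> : 2 * (t * box_weight t) = (2 * t - 1) * box_weight t + box_weight t by ring.
    lra.
  have [h2|h2] := leP (1 / 2) t; first by apply: IH => //; have := exprn_ege1 j (ler1n R 2); nra.
  have t2 : 0 < 2 * t by rewrite mulr_gt0.
  have := IH (2 * t) t2 (ltac:(lra)); rewrite mulrA -exprSr => /(_ ht) h3.
  have -> : (t ^+ N) `^ p = b * ((2 * t) ^+ N) `^ p.
    rewrite /b -powRM ?exprn_ge0 ?divr_ge0 ?ltW // -exprMn; congr ((_ ^+ _) `^ _).
    by field.
  apply: (@le_trans _ _ (b * (A * (2 * t * (D * box_weight t))))).
    apply: ler_wpM2l => //; apply: (le_trans h3); rewrite ler_pM2l // ler_pM2l //; exact: DP.
  have -> : b * (A * (2 * t * (D * box_weight t))) = (2 * (b * D)) * (A * (t * box_weight t)) by ring.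
  have P0 : 0 <= A * (t * box_weight t).
    by rewrite mulr_ge0 ?(ltW A0) // mulr_ge0 ?box_weight_ge0 ?(ltW t0).
  by rewrite ler_piMl //; lra.
Qed.

End TestFunctions.

End WeightedEstimates.

(** * Carleson measures and Bergman balls *)

(** It serves twice: as centres of a countable cover of the ball by pseudohyperbolic balls, and as
    the points on which a subsequence of a normal family is made to converge. *)
Lemma dense_sequence (R : realType) (n : nat) : exists s : nat -> Cn R n,
  forall z e, 0 < e -> exists i, cnorm (s i - z) < e.
Proof.
pose pt (x : {ffun 'I_n -> rat * rat}) : Cn R n :=
  \row_j ((ratr (x j).1)%:C%C + (ratr (x j).2)%:C%C * 'i%C).
exists (fun i => if unpickle i is Some x then pt x else 0) => z e e0.
pose dl := e / (2 * n.+1%:R).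
have dl0 : 0 < dl by rewrite divr_gt0 // mulr_gt0.
have /choice [f fP] : forall j : 'I_n, exists x : rat * rat,
    `|ratr x.1 - cre (z 0 j)| < dl /\ `|ratr x.2 - cim (z 0 j)| < dl.
  move=> j; have L (x : R) : x - dl < x + dl by lra.
  have [a ha] := rat_in_itvoo (L (cre (z 0 j))).
  have [b hb] := rat_in_itvoo (L (cim (z 0 j))).
  exists (a, b); move: ha hb; rewrite !in_itv /= !ltr_norml; lra.
exists (pickle (finfun f)); rewrite pickleK; apply: (le_lt_trans (cnorm_le_sum _)).
have : \sum_(j < n) cabs ((pt (finfun f) - z) 0 j) <= \sum_(j < n) (2 * dl).
  apply: ler_sum => j _; apply: le_trans (cabs_le_reim _) _.
  have [h1 h2] := fP j; rewrite !mxE ffunE.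
  have -> : cre ((ratr (f j).1)%:C%C + (ratr (f j).2)%:C%C * 'i%C - z 0 j) = ratr (f j).1 - cre (z 0 j).
    by rewrite !creE creM creN !cre_real !cim_real /cre /cim /=; ring.
  have -> : cim ((ratr (f j).1)%:C%C + (ratr (f j).2)%:C%C * 'i%C - z 0 j) = ratr (f j).2 - cim (z 0 j).
    by rewrite !cimE cimM cimN !cre_real !cim_real /cre /cim /=; ring.
  lra.
move/le_lt_trans; apply; rewrite sumr_const card_ord /dl.
have n2 : (n%:R : R) < n.+1%:R by rewrite ltr_nat.
have -> : 2 * (e / (2 * n.+1%:R)) *+ n = e * (n%:R / n.+1%:R).
  by rewrite -[_ *+ n]mulr_natr; field; rewrite ?gt_eqF.
by rewrite gtr_pMr // ltr_pdivrMr // mul1r.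
Qed.

Lemma powRN_le (R : realType) (D x y s : R) : 0 <= D -> 0 < x -> 0 < y -> 0 <= s ->
  y <= D * x -> x `^ (- s) <= D `^ s * y `^ (- s).
Proof.
move=> D0 x0 y0 s0 yD; rewrite !powRN ler_pdivlMr ?powR_gt0 // mulrC ler_pdivrMr ?powR_gt0 //.
by rewrite -powRM ?(ltW x0) //; apply: powR_le => //; exact: ltW.
Qed.

Section BergmanNear.
Variables (R : realType) (n : nat).
Implicit Types z w : Cn R n.

(* For points of the ball this says that the pseudohyperbolic distance is below 1/2. *)
Definition near_ball z w := [/\ cnorm z < 1, cnorm w < 1 &
  3 / 4 * cabs (1 - cinner w z) ^+ 2 < (1 - cnorm z ^+ 2) * (1 - cnorm w ^+ 2)].

Lemma near_ballP z w : cnorm z < 1 -> cnorm w < 1 ->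
  near_ball z w <-> pseudohyp z w < 1 / 2.
Proof.
move=> z1 w1; have := auto_ball_norm z1 w1; rewrite -/(pseudohyp z w) => E.
have c0 := cabs_one_sub_cinner_gt0 w1 (ltW z1).
have c2 : 0 < cabs (1 - cinner w z) ^+ 2 by rewrite exprn_gt0.
have r0 := pseudohyp_ge0 z w.
have : (3 / 4 * cabs (1 - cinner w z) ^+ 2 < (1 - cnorm z ^+ 2) * (1 - cnorm w ^+ 2)) =
   (3 / 4 < 1 - pseudohyp z w ^+ 2) by rewrite E ltr_pdivlMr.
move=> E2; split.
  by move=> [_ _]; rewrite E2 => h; nra.
by move=> h; split=> //; rewrite E2; nra.
Qed.

Lemma near_ballC z w : near_ball z w -> near_ball w z.
Proof.
move=> [z1 w1 h]; split=> //; rewrite [ltRHS]mulrC.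
by rewrite -cabs_conjc conjcB conjc_one -cinnerC.
Qed.

(** With d = 1 - |z|, e = 1 - |w| and m = |1 - <w,z>|, one has d, e <= m, and the condition gives
    3/4 m^2 < 4 d e. Hence d, e and m are comparable with ratio at most 16/3, rounded up to 8. *)
Lemma near_ball_dist z w : near_ball z w ->
  [/\ 1 - cnorm z <= 8 * (1 - cnorm w), 1 - cnorm w <= 8 * (1 - cnorm z) &
      cabs (1 - cinner w z) <= 8 * (1 - cnorm z)].
Proof.
move=> [z1 w1]; have z0 := cnorm_ge0 z; have w0 := cnorm_ge0 w.
have : 1 - cnorm z * cnorm w <= cabs (1 - cinner w z).
  apply: le_trans (ler_cabsB _ _); rewrite cabs1 lerD2l lerN2 mulrC.
  exact: cauchy_schwarz.
move: (cabs _) => m hm; move: (cnorm z) (cnorm w) z0 w0 z1 w1 hm => a b a0 b0 a1 b1 hm h.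
pose d := 1 - a; pose e := 1 - b.
have aE : a = 1 - d by rewrite /d; ring.
have bE : b = 1 - e by rewrite /e; ring.
have d0 : 0 < d by rewrite /d; lra.
have e0 : 0 < e by rewrite /e; lra.
have d1 : d <= 1 by rewrite /d; lra.
have e1 : e <= 1 by rewrite /e; lra.
rewrite -/d -/e; rewrite aE bE in hm h.
have md : d <= m by nra.
have me : e <= m by nra.
have h2 : (1 - (1 - d) ^+ 2) * (1 - (1 - e) ^+ 2) <= 4 * (d * e).
  have -> : 1 - (1 - d) ^+ 2 = d * (2 - d) by ring.
  have -> : 1 - (1 - e) ^+ 2 = e * (2 - e) by ring.
  have de : 0 < d * e by rewrite mulr_gt0.
  have -> : d * (2 - d) * (e * (2 - e)) = d * e * ((2 - d) * (2 - e)) by ring.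
  have : (2 - d) * (2 - e) <= 4 by nra.
  nra.
have h3 : 3 / 4 * m ^+ 2 < 4 * (d * e) by exact: lt_le_trans h h2.
have m2d : d ^+ 2 <= m ^+ 2 by nra.
have m2e : e ^+ 2 <= m ^+ 2 by nra.
have dE : d <= 8 * e by nra.
have eD : e <= 8 * d by nra.
split=> //; nra.
Qed.

(** Expanding |z + w|^2 costs 3/64 of 1 - |z|^2 and 1 - <z + w,z> costs 1/64 of it; the point stays
    near since 3/4 (1 + 1/64)^2 < 1 - 3/64. The first conclusion keeps all translates in one ball of
    radius less than 1, as the means over rotation-invariant sets demand. *)
Lemma near_ball_translate z w : cnorm z < 1 ->
  small_polydisc z ((1 - cnorm z) / 64) w ->
  cnorm (z + w) ^+ 2 <= 1 - (1 - 3 / 64) * (1 - cnorm z ^+ 2) /\ near_ball z (z + w).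
Proof.
move=> z1 [wn wz]; have z0 := cnorm_ge0 z.
pose A := 1 - cnorm z ^+ 2.
have dA : 1 - cnorm z <= A by rewrite /A; nra.
have A0 : 0 < A by lra.
have h1 : cnorm (z + w) ^+ 2 <= 1 - (1 - 3 / 64) * A.
  rewrite cnormD_sq cinnerC cre_conjc mulr2n.
  have := cre_le_cabs (cinner w z); rewrite ler_norml /A; move: wn wz dA; rewrite /A.
  move: (cre _) (cabs _) => x y; lra.
have zw1 : cnorm (z + w) < 1.
  rewrite -(@ltr_pXn2r _ 2) ?nnegrE ?cnorm_ge0 // expr1n; lra.
split=> //; split=> //.
have E : 1 - cinner (z + w) z = A%:C%C - cinner w z.
  by rewrite cinnerDl cinner_self /A realcB realc1; ring.
have h2 : cabs (1 - cinner (z + w) z) <= (1 + 1 / 64) * A.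
  rewrite E; apply: (le_trans (cabsD _ _)); rewrite cabsN cabs_real gtr0_norm //; lra.
have h3 : (1 - 3 / 64) * A <= 1 - cnorm (z + w) ^+ 2 by lra.
have h4 := cabs_ge0 (1 - cinner (z + w) z).
rewrite -/A; apply: (@lt_le_trans _ _ (A * ((1 - 3 / 64) * A))); last by rewrite ler_pM2l.
move: h2 h4; move: (cabs _) => m h2 h4; nra.
Qed.

Let T := CnM R n.

Lemma measurable_near_ball d (X : measurableType d) (F G : X -> T) :
  measurable_fun setT F -> measurable_fun setT G ->
  measurable [set x | near_ball (F x) (G x)].
Proof.
move=> mF mG.
have mnF : measurable_fun setT (fun x => cnorm (F x : Cn R n)) by exact: measurableT_comp (@measurable_cnorm R n) mF.
have mnG : measurable_fun setT (fun x => cnorm (G x : Cn R n)) by exact: measurableT_comp (@measurable_cnorm R n) mG.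
have mre j : measurable_fun setT (fun x => cre (F x 0 j)) by exact: measurableT_comp (@measurable_cre R n j) mF.
have mim j : measurable_fun setT (fun x => cim (F x 0 j)) by exact: measurableT_comp (@measurable_cim R n j) mF.
have mre' j : measurable_fun setT (fun x => cre (G x 0 j)) by exact: measurableT_comp (@measurable_cre R n j) mG.
have mim' j : measurable_fun setT (fun x => cim (G x 0 j)) by exact: measurableT_comp (@measurable_cim R n j) mG.
have cst (c : R) : measurable_fun setT (fun _ : X => c) by exact: measurable_cst.
have mc : measurable_fun setT (fun x => cabs (1 - cinner (G x : Cn R n) (F x)) ^+ 2).
  apply: (eq_measurable_fun (fun x =>
    (1 - \sum_(j < n) (cre (G x 0 j) * cre (F x 0 j) + cim (G x 0 j) * cim (F x 0 j))) ^+ 2 +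
    (\sum_(j < n) (cim (G x 0 j) * cre (F x 0 j) - cre (G x 0 j) * cim (F x 0 j))) ^+ 2)).
    move=> x _; rewrite cabs_sq creE creN cre1 cimE cimN cim1 /cinner cre_sum cim_sum.
    congr (_ + _); last rewrite add0r sqrrN; congr (_ ^+ 2); first congr (1 - _);
      apply: eq_bigr => j _; rewrite ?creM ?cimM cre_conjc cim_conjc; ring.
  apply: measurable_funD; apply: measurable_funX.
    apply: measurable_funB => //; apply: measurable_sum => j.
    by apply: measurable_funD; exact: measurable_funM.
  apply: measurable_sum => j.
  by apply: measurable_funB; exact: measurable_funM.
have mb : measurable_fun setT (fun x => [&& cnorm (F x : Cn R n) < 1, cnorm (G x : Cn R n) < 1 &
   3 / 4 * cabs (1 - cinner (G x : Cn R n) (F x)) ^+ 2 <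
     (1 - cnorm (F x : Cn R n) ^+ 2) * (1 - cnorm (G x : Cn R n) ^+ 2)]).
  apply: measurable_and; first exact: measurable_fun_ltr.
  apply: measurable_and; first exact: measurable_fun_ltr.
  apply: measurable_fun_ltr; first exact: measurable_funM.
  by apply: measurable_funM; apply: measurable_funB => //; exact: measurable_funX.
rewrite (_ : [set x | _] = (fun x => [&& cnorm (F x : Cn R n) < 1, cnorm (G x : Cn R n) < 1 &
   3 / 4 * cabs (1 - cinner (G x : Cn R n) (F x)) ^+ 2 <
     (1 - cnorm (F x : Cn R n) ^+ 2) * (1 - cnorm (G x : Cn R n) ^+ 2)]) @^-1` [set true]).
  by rewrite -[X in measurable X]setTI; apply: mb.
apply/seteqP; split=> x /=; first by move=> [-> -> ->].
by move=> /and3P[].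
Qed.

End BergmanNear.

(** * From pseudohyperbolic balls to the embedding *)

Section CarlesonEmbedding.
Variables (R : realType) (n : nat) (V : {measure set (CnM R n) -> \bar R}).
Hypotheses (HV : normalized_volume V) (n0 : (0 < n)%N).
Variable omega : R -> R.
Hypotheses (Homega : radial_weight V omega) (HD : Dclass omega).
Variable p : R.
Hypothesis p0 : 0 < p.

Let T := CnM R n.
Let B : set T := @ball_n R n.
Let mB : measurable B := @measurable_ball R n.
Let mcn : measurable_fun setT (fun z : T => cnorm (z : Cn R n)) := @measurable_cnorm R n.
Let bw (z : Cn R n) : R := @box_weight R n omega (1 - cnorm z).

Let bw_gt0 z : cnorm z < 1 -> 0 < bw z.
Proof. by move=> z1; apply: (box_weight_gt0 HV n0 Homega HD); rewrite subr_gt0. Qed.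

Let bpow (f : Cn R n -> R[i]) (z : T) : R := if cnorm (z : Cn R n) < 1 then cabs (f z) `^ p else 0.

Let bpow0 f z : 0 <= bpow f z.
Proof. by rewrite /bpow; case: ifP => // _; exact: powR_ge0. Qed.

Let near_ind (z w : T) : R := \1_[set w | near_ball (z : Cn R n) w] w.

(** [rotation_mean_le] over the translate to z of a small polydisc adapted to z, which lies in the
    pseudohyperbolic ball and has volume at least of order (1 - |z|)^(n+1). *)
Lemma submean_near : exists2 C : R, 0 < C & forall f, holomorphic f -> forall z, cnorm z < 1 ->
  ((cabs (f z) `^ p * (1 - cnorm z) ^+ n.+1)%:E <=
   C%:E * \int[V]_w (near_ind z w * bpow f w)%:E)%E.
Proof.
have [c c0 cP] := volume_small_polydisc_ge HV n0.
exists ((64 ^+ n.+1) / c); first by rewrite divr_gt0 // exprn_gt0.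
move=> f hf z z1; pose d := 1 - cnorm z.
have d0 : 0 < d by rewrite subr_gt0.
have z0 := cnorm_ge0 z.
have d1 : d <= 1 by rewrite /d; lra.
have d64 : 0 < d / 64 <= 1 by rewrite divr_gt0 //=; lra.
have [d64' d64''] := andP d64.
pose Om := small_polydisc z (d / 64).
have mOm : measurable Om := small_polydisc_measurable z (ltW d64').
pose r := Num.sqrt (1 - (1 - 3 / 64) * (1 - cnorm z ^+ 2)).
have A0 : 0 < 1 - cnorm z ^+ 2 by rewrite subr_gt0 expr_lt1.
have r1 : r < 1.
  rewrite /r -[ltRHS]sqrtr1 ltr_sqrt //; lra.
have inr (w : Cn R n) : cnorm w ^+ 2 <= 1 - (1 - 3 / 64) * (1 - cnorm z ^+ 2) -> cnorm w <= r.
  by move=> h; rewrite -(ger0_norm (cnorm_ge0 w)) -sqrtr_sqr; apply: ler_wsqrtr.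
have Om1 w : Om w -> cnorm (w : Cn R n) <= 1.
  by move=> [h _]; have := cnorm_ge0 (w : Cn R n); nra.
have VOm : (V Om < +oo)%E.
  apply: (@le_lt_trans _ _ (V [set w : T | cnorm ((w : Cn R n) - 0) < 2])); last first.
    by rewrite volume_ball ?ltry.
  apply: le_measure; rewrite ?inE //.
    rewrite (_ : [set w : T | _] = [set w : T | cnorm (w : Cn R n) < 2]).
      exact: cball_measurable.
    by apply/seteqP; split=> w /=; rewrite subr0.
  by move=> w /Om1 /=; rewrite subr0; lra.
have Om_scale w (x : R[i]) : Om w -> cabs x <= 1 -> Om (x *: (w : Cn R n)).
  move=> [h1 h2] x1; split.
    rewrite cnormZ exprMn; apply: le_lt_trans h1; rewrite ler_piMl ?sqr_ge0 //.
    by have := cabs_ge0 x; nra.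
  rewrite cinnerZl cabsM; apply: le_lt_trans h2; rewrite ler_piMl // cabs_ge0 //.
have V_rot (g : T -> \bar R) (u : R[i]) : measurable_fun setT g -> (forall z, 0 <= g z)%E ->
    cabs u = 1 -> (\int[V]_z g (u *: (z : Cn R n))%R = \int[V]_z g z)%E.
  by move=> mg g0; exact: integral_rotate.
have H := @rotation_mean_le _ _ V (volume_sigma_finite HV) V_rot f p hf p0 Om z 1 r 1
  mOm ltr01 r1 (fun u w u1 Ow => Om_scale w u Ow (eq_ind_r (fun t => t <= 1) (lexx 1) u1)) Om1 VOm
  (fun w x Ow x1 => inr _ (near_ball_translate z1 (Om_scale w x Ow x1)).1) 0 1 (lexx 0) ler01 (lexx 1).
have mg : measurable_fun setT (fun w => (near_ind z w * bpow f w)%:E).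
  apply/measurable_EFinP; apply: measurable_funM; last exact: measurable_ball_pow hf.
  apply: measurable_indic; apply: measurable_near_ball; first exact: measurable_cst.
  exact: measurable_id.
have g0 w : (0 <= (near_ind z w * bpow f w)%:E)%E by rewrite lee_fin mulr_ge0.
have H2 : (\int[V]_(w in Om) (cabs (f (z + 0%:C%C *: (w : Cn R n))) `^ p)%:E =
   (cabs (f z) `^ p)%:E * V Om)%E.
  have E (w : Cn R n) : z + 0%:C%C *: w = z by rewrite scale0r addr0.
  transitivity (\int[V]_(w in Om) (cabs (f z) `^ p)%:E)%E; last exact: integral_cst.
  by apply: eq_integral => w _; rewrite (E w).
have H3 : (\int[V]_(w in Om) (cabs (f (z + 1%:C%C *: (w : Cn R n))) `^ p)%:E <=
   \int[V]_w (near_ind z w * bpow f w)%:E)%E.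
  rewrite -(integral_translate HV mg g0 z).
  have mg' : measurable_fun setT (fun w : T => (near_ind z ((w : Cn R n) + z) * bpow f ((w : Cn R n) + z))%:E).
    exact: measurableT_comp mg (measurable_translate z).
  apply: (@le_trans _ _ (\int[V]_(w in Om) (near_ind z ((w : Cn R n) + z)%R * bpow f ((w : Cn R n) + z)%R)%:E)%E).
    rewrite le_eqVlt; apply/orP; left; apply/eqP; apply: eq_integral => w /set_mem Ow.
    have [_ [_ zw1 h]] := near_ball_translate z1 Ow.
    rewrite realc1 scale1r /near_ind /bpow [w + z]addrC indicE mem_set ?zw1 ?mul1r //.
  apply: ge0_subset_integral => //.
move: (le_trans H H3); rewrite H2 => H4.
have H5 := cP z (d / 64) z1 d64.
apply: (@le_trans _ _ ((64 ^+ n.+1 / c)%:E * ((cabs (f z) `^ p)%:E * V Om))%E); last first.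
  by apply: lee_wpmul2l => //; rewrite lee_fin divr_ge0 ?exprn_ge0 // ltW.
apply: (@le_trans _ _ ((64 ^+ n.+1 / c)%:E * ((cabs (f z) `^ p)%:E * (c * (d / 64) ^+ n.+1)%:E))%E).
  rewrite -!EFinM lee_fin -/d expr_div_n le_eqVlt; apply/orP; left; apply/eqP.
  have x0 : (64 : R) ^+ n.+1 != 0 by rewrite expf_neq0 // pnatr_eq0.
  by move: (64 ^+ n.+1) x0 => x x0; field; rewrite x0 gt_eqF.
apply: lee_wpmul2l; first by rewrite lee_fin divr_ge0 ?exprn_ge0 // ltW.
by apply: lee_wpmul2l; rewrite ?lee_fin ?powR_ge0.
Qed.

Let tw := tail_weight omega.
(** The integrand controlled by [weighted_embeddingP], extended by zero off the ball. The inverse is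
    written as a power because measurability of powers is at hand. *)
Let dens (f : Cn R n -> R[i]) (w : T) : R := bpow f w * (tw (1 - cnorm (w : Cn R n)) * (1 - cnorm (w : Cn R n)) `^ (-1)).

Let dens0 f w : 0 <= dens f w.
Proof. by rewrite mulr_ge0 // mulr_ge0 ?powR_ge0 // (tail_weight_ge0 HV n0 Homega HD). Qed.

Let mdens f : holomorphic f -> measurable_fun setT (dens f).
Proof.
move=> hf; apply: measurable_funM; first exact: measurable_ball_pow.
have ms : measurable_fun setT (fun w : T => 1 - cnorm (w : Cn R n)) by exact: measurable_funB.
apply: measurable_funM.
  exact: measurableT_comp (measurable_tail_weight HV n0 Homega HD) ms.
exact: measurableT_comp (measurable_powR (-1)) ms.
Qed.

Let tw_double : exists2 D : R, 1 <= D & forall s t, 0 < t -> s <= 8 * t -> tw s <= D * tw t.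
Proof.
have [D D1 DP] := tail_weight_double HV n0 Homega HD; exists (D ^+ 3).
  exact: exprn_ege1.
move=> s t t0 st; apply: (le_trans (tail_weight_le HV n0 Homega HD st)).
have D0 : 0 <= D by exact: le_trans D1.
have -> : 8 * t = 2 * (2 * (2 * t)) by ring.
have t2 : 0 < 2 * t by rewrite mulr_gt0.
have t4 : 0 < 2 * (2 * t) by rewrite mulr_gt0.
apply: (le_trans (DP _ t4)); rewrite !exprS expr0 mulr1 -!mulrA; apply: ler_wpM2l => //.
apply: (le_trans (DP _ t2)); apply: ler_wpM2l => //; exact: DP.
Qed.

(** W is (1 - |z|)^(n+1) times the density hat(omega)(|z|) / (1 - |z|), and this density changes at
    most by a constant factor between near points, so it can be moved under the integral of
    [submean_near]. *)
Lemma weighted_submean : exists2 C : R, 0 < C & forall f, holomorphic f -> forall z, cnorm z < 1 ->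
  ((cabs (f z) `^ p * bw z)%:E <= C%:E * \int[V]_w (near_ind z w * dens f w)%:E)%E.
Proof.
have [C C0 CP] := submean_near; have [D D1 DP] := tw_double.
have D0 : 0 < D by exact: lt_le_trans D1.
exists (C * (8 * D)); first by rewrite !mulr_gt0.
move=> f hf z z1; set d := 1 - cnorm z; have d0 : 0 < d by rewrite subr_gt0.
have tw0 := tail_weight_gt0 HV n0 Homega HD d0; rewrite -/tw in tw0.
have -> : (cabs (f z) `^ p * bw z)%:E =
    ((tw d / d)%:E * (cabs (f z) `^ p * d ^+ n.+1)%:E)%E.
  rewrite -EFinM /bw /box_weight -/tw -/d exprS; congr EFin; field; by rewrite gt_eqF.
apply: (@le_trans _ _ ((tw d / d)%:E * (C%:E * \int[V]_w (near_ind z w * bpow f w)%:E))%E).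
  by apply: lee_wpmul2l; [rewrite lee_fin divr_ge0 // ltW | exact: CP].
rewrite muleCA [(C * _)%:E]EFinM -muleA; apply: lee_wpmul2l; first by rewrite lee_fin ltW.
have mn : measurable_fun setT (near_ind z).
  apply: measurable_indic; apply: measurable_near_ball; first exact: measurable_cst.
  exact: measurable_id.
have td0 : 0 <= tw d / d by rewrite divr_ge0 // ltW.
rewrite -!ge0_integralZl_EFin //; last 5 first.
- by move=> w _; rewrite lee_fin mulr_ge0.
- by apply/measurable_EFinP; apply: measurable_funM => //; exact: mdens.
- by rewrite mulr_ge0 // ltW.
- by move=> w _; rewrite lee_fin mulr_ge0.
- by apply/measurable_EFinP; apply: measurable_funM => //; exact: measurable_ball_pow.
apply: ge0_le_integral => //.
- by move=> w _; rewrite -EFinM lee_fin mulr_ge0 // mulr_ge0.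
- apply/measurable_EFinP; apply: measurable_funM; first exact: measurable_cst.
  by apply: measurable_funM => //; exact: measurable_ball_pow.
- apply/measurable_EFinP; apply: measurable_funM; first exact: measurable_cst.
  by apply: measurable_funM => //; exact: mdens.
move=> w _; rewrite -!EFinM lee_fin mulrCA [leRHS]mulrCA.
rewrite /near_ind indicE.
case: (boolP (w \in _)) => [/set_mem /= zw|_]; last by rewrite mulr0n !mul0r.
rewrite mulr1n !mul1r.
have [h1 h2 _] := near_ball_dist zw; have [_ w1 _] := zw.
set e := 1 - cnorm (w : Cn R n) in h1 h2 *.
have e0 : 0 < e by rewrite subr_gt0.
rewrite /dens -/e [leLHS]mulrC [leRHS]mulrCA; apply: ler_wpM2l => //.
rewrite (powR_inv1 (ltW e0)) ler_pdivrMr //.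
have twe : 0 < tw e by exact: (tail_weight_gt0 HV n0 Homega HD e0).
apply: (le_trans (DP d e e0 h1)).
have -> : 8 * D * (tw e * e^-1) * d = D * tw e * (8 * d / e) by ring.
by rewrite ler_peMr // ?mulr_ge0 ?(ltW twe) ?(ltW D0) // ler_pdivlMr // mul1r.
Qed.

Lemma growth_bound : exists2 C : R, 0 < C & forall f, holomorphic f -> forall z, cnorm z < 1 ->
  ((cabs (f z) `^ p * bw z)%:E <= C%:E * Ap_int V omega p f)%E.
Proof.
have [C C0 CP] := weighted_submean; have [D D0 DP] := weighted_embeddingP HV n0 Homega HD.
exists (C * D); first by rewrite mulr_gt0.
move=> f hf z z1; apply: (le_trans (CP f hf z z1)).
rewrite EFinM -muleA; apply: lee_wpmul2l; first by rewrite lee_fin ltW.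
apply: le_trans (DP f p hf p0).
rewrite [leRHS]integral_mkcond; apply: ge0_le_integral => //.
- by move=> w _; rewrite lee_fin mulr_ge0.
- apply/measurable_EFinP; apply: measurable_funM; last exact: mdens.
  apply: measurable_indic; apply: measurable_near_ball; first exact: measurable_cst.
  exact: measurable_id.
- apply: (eq_measurable_fun (EFin \o dens f)); last by apply/measurable_EFinP; exact: mdens.
  move=> w _; rewrite patchE /= /dens /bpow; case: (boolP (cnorm (w : Cn R n) < 1)) => w1.
    by rewrite mem_set // powR_inv1 // subr_ge0 ltW.
  by rewrite mul0r memNset //; exact/negP.
move=> w _; rewrite patchE /near_ind indicE /dens /bpow.
case: (boolP (w \in [set w | near_ball z w])) => [/set_mem /= [_ w1 _]|_].
  by rewrite w1 mem_set // mul1r powR_inv1 // subr_ge0 ltW.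
rewrite mul0r; case: ifPn => // wB; have w1 : cnorm (w : Cn R n) < 1 := set_mem wB.
rewrite lee_fin mulr_ge0 ?powR_ge0 // divr_ge0 ?(tail_weight_ge0 HV n0 Homega HD) //.
by rewrite subr_ge0 ltW.
Qed.

Lemma near_box_weight : exists2 D : R, 1 <= D & forall z w, near_ball z w -> bw w <= D * bw z.
Proof.
have [D D1 DP] := box_weight_double HV n0 Homega HD; exists (D ^+ 3); first exact: exprn_ege1.
move=> z w zw; have [_ h _] := near_ball_dist zw; have [z1 w1 _] := zw.
rewrite /bw; set t := 1 - cnorm z in h *.
have t0 : 0 < t by rewrite subr_gt0.
have e0 : 0 <= 1 - cnorm w by rewrite subr_ge0 ltW.
apply: (le_trans (box_weight_le HV n0 Homega HD e0 h)).
have D0 : 0 <= D by exact: le_trans D1.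
have -> : 8 * t = 2 * (2 * (2 * t)) by ring.
have t2 : 0 < 2 * t by rewrite mulr_gt0.
have t4 : 0 < 2 * (2 * t) by rewrite mulr_gt0.
apply: (le_trans (DP _ t4)); rewrite !exprS expr0 mulr1 -!mulrA; apply: ler_wpM2l => //.
apply: (le_trans (DP _ t2)); apply: ler_wpM2l => //; exact: DP.
Qed.

(** Tonelli between [nu] and the volume needs sigma-finiteness, and finiteness on pseudohyperbolic
    balls provides it: those centred at a dense sequence cover the ball, because the small
    neighbourhood of each z from [near_ball_translate] contains a centre. *)
Lemma near_ball_sigma_finite (nu : {measure set T -> \bar R}) :
  (forall a : Cn R n, cnorm a < 1 -> (nu [set z : T | near_ball a z] < +oo)%E) ->
  (forall E, E `<=` ~` B -> measurable E -> nu E = 0%E) -> sigma_finite setT nu.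
Proof.
move=> nuf nu0; have [s sP] := dense_sequence R n.
have mN (a : Cn R n) : measurable [set z : T | near_ball a z].
  by apply: measurable_near_ball; [exact: measurable_cst | exact: measurable_id].
have mC : measurable (~` B) by exact: measurableC.
exists (fun i => (if `[< cnorm (s i) < 1 >] then [set z : T | near_ball (s i) z] else set0) `|` ~` B).
  apply/seteqP; split=> // z _.
  have [zB|zB] := pselect (B z); last by exists 0%N => //; right.
  have z1 : cnorm (z : Cn R n) < 1 := zB; have z0 := cnorm_ge0 (z : Cn R n).
  have d0 : 0 < (1 - cnorm (z : Cn R n)) / 64 by rewrite divr_gt0 // subr_gt0.
  have [i iP] := sP z _ d0; exists i => //; left.
  have w0 := cnorm_ge0 (s i - z).
  have Ow : small_polydisc (z : Cn R n) ((1 - cnorm (z : Cn R n)) / 64) (s i - z).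
    split; first nra.
    apply: (le_lt_trans (cauchy_schwarz _ _)); nra.
  have [_ zs] := near_ball_translate z1 Ow.
  rewrite addrC subrK in zs; have [_ s1 _] := zs.
  by rewrite ifT; [exact: near_ballC | exact/asboolP].
move=> i; set N := (X in X `|` _); have mNi : measurable N by rewrite /N; case: ifP.
split; first exact: measurableU.
apply: le_lt_trans (measureU2 _ mNi mC) _.
rewrite [X in (_ + X)%E](nu0 (~` B)) // adde0 /N; case: ifPn => [/asboolP|_]; first exact: nuf.
by rewrite measure0.
Qed.

(** With s = q/p, one splits |f|^q = |f|^p (|f|^p)^(s-1). The second factor is bounded pointwise by
    [growth_bound], which is where p <= q enters; the first is replaced by its weighted average.
    Tonelli then leaves the [nu]-measure of a pseudohyperbolic ball, whose bound W^s cancels the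
    power W^(-s) that was produced. *)
Lemma carleson_embedding q : p <= q -> exists2 C : R, 0 < C &
  forall (nu : {measure set T -> \bar R}) (K : R), 0 <= K ->
  (forall a, cnorm a < 1 -> (nu [set z : T | near_ball a z] <= (K * bw a `^ (q / p))%:E)%E) ->
  forall f, in_Ap V omega p f ->
  (\int[nu]_(z in B) (cabs (f z) `^ q)%:E <=
    (C * K * (fine (Ap_int V omega p f)) `^ (q / p))%:E)%E.
Proof.
move=> pq; set s := q / p.
have s1 : 1 <= s by rewrite /s ler_pdivlMr // mul1r.
have [C1 C10 C1P] := growth_bound.
have [C2 C20 C2P] := weighted_submean.
have [C3 C30 C3P] := weighted_embeddingP HV n0 Homega HD.
have [D D1 DP] := near_box_weight; have D0 : 0 < D by exact: lt_le_trans D1.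
exists (C1 `^ (s - 1) * C2 * C3 * D `^ s); first by rewrite !mulr_gt0 // powR_gt0.
move=> nu K K0 nuK f [hf If].
have IE : Ap_int V omega p f = (fine (Ap_int V omega p f))%:E.
  rewrite fineK // ge0_fin_numE //; apply: integral_ge0 => z zB; rewrite lee_fin mulr_ge0 ?powR_ge0 //.
  have z01 : 0 <= cnorm (z : Cn R n) < 1 by rewrite cnorm_ge0.
  by have [/(_ _ z01) /ltW] := Homega.
set I := fine _ in IE *.
have I0 : 0 <= I.
  apply: fine_ge0; apply: integral_ge0 => z zB; rewrite lee_fin mulr_ge0 ?powR_ge0 //.
  have z01 : 0 <= cnorm (z : Cn R n) < 1 by rewrite cnorm_ge0.
  by have [/(_ _ z01) /ltW] := Homega.
have mNr (a : Cn R n) : measurable [set z : T | near_ball z a].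
  by apply: measurable_near_ball; [exact: measurable_id | exact: measurable_cst].
have nearC (a : Cn R n) : [set z : T | near_ball z a] = [set z : T | near_ball a z].
  by apply/seteqP; split=> z /=; exact: near_ballC.
(* The hypothesis says nothing about [nu] off the ball, so its restriction to the ball is the
   measure shown to be sigma-finite. *)
have [W [WE WI]] := restriction_measureP nu mB.
have W_sf : sigma_finite setT W.
  apply: near_ball_sigma_finite.
    move=> a a1; rewrite -nearC WE // setIidl; last by move=> z [].
    by rewrite nearC; apply: le_lt_trans (nuK a a1) _; rewrite ltry.
  by move=> E EB mE; rewrite WE // (_ : E `&` B = set0) ?measure0 // -subset0 => z [/EB].
have V_sf := volume_sigma_finite HV.
pose gq (z : T) : R := if cnorm (z : Cn R n) < 1 then cabs (f z) `^ q else 0.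
have mgq : measurable_fun setT gq by exact: measurable_ball_pow.
have gq0 z : 0 <= gq z by rewrite /gq; case: ifP => // _; exact: powR_ge0.
have -> : (\int[nu]_(z in B) (cabs (f z) `^ q)%:E = \int[W]_z (gq z)%:E)%E.
  rewrite WI; [| exact/measurable_EFinP | by move=> z; rewrite lee_fin].
  by apply: eq_integral => z /set_mem zB; rewrite /gq (zB : cnorm (z : Cn R n) < 1).
pose bS (z : T) : R := bw z `^ (- s).
have mbw : measurable_fun setT (fun z : T => bw z).
  have ms : measurable_fun setT (fun w : T => 1 - cnorm (w : Cn R n)) by exact: measurable_funB.
  rewrite /bw /box_weight; apply: measurable_funM; first exact: measurable_funX.
  exact: measurableT_comp (measurable_tail_weight HV n0 Homega HD) ms.
have mbS : measurable_fun setT bS by exact: measurableT_comp (measurable_powR (- s)) mbw.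
have bS0 z : 0 <= bS z by exact: powR_ge0.
(* [growth_bound] reads |f|^p <= C1 I / W; raised to the power s - 1 it gives M W^(1-s), written
   below as M W^(-s) times W so that [weighted_submean] applies to the remaining |f|^p W. *)
pose M := (C1 * I) `^ (s - 1).
have M0 : 0 <= M by exact: powR_ge0.
have gqle z : gq z <= M * bS z * (bpow f z * bw z).
  rewrite /gq /bpow; case: ifPn => z1; last by rewrite mul0r mulr0.
  have b0 := bw_gt0 z1; have := C1P f hf z z1; rewrite IE -EFinM lee_fin.
  have -> : cabs (f z) `^ q = (cabs (f z) `^ p) `^ s by rewrite -powRrM /s mulrC divfK // gt_eqF.
  move: (cabs (f z) `^ p) (powR_ge0 (cabs (f z)) p) => x x0 xA.
  have [x00|x00] := eqVneq x 0.
    by rewrite x00 powR0 ?mul0r ?mulr0 // gt_eqF // (lt_le_trans _ s1).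
  have xp : 0 < x by rewrite lt_neqAle eq_sym x00.
  have -> : s = 1 + (s - 1) by ring.
  rewrite powRD; last by rewrite x00 implybT.
  rewrite powRr1 // mulrA [leRHS]mulrC -mulrA [leLHS]mulrC.
  rewrite /bS [X in _ <= _ * X]mulrA mulrC.
  have -> : bw z * (M * bw z `^ (- s) * x) = x * (M * (bw z * bw z `^ (- s))) by ring.
  apply: ler_wpM2l => //.
  have -> : bw z * bw z `^ (- s) = (bw z `^ (s - 1))^-1.
    rewrite -powRN opprB -{1}[bw z]powRr1 ?(ltW b0) // -powRD //.
    by rewrite (gt_eqF b0) implybT.
  rewrite ler_pdivlMr ?powR_gt0 // -powRM ?(ltW b0) //.
  by apply: powR_le => //; [rewrite subr_ge0 | rewrite mulr_ge0 // ltW].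
pose F (x : T * T) : R := near_ind x.1 x.2 * (bS x.1 * dens f x.2).
have mF : measurable_fun setT (EFin \o F).
  apply/measurable_EFinP; apply: measurable_funM.
    have mS : measurable [set x : T * T | near_ball (x.1 : Cn R n) x.2].
      by apply: measurable_near_ball; [exact: measurable_fst | exact: measurable_snd].
    apply: (eq_measurable_fun (\1_[set x : T * T | near_ball (x.1 : Cn R n) x.2] : T * T -> R)).
      by move=> x _; rewrite /near_ind !indicE; congr (_ : bool)%:R; apply/idP/idP => /set_mem/mem_set.
    exact: measurable_indic.
  apply: measurable_funM; first exact: measurableT_comp mbS measurable_fst.
  exact: measurableT_comp (mdens hf) measurable_snd.
have F0 x : (0 <= (EFin \o F) x)%E.
  by rewrite lee_fin /F mulr_ge0 // mulr_ge0.
have mF1 : measurable_fun setT (fun z => \int[V]_w (EFin \o F) (z, w))%E.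
  exact: (@measurable_inner_integral _ _ T T R V _ V_sf mF F0).
have F10 z : (0 <= \int[V]_w (EFin \o F) (z, w))%E by apply: integral_ge0 => w _; exact: F0.
apply: (@le_trans _ _ ((M * C2)%:E * \int[W]_z \int[V]_w (EFin \o F) (z, w))%E).
  rewrite -ge0_integralZl_EFin //; last by rewrite mulr_ge0 // ltW.
  apply: ge0_le_integral => //.
  - by move=> z _; rewrite lee_fin.
  - by apply/measurable_EFinP.
  - by apply: emeasurable_funM => //; exact: measurable_cst.
  move=> z _; have [z1|z1] := boolP (cnorm (z : Cn R n) < 1); last first.
    by rewrite /gq (negPf z1) mule_ge0 // lee_fin mulr_ge0 // ltW.
  apply: (@le_trans _ _ ((M * bS z)%:E * (bpow f z * bw z)%:E)%E); first by rewrite -EFinM lee_fin.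
  apply: (@le_trans _ _ ((M * bS z)%:E * (C2%:E * \int[V]_w (near_ind z w * dens f w)%:E))%E).
    apply: lee_wpmul2l; first by rewrite lee_fin mulr_ge0.
    by rewrite /bpow z1; exact: C2P.
  rewrite muleA -EFinM -mulrA [bS z * C2]mulrC mulrA [(M * C2 * bS z)%:E]EFinM -muleA.
  apply: lee_wpmul2l; first by rewrite lee_fin mulr_ge0 // ltW.
  rewrite -ge0_integralZl_EFin //; last 2 first.
  - by move=> w _; rewrite lee_fin mulr_ge0.
  - apply/measurable_EFinP; apply: measurable_funM; last exact: mdens.
    by apply: measurable_indic; rewrite -nearC.
  rewrite le_eqVlt; apply/orP; left; apply/eqP; apply: eq_integral => w _.
  by rewrite -EFinM /F /= mulrCA.
rewrite (@tonelli_sigma_finite _ _ T T R W V _ W_sf V_sf mF F0).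
apply: (@le_trans _ _ ((M * C2)%:E * \int[V]_w (D `^ s * K * dens f w)%:E)%E).
  apply: lee_wpmul2l; first by rewrite lee_fin mulr_ge0 // ltW.
  have DK0 : 0 <= D `^ s * K by rewrite mulr_ge0 // powR_ge0.
  apply: ge0_le_integral; first exact: measurableT.
  - by move=> w _; apply: integral_ge0 => z _; exact: F0.
  - have mF' : measurable_fun setT (fun x : T * T => (EFin \o F) (x.2, x.1)).
      by apply: (measurableT_comp mF); exact: measurable_swap.
    exact: (@measurable_inner_integral _ _ T T R W _ W_sf mF' (fun x => F0 _)).
  - by apply/measurable_EFinP; apply: measurable_funM; [exact: measurable_cst | exact: mdens].
  move=> w _; have [w1|w1] := boolP (cnorm (w : Cn R n) < 1); last first.
    rewrite integral0_eq; first by rewrite lee_fin mulr_ge0.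
    move=> z _.
    rewrite /= /F /near_ind indicE memNset ?mul0r // => -[_ h _]; by move/negP: w1; apply.
  have b0 := bw_gt0 w1.
  apply: (@le_trans _ _ (\int[W]_z ((D `^ s * bS w * dens f w)%:E * (\1_[set z : T | near_ball (z : Cn R n) w] z)%:E))%E).
    have c0 : 0 <= D `^ s * bS w * dens f w.
      by apply: mulr_ge0 => //; apply: mulr_ge0 => //; exact: powR_ge0.
    apply: ge0_le_integral; first exact: measurableT.
    - by move=> z _; exact: F0.
    - by apply: (measurableT_comp mF); exact: measurable_pair2.
    - apply: emeasurable_funM; first exact: measurable_cst.
      by apply/measurable_EFinP; exact: measurable_indic.
    move=> z _; rewrite -EFinM lee_fin /F /near_ind /= !indicE.
    have -> : (w \in [set w : T | near_ball (z : Cn R n) w]) = (z \in [set z : T | near_ball (z : Cn R n) w]).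
      by apply/idP/idP => /set_mem/mem_set.
    case: (boolP (z \in _)) => [/set_mem /= zw|_]; last by rewrite mul0r mulr0.
    rewrite mul1r mulr1 ler_wpM2r // /bS.
    have [z1 _ _] := zw; have bz0 := bw_gt0 z1.
    by apply: powRN_le (ltW D0) bz0 b0 _ (DP _ _ zw); exact: le_trans s1.
  have c0 : 0 <= D `^ s * bS w * dens f w.
      by apply: mulr_ge0 => //; apply: mulr_ge0 => //; exact: powR_ge0.
  rewrite ge0_integralZl_EFin //; last by apply/measurable_EFinP; exact: measurable_indic.
  rewrite integral_indic // setIT WE // setIidl; last by move=> z [].
  rewrite nearC; apply: (@le_trans _ _ ((D `^ s * bS w * dens f w)%:E * (K * bw w `^ s)%:E)%E).
    by apply: lee_wpmul2l; [rewrite lee_fin | exact: nuK].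
  rewrite -EFinM lee_fin le_eqVlt; apply/orP; left; apply/eqP.
  have : bS w * bw w `^ s = 1 by rewrite /bS powRN mulVf // gt_eqF // powR_gt0.
  by move=> e; rewrite -[RHS]mulr1 -e; ring.
have DK0 : 0 <= D `^ s * K by rewrite mulr_ge0 // powR_ge0.
under eq_integral do rewrite EFinM.
rewrite ge0_integralZl_EFin //; last 2 first.
- by move=> w _; rewrite lee_fin.
- by apply/measurable_EFinP; exact: mdens.
have IB : (\int[V]_w (dens f w)%:E <= (C3 * I)%:E)%E.
  rewrite EFinM -IE; apply: le_trans (C3P f p hf p0).
  rewrite [leRHS]integral_mkcond le_eqVlt; apply/orP; left; apply/eqP.
  apply: eq_integral => w _; rewrite patchE /dens /bpow.
  case: (boolP (cnorm (w : Cn R n) < 1)) => w1.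
    by rewrite mem_set // powR_inv1 // subr_ge0 ltW.
  by rewrite mul0r memNset //; exact/negP.
apply: (@le_trans _ _ ((M * C2)%:E * ((D `^ s * K)%:E * (C3 * I)%:E))%E).
  apply: lee_wpmul2l; first by rewrite lee_fin mulr_ge0 // ltW.
  by apply: lee_wpmul2l; rewrite ?lee_fin.
rewrite -!EFinM lee_fin /M powRM ?(ltW C10) //.
have -> : C1 `^ (s - 1) * I `^ (s - 1) * C2 * (D `^ s * K * (C3 * I)) =
  C1 `^ (s - 1) * C2 * C3 * D `^ s * K * (I `^ (s - 1) * I) by ring.
apply: ler_wpM2l; first by rewrite !mulr_ge0 ?powR_ge0 // ltW.
have [->|I00] := eqVneq I 0; first by rewrite mulr0 powR_ge0.
rewrite -{2}[I]powRr1 // -powRD ?subrK //.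
by rewrite I00 implybT.
Qed.

End CarlesonEmbedding.

(** * Testing the operator *)

Section QuasiTriangle.
Variable R : realType.

(** The sum is at most the number of terms times the largest one. This treats exponents below and
    above 1 alike, where convexity would serve only the latter. *)
Lemma powR_sum_le (I : finType) (F : I -> R) q : 0 < q -> (forall i, 0 <= F i) ->
  (\sum_i F i) `^ q <= #|I|%:R `^ q * \sum_i F i `^ q.
Proof.
move=> q0 F0; have S0 : 0 <= \sum_i F i `^ q by apply: sumr_ge0 => i _; exact: powR_ge0.
have [i0 _|I0] := pickP (fun _ : I => true); last first.
  by rewrite big_pred0 // powR0 ?gt_eqF // mulr_ge0 // powR_ge0.
pose i := [arg max_(j > i0) F j]%O.
have iP j : F j <= F i by rewrite /i; case: arg_maxP => // k _ /(_ j isT).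
apply: (@le_trans _ _ ((#|I|%:R * F i) `^ q)).
  apply: powR_le; [exact: ltW | exact: sumr_ge0 |].
  rewrite mulr_natl -sumr_const; exact: ler_sum.
rewrite powRM //; apply: ler_wpM2l; first exact: powR_ge0.
by rewrite (bigD1 i) //= lerDl; apply: sumr_ge0 => j _; exact: powR_ge0.
Qed.

Lemma powRD_le (x y q : R) : 0 < q -> 0 <= x -> 0 <= y ->
  (x + y) `^ q <= 2 `^ q * (x `^ q + y `^ q).
Proof.
move=> q0 x0 y0; have := @powR_sum_le bool (fun b => if b then x else y) q q0.
by rewrite !big_bool card_bool; apply; case.
Qed.

(** The integral of a nonnegative function is a supremum over the simple functions below it, so
    monotonicity holds for arbitrary functions. It is applied to the weight of the pushforward,
    whose measurability is not established. *)
Lemma ge0_integral_mono d (T : measurableType d) (m : {measure set T -> \bar R})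
    (f g : T -> \bar R) : (forall x, 0 <= f x)%E -> (forall x, f x <= g x)%E ->
  (\int[m]_x f x <= \int[m]_x g x)%E.
Proof.
move=> f0 fg; have g0 x : (0 <= g x)%E by exact: le_trans (fg x).
rewrite !ge0_integralTE //; apply: le_ereal_sup => _ [h hf <-]; exists h => // x.
exact: le_trans (fg x).
Qed.

End QuasiTriangle.

Section TestInequality.
Variables (R : realType) (n : nat).
Implicit Types a x y : Cn R n.

(** [x] and [y] stand for the images of phi(z) and psi(z) under the automorphism, and [Fx], [Fy] for
    the values of the test function. The bound |y| <= 1 is what allows the plain test value to be
    multiplied by the coordinates of y. *)
Lemma test_combination (U V Fx Fy : R[i]) x y : cnorm y <= 1 ->
  cabs U * cabs Fx * cnorm (x - y) <=
  n.+1%:R * (cabs (U * Fx - V * Fy) +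
     \sum_(j < n) cabs (U * (Fx * x 0 j) - V * (Fy * y 0 j))).
Proof.
move=> y1; set t0 := U * Fx - V * Fy.
set S := \sum_(j < n) _.
have S0 : 0 <= S by apply: sumr_ge0 => j _.
apply: (@le_trans _ _ (S + \sum_(j < n) cabs t0)).
  rewrite -big_split /=.
  apply: (@le_trans _ _ (cabs U * cabs Fx * \sum_(j < n) cabs ((x - y) 0 j))).
    by apply: ler_wpM2l; [rewrite mulr_ge0 | exact: cnorm_le_sum].
  rewrite mulr_sumr; apply: ler_sum => j _.
  rewrite -!cabsM !mxE.
  have -> : U * Fx * (x 0 j - y 0 j) = (U * (Fx * x 0 j) - V * (Fy * y 0 j)) - t0 * y 0 j.
    by rewrite /t0; ring.
  apply: (le_trans (cabsD _ _)); rewrite cabsN cabsM lerD2l ler_piMr //.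
  exact: le_trans (cabs_coord_le _ _) y1.
rewrite sumr_const card_ord -[_ *+ n]mulr_natl -natr1 mulrDl mul1r mulrDr.
have nS : 0 <= n%:R * S by rewrite mulr_ge0.
have := cabs_ge0 t0; lra.
Qed.

Lemma cabs_subX_le (z w : R[i]) N : cabs z <= 2 -> cabs w <= 2 ->
  cabs (z ^+ N - w ^+ N) <= N%:R * 2 ^+ N * cabs (z - w).
Proof.
move=> z2 w2; elim: N => [|N IH]; first by rewrite !expr0 subrr cabs0 !mul0r.
have -> : z ^+ N.+1 - w ^+ N.+1 = z * (z ^+ N - w ^+ N) + (z - w) * w ^+ N.
  by rewrite !exprS; ring.
apply: (le_trans (cabsD _ _)); rewrite !cabsM cabsX.
have h1 : cabs w ^+ N <= 2 ^+ N by apply: lerXn2r; rewrite ?nnegrE.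
have h2 : cabs z * cabs (z ^+ N - w ^+ N) <= 2 * (N%:R * 2 ^+ N * cabs (z - w)).
  by apply: ler_pM.
have h3 : cabs (z - w) * cabs w ^+ N <= cabs (z - w) * 2 ^+ N by apply: ler_wpM2l.
have h4 : 0 <= 2 ^+ N * cabs (z - w) by rewrite mulr_ge0 // exprn_ge0.
rewrite exprS -natr1; apply: (le_trans (lerD h2 h3)).
have -> : (N%:R + 1) * (2 * 2 ^+ N) * cabs (z - w) =
  2 * (N%:R * 2 ^+ N * cabs (z - w)) + 2 * (2 ^+ N * cabs (z - w)) by ring.
rewrite [cabs (z - w) * _]mulrC; lra.
Qed.

(** In the coordinate X = phi_a(x) the test function is a constant times the polynomial (1 -
    <X,a>)^N. Its values at two points are thus compared by a Lipschitz estimate whose constant does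
    not depend on [a]. *)
Lemma test_fun_auto N a x : cnorm a < 1 -> cnorm x < 1 ->
  test_fun N a x = ((1 - cnorm a)%:C%C / (1 - cinner a a)) ^+ N *
    (1 - cinner (auto_ball a x) a) ^+ N.
Proof.
move=> a1 x1; rewrite /test_fun auto_ball_cinner_center // -exprMn; congr (_ ^+ _).
have h1 := one_sub_cinner_neq0 a1 (ltW a1); have h2 := one_sub_cinner_neq0 x1 (ltW a1).
by field; rewrite h1 h2.
Qed.

Lemma pseudohyp_le_cnorm x y : cnorm x <= 1 / 2 -> cnorm y < 1 ->
  pseudohyp x y <= 2 * cnorm (x - y).
Proof.
move=> x2 y1; have x1 : cnorm x < 1 by lra.
have := pseudohyp_dist x1 y1; have := cauchy_schwarz x (y - x).
rewrite (cnormB_sym y x); have c0 := cabs_ge0 (cinner x (y - x)).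
have := pseudohyp_ge0 x y; have := cnorm_ge0 (x - y); have := cnorm_ge0 x.
have : 1 / 2 <= cabs (1 - cinner x y).
  apply: le_trans (ler_cabsB _ _); rewrite cabs1.
  have := cauchy_schwarz x y; have := cnorm_ge0 x; have := cnorm_ge0 y; nra.
move: c0; move: (cabs _) (cabs _) (cnorm _) (cnorm _) (pseudohyp _ _) x2 => c m e d h x2.
move=> c0 m2 e0 d0 h0 ce H.
have c2 : m ^+ 2 <= d ^+ 2 * e ^+ 2.
  by rewrite -exprMn; apply: lerXn2r; rewrite ?nnegrE ?mulr_ge0.
have hm : (h * c) ^+ 2 <= e ^+ 2 by rewrite exprMn; lra.
have hmd : h * c <= e by exact: le_of_sqr.
nra.
Qed.

(** A point within pseudohyperbolic distance r < 1 of the half ball stays at a definite distance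
    from the sphere. This bounds |1 - <y,a>| from below, uniformly in [a]. *)
Lemma pseudohyp_near_bound r x y : r < 1 -> cnorm x <= 1 / 2 -> cnorm y < 1 ->
  0 <= r -> pseudohyp x y < r -> (1 - r ^+ 2) / 8 <= 1 - cnorm y.
Proof.
move=> r1 x2 y1 r0 h; have x1 : cnorm x < 1 by lra.
have := auto_ball_norm x1 y1.
have : 1 / 2 <= cabs (1 - cinner y x).
  apply: le_trans (ler_cabsB _ _); rewrite cabs1.
  have := cauchy_schwarz y x; have := cnorm_ge0 x; have := cnorm_ge0 y; nra.
have := pseudohyp_ge0 x y; move: h; rewrite /pseudohyp.
have := cnorm_ge0 x; have := cnorm_ge0 y.
move: (cabs _) (cnorm (auto_ball x y)) => m h y0 x0 hr h0 m2 E.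
have m0 : 0 < m ^+ 2 by rewrite exprn_gt0 //; lra.
have {}E : (1 - h ^+ 2) * m ^+ 2 = (1 - cnorm x ^+ 2) * (1 - cnorm y ^+ 2) by rewrite E divfK // gt_eqF.
have h1 : 1 - r ^+ 2 <= 1 - h ^+ 2 by nra.
have h2 : 1 / 4 <= m ^+ 2 by nra.
have h3 : (1 - r ^+ 2) * (1 / 4) <= (1 - h ^+ 2) * m ^+ 2 by apply: ler_pM => //; nra.
have h4 : (1 - cnorm x ^+ 2) * (1 - cnorm y ^+ 2) <= 1 - cnorm y ^+ 2.
  have y2 : 0 <= 1 - cnorm y ^+ 2 by nra.
  by have := mulr_ge0 (sqr_ge0 (cnorm x)) y2; lra.
have h5 : 1 - cnorm y ^+ 2 <= 2 * (1 - cnorm y) by nra.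
lra.
Qed.

Lemma test_fun_near_ge N a x : near_ball a x -> (8 ^+ N)^-1 <= cabs (test_fun N a x).
Proof.
move=> ax; have [a1 x1 _] := ax; have [_ _ h] := near_ball_dist ax.
have c0 := cabs_one_sub_cinner_gt0 x1 (ltW a1).
rewrite (cabs_test_fun N x a1); move: (cabs _) (1 - cnorm a) c0 h => m d m0 h.
have -> : (8 ^+ N)^-1 = (8^-1) ^+ N :> R by rewrite exprVn.
apply: lerXn2r; rewrite ?nnegrE ?invr_ge0 //; first by apply: divr_ge0; lra.
by rewrite ler_pdivlMr // mulrC ler_pdivrMr // mulrC.
Qed.

Let test_sum (U V fx fy : R[i]) x y := cabs (U * fx - V * fy) +
  \sum_(j < n) cabs (U * (fx * x 0 j) - V * (fy * y 0 j)).

(** The first bound is [test_combination], the pseudohyperbolic distance being at most 2 |X - Y|.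
    For the second, (U - V) fx = (U fx - V fy) + V (fy - fx), and the Lipschitz estimate gives |fy -
    fx| <= L |fy| |X - Y|; the product |V| |fy| |X - Y| is again controlled by [test_combination],
    with the two points exchanged. Dividing by |fx| costs the factor 8^N. *)
Let test_inequality_centered N r : 0 < r < 1 -> exists2 C : R, 0 < C &
  forall a X Y (U V fx fy c : R[i]), cnorm a < 1 -> cnorm X < 1 / 2 -> cnorm Y < 1 ->
  fx = c * (1 - cinner X a) ^+ N -> fy = c * (1 - cinner Y a) ^+ N ->
  (8 ^+ N)^-1 <= cabs fx ->
  pseudohyp X Y * cabs U <= C * test_sum U V fx fy X Y /\
  (pseudohyp X Y < r -> cabs (U - V) <= C * test_sum U V fx fy X Y).
Proof.
move=> /andP[r0 r1].
pose k := (1 - r ^+ 2) / 8; have k0 : 0 < k by rewrite divr_gt0 // subr_gt0 expr_lt1 // ltW.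
pose L := N%:R * 2 ^+ N / k ^+ N.
have L0 : 0 <= L.
  by apply: divr_ge0; [rewrite mulr_ge0 // exprn_ge0 | rewrite exprn_ge0 // ltW].
pose C1 : R := 8 ^+ N * (2 * n.+1%:R); pose C2 : R := 8 ^+ N * (1 + L * n.+1%:R).
have e8 : 0 < (8 : R) ^+ N by rewrite exprn_gt0.
have C10 : 0 < C1 by rewrite mulr_gt0 // mulr_gt0.
have C20 : 0 < C2 by rewrite mulr_gt0 // ltr_pwDl // mulr_ge0.
exists (C1 + C2); first exact: addr_gt0.
move=> a X Y U V fx fy c a1 X2 Y1 Fx Fy Fx8.
set S := test_sum U V fx fy X Y.
have S0 : 0 <= S by rewrite /S addr_ge0 // sumr_ge0.
have t0S : cabs (U * fx - V * fy) <= S by rewrite /S lerDl sumr_ge0.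
have H1 := @test_combination U V fx fy X Y (ltW Y1).
have X1 : cnorm X <= 1 by lra.
have H2 := @test_combination V U fy fx Y X X1.
have ES : cabs (V * fy - U * fx) + \sum_(j < n) cabs (V * (fy * Y 0 j) - U * (fx * X 0 j)) = S.
  rewrite /S cabsB_sym; congr (_ + _); apply: eq_bigr => j _; exact: cabsB_sym.
rewrite ES (cnormB_sym Y X) in H2; rewrite -/S in H1.
have D0 := cnorm_ge0 (X - Y).
have p2 := pseudohyp_le_cnorm (ltW X2) Y1.
have E8 (z : R) : 0 <= z -> z <= 8 ^+ N * (z * cabs fx).
  by move=> z0; rewrite mulrCA -[leLHS]mulr1 ler_wpM2l // -ler_pdivrMl // mulr1.
split.
  have hU : cabs U <= 8 ^+ N * (cabs U * cabs fx) by exact: E8.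
  have p0 := pseudohyp_ge0 X Y.
  apply: (@le_trans _ _ (C1 * S)); last by rewrite ler_wpM2r // lerDl ltW.
  apply: (@le_trans _ _ ((2 * cnorm (X - Y)) * (8 ^+ N * (cabs U * cabs fx)))); first exact: ler_pM.
  have -> : 2 * cnorm (X - Y) * (8 ^+ N * (cabs U * cabs fx)) =
    8 ^+ N * 2 * (cabs U * cabs fx * cnorm (X - Y)) by ring.
  have -> : C1 * S = 8 ^+ N * 2 * (n.+1%:R * S) by rewrite /C1; ring.
  by apply: ler_wpM2l => //; rewrite mulr_ge0 // ltW.
move=> hr; have kY := pseudohyp_near_bound r1 (ltW X2) Y1 (ltW r0) hr.
apply: (@le_trans _ _ (C2 * S)); last by rewrite ler_wpM2r // lerDr ltW.
apply: (le_trans (E8 _ (cabs_ge0 _))); rewrite /C2 -mulrA ler_pM2l // -cabsM.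
have -> : (U - V) * fx = (U * fx - V * fy) + V * (fy - fx) by ring.
apply: (le_trans (cabsD _ _)); rewrite mulrDl mul1r; apply: lerD => //.
have cs (Z : Cn R n) : cnorm Z <= 1 -> cabs (1 - cinner Z a) <= 2.
  move=> Z1; apply: (le_trans (cabsD _ _)); rewrite cabs1 cabsN.
  have := cauchy_schwarz Z a; have := cnorm_ge0 Z; have := cnorm_ge0 a; nra.
have kb : k <= cabs (1 - cinner Y a).
  apply: (le_trans kY); apply: le_trans (ler_cabsB _ _); rewrite cabs1 lerD2l lerN2.
  have := cauchy_schwarz Y a; have := cnorm_ge0 Y; have := cnorm_ge0 a; nra.
have key : cabs (fy - fx) <= L * (cabs fy * cnorm (X - Y)).
  rewrite Fx Fy -mulrBr !cabsM cabsX.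
  apply: (@le_trans _ _ (cabs c * (N%:R * 2 ^+ N * cnorm (X - Y)))).
    apply: ler_wpM2l => //; apply: (le_trans (cabs_subX_le _ (cs Y (ltW Y1)) (cs X X1))).
    apply: ler_wpM2l; first by rewrite mulr_ge0 // exprn_ge0.
    have -> : 1 - cinner Y a - (1 - cinner X a) = cinner (X - Y) a by rewrite cinnerBl; ring.
    have := cauchy_schwarz (X - Y) a; have := cnorm_ge0 a; nra.
  have -> : L * (cabs c * cabs (1 - cinner Y a) ^+ N * cnorm (X - Y)) =
     cabs c * (N%:R * 2 ^+ N * cnorm (X - Y)) * (cabs (1 - cinner Y a) ^+ N / k ^+ N).
    by rewrite /L; ring.
  rewrite ler_peMr //; first by rewrite !mulr_ge0 // exprn_ge0.
  by rewrite ler_pdivlMr ?exprn_gt0 // mul1r; apply: lerXn2r; rewrite ?nnegrE // ltW.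
rewrite cabsM; apply: (@le_trans _ _ (cabs V * (L * (cabs fy * cnorm (X - Y))))); first exact: ler_wpM2l.
have -> : cabs V * (L * (cabs fy * cnorm (X - Y))) = L * (cabs V * cabs fy * cnorm (X - Y)) by ring.
by rewrite -[leRHS]mulrA; apply: ler_wpM2l.
Qed.

(** The automorphism phi_a carries the pseudohyperbolic ball around [a] to the half ball and
    preserves the distance between x and y, which reduces the claim to the centred case. *)
Lemma test_inequality N r : 0 < r < 1 -> exists2 C : R, 0 < C &
  forall a x y (U V : R[i]), near_ball a x -> cnorm y < 1 ->
  let S := cabs (U * test_fun N a x - V * test_fun N a y) +
    \sum_(j < n) cabs (U * (test_fun N a x * auto_ball a x 0 j) -
                       V * (test_fun N a y * auto_ball a y 0 j)) in
  pseudohyp x y * cabs U <= C * S /\ (pseudohyp x y < r -> cabs (U - V) <= C * S).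
Proof.
move=> r01; have [C C0 CP] := test_inequality_centered N r01; exists C => //.
move=> a x y U V ax y1 S; have [a1 x1 _] := ax.
have hx : cnorm (auto_ball a x) < 1 / 2 := (near_ballP a1 x1).1 ax.
have := CP a (auto_ball a x) (auto_ball a y) U V _ _ _ a1 hx (auto_ball_lt1 a1 y1)
  (test_fun_auto N a1 x1) (test_fun_auto N a1 y1) (test_fun_near_ge N ax).
by rewrite (pseudohyp_auto a1 x1 y1).
Qed.

End TestInequality.

(** * Measurability of the weighted composition operators *)

Section SelfMaps.
Variables (R : realType) (n : nat).

Let T := CnM R n.
Let B : set T := @ball_n R n.

Lemma selfmap_continuous (phi : Cn R n -> Cn R n) z e : holo_selfmap phi -> ball_n z ->
  0 < e -> exists2 d, 0 < d & forall w, cnorm (w - z) < d -> cnorm (phi w - phi z) < e.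
Proof.
move=> [hphi _] zB e0.
have en : 0 < e / n.+1%:R by rewrite divr_gt0.
have /choice [d dP] : forall j : 'I_n, exists d, 0 < d /\
    forall w, cnorm (w - z) < d -> cabs (phi w 0 j - phi z 0 j) < e / n.+1%:R.
  by move=> j; have [d d0 dP] := holo_at_continuous (hphi j z zB) en; exists d.
have s0 : 0 <= \sum_j (d j)^-1 by apply: sumr_ge0 => j _; rewrite invr_ge0 ltW // (dP j).1.
exists (1 + \sum_j (d j)^-1)^-1; first by rewrite invr_gt0 ltr_pwDl.
move=> w wz; apply: (le_lt_trans (cnorm_le_sum _)).
have : \sum_(j < n) cabs ((phi w - phi z) 0 j) <= \sum_(j < n) (e / n.+1%:R).
  apply: ler_sum => j _; rewrite !mxE; apply/ltW/(dP j).2; apply: (lt_le_trans wz).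
  have dj := (dP j).1; rewrite -[leRHS]invrK lef_pV2 ?posrE ?invr_gt0 ?ltr_pwDl //.
  have : (d j)^-1 <= \sum_j (d j)^-1.
    by rewrite (bigD1 j) //= lerDl; apply: sumr_ge0 => i _; rewrite invr_ge0 ltW // (dP i).1.
  by move/le_trans; apply; rewrite lerDr.
move/le_lt_trans; apply; rewrite sumr_const card_ord.
have n2 : (n%:R : R) < n.+1%:R by rewrite ltr_nat.
have -> : e / n.+1%:R *+ n = e * (n%:R / n.+1%:R) by rewrite -[_ *+ n]mulr_natl; ring.
by rewrite gtr_pMr // ltr_pdivrMr // mul1r.
Qed.

Lemma measurable_selfmap_comp f (phi : Cn R n -> Cn R n) :
  holomorphic f -> holo_selfmap phi -> Lq_measurable (fun z => f (phi z)).
Proof.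
move=> hf hphi.
have H (g : R[i] -> R) : (forall x y, `|g x - g y| <= cabs (x - y)) ->
    measurable_fun B (fun z : T => g (f (phi z))).
  move=> gl; apply: (ccontinuous_measurable (@copen_ball R n)) => z zB e e0.
  have [d1 d10 d1P] := holo_at_continuous (hf _ (hphi.2 z zB)) e0.
  have [d d0 dP] := selfmap_continuous hphi zB d10.
  by exists d => // w /dP /d1P; apply: le_lt_trans.
split; apply: H => x y.
  by rewrite -creN -creE; exact: cre_le_cabs.
by rewrite -cimN -cimE; exact: cim_le_cabs.
Qed.

Lemma Lq_measurableM (f g : Cn R n -> R[i]) : Lq_measurable f -> Lq_measurable g ->
  Lq_measurable (fun z => f z * g z).
Proof.
move=> [f1 f2] [g1 g2]; split.
  apply: (eq_measurable_fun (fun z : T => cre (f z) * cre (g z) - cim (f z) * cim (g z))).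
    by move=> z _; rewrite creM.
  by apply: measurable_funB; exact: measurable_funM.
apply: (eq_measurable_fun (fun z : T => cre (f z) * cim (g z) + cim (f z) * cre (g z))).
  by move=> z _; rewrite cimM.
by apply: measurable_funD; exact: measurable_funM.
Qed.

Lemma Lq_measurableB (f g : Cn R n -> R[i]) : Lq_measurable f -> Lq_measurable g ->
  Lq_measurable (fun z => f z - g z).
Proof.
move=> [f1 f2] [g1 g2]; split.
  apply: (eq_measurable_fun (fun z : T => cre (f z) - cre (g z))).
    by move=> z _; rewrite creE creN.
  exact: measurable_funB.
apply: (eq_measurable_fun (fun z : T => cim (f z) - cim (g z))).
  by move=> z _; rewrite cimE cimN.
exact: measurable_funB.
Qed.

Lemma Lq_measurable_pow (f : Cn R n -> R[i]) q : Lq_measurable f ->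
  measurable_fun B (fun z : T => cabs (f z) `^ q).
Proof.
move=> [f1 f2]; apply: (measurableT_comp (measurable_powR q)).
apply: (eq_measurable_fun (fun z : T => (cre (f z) ^+ 2 + cim (f z) ^+ 2) `^ (2^-1))).
  by move=> z _; rewrite powR12_sqrt // addr_ge0 // sqr_ge0.
apply: (measurableT_comp (measurable_powR 2^-1)).
by apply: measurable_funD; exact: measurable_funX.
Qed.

Lemma wcomp_measurable (u v f : Cn R n -> R[i]) (phi psi : Cn R n -> Cn R n) :
  Lq_measurable u -> Lq_measurable v -> holo_selfmap phi -> holo_selfmap psi ->
  holomorphic f -> Lq_measurable (wcomp_diff u v phi psi f).
Proof.
move=> mu mv hphi hpsi hf.
by apply: Lq_measurableB; apply: Lq_measurableM => //; exact: measurable_selfmap_comp.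
Qed.

Lemma holomorphic_measurable (f : Cn R n -> R[i]) : holomorphic f -> Lq_measurable f.
Proof.
by move=> hf; apply: (@measurable_selfmap_comp f id) => //; split => // j z _; exact: holo_coord.
Qed.

End SelfMaps.

Lemma poweR_inv_le (R : realType) (x : \bar R) (c q : R) : 0 < q -> (0 <= x)%E -> 0 <= c ->
  (x `^ q^-1 <= c%:E)%E <-> (x <= (c `^ q)%:E)%E.
Proof.
move=> q0 x0 c0; case: x x0 => [x| |] x0; last by [].
  rewrite lee_fin in x0; rewrite poweR_EFin !lee_fin; split=> h.
    rewrite -[x]powRr1 // -(mulVf (lt0r_neq0 q0)) powRrM; apply: powR_le => //.
      exact: ltW.
    exact: powR_ge0.
  rewrite -[c]powRr1 // -(mulfV (lt0r_neq0 q0)) powRrM; apply: powR_le => //.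
  by rewrite invr_ge0 ltW.
by split; rewrite ?poweRyr ?invr_eq0 ?gt_eqF // leye_eq.
Qed.

Section TestOperators.
Variables (R : realType) (n : nat) (V : {measure set (CnM R n) -> \bar R}).
Hypotheses (HV : normalized_volume V) (n0 : (0 < n)%N).
Variable omega : R -> R.
Hypotheses (Homega : radial_weight V omega) (HD : Dclass omega).
Variables p q : R.
Hypotheses (p0 : 0 < p) (pq : p <= q).

Let T := CnM R n.
Let B : set T := @ball_n R n.
Let mB : measurable B := @measurable_ball R n.
Let q0 : 0 < q := lt_le_trans p0 pq.
Let bw (z : Cn R n) : R := @box_weight R n omega (1 - cnorm z).
Let bw_gt0 z : cnorm z < 1 -> 0 < bw z.
Proof. by move=> z1; apply: (box_weight_gt0 HV n0 Homega HD); rewrite subr_gt0. Qed.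

Let omega0 (z : T) : B z -> 0 <= omega (cnorm (z : Cn R n)).
Proof.
move=> zB; have z01 : 0 <= cnorm (z : Cn R n) < 1 by rewrite cnorm_ge0.
by have [/(_ _ z01) /ltW] := Homega.
Qed.

Lemma Ap_int_ge0 f : (0 <= Ap_int V omega p f)%E.
Proof. by apply: integral_ge0 => z zB; rewrite lee_fin mulr_ge0 ?powR_ge0 ?omega0. Qed.

Lemma Lq_int_ge0 (mu : {measure set T -> \bar R}) f : (0 <= Lq_int mu q f)%E.
Proof. by apply: integral_ge0 => z zB; rewrite lee_fin powR_ge0. Qed.

Lemma measurable_Ap_integrand f : holomorphic f ->
  measurable_fun B (fun z : T => (cabs (f z) `^ p * omega (cnorm (z : Cn R n)))%:E).
Proof.
move=> hf; apply/measurable_EFinP.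
apply: (eq_measurable_fun (fun z : T => cabs (f z) `^ p * weight_ext omega (cnorm (z : Cn R n)))).
  by move=> z /set_mem zB; rewrite weight_extE // cnorm_ge0.
apply: measurable_funM; first by apply: Lq_measurable_pow; exact: holomorphic_measurable.
apply: measurable_funTS.
exact: measurableT_comp (measurable_weight_ext Homega) (@measurable_cnorm R n).
Qed.

Lemma Ap_int_le_scale f g (c : R) : holomorphic f -> holomorphic g -> 0 <= c ->
  (forall z, cnorm z < 1 -> cabs (f z) <= c * cabs (g z)) ->
  (Ap_int V omega p f <= (c `^ p)%:E * Ap_int V omega p g)%E.
Proof.
move=> hf hg c0 fg.
have mg := measurable_Ap_integrand hg.
rewrite /Ap_int -ge0_integralZl_EFin //; last 2 first.
- by move=> z zB; rewrite lee_fin mulr_ge0 ?powR_ge0 ?omega0.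
- exact: powR_ge0.
apply: ge0_le_integral; first exact: mB.
- by move=> z zB; rewrite lee_fin mulr_ge0 ?powR_ge0 ?omega0.
- exact: measurable_Ap_integrand.
- by apply: emeasurable_funM => //; exact: measurable_cst.
move=> z zB; rewrite -EFinM lee_fin mulrA ler_wpM2r ?omega0 // -powRM //.
by apply: powR_le; [exact: ltW | exact: cabs_ge0 | exact: fg].
Qed.

Definition test_family (N : nat) (a : Cn R n) (i : option 'I_n) : Cn R n -> R[i] :=
  if i is Some j then fun z => test_fun N a z * auto_ball a z 0 j else test_fun N a.

Lemma auto_ball_holomorphic (a : Cn R n) j : cnorm a < 1 -> holomorphic (fun z => auto_ball a z 0 j).
Proof.
move=> a1 z z1.
have h1 : holo_at (fun z => (1 - cinner z a)^-1) z.
  have := test_fun_holomorphic 1 a1 z1.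
  have d0 : (1 - cnorm a)%:C%C != 0 :> R[i] by rewrite -cabs_gt0 cabs_real gtr0_norm subr_gt0.
  have E : (fun z => (1 - cinner z a)^-1) =
      (fun z => ((1 - cnorm a)%:C%C)^-1 * test_fun 1 a z).
    by apply/funext => y; rewrite /test_fun expr1 mulKf.
  by rewrite E; exact: holoZ.
have hc : holo_at (fun z => cinner z a) z.
  have -> : (fun z => cinner z a) = (fun z => \sum_(j < n) (conjc (a 0 j)) * z 0 j).
    by apply/funext => y; rewrite /cinner; apply: eq_bigr => i _; ring.
  by apply: holo_sum => i; apply: holoZ; exact: holo_coord.
pose s : R[i] := (Num.sqrt (1 - cnorm a ^+ 2))%:C%C.
have -> : (fun z => auto_ball a z 0 j) = (fun z => (1 - cinner z a)^-1 *
    (a 0 j + (- (cinner a a)^-1 * a 0 j * (1 - s)) * cinner z a + - s * z 0 j)).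
  apply/funext => y; rewrite /auto_ball /Pa !mxE -/s; congr (_ * _); ring.
apply: holoM => //; apply: holoD; last by apply: holoZ; exact: holo_coord.
by apply: holoD; [exact: holo_cst | exact: holoZ].
Qed.

Lemma test_family_holomorphic N a i : cnorm a < 1 -> holomorphic (test_family N a i).
Proof.
move=> a1; case: i => [j|] /=; last exact: test_fun_holomorphic.
by move=> z z1; apply: holoM; [exact: test_fun_holomorphic | exact: auto_ball_holomorphic].
Qed.

Lemma cabs_test_family N a i z : cnorm a < 1 -> cnorm z < 1 ->
  cabs (test_family N a i z) <= cabs (test_fun N a z).
Proof.
move=> a1 z1; case: i => [j|] //=; rewrite cabsM ler_piMr //.
by apply: le_trans (cabs_coord_le _ _) _; exact/ltW/auto_ball_lt1.
Qed.

Variables (phi psi : Cn R n -> Cn R n) (u v : Cn R n -> R[i]).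
Variable mu : {measure set T -> \bar R}.
Hypotheses (hphi : holo_selfmap phi) (hpsi : holo_selfmap psi).
Hypotheses (hu : Lq_measurable u) (hv : Lq_measurable v).
Variable r : R.
Hypothesis r01 : 0 < r < 1.

Let Top := wcomp_diff u v phi psi.

Let weight (z : Cn R n) : R := (pseudohyp (phi z) (psi z) * cabs (u z)) `^ q +
  \1_[set z | pseudohyp (phi z) (psi z) < r] z * cabs (u z - v z) `^ q.

(** The pointwise [test_inequality] raised to the power q and integrated over the preimage of the
    pseudohyperbolic ball, with [powR_sum_le] splitting the sum over the n + 1 test functions. *)
Lemma test_near_le N : exists2 C : R, 0 < C &
  forall (nu : {measure set T -> \bar R}), is_pushforward mu weight phi nu ->
  forall a (K : R), cnorm a < 1 ->
    (forall i, (Lq_int mu q (Top (test_family N a i)) <= K%:E)%E) ->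
    (nu [set z : T | near_ball a z] <= (C * K)%:E)%E.
Proof.
have [C C0 CP] := @test_inequality R n N r r01.
pose A := 2 * C `^ q * #|{: option 'I_n}|%:R `^ q.
have A0 : 0 <= A by rewrite !mulr_ge0 ?powR_ge0.
have cI : (0 : R) < #|{: option 'I_n}|%:R by rewrite ltr0n card_option.
exists (A * #|{: option 'I_n}|%:R); first by rewrite mulr_gt0 // !mulr_gt0 ?powR_gt0.
move=> nu nuE a K a1 HK.
have mN : measurable [set z : T | near_ball a z].
  by apply: measurable_near_ball; [exact: measurable_cst | exact: measurable_id].
rewrite (nuE _ mN) integral_mkcond.
pose G (z : T) : \bar R := (A%:E * \sum_(i : option 'I_n) (cabs (Top (test_family N a i) z) `^ q)%:E)%E.
have mT i : measurable_fun B (fun z : T => (cabs (Top (test_family N a i) z) `^ q)%:E).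
  apply/measurable_EFinP; apply: Lq_measurable_pow; apply: wcomp_measurable => //.
  exact: test_family_holomorphic.
have G0 z : (0 <= G z)%E.
  apply: mule_ge0; first by rewrite lee_fin.
  by apply: sume_ge0 => i _; rewrite lee_fin powR_ge0.
have w0 z : 0 <= weight z by rewrite /weight addr_ge0 ?mulr_ge0 ?powR_ge0.
apply: (@le_trans _ _ (\int[mu]_z (G \_ B) z)%E).
  apply: ge0_integral_mono => z; rewrite patchE.
    by case: ifP => // _; rewrite lee_fin.
  case: ifPn => [/set_mem [zB zn]|_]; last by rewrite patchE; case: ifP.
  rewrite patchE mem_set // /G sumEFin -EFinM lee_fin.
  have y1 : cnorm (psi z) < 1 := hpsi.2 z zB.
  have [h1 h2] := CP a (phi z) (psi z) (u z) (v z) zn y1.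
  set S := (X in _ <= C * X) in h1; rewrite -/S in h2.
  have SE : S = \sum_(i : option 'I_n) cabs (Top (test_family N a i) z).
    rewrite /S (bigD1 None) //=; congr (_ + _).
    rewrite (reindex_omap Some id) //=; last by case.
    by apply: eq_bigl => j; rewrite eqxx.
  have S0 : 0 <= S by rewrite SE sumr_ge0.
  have e1 : (pseudohyp (phi z) (psi z) * cabs (u z)) `^ q <= (C * S) `^ q.
    by apply: powR_le => //; [exact: ltW | rewrite mulr_ge0 // pseudohyp_ge0].
  have e2 : \1_[set z | pseudohyp (phi z) (psi z) < r] z * cabs (u z - v z) `^ q <= (C * S) `^ q.
    rewrite indicE; case: (boolP (z \in _)) => [/set_mem /= h|_]; last by rewrite mul0r powR_ge0.
    by rewrite mul1r; apply: powR_le; [exact: ltW | exact: cabs_ge0 | exact: h2].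
  have e3 : (C * S) `^ q <= C `^ q * (#|{: option 'I_n}|%:R `^ q *
      \sum_(i : option 'I_n) cabs (Top (test_family N a i) z) `^ q).
    rewrite powRM // ?(ltW C0) // ler_wpM2l ?powR_ge0 // SE.
    by apply: powR_sum_le.
  rewrite /weight /A; move: e1 e2 e3.
  have -> : 2 * C `^ q * #|{: option 'I_n}|%:R `^ q *
     (\sum_(i : option 'I_n) cabs (Top (test_family N a i) z) `^ q) =
    2 * (C `^ q * (#|{: option 'I_n}|%:R `^ q *
      \sum_(i : option 'I_n) cabs (Top (test_family N a i) z) `^ q)) by ring.
  move: (_ `^ q) (_ * _ `^ q) ((C * S) `^ q) (C `^ q * _) => x1 x2 x3 x4; lra.
rewrite -integral_mkcond ge0_integralZl_EFin //; last 2 first.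
- by move=> z _; apply: sume_ge0 => i _; rewrite lee_fin powR_ge0.
- by apply: emeasurable_fun_sum => i; exact: mT.
rewrite -[A * _ * K]mulrA [(A * _)%:E]EFinM; apply: lee_wpmul2l; first by rewrite lee_fin.
rewrite ge0_integral_sum //; last by move=> i z _; rewrite lee_fin powR_ge0.
apply: (@le_trans _ _ (\sum_(i : option 'I_n) K%:E)%E); first by apply: lee_sum => i _; exact: HK.
by rewrite sumEFin sumr_const mulr_natl.
Qed.

End TestOperators.

Lemma powRK (R : realType) (p x : R) : 0 < p -> 0 <= x -> (x `^ p) `^ p^-1 = x.
Proof. by move=> p0 x0; rewrite -powRrM mulfV ?lt0r_neq0 // powRr1. Qed.

Lemma powR_continuous_ge0 (R : realType) (q x e : R) : 0 < q -> 0 <= x -> 0 < e ->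
  exists2 d, 0 < d & forall y, 0 <= y -> `|y - x| < d -> `|y `^ q - x `^ q| < e.
Proof.
move=> q0; rewrite le_eqVlt => /predU1P[<-|x0] e0.
  exists (e `^ q^-1); first exact: powR_gt0.
  move=> y y0; rewrite subr0 (ger0_norm y0) => yd.
  rewrite powR0 ?gt_eqF // subr0 ger0_norm ?powR_ge0 //.
  rewrite -[ltRHS]powRr1 ?(ltW e0) // -(mulVf (lt0r_neq0 q0)) powRrM.
  by rewrite gt0_ltr_powR // nnegrE powR_ge0.
have c : {for x, continuous (fun t => expR (q * ln t))}.
  apply: (@continuous_comp _ _ _ (fun t => q * ln t) expR); last exact: continuous_expR.
  by apply: cvgM; [exact: cvg_cst | exact: continuous_ln].
move/cvgrPdist_lt : c => /(_ e e0) /nbhs_ballP[d d0 dP].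
exists (Num.min d x); first by rewrite lt_min d0 x0.
move=> y y0; rewrite lt_min => /andP[yd yx].
have yp : 0 < y by move: yx; rewrite ltr_norml => /andP[]; lra.
rewrite /powR !gt_eqF // distrC; apply: dP.
by rewrite /ball /= distrC.
Qed.

Lemma limn_einf_le (R : realType) (u : nat -> \bar R) (c : \bar R) :
  (forall k, (u k <= c)%E) -> (limn_einf u <= c)%E.
Proof.
move=> uc; rewrite limn_einf_lim; apply: lime_le; first exact: is_cvg_einfs.
apply: nearW => k; apply: le_trans (uc k).
by apply: ereal_inf_lbound; exists k => /=.
Qed.

Lemma fatou_powR_le d (T : measurableType d) (R : realType) (m : {measure set T -> \bar R})
    (D : set T) (f : nat -> T -> R) (g : T -> R) (q : R) (c : \bar R) :
  measurable D -> 0 < q -> (forall k, measurable_fun D (f k)) ->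
  (forall k x, 0 <= f k x) -> (forall x, 0 <= g x) ->
  (forall x, D x -> forall e, 0 < e -> exists N, forall k, (N <= k)%N -> `|f k x - g x| < e) ->
  (forall k, (\int[m]_(x in D) (f k x `^ q)%:E <= c)%E) ->
  (\int[m]_(x in D) (g x `^ q)%:E <= c)%E.
Proof.
move=> mD q0 mf f0 g0 fg fc.
have mfq k : measurable_fun D (fun x => (f k x `^ q)%:E).
  by apply/measurable_EFinP; apply: measurableT_comp (measurable_powR q) (mf k).
suff E : (\int[m]_(x in D) (g x `^ q)%:E =
    \int[m]_(x in D) limn_einf (fun k => (f k x `^ q)%:E))%E.
  rewrite E; apply: (le_trans (fatou m mD mfq _)).
    by move=> k x _; rewrite lee_fin powR_ge0.
  exact: limn_einf_le.
apply: eq_integral => x /set_mem xD; apply/esym.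
suff cv : (fun k => (f k x `^ q)%:E) @ \oo --> (g x `^ q)%:E by rewrite (cvg_limn_einf_sup cv).1.
apply: cvg_EFin; first exact: nearW.
apply/cvgrPdist_lt => e e0.
have [d1 d10 d1P] := powR_continuous_ge0 q0 (g0 x) e0.
have [N NP] := fg x xD d1 d10.
by exists N => // k /= Nk; rewrite distrC; apply: d1P => //; exact: NP.
Qed.

Lemma ge0_integral_le_scaleD d (T : measurableType d) (R : realType)
    (m : {measure set T -> \bar R}) (D : set T) (f g h : T -> R) (c : R) :
  measurable D -> measurable_fun D f -> measurable_fun D g -> measurable_fun D h ->
  0 <= c -> (forall x, 0 <= f x) -> (forall x, 0 <= g x) -> (forall x, 0 <= h x) ->
  (forall x, f x <= c * (g x + h x)) ->
  (\int[m]_(x in D) (f x)%:E <=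
   c%:E * (\int[m]_(x in D) (g x)%:E + \int[m]_(x in D) (h x)%:E))%E.
Proof.
move=> mD mf mg mh c0 f0 g0 h0 fgh.
have mgE : measurable_fun D (fun x => (g x)%:E) by exact/measurable_EFinP.
have mhE : measurable_fun D (fun x => (h x)%:E) by exact/measurable_EFinP.
have mghE : measurable_fun D (fun x => (g x)%:E + (h x)%:E)%E by exact: emeasurable_funD.
have gh0 x : D x -> (0 <= (g x)%:E + (h x)%:E)%E by rewrite -EFinD lee_fin addr_ge0.
rewrite -ge0_integralD; [|exact: mD|by move=> x _; rewrite lee_fin|exact: mgE|
  by move=> x _; rewrite lee_fin|exact: mhE].
rewrite -ge0_integralZl_EFin; [|exact: mD|exact: gh0|exact: mghE|exact: c0].
apply: ge0_le_integral; first exact: mD.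
- by move=> x _; rewrite lee_fin.
- exact/measurable_EFinP.
- by apply: emeasurable_funM => //; exact: measurable_cst.
by move=> x _; rewrite -EFinD -EFinM lee_fin.
Qed.

Lemma ereal_cvg0P (R : realType) (u : nat -> \bar R) : (forall k, (0 <= u k)%E) ->
  (u @ \oo --> 0%E) <->
  (forall e : R, 0 < e -> exists N, forall k, (N <= k)%N -> (u k <= e%:E)%E).
Proof.
move=> u0; rewrite -[0%E]/(0%:E); split.
  move/fine_cvgP => [uf /cvgrPdist_lt uc] e e0.
  have [N1 _ N1P] := uf; have [N2 _ N2P] := uc e e0.
  exists (maxn N1 N2) => k; rewrite geq_max => /andP[k1 k2].
  have fk : u k \is a fin_num by exact: N1P.
  have := N2P k k2; rewrite /= sub0r normrN => /ltW h.
  by rewrite -(fineK fk) lee_fin; apply: le_trans h; exact: ler_norm.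
move=> H; apply/fine_cvgP.
have fk k (e : R) : (u k <= e%:E)%E -> u k \is a fin_num.
  by move=> h; rewrite ge0_fin_numE //; exact: le_lt_trans h (ltry _).
split; first by have [N NP] := H 1 ltr01; exists N => // k /= /NP; exact: fk.
apply/cvgrPdist_le => e e0; have [N NP] := H e e0.
exists N => // k /= /NP h; rewrite sub0r normrN ger0_norm ?fine_ge0 //.
by rewrite -lee_fin fineK //; exact: fk h.
Qed.

(** * Consequences of boundedness and compactness of the operator *)

Section OperatorBounds.
Variables (R : realType) (n : nat) (V : {measure set (CnM R n) -> \bar R}).
Hypotheses (HV : normalized_volume V) (n0 : (0 < n)%N).
Variable omega : R -> R.
Hypotheses (Homega : radial_weight V omega) (HD : Dclass omega).
Variables p q : R.
Hypotheses (p0 : 0 < p) (pq : p <= q).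

Let T := CnM R n.
Let B : set T := @ball_n R n.
Let mB : measurable B := @measurable_ball R n.
Let q0 : 0 < q := lt_le_trans p0 pq.
Let bw (z : Cn R n) : R := @box_weight R n omega (1 - cnorm z).
Let bw_gt0 z : cnorm z < 1 -> 0 < bw z.
Proof. by move=> z1; apply: (box_weight_gt0 HV n0 Homega HD); rewrite subr_gt0. Qed.

(** With [s = 0] this is the geometric Carleson condition; the vanishing one asks, for every
    [K > 0], for some [s < 1]. *)
Definition near_bounded (nu : {measure set T -> \bar R}) (s K : R) : Prop :=
  forall a, s <= cnorm a -> cnorm a < 1 ->
    (nu [set z : T | near_ball a z] <= (K * bw a `^ (q / p))%:E)%E.

Lemma Lq_int_quasi_triangle (m : {measure set T -> \bar R}) (f g : Cn R n -> R[i]) :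
  Lq_measurable f -> Lq_measurable g ->
  (Lq_int m q (fun z => f z - g z)%R <= (2 `^ q)%:E * (Lq_int m q f + Lq_int m q g))%E.
Proof.
move=> mf mg; apply: ge0_integral_le_scaleD; first exact: mB.
- by apply: Lq_measurable_pow; exact: Lq_measurableB.
- exact: Lq_measurable_pow.
- exact: Lq_measurable_pow.
- exact: powR_ge0.
- by move=> z; exact: powR_ge0.
- by move=> z; exact: powR_ge0.
- by move=> z; exact: powR_ge0.
move=> z; apply: le_trans (powRD_le q0 (cabs_ge0 (f z)) (cabs_ge0 (g z))).
by apply: powR_le; [exact: ltW | exact: cabs_ge0 | rewrite -(cabsN (g z)); exact: cabsD].
Qed.

Lemma carleson_of_near (nu : {measure set T -> \bar R}) (K : R) : 0 <= K ->
  near_bounded nu 0 K -> carleson V omega p q nu.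
Proof.
move=> K0 nuK; have [C C0 CP] := carleson_embedding HV n0 Homega HD p0 pq.
exists ((C * K) `^ q^-1) => f hf; have [fh fi] := hf.
have L : (Lq_int nu q f <= (C * K * fine (Ap_int V omega p f) `^ (q / p))%:E)%E.
  by apply: CP => // a a1; apply: nuK => //; exact: cnorm_ge0.
split; first by split; [exact: holomorphic_measurable | exact: le_lt_trans L (ltry _)].
have I0 := Ap_int_ge0 Homega p f.
have IE : Ap_int V omega p f = (fine (Ap_int V omega p f))%:E.
  by rewrite fineK // ge0_fin_numE.
rewrite /Lq_norm /Ap_norm IE poweR_EFin -EFinM.
apply/(poweR_inv_le q0 (Lq_int_ge0 q _ _)); first by rewrite mulr_ge0 ?powR_ge0.
move/le_trans: L; apply; rewrite lee_fin (powRM _ (powR_ge0 _ _) (powR_ge0 _ _)).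
by rewrite -!powRrM mulVf ?lt0r_neq0 // (powRr1 (mulr_ge0 (ltW C0) K0)) [p^-1 * q]mulrC.
Qed.

Variables (phi psi : Cn R n -> Cn R n) (u v : Cn R n -> R[i]).
Variable mu : {measure set T -> \bar R}.
Hypotheses (hphi : holo_selfmap phi) (hpsi : holo_selfmap psi).
Hypotheses (hu : Lq_measurable u) (hv : Lq_measurable v).
Variable r : R.
Hypothesis r01 : 0 < r < 1.

Let Top := wcomp_diff u v phi psi.

Definition difference_weight (z : Cn R n) : R := (pseudohyp (phi z) (psi z) * cabs (u z)) `^ q +
  \1_[set z | pseudohyp (phi z) (psi z) < r] z * cabs (u z - v z) `^ q.

(** Division by W(a)^(1/p) makes these functions a bounded family in the Bergman space, uniformly in
    [a]. *)
Definition normalized_test N a i (z : Cn R n) : R[i] :=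
  ((bw a `^ p^-1)^-1)%:C%C * test_family N a i z.

Lemma normalized_test_holomorphic N a i : cnorm a < 1 -> holomorphic (normalized_test N a i).
Proof. by move=> a1 z z1; apply: holoZ; exact: test_family_holomorphic. Qed.

Let scale_gt0 a : cnorm a < 1 -> 0 < bw a `^ p^-1.
Proof. by move=> a1; rewrite powR_gt0 // bw_gt0. Qed.

Lemma cabs_normalized_test N a i z : cnorm a < 1 ->
  cabs (normalized_test N a i z) = (bw a `^ p^-1)^-1 * cabs (test_family N a i z).
Proof. by move=> a1; rewrite cabsM cabs_real ger0_norm // invr_ge0 powR_ge0. Qed.

Lemma wcomp_normalized_test N a i z : cnorm a < 1 ->
  cabs (Top (test_family N a i) z) = bw a `^ p^-1 * cabs (Top (normalized_test N a i) z).
Proof.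
move=> a1; have -> : Top (normalized_test N a i) z =
    ((bw a `^ p^-1)^-1)%:C%C * Top (test_family N a i) z.
  by rewrite /Top /wcomp_diff /normalized_test; ring.
by rewrite cabsM cabs_real ger0_norm ?invr_ge0 ?powR_ge0 // mulVKf // lt0r_neq0 // scale_gt0.
Qed.

Lemma wcomp_pow_measurable f : holomorphic f ->
  measurable_fun B (fun z : T => (cabs (Top f z) `^ q)%:E).
Proof.
move=> hf; have /(Lq_measurable_pow q) h := wcomp_measurable hu hv hphi hpsi hf.
exact/measurable_EFinP.
Qed.

Lemma normalized_test_int N Ct a i : cnorm a < 1 ->
  (Ap_int V omega p (test_fun N a) <= (Ct * bw a)%:E)%E ->
  (Ap_int V omega p (normalized_test N a i) <= Ct%:E)%E.
Proof.
move=> a1 CtP; have sc := scale_gt0 a1.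
have := Ap_int_le_scale Homega p0 (normalized_test_holomorphic N i a1)
  (test_fun_holomorphic N a1) (ltW (eq_ind_r (fun b => is_true b) sc (invr_gt0 _))).
move=> /(_ _)/le_trans; apply.
  move=> z z1; rewrite cabs_normalized_test // ler_wpM2l ?invr_ge0 ?powR_ge0 //.
  exact: cabs_test_family.
apply: (@le_trans _ _ ((((bw a `^ p^-1)^-1) `^ p)%:E * (Ct * bw a)%:E)%E).
  by apply: lee_wpmul2l => //; rewrite lee_fin powR_ge0.
rewrite -EFinM lee_fin -powRN -powRrM mulNr mulVf ?lt0r_neq0 // powRN powRr1 ?(ltW (bw_gt0 a1)) //.
by rewrite mulrCA mulVf ?mulr1 // lt0r_neq0 // bw_gt0.
Qed.

Lemma near_of_test_bound N : exists2 A : R, 0 < A &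
  forall nu : {measure set T -> \bar R}, is_pushforward mu difference_weight phi nu ->
  forall (s K : R), (forall a i, s <= cnorm a -> cnorm a < 1 ->
      (Lq_int mu q (Top (normalized_test N a i)) <= K%:E)%E) -> near_bounded nu s (A * K).
Proof.
have [A A0 AP] := test_near_le p0 pq mu hphi hpsi hu hv r01 N.
exists A => // nu nuE s K HK a sa a1.
rewrite -[A * _ * _]mulrA; apply: (AP nu nuE a _ a1) => i.
have -> : (Lq_int mu q (wcomp_diff u v phi psi (test_family N a i)) =
    (bw a `^ (q / p))%:E * Lq_int mu q (Top (normalized_test N a i)))%E.
  rewrite /Lq_int -ge0_integralZl_EFin; first last.
  - exact: powR_ge0.
  - by apply: wcomp_pow_measurable; exact: normalized_test_holomorphic.
  - by move=> z _; rewrite lee_fin powR_ge0.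
  - exact: mB.
  apply: eq_integral => z _; rewrite wcomp_normalized_test // -EFinM; congr (_%:E).
  by rewrite powRM ?powR_ge0 ?cabs_ge0 // -powRrM [p^-1 * q]mulrC.
rewrite [K * _]mulrC EFinM; apply: lee_wpmul2l; last exact: HK.
by rewrite lee_fin powR_ge0.
Qed.

Lemma bounded_op_int (c : R) : 0 <= c -> bounded_op V omega p mu q Top ->
  exists2 K : R, 0 <= K & forall f, in_Ap V omega p f -> (Ap_int V omega p f <= c%:E)%E ->
    (Lq_int mu q (Top f) <= K%:E)%E.
Proof.
move=> c0 [C0 bT]; pose C := Num.max C0 0.
have C_ge0 : 0 <= C by rewrite le_max lexx orbT.
have Cc : 0 <= C * c `^ p^-1 by rewrite mulr_ge0 ?powR_ge0.
exists ((C * c `^ p^-1) `^ q); first exact: powR_ge0.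
move=> f hf fc; have [_ L] := bT f hf; have I0 := Ap_int_ge0 Homega p f.
apply/(poweR_inv_le q0 (Lq_int_ge0 q _ _) Cc).
apply: (le_trans L); apply: (@le_trans _ _ (C%:E * Ap_norm V omega p f)%E).
  by apply: lee_wpmul2r; [exact: poweR_ge0 | rewrite lee_fin le_max lexx].
rewrite EFinM; apply: lee_wpmul2l => //.
apply/(poweR_inv_le p0 I0); first exact: powR_ge0.
by rewrite -powRrM mulVf ?lt0r_neq0 // powRr1.
Qed.

Lemma compact_op_subsequence (fs : nat -> Cn R n -> R[i]) (c : R) : 0 <= c ->
  compact_op V omega p mu q Top ->
  (forall k, in_Ap V omega p (fs k)) -> (forall k, (Ap_int V omega p (fs k) <= c%:E)%E) ->
  exists sigma g, [/\ forall k, (k <= sigma k)%N, in_Lq mu q g &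
    forall e : R, 0 < e -> exists N, forall k, (N <= k)%N ->
      (Lq_int mu q (fun z => Top (fs (sigma k)) z - g z)%R <= e%:E)%E].
Proof.
move=> c0 cT hfs fc.
have [] := cT fs (c `^ p^-1) hfs.
  move=> k; apply/(poweR_inv_le p0 (Ap_int_ge0 Homega p _)); first exact: powR_ge0.
  by rewrite -powRrM mulVf ?lt0r_neq0 // powRr1.
move=> sigma [g [sS [hg cv]]]; exists sigma, g; split => //.
  by elim=> // k IH; exact: leq_ltn_trans IH (sS k).
move=> e e0; have eq0 : 0 < e `^ q^-1 by rewrite powR_gt0.
have [N NP] := (ereal_cvg0P (fun k => poweR_ge0 _ _)).1 cv _ eq0.
exists N => k /NP /(poweR_inv_le q0 (Lq_int_ge0 q _ _)) h.
apply: le_trans (h _) _; first exact: powR_ge0.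
by rewrite -powRrM mulVf ?lt0r_neq0 // powRr1 // ltW.
Qed.

Lemma Lq_int_le_sub (f g : Cn R n -> R[i]) : Lq_measurable f -> Lq_measurable g ->
  (Lq_int mu q f <= (2 `^ q)%:E * (Lq_int mu q (fun z => f z - g z)%R + Lq_int mu q g))%E.
Proof.
move=> mf mg; apply: ge0_integral_le_scaleD; first exact: mB.
- exact: Lq_measurable_pow.
- by apply: Lq_measurable_pow; exact: Lq_measurableB.
- exact: Lq_measurable_pow.
- exact: powR_ge0.
- by move=> z; exact: powR_ge0.
- by move=> z; exact: powR_ge0.
- by move=> z; exact: powR_ge0.
move=> z; apply: le_trans (powRD_le q0 (cabs_ge0 (f z - g z)) (cabs_ge0 (g z))).
apply: powR_le; [exact: ltW | exact: cabs_ge0 |].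
by rewrite -[X in cabs X](subrK (g z)); exact: cabsD.
Qed.

(** [compact_op] speaks of sequences only and asserts neither a norm bound nor that T f lies in L^q.
    Both follow by contradiction: from functions f_k with integral of |T f_k|^q above k, a
    subsequence would have images converging to an element of L^q. *)
Lemma compact_op_int (c : R) : 0 <= c -> compact_op V omega p mu q Top ->
  exists2 K : R, 0 <= K & forall f, in_Ap V omega p f -> (Ap_int V omega p f <= c%:E)%E ->
    (Lq_int mu q (Top f) <= K%:E)%E.
Proof.
move=> c0 cT; apply: contrapT => nK.
have /choice [fs fsP] : forall k : nat, exists f, [/\ in_Ap V omega p f,
    (Ap_int V omega p f <= c%:E)%E & (k%:R%:E < Lq_int mu q (Top f))%E].
  move=> k; apply: contrapT => nf; apply: nK; exists k%:R => // f hf fc.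
  by rewrite leNgt; apply/negP => h; apply: nf; exists f.
have hfs k : in_Ap V omega p (fs k) by have [] := fsP k.
have [|sigma [g [sk [mg gf] cv]]] := compact_op_subsequence c0 cT hfs.
  by move=> k; have [] := fsP k.
have [N NP] := cv 1 ltr01.
have gE : Lq_int mu q g = (fine (Lq_int mu q g))%:E.
  by rewrite fineK // ge0_fin_numE // Lq_int_ge0.
pose L : R := 2 `^ q * (1 + fine (Lq_int mu q g)).
have [k [Nk Lk]] : exists k, (N <= k)%N /\ L <= k%:R.
  have Lj := archi_boundP (normr_ge0 L); set j := Num.bound _ in Lj; exists (maxn N j); split; first exact: leq_maxl.
  by apply: (le_trans (ler_norm _)); apply: (le_trans (ltW Lj)); rewrite ler_nat leq_maxr.
have [_ _ /ltW h] := fsP (sigma k).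
have := Lq_int_le_sub (wcomp_measurable hu hv hphi hpsi (hfs (sigma k)).1) mg.
rewrite gE => h2; have : ((sigma k)%:R%:E < L%:E)%E.
  have [_ _ h3] := fsP (sigma k); apply: (lt_le_trans h3); apply: (le_trans h2).
  rewrite EFinM EFinD; apply: lee_wpmul2l; first by rewrite lee_fin powR_ge0.
  by apply: leeD => //; exact: NP.
rewrite lte_fin ltNge (le_trans Lk) // ler_nat; exact: sk.
Qed.

Lemma near_of_int_bound : (forall c : R, 0 <= c -> exists2 K : R, 0 <= K &
    forall f, in_Ap V omega p f -> (Ap_int V omega p f <= c%:E)%E ->
    (Lq_int mu q (Top f) <= K%:E)%E) ->
  exists2 K : R, 0 <= K & forall nu : {measure set T -> \bar R},
    is_pushforward mu difference_weight phi nu -> near_bounded nu 0 K.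
Proof.
move=> H; have [N [Ct [Ct0 CtP _]]] := test_fun_integral HV n0 Homega HD p0.
have [K K0 KP] := H Ct (ltW Ct0); have [A A0 AP] := near_of_test_bound N.
exists (A * K); first by rewrite mulr_ge0 // ltW.
move=> nu nuE; apply: AP => // a i _ a1.
have I := normalized_test_int i a1 (CtP a a1).
apply: KP => //; split; [exact: normalized_test_holomorphic | exact: le_lt_trans I (ltry _)].
Qed.

(** Convergence along a subsequence in L^q and pointwise convergence to 0 have to be reconciled:
    Fatou's lemma applied to |T f_k - g| shows that the integral of |g|^q vanishes. *)
Lemma compact_op_vanish (fs : nat -> Cn R n -> R[i]) (c e : R) : 0 <= c ->
  compact_op V omega p mu q Top ->
  (forall k, in_Ap V omega p (fs k)) -> (forall k, (Ap_int V omega p (fs k) <= c%:E)%E) ->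
  (forall z, ball_n z -> forall e : R, 0 < e -> exists N, forall k, (N <= k)%N ->
    cabs (Top (fs k) z) < e) -> 0 < e -> exists k, (Lq_int mu q (Top (fs k)) <= e%:E)%E.
Proof.
move=> c0 cT hfs fc Tz e0.
have [sigma [g [sk [mg gf] cv]]] := compact_op_subsequence c0 cT hfs fc.
have mT k := wcomp_measurable hu hv hphi hpsi (hfs k).1.
have g0 : (Lq_int mu q g <= 0)%E.
  apply/lee_addgt0Pr => d d0; rewrite add0e; have [N NP] := cv d d0.
  apply: (@fatou_powR_le _ T _ mu B (fun k z => cabs (Top (fs (sigma (N + k)%N)) z - g z))
    (fun z => cabs (g z)) q) => //.
  - move=> k.
    have /Lq_measurable_pow -/(_ 1) := Lq_measurableB (mT (sigma (N + k)%N)) mg.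
    by apply: eq_measurable_fun => z _; rewrite powRr1 // cabs_ge0.
  - move=> z zB d' d'0; have [M MP] := Tz z zB d' d'0; exists M => k Mk.
    apply: le_lt_trans (MP (sigma (N + k)%N) _); last first.
      by apply: leq_trans (sk _); exact: leq_trans Mk (leq_addl _ _).
    rewrite -(cabsN (g z)); apply: le_trans (ler_dist_cabs _ _) _.
    by rewrite opprK subrK.
  - by move=> k; apply: NP; exact: leq_addr.
have [|N NP] := cv (e / 2 `^ q); first by rewrite divr_gt0 // powR_gt0.
exists (sigma N); apply: (le_trans (Lq_int_le_sub (mT _) mg)).
apply: (@le_trans _ _ ((2 `^ q)%:E * ((e / 2 `^ q)%:E + 0))%E).
  apply: lee_wpmul2l; first by rewrite lee_fin powR_ge0.
  by apply: leeD => //; exact: NP.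
by rewrite adde0 -EFinM lee_fin mulrC divfK // lt0r_neq0 // powR_gt0.
Qed.

(** The hypothesis is the decay part of [test_fun_integral]. Its extra factor 1 - |a| survives the
    normalization and forces pointwise convergence to 0 as |a| tends to 1. *)
Lemma normalized_test_le N Ct a i x : 0 <= Ct -> cnorm a < 1 -> cnorm x < 1 ->
  ((1 - cnorm a) ^+ N) `^ p <= Ct * ((1 - cnorm a) * bw a) ->
  cabs (normalized_test N a i x) <=
    (Ct * (1 - cnorm a)) `^ p^-1 / (1 - cnorm x) ^+ N.
Proof.
move=> Ct0 a1 x1 H; have sc := scale_gt0 a1; have bwa := bw_gt0 a1.
have t0 : 0 < 1 - cnorm a by rewrite subr_gt0.
have y0 : 0 < 1 - cnorm x by rewrite subr_gt0.
rewrite cabs_normalized_test // ler_pdivrMl //.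
apply: (le_trans (cabs_test_family N i a1 x1)).
have tN : (1 - cnorm a) ^+ N <= bw a `^ p^-1 * (Ct * (1 - cnorm a)) `^ p^-1.
  have tN0 : 0 <= (1 - cnorm a) ^+ N by rewrite exprn_ge0 // ltW.
  rewrite -[leLHS](powRK p0) // -(powRM _ (ltW bwa) (mulr_ge0 Ct0 (ltW t0))).
  apply: powR_le; first by rewrite invr_ge0 ltW.
    exact: powR_ge0.
  by apply: (le_trans H); rewrite mulrA mulrC.
rewrite cabs_test_fun // exprMn mulrA; apply: ler_pM.
- by rewrite exprn_ge0 // ltW.
- by rewrite exprn_ge0 // invr_ge0 cabs_ge0.
- exact: tN.
have y : 1 - cnorm x <= cabs (1 - cinner x a).
  apply: le_trans (cabs_one_sub_cinner_ge x a).
  by rewrite lerB // ler_piMr ?cnorm_ge0 // ltW.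
rewrite exprVn lef_pV2 ?posrE ?exprn_gt0 ?(lt_le_trans y0) //.
by apply: lerXn2r => //; rewrite nnegrE ?(ltW y0) ?cabs_ge0.
Qed.

Lemma compact_near_small (e : R) : compact_op V omega p mu q Top -> 0 < e ->
  exists2 s : R, s < 1 & forall nu : {measure set T -> \bar R},
    is_pushforward mu difference_weight phi nu -> near_bounded nu s e.
Proof.
move=> cT e0; have [N [Ct [Ct0 CtP CtN]]] := test_fun_integral HV n0 Homega HD p0.
have [A A0 AP] := near_of_test_bound N.
have eA : 0 < e / A by rewrite divr_gt0.
suff [s s1 sP] : exists2 s : R, s < 1 & forall a i, s <= cnorm a -> cnorm a < 1 ->
    (Lq_int mu q (Top (normalized_test N a i)) <= (e / A)%:E)%E.
  exists s => // nu nuE a sa a1.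
  by have := AP nu nuE s _ sP a sa a1; rewrite [A * _]mulrC divfK // lt0r_neq0.
apply: contrapT => ns.
(* If no [s] works, there are centres with 1 - |a| <= 1/(k+1) whose test functions have images
   bounded away from 0; they are fed to [compact_op_vanish]. *)
have /choice [x xP] : forall k : nat, exists x : Cn R n * option 'I_n,
    [/\ 1 - k.+1%:R^-1 <= cnorm x.1, cnorm x.1 < 1 &
      ((e / A)%:E < Lq_int mu q (Top (normalized_test N x.1 x.2)))%E].
  move=> k; apply: contrapT => nx; apply: ns; exists (1 - k.+1%:R^-1).
    by rewrite ltrBlDr ltrDl invr_gt0.
  move=> a i ka a1; rewrite leNgt; apply/negP => h; apply: nx.
  by exists (a, i).
pose fs k := normalized_test N (x k).1 (x k).2.
have I k : (Ap_int V omega p (fs k) <= Ct%:E)%E.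
  by have [_ a1 _] := xP k; apply: normalized_test_int => //; exact: CtP.
have hfs k : in_Ap V omega p (fs k).
  have [_ a1 _] := xP k; split; first exact: normalized_test_holomorphic.
  exact: le_lt_trans (I k) (ltry _).
have small y (d : R) : cnorm y < 1 -> 0 < d -> exists M, forall k, (M <= k)%N ->
    cabs (fs k y) <= d.
  move=> y1 d0; have Y0 : 0 < (1 - cnorm y) ^+ N by rewrite exprn_gt0 // subr_gt0.
  (* As soon as 1/(k+1) <= z, the bound of [normalized_test_le] at [y] is at most [d]. *)
  pose z := (d * (1 - cnorm y) ^+ N) `^ p / Ct.
  have z0 : 0 < z by rewrite divr_gt0 // powR_gt0 // mulr_gt0.
  have zM := archi_boundP (ltW (etrans (invr_gt0 z) z0)); set M := Num.bound _ in zM.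
  exists M => k Mk; have [ka a1 _] := xP k.
  have t01 : 0 < 1 - cnorm (x k).1 <= 1.
    by rewrite subr_gt0 a1 /= lerBlDr lerDl cnorm_ge0.
  apply: (le_trans (normalized_test_le _ (ltW Ct0) a1 y1 (CtN _ t01))).
  rewrite ler_pdivrMr //.
  have dY : 0 <= d * (1 - cnorm y) ^+ N by rewrite mulr_ge0 // ltW.
  rewrite -[leRHS](powRK p0) //.
  apply: powR_le; first by rewrite invr_ge0 ltW.
    by rewrite mulr_ge0 ?(ltW Ct0) //; have /andP[/ltW] := t01.
  rewrite mulrC -ler_pdivlMr // -/z.
  have k0 : k.+1%:R^-1 <= z.
    rewrite -[leRHS]invrK lef_pV2 ?posrE ?invr_gt0 //.
    by apply: (le_trans (ltW zM)); rewrite ler_nat (leq_trans Mk).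
  by apply: le_trans k0; rewrite lerBlDr addrC -lerBlDr.
have [||k] := @compact_op_vanish fs Ct (e / A) (ltW Ct0) cT hfs I.
- move=> z zB d d0; have d2 : 0 < d / (1 + cabs (u z) + cabs (v z)).
    by rewrite divr_gt0 // -addrA ltr_pwDl // addr_ge0 ?cabs_ge0.
  have [M1 M1P] := small _ _ (hphi.2 z zB) d2.
  have [M2 M2P] := small _ _ (hpsi.2 z zB) d2.
  exists (maxn M1 M2) => k; rewrite geq_max => /andP[/M1P h1 /M2P h2].
  rewrite /Top /wcomp_diff; apply: (le_lt_trans (cabsD _ _)); rewrite cabsN (cabsM (u z)) (cabsM (v z)).
  have S0 : 0 < 1 + cabs (u z) + cabs (v z) by rewrite -addrA ltr_pwDl // addr_ge0 ?cabs_ge0.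
  set D := d / _ in d2 h1 h2.
  have -> : d = (1 + cabs (u z) + cabs (v z)) * D by rewrite mulrC divfK // lt0r_neq0.
  by have := cabs_ge0 (u z); have := cabs_ge0 (v z); nra.
- by [].
by have [_ _ h] := xP k; rewrite leNgt h.
Qed.

End OperatorBounds.

(** * Normal families and vanishing Carleson measures *)

Lemma cabs_add_real_le (R : realType) (A M : R) (x : R[i]) : 0 < M -> 2 * M <= A ->
  cabs x <= M -> cabs (A%:C%C + x) <= A + cre x + M ^+ 2 / A.
Proof.
move=> M0 AM xM; have A0 : 0 < A by apply: lt_le_trans AM; rewrite mulr_gt0.
have xr : `|cre x| <= M := le_trans (cre_le_cabs x) xM.
have d0 : 0 <= M ^+ 2 / A by rewrite divr_ge0 ?sqr_ge0 // ltW.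
move: xr; rewrite ler_norml => /andP[xr1 xr2].
apply: le_of_sqr; first by lra.
rewrite cabs_sq creE cimE cre_real cim_real add0r.
have := cabs_sq x; have x2 : cabs x ^+ 2 <= M ^+ 2.
  by apply: lerXn2r => //; rewrite nnegrE ?cabs_ge0 // ltW.
have dA : M ^+ 2 / A * A = M ^+ 2 by rewrite divfK // lt0r_neq0.
set d := M ^+ 2 / A in d0 dA *; move: (cre x) (cim x) (cabs x ^+ 2) x2 xr1 xr2 => s t k x2 xr1 xr2 E.
have : d * (2 * M) <= d * A by rewrite ler_wpM2l.
have : d * - M <= d * s by rewrite ler_wpM2l.
nra.
Qed.

(** By convexity the power lies below its chord on [0, 1]. *)
Lemma expr_one_plus_le (R : realType) (x : R) m : 0 <= x <= 1 ->
  (1 + x) ^+ m <= 1 + x * (2 ^+ m - 1).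
Proof.
move=> /andP[x0 x1]; elim: m => [|m IH]; first by rewrite !expr0 subrr mulr0 addr0.
have m1 : 1 <= (2 : R) ^+ m by rewrite exprn_ege1 // ler1n.
have h : (1 + x) * (1 + x) ^+ m <= (1 + x) * (1 + x * (2 ^+ m - 1)).
  by rewrite ler_wpM2l // addr_ge0.
rewrite !exprS; apply: (le_trans h); set y := 2 ^+ m in m1 *.
have a1 : 0 <= 1 - x by lra.
have a2 : 0 <= y - 1 by lra.
by have := mulr_ge0 (mulr_ge0 x0 a1) a2; lra.
Qed.

Section NormalFamilies.
Variables (R : realType) (n : nat) (V : {measure set (CnM R n) -> \bar R}).
Hypotheses (HV : normalized_volume V) (n0 : (0 < n)%N).

Let T := CnM R n.
Let disc (c : Cn R n) (s : R) : set T := [set w : T | cnorm ((w : Cn R n) - c) < s].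

Let disc_measurable c s : measurable (disc c s).
Proof.
apply: copen_measurable => z; rewrite /disc /= => zr; exists (s - cnorm (z - c)); first by rewrite subr_gt0.
by move=> w wz; have := cnorm_triangle w z c; move: wz; lra.
Qed.

Lemma ball_submean f (c : Cn R n) (s r1 : R) : holomorphic f -> 0 < s -> r1 < 1 ->
  (forall w, cnorm (w - c) <= s -> cnorm w <= r1) ->
  ((cabs (f c) * s ^+ (2 * n))%:E <= \int[V]_(w in disc c s) (cabs (f w))%:E)%E.
Proof.
move=> hf s0 r11 inr.
pose Om : set T := [set w : T | cnorm (w : Cn R n) < s].
have mOm : measurable Om by exact: cball_measurable.
have VOm : V Om = (s ^+ (2 * n))%:E.
  by rewrite -(volume_ball HV 0 s0); congr (V _); apply/seteqP; split=> w /=; rewrite subr0.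
have V_rot (g : T -> \bar R) (u : R[i]) : measurable_fun setT g -> (forall z, 0 <= g z)%E ->
    cabs u = 1 -> (\int[V]_z g (u *: (z : Cn R n))%R = \int[V]_z g z)%E.
  by move=> mg g0; exact: integral_rotate.
have Orot (u : R[i]) (w : Cn R n) : cabs u = 1 -> Om w -> Om (u *: w).
  by move=> u1; rewrite /Om /= cnormZ u1 mul1r.
have Os (w : Cn R n) : Om w -> cnorm w <= s by move/ltW.
have Oin (w : Cn R n) (x : R[i]) : Om w -> cabs x <= 1 -> cnorm (c + x *: w) <= r1.
  move=> /ltW Ow x1; apply: inr; rewrite addrC addKr cnormZ.
  by apply: le_trans Ow; rewrite ler_piMl ?cnorm_ge0.
have VOm1 : (V Om < +oo)%E by rewrite VOm ltry.
have H := @rotation_mean_le _ _ V (volume_sigma_finite HV) V_rot f 1 hf ltr01 Om c s r1 1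
  mOm s0 r11 Orot Os VOm1 Oin 0 1 (lexx 0) ler01 (lexx 1).
pose g (w : T) : R := \1_(disc c s) w * (if cnorm (w : Cn R n) < 1 then cabs (f w) `^ 1 else 0).
have mg : measurable_fun setT (fun w => (g w)%:E).
  apply/measurable_EFinP; apply: measurable_funM; last exact: measurable_ball_pow hf.
  by apply: measurable_indic; exact: disc_measurable.
have g0 w : (0 <= (g w)%:E)%E.
  by rewrite lee_fin mulr_ge0 //; case: ifP => // _; exact: powR_ge0.
have E1 : (\int[V]_(w in Om) (cabs (f (c + 0%:C%C *: (w : Cn R n))) `^ 1)%:E =
    (cabs (f c) * s ^+ (2 * n))%:E)%E.
  rewrite EFinM -VOm -[in RHS](powRr1 (cabs_ge0 (f c))).
  transitivity (\int[V]_(w in Om) (cabs (f c) `^ 1)%:E)%E; last exact: integral_cst.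
  by apply: eq_integral => w _; rewrite (_ : c + 0%:C%C *: (w : Cn R n) = c) // scale0r addr0.
have E2 : (\int[V]_(w in Om) (cabs (f (c + 1%:C%C *: (w : Cn R n))) `^ 1)%:E =
    \int[V]_w (g w)%:E)%E.
  rewrite -(integral_translate HV mg g0 c) integral_mkcond.
  apply: eq_integral => w _; rewrite patchE /g indicE.
  have -> : ((w : Cn R n) + c \in disc c s) = (w \in Om).
    by apply/idP/idP => /set_mem h; apply/mem_set; move: h; rewrite /disc /Om /= addrK.
  case: ifP => [/set_mem Ow|_]; last by rewrite mul0r.
  rewrite realc1 scale1r mul1r [w + c]addrC.
  have -> // : cnorm (c + (w : Cn R n)) < 1.
  by have := Oin w 1 Ow; rewrite cabs1 lexx scale1r => /(_ isT)/le_lt_trans; apply.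
rewrite -E1; apply: (le_trans H); rewrite E2 le_eqVlt; apply/orP; left; apply/eqP.
rewrite [RHS]integral_mkcond; apply: eq_integral => w _; rewrite patchE /g indicE.
case: (boolP (w \in disc c s)) => [/set_mem wd|_]; last by rewrite mul0r.
rewrite mul1r powRr1 ?cabs_ge0 //.
by have -> // : cnorm (w : Cn R n) < 1 := le_lt_trans (inr _ (ltW wd)) r11.
Qed.

Lemma cabs_disc_measurable f c s : holomorphic f -> (forall w, disc c s w -> ball_n w) ->
  measurable_fun (disc c s) (fun w : T => (cabs (f w))%:E).
Proof.
move=> hf cB; have /(Lq_measurable_pow 1) m := holomorphic_measurable hf.
apply/measurable_EFinP; apply: (eq_measurable_fun (fun w : T => cabs (f w) `^ 1)).
  by move=> w _; rewrite powRr1 ?cabs_ge0.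
by apply: measurable_funS m; [exact: measurable_ball | exact: cB].
Qed.

(* [A + f] and [A - f] have nonnegative real parts, and their moduli exceed these
   by at most [M^2/A], so the two sub-mean value inequalities nearly add up to the
   mean value equality for [Re f]. *)
Lemma cre_oscillation f (c c' : Cn R n) (A M s s' r1 : R) : holomorphic f ->
  0 < s -> s <= s' -> r1 < 1 -> 0 < M -> 2 * M <= A ->
  (forall w, cnorm (w - c') <= s' -> cnorm w <= r1) ->
  (forall w, cnorm w <= r1 -> cabs (f w) <= M) ->
  cnorm (c - c') <= s' - s ->
  (A + cre (f c)) * s ^+ (2 * n) + (A - cre (f c')) * s' ^+ (2 * n) <=
  (2 * A + 2 * (M ^+ 2 / A)) * s' ^+ (2 * n).
Proof.
move=> hf s0 ss' r11 M0 AM inr fM cc'.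
have s'0 : 0 < s' := lt_le_trans s0 ss'.
pose F (x : R[i]) (w : Cn R n) := A%:C%C + x * f w.
have hF x : holomorphic (F x).
  by move=> z z1; apply: holoD; [exact: holo_cst | apply: holoZ; exact: hf].
have sub w : disc c s w -> disc c' s' w.
  by rewrite /disc /= => h; have := cnorm_triangle w c c'; move: h cc'; lra.
have dB w : disc c' s' w -> ball_n w by move=> /ltW /inr h; exact: le_lt_trans r11.
have inr_c w : cnorm (w - c) <= s -> cnorm w <= r1.
  by move=> h; apply: inr; have := cnorm_triangle w c c'; move: h cc'; lra.
have mF x : measurable_fun (disc c' s') (fun w : T => (cabs (F x w))%:E).
  exact: cabs_disc_measurable.
have H1 : (((A + cre (f c)) * s ^+ (2 * n))%:E <= \int[V]_(w in disc c' s') (cabs (F 1 w))%:E)%E.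
  apply: (@le_trans _ _ (cabs (F 1 c) * s ^+ (2 * n))%:E).
    rewrite lee_fin ler_wpM2r ?exprn_ge0 ?(ltW s0) //.
    apply: le_trans (cre_le_cabs _); apply: le_trans (ler_norm _).
    by rewrite /F mul1r creE cre_real.
  apply: (le_trans (ball_submean (hF 1) s0 r11 inr_c)).
  apply: (ge0_subset_integral _ (disc_measurable c s) (disc_measurable c' s') (mF 1)) => //.
  by move=> w _; rewrite lee_fin cabs_ge0.
have H2 : (((A - cre (f c')) * s' ^+ (2 * n))%:E <= \int[V]_(w in disc c' s') (cabs (F (-1) w))%:E)%E.
  apply: (@le_trans _ _ (cabs (F (-1) c') * s' ^+ (2 * n))%:E).
    rewrite lee_fin ler_wpM2r ?exprn_ge0 ?(ltW s'0) //.
    apply: le_trans (cre_le_cabs _); apply: le_trans (ler_norm _).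
    by rewrite /F mulN1r creE creN cre_real.
  exact: (ball_submean (hF (-1)) s'0 r11 inr).
rewrite -lee_fin EFinD; apply: (le_trans (leeD H1 H2)).
rewrite -ge0_integralD; [|exact: disc_measurable|by move=> w _; rewrite lee_fin cabs_ge0|
  exact: mF|by move=> w _; rewrite lee_fin cabs_ge0|exact: mF].
rewrite EFinM -(volume_ball HV c' s'0) -integral_cst; last exact: disc_measurable.
apply: ge0_le_integral; first exact: disc_measurable.
- by move=> w _; rewrite -EFinD lee_fin addr_ge0 ?cabs_ge0.
- by apply: emeasurable_funD; exact: mF.
- exact: measurable_cst.
move=> w wd; rewrite -EFinD lee_fin /F mul1r mulN1r.
have fw : cabs (f w) <= M by apply: fM; apply: inr; exact: ltW.
have := cabs_add_real_le M0 AM fw; have : cabs (- f w) <= M by rewrite cabsN.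
by move/(cabs_add_real_le M0 AM); rewrite creN; lra.
Qed.

(** The sub-mean value inequality over balls takes the place of Cauchy estimates: [cre_oscillation]
    compares a ball around [c] with a slightly larger one around [c']. *)
Lemma equicontinuous (r0 M e : R) : r0 < 1 -> 0 < M -> 0 < e ->
  exists2 d, 0 < d & forall f : Cn R n -> R[i], holomorphic f ->
    (forall w, cnorm w <= (1 + r0) / 2 -> cabs (f w) <= M) ->
    forall c c', cnorm c <= r0 -> cnorm c' <= r0 -> cnorm (c - c') <= d ->
    cabs (f c - f c') <= e.
Proof.
move=> r01 M0 e0; pose P : R := 2 ^+ (2 * n).
have P1 : 1 <= P by rewrite exprn_ege1 // ler1n.
have P0 : 0 < P := lt_le_trans ltr01 P1.
(* With P = 2^(2n), the oscillation is at most (A + M) x P + 2 (M^2 / A) P, where [x] is the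
   relative enlargement of the radius. First [A] makes the second term at most e/2, then [x] does
   the same for the first. The radius [s] is small enough for the enlarged ball to stay in |z| <= (1
   + r0) / 2. *)
pose A := 2 * M + M ^+ 2 * (4 * P / e); pose s := (1 - r0) / 4.
have s0 : 0 < s by rewrite divr_gt0 // subr_gt0.
have A2 : 2 * M <= A.
  by rewrite lerDl mulr_ge0 ?sqr_ge0 // divr_ge0 ?(ltW e0) // mulr_ge0 // ltW.
have A0 : 0 < A by apply: lt_le_trans A2; rewrite mulr_gt0.
pose x := Num.min 1 (e / (2 * (A + M) * P)).
have AMP : 0 < 2 * (A + M) * P by rewrite !mulr_gt0 // addr_gt0.
have x0 : 0 < x by rewrite lt_min ltr01 divr_gt0.
have x1 : x <= 1 by rewrite ge_min lexx.
have xe : x * (2 * (A + M) * P) <= e by rewrite -ler_pdivlMr // ge_min lexx orbT.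
have dP : M ^+ 2 / A * (4 * P) <= e.
  rewrite mulrAC ler_pdivrMr //.
  have : M ^+ 2 * (4 * P / e) <= A by rewrite lerDr mulr_ge0 // ltW.
  by rewrite mulrA ler_pdivrMr // [A * e]mulrC.
exists (x * s); first by rewrite mulr_gt0.
move=> f hf fM c c' cr c'r cc'.
have [->|w0] := eqVneq (f c) (f c'); first by rewrite subrr cabs0 ltW.
set w := f c - f c'; have wn0 : w != 0 by rewrite subr_eq0.
have w_gt0 : 0 < cabs w by rewrite cabs_gt0.
(* Multiplication by this unimodular number makes the difference of the two values real and
   positive, so that bounding the real part is enough. *)
pose o := conjc w * ((cabs w)^-1)%:C%C.
have o1 : cabs o = 1.
  by rewrite cabsM cabs_conjc cabs_real gtr0_norm ?invr_gt0 // mulfV // lt0r_neq0.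
have ow : cre (o * f c) - cre (o * f c') = cabs w.
  rewrite -creN -creE -mulrBr -/w /o mulrAC [conjc w * w]mulrC conjc_mul -realcM cre_real.
  by rewrite expr2 mulfK // lt0r_neq0.
have hof : holomorphic (fun z => o * f z) by move=> z z1; apply: holoZ; exact: hf.
have xs : x * s <= s by rewrite ler_piMl // ltW.
have r11 : (1 + r0) / 2 < 1 by lra.
have inr z : cnorm (z - c') <= s + x * s -> cnorm z <= (1 + r0) / 2.
  move=> h; have := ler_cnormB z c'; move: h xs c'r; rewrite /s; lra.
have ofM z : cnorm z <= (1 + r0) / 2 -> cabs (o * f z) <= M.
  by move=> /fM; rewrite cabsM o1 mul1r.
have ss' : s <= s + x * s by rewrite lerDl mulr_ge0 // ltW.
have sd : cnorm (c - c') <= s + x * s - s by rewrite [s + _]addrC addrK.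
have H := cre_oscillation hof s0 ss' r11 M0 A2 inr ofM sd.
have c'M : cre (o * f c') <= M.
  apply: (le_trans (ler_norm _)); apply: (le_trans (cre_le_cabs _)); apply: ofM; lra.
have E : (s + x * s) ^+ (2 * n) = s ^+ (2 * n) * (1 + x) ^+ (2 * n).
  by rewrite -exprMn; congr (_ ^+ _); ring.
have S0 : 0 < s ^+ (2 * n) by rewrite exprn_gt0.
rewrite E in H; set S := s ^+ (2 * n) in H S0; set Y := (1 + x) ^+ (2 * n) in H.
have x01 : 0 <= x <= 1 by rewrite x1 (ltW x0).
have YP : Y <= 1 + x * (P - 1) := expr_one_plus_le (2 * n) x01.
have Y1 : 1 <= Y by rewrite exprn_ege1 // lerDl ltW.
set d := M ^+ 2 / A in dP H; have d0 : 0 <= d by rewrite divr_ge0 ?sqr_ge0 // ltW.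
have {H} H : (A + cre (o * f c)) + (A - cre (o * f c')) * Y <= (2 * A + 2 * d) * Y.
  rewrite -(ler_pM2l S0); move: H; lra.
rewrite -ow; move: (cre (o * f c)) (cre (o * f c')) H c'M => t t' H c'M.
have Y2 : Y - 1 <= x * P by lra.
have YPP : Y <= P.
  have : 0 <= (1 - x) * (P - 1) by rewrite mulr_ge0 ?subr_ge0.
  lra.
have h1 : (A + t') * (Y - 1) <= (A + M) * (x * P).
  apply: (@le_trans _ _ ((A + M) * (Y - 1))).
    by rewrite ler_wpM2r ?subr_ge0 // lerD2l.
  by rewrite ler_wpM2l // addr_ge0 // ltW.
have h2 : d * Y <= d * P by rewrite ler_wpM2l.
lra.
Qed.

(** The limit [g] is taken pointwise along a free ultrafilter, so it exists on the whole ball before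
    any subsequence does. The index [sigma j] is then chosen with values within 1/(j+1) of [g] at
    those of the first j dense points that lie in the ball; equicontinuity extends the convergence
    to every point. *)
Lemma normal_family (fs : nat -> Cn R n -> R[i]) : (forall k, holomorphic (fs k)) ->
  (forall r0, r0 < 1 -> exists M : R, forall k z, cnorm z <= r0 -> cabs (fs k z) <= M) ->
  exists sigma g, (forall k, (sigma k < sigma k.+1)%N) /\
    forall z, ball_n z -> forall e : R, 0 < e -> exists N, forall k, (N <= k)%N ->
      cabs (fs (sigma k) z - g z) < e.
Proof.
move=> hfs fsM; have [U [UU Ufree]] := ex_free_ultrafilter.
have /choice [g gP] : forall z, exists l, ball_n z -> forall e : R, 0 < e ->
    U [set k | cabs (fs k z - l) < e].
  move=> z; have [zB|/negP zB] := boolP (cnorm z < 1); last by exists 0.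
  have [M MP] := fsM _ zB; have [l lP] := ultra_complex_limit UU (fun k => MP k z (lexx _)).
  by exists l.
have [s sP] := dense_sequence R n.
have UJ (J : nat) (e : R) : 0 < e ->
    U [set k | forall i, (i < J)%N -> ball_n (s i) -> cabs (fs k (s i) - g (s i)) < e].
  move=> e0; elim: J => [|J IH]; first by apply: filterE => k i.
  have [sB|sB] := pselect (ball_n (s J)).
    apply: filterS (filterI IH (gP _ sB e e0)) => k [h1 h2] i.
    by rewrite ltnS leq_eqVlt => /predU1P[->//|]; exact: h1.
  apply: filterS IH => k h i; rewrite ltnS leq_eqVlt => /predU1P[->//|]; exact: h.
have /choice [nx nxP] : forall jN : nat * nat, exists k, (jN.2 <= k)%N /\
    forall i, (i < jN.1)%N -> ball_n (s i) -> cabs (fs k (s i) - g (s i)) < jN.1.+1%:R^-1.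
  move=> [j N] /=; have j0 : (0 : R) < j.+1%:R^-1 by rewrite invr_gt0.
  by have [k [h1 h2]] := filter_ex (filterI (Ufree N) (UJ j _ j0)); exists k.
pose sigma := fix sg j := if j is j'.+1 then nx (j, (sg j').+1) else nx (0%N, 0%N).
have sigma_lt k : (sigma k < sigma k.+1)%N by have [] := nxP (k.+1, (sigma k).+1).
have sigmaP j i : (i < j)%N -> ball_n (s i) -> cabs (fs (sigma j) (s i) - g (s i)) < j.+1%:R^-1.
  by case: j => // j ij; have [_] := nxP (j.+1, (sigma j).+1); exact.
exists sigma, g; split=> // z zB e e0.
pose r0 := (1 + cnorm z) / 2; have z1 : cnorm z < 1 := zB.
have r01 : r0 < 1 by rewrite /r0; lra.
have [M MP] : exists M : R, forall k w, cnorm w <= (1 + r0) / 2 -> cabs (fs k w) <= M.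
  by apply: fsM; lra.
have M0 : 0 < Num.max M 1 by rewrite lt_max ltr01 orbT.
have e8 : 0 < e / 8 by rewrite divr_gt0.
have [d d0 dP] := equicontinuous r01 M0 e8.
have {}dP k w : cnorm w <= r0 -> cnorm (w - z) <= d -> cabs (fs k w - fs k z) <= e / 8.
  move=> wr wz; apply: dP => //; last by rewrite /r0; lra.
  by move=> y /MP h; rewrite le_max h.
have m0 : 0 < Num.min d ((1 - cnorm z) / 2) by rewrite lt_min d0 divr_gt0 // subr_gt0.
have [i +] := sP z _ m0; rewrite lt_min => /andP[id iz].
have ir : cnorm (s i) <= r0 by have := ler_cnormB (s i) z; move: iz; rewrite /r0; lra.
have sB : ball_n (s i) := le_lt_trans ir r01.
have [k [k1 k2]] := filter_ex (filterI (gP _ zB _ e8) (gP _ sB _ e8)).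
have gg : cabs (g (s i) - g z) < e / 2.
  have := dP k (s i) ir (ltW id); move: k1 k2 => /=.
  have := cabs_triangle (g (s i)) (fs k (s i)) (g z).
  have := cabs_triangle (fs k (s i)) (fs k z) (g z).
  rewrite (cabsB_sym (g (s i)) (fs k (s i))); lra.
have zM := archi_boundP (ltW (divr_gt0 ltr01 e8)); set N := Num.bound _ in zM.
exists (maxn N i.+1) => j; rewrite geq_max => /andP[Nj ij].
have j8 : j.+1%:R^-1 <= e / 8.
  rewrite -[leRHS]invrK lef_pV2 ?posrE ?invr_gt0 // -[X in X <= _]div1r.
  by apply: (le_trans (ltW zM)); rewrite ler_nat (leq_trans Nj).
have {zM j8} := lt_le_trans (sigmaP j i ij sB) j8; have := dP (sigma j) (s i) ir (ltW id).
have := cabs_triangle (fs (sigma j) z) (fs (sigma j) (s i)) (g z).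
have := cabs_triangle (fs (sigma j) (s i)) (g (s i)) (g z).
rewrite (cabsB_sym (fs (sigma j) z) (fs (sigma j) (s i))); lra.
Qed.

End NormalFamilies.

(** * Compactness of the embedding *)

Section Vanishing.
Variables (R : realType) (n : nat) (V : {measure set (CnM R n) -> \bar R}).
Hypotheses (HV : normalized_volume V) (n0 : (0 < n)%N).
Variable omega : R -> R.
Hypotheses (Homega : radial_weight V omega) (HD : Dclass omega).
Variables p q : R.
Hypotheses (p0 : 0 < p) (pq : p <= q).

Let T := CnM R n.
Let B : set T := @ball_n R n.
Let mB : measurable B := @measurable_ball R n.
Let q0 : 0 < q := lt_le_trans p0 pq.

(** The embedding applied to the constant 1 shows that [nu] is finite on the ball, which makes a
    constant an admissible dominating function. *)
Lemma one_in_Ap : in_Ap V omega p (fun _ : Cn R n => 1).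
Proof.
split; first by move=> z _; exact: holo_cst.
have [om0 [_ /integrableP[_ I]]] := Homega.
apply: le_lt_trans I; rewrite le_eqVlt; apply/orP; left; apply/eqP.
apply: eq_integral => z /set_mem zB /=.
have z01 : 0 <= cnorm (z : Cn R n) < 1 by rewrite cnorm_ge0.
by rewrite cabs1 powR1 mul1r ger0_norm // ltW // om0.
Qed.

Lemma Lq_int_split (nu W : {measure set T -> \bar R}) (S : set T) (h : Cn R n -> R[i]) :
  measurable S -> Lq_measurable h ->
  (forall g : T -> \bar R, measurable_fun setT g -> (forall x, (0 <= g x)%E) ->
     (\int[W]_x g x = \int[nu]_(x in S) g x)%E) ->
  (Lq_int nu q h = Lq_int W q h +
     \int[nu]_(z in B `\` S) (cabs (h z) `^ q)%:E)%E.
Proof.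
move=> mS mh WP; pose F (z : T) : \bar R := (cabs (h z) `^ q)%:E.
have mF : measurable_fun B F by apply/measurable_EFinP; exact: Lq_measurable_pow.
have F0 z : (0 <= F z)%E by rewrite lee_fin powR_ge0.
have -> : Lq_int W q h = (\int[nu]_(z in B `&` S) F z)%E.
  rewrite /Lq_int integral_mkcond WP; first last.
  - by move=> x; rewrite patchE; case: ifP => _; [exact: F0 | exact: lexx].
  - by apply/(measurable_restrictT _ mB).
  by rewrite setIC -integral_mkcondr.
rewrite -/F /Lq_int -[X in (\int[nu]_(z in X) _ = _)%E](setUIDK B S).
have mI : measurable (B `&` S) by exact: measurableI.
have mD : measurable (B `\` S) by exact: measurableD.
apply: (ge0_integral_setU nu mI mD) => //; [by rewrite setUIDK| |].
  by move=> x _; exact: F0.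
by apply/disj_setPS => z [[_ zS] [_ nS]].
Qed.

Lemma vanishing_of_near (nu : {measure set T -> \bar R}) (K : R) : 0 <= K ->
  near_bounded omega p q nu 0 K ->
  (forall e : R, 0 < e -> exists2 s : R, s < 1 & near_bounded omega p q nu s e) ->
  vanishing_carleson V omega p q nu.
Proof.
move=> K0 nuK nu_small fs M hfs fsM.
pose c := Num.max M 0 `^ p; have c0 : 0 <= c by exact: powR_ge0.
have Mx0 : 0 <= Num.max M 0 by rewrite le_max lexx orbT.
have fc k : (Ap_int V omega p (fs k) <= c%:E)%E.
  apply/(poweR_inv_le p0 (Ap_int_ge0 Homega p _) Mx0).
  by apply: (le_trans (fsM k)); rewrite lee_fin le_max lexx.
have [Cg Cg0 CgP] := growth_bound HV n0 Homega HD p0.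
have bd r0 : r0 < 1 -> exists M : R, forall k z, cnorm z <= r0 -> cabs (fs k z) <= M.
  move=> r01; pose b := @box_weight R n omega (1 - r0).
  have b0 : 0 < b by apply: (box_weight_gt0 HV n0 Homega HD); rewrite subr_gt0.
  exists ((Cg * c / b) `^ p^-1) => k z zr; have z1 := le_lt_trans zr r01.
  have := CgP _ (hfs k).1 z z1 => h; rewrite -(powRK p0 (cabs_ge0 _)).
  apply: powR_le; [by rewrite invr_ge0 ltW | exact: powR_ge0 |].
  rewrite ler_pdivlMr //.
  apply: (@le_trans _ _ (cabs (fs k z) `^ p * @box_weight R n omega (1 - cnorm z))).
    rewrite ler_wpM2l ?powR_ge0 //; apply: (box_weight_le HV n0 Homega HD).
      by rewrite subr_ge0 ltW.
    by rewrite lerB.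
  rewrite -lee_fin; apply: (le_trans h); rewrite EFinM.
  by apply: lee_wpmul2l => //; rewrite lee_fin ltW.
have [sigma [g [sS cv]]] := normal_family HV (fun k => (hfs k).1) bd.
pose f k := fs (sigma k); have hf k : in_Ap V omega p (f k) := hfs _.
have mf k : Lq_measurable (f k) := holomorphic_measurable (hf k).1.
have mg : Lq_measurable g.
  have conv (P : R[i] -> R) : (forall x y, `|P x - P y| <= cabs (x - y)) ->
      forall z : T, B z -> (fun k => P (f k z)) @ \oo --> P (g z).
    move=> Pl z zB; apply/cvgrPdist_lt => e e0; have [N NP] := cv z zB e e0.
    exists N => // k /= /NP; apply: le_lt_trans.
    by rewrite distrC; exact: Pl.
  split.
    apply: (@measurable_fun_cvg _ T R B (fun k z => cre (f k z))); first by move=> k; exact: (mf k).1.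
    by apply: conv => x y; rewrite -creN -creE; exact: cre_le_cabs.
  apply: (@measurable_fun_cvg _ T R B (fun k z => cim (f k z))); first by move=> k; exact: (mf k).2.
  by apply: conv => x y; rewrite -cimN -cimE; exact: cim_le_cabs.
have mcf k : measurable_fun B (fun z : T => cabs (f k z)).
  by have := Lq_measurable_pow 1 (mf k); apply: eq_measurable_fun => z _; rewrite powRr1 // cabs_ge0.
have cvabs (z : T) : B z -> forall e, 0 < e -> exists N, forall k, (N <= k)%N ->
    `|cabs (f k z) - cabs (g z)| < e.
  move=> zB e e0; have [N NP] := cv z zB e e0; exists N => k /NP.
  by apply: le_lt_trans; exact: ler_dist_cabs.
have [C C0 CP] := carleson_embedding HV n0 Homega HD p0 pq.
pose cq := c `^ (q / p); have cq0 : 0 <= cq := powR_ge0 _ _.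
have embed (W : {measure set T -> \bar R}) L : 0 <= L -> near_bounded omega p q W 0 L ->
    (forall k, (Lq_int W q (f k) <= (C * L * cq)%:E)%E) /\
    (Lq_int W q g <= (C * L * cq)%:E)%E.
  move=> L0 WL.
  have H k : (Lq_int W q (f k) <= (C * L * cq)%:E)%E.
    apply: (le_trans (CP W L L0 (fun a a1 => WL a (cnorm_ge0 a) a1) (f k) (hf k))).
    rewrite lee_fin ler_wpM2l ?mulr_ge0 ?(ltW C0) //.
    apply: powR_le; first by rewrite divr_ge0 // ltW.
      exact: fine_ge0 (Ap_int_ge0 Homega p _).
    by rewrite -lee_fin fineK ?ge0_fin_numE ?(Ap_int_ge0 Homega) //; [exact: fc | exact: (hf k).2].
  split=> //.
  exact: (@fatou_powR_le _ T _ W B (fun k z => cabs (f k z)) (fun z => cabs (g z)) q).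
exists sigma, g; split=> //; split.
  by split=> //; have [_ h] := embed nu K K0 nuK; exact: le_lt_trans h (ltry _).
apply/ereal_cvg0P => [k|e' e'0]; first exact: poweR_ge0.
suff : forall e : R, 0 < e -> exists N, forall k, (N <= k)%N ->
    (Lq_int nu q (fun z => f k z - g z)%R <= e%:E)%E.
  move/(_ (e' `^ q) (powR_gt0 _ e'0)) => [N NP]; exists N => k /NP h.
  by apply/(poweR_inv_le q0 (Lq_int_ge0 q _ _) (ltW e'0)).
move=> e e0; have mfg k := Lq_measurableB (mf k) mg.
(* The tail costs 2^q (C eps cq + C eps cq), which this choice makes at most e/2; the added 1 covers
   the case [cq = 0]. *)
pose eps := e / (4 * 2 `^ q * (C * cq + 1)).
have Ccq : 0 <= C * cq by rewrite mulr_ge0 // ltW.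
have P2 : 0 < (2 : R) `^ q by rewrite powR_gt0.
have eps0 : 0 < eps by rewrite divr_gt0 // !mulr_gt0 // ltr_wpDl.
have [s0 s01 sP] := nu_small eps eps0.
pose s := Num.max s0 0; have s1 : s < 1 by rewrite gt_max s01 /=.
(* By [near_ball_dist], a pseudohyperbolic ball centred at |a| < s does not meet |z| >= t. The
   restriction of [nu] to |z| >= t is therefore small on every pseudohyperbolic ball, and
   [carleson_embedding] applies to it with the constant [eps]. *)
pose t := 1 - (1 - s) / 8; have t1 : t < 1 by rewrite /t; lra.
pose S : set T := [set z : T | t <= cnorm (z : Cn R n)].
have mS : measurable S.
  have -> : S = ~` [set z : T | cnorm (z : Cn R n) < t].
    by apply/seteqP; split=> z; rewrite /S /=; [rewrite leNgt => /negP | move/negP; rewrite -leNgt].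
  by apply: measurableC; exact: cball_measurable.
have [W [WE WP]] := restriction_measureP nu mS.
have mN a : measurable [set z : T | near_ball a z].
  by apply: measurable_near_ball; [exact: measurable_cst | exact: measurable_id].
have Wsmall : near_bounded omega p q W 0 eps.
  move=> a _ a1; rewrite WE //; have [sa|sa] := leP s (cnorm a).
    apply: le_trans (sP a _ a1); last by apply: le_trans sa; rewrite le_max lexx.
    by apply: le_measure; rewrite ?inE //; exact: measurableI.
  have R0 := mulr_ge0 (ltW eps0) (powR_ge0 (@box_weight R n omega (1 - cnorm a)) (q / p)).
  rewrite (_ : _ `&` S = set0); first by rewrite measure0 lee_fin.
  rewrite -subset0 => w [/near_ball_dist[h _ _]]; rewrite /S /= => tw.
  by move: sa h tw; rewrite /t; lra.
have [Wf Wg] := embed W eps (ltW eps0) Wsmall.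
have tail k : (Lq_int W q (fun z => f k z - g z)%R <= (e / 2)%:E)%E.
  apply: (le_trans (Lq_int_quasi_triangle p0 pq W (mf k) mg)).
  apply: (@le_trans _ _ ((2 `^ q)%:E * ((C * eps * cq)%:E + (C * eps * cq)%:E))%E).
    have L0 : (0 <= (2 `^ q)%:E)%E by rewrite lee_fin ltW.
    exact: (lee_wpmul2l L0 (leeD (Wf k) Wg)).
  rewrite -EFinD -EFinM lee_fin.
  have -> : 2 `^ q * (C * eps * cq + C * eps * cq) = e / 2 * (C * cq / (C * cq + 1)).
    by rewrite /eps; field; rewrite !lt0r_neq0 // ltr_wpDl.
  by rewrite ler_piMr ?divr_ge0 ?(ltW e0) // ler_pdivrMr ?ltr_wpDl // mul1r lerDl.
have [Mt MtP] := bd t t1.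
have mD : measurable (B `\` S) by exact: measurableD.
have DM k (z : T) : (B `\` S) z -> cabs (f k z) <= Mt.
  by move=> [_ zS]; apply: MtP; rewrite leNgt; apply/negP => /ltW.
have gM (z : T) : (B `\` S) z -> cabs (g z) <= Mt.
  move=> zD; apply/ler_addgt0Pl => d d0; have [N NP] := cvabs z zD.1 d d0.
  by have := NP N (leqnn _); have := DM N z zD; rewrite ltr_norml => h /andP[]; lra.
have nuD : (nu (B `\` S) < +oo)%E.
  apply: (@le_lt_trans _ _ (nu B)); first by apply: le_measure; rewrite ?inE //; exact: subDsetl.
  have H := CP nu K K0 (fun a a1 => nuK a (cnorm_ge0 a) a1) _ one_in_Ap.
  apply: le_lt_trans (ltry _); apply: le_trans H; rewrite le_eqVlt; apply/orP; left; apply/eqP.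
  by rewrite cabs1 powR1 integral_cst // mul1e.
have dom := @dominated_convergence _ T R nu (B `\` S) mD
  (fun k z => (cabs (f k z - g z) `^ q)%:E) (cst 0%E) (cst ((Mt + Mt) `^ q)%:E).
have [||||| _ _ ] := dom.
- move=> k; apply/measurable_EFinP; apply: measurable_funS (Lq_measurable_pow q (mfg k)) => //.
- exact: measurable_cst.
- apply: aeW => z zD; apply/(ereal_cvg0P (fun k => _)).
    by move=> k; rewrite lee_fin powR_ge0.
  move=> d d0; have [N NP] := cv z zD.1 (d `^ q^-1) (powR_gt0 _ d0).
  exists N => k /NP /ltW h; rewrite lee_fin.
  have -> : d = (d `^ q^-1) `^ q by rewrite -powRrM mulVf ?lt0r_neq0 // powRr1 // ltW.
  exact: (powR_le (ltW q0) (cabs_ge0 _) h).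
- apply/integrableP; split; first exact: measurable_cst.
  rewrite (eq_integral (cst ((Mt + Mt) `^ q)%:E)).
    by rewrite integral_cst // lte_mul_pinfty // lee_fin powR_ge0.
  by move=> z _ /=; rewrite ger0_norm // powR_ge0.
- apply: aeW => z k zD; rewrite abse_EFin lee_fin ger0_norm ?powR_ge0 //.
  apply: powR_le; [exact: ltW | exact: cabs_ge0 |].
  apply: le_trans (cabsD _ _) _; rewrite cabsN.
  by apply: lerD; [exact: DM | exact: gM].
rewrite integral0 => cvI.
have I0 k : (0 <= \int[nu]_(z in B `\` S) (cabs (f k z - g z) `^ q)%:E)%E.
  by apply: integral_ge0 => z _; rewrite lee_fin powR_ge0.
have [N NP] := (ereal_cvg0P I0).1 cvI (e / 2) (divr_gt0 e0 (ltr0Sn R 1)).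
exists N => k Nk; rewrite (Lq_int_split mS (mfg k) WP).
have -> : e = e / 2 + e / 2 by lra.
by rewrite EFinD; apply: leeD; [exact: tail | exact: NP].
Qed.

Variables (phi psi : Cn R n -> Cn R n) (u v : Cn R n -> R[i]).
Variable mu : {measure set T -> \bar R}.
Hypotheses (hphi : holo_selfmap phi) (hpsi : holo_selfmap psi).
Hypotheses (hu : Lq_measurable u) (hv : Lq_measurable v).
Variable r : R.
Hypothesis r01 : 0 < r < 1.
Variable nu : {measure set T -> \bar R}.
Hypothesis nuE : is_pushforward mu (difference_weight q phi psi u v r) phi nu.

Lemma carleson_pushforward : bounded_op V omega p mu q (wcomp_diff u v phi psi) ->
  carleson V omega p q nu.
Proof.
move=> bT.
have [K K0 KP] := near_of_int_bound HV n0 Homega HD p0 pq hphi hpsi hu hv r01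
  (fun c c0 => bounded_op_int Homega p0 pq c0 bT).
by apply: (carleson_of_near HV n0 Homega HD p0 pq K0); exact: KP.
Qed.

Lemma vanishing_carleson_pushforward :
  compact_op V omega p mu q (wcomp_diff u v phi psi) -> vanishing_carleson V omega p q nu.
Proof.
move=> cT.
have [K K0 KP] := near_of_int_bound HV n0 Homega HD p0 pq hphi hpsi hu hv r01
  (fun c c0 => compact_op_int Homega p0 pq hphi hpsi hu hv c0 cT).
apply: (vanishing_of_near K0 (KP nu nuE)) => e e0.
have [s s1 sP] := compact_near_small HV n0 Homega HD p0 pq hphi hpsi hu hv r01 cT e0.
by exists s => //; exact: sP.
Qed.

End Vanishing.

Lemma indic_eq (T : Type) (R : pzRingType) (A B : set T) (x y : T) : (A x <-> B y) ->
  \1_A x = \1_B y :> R.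
Proof.
by move=> AB; rewrite !indicE; congr (nat_of_bool _)%:R; apply/idP/idP => /set_mem /AB /mem_set.
Qed.

(** * Exchanging the two weighted composition operators *)

Section Symmetry.
Variables (R : realType) (n : nat) (V : {measure set (CnM R n) -> \bar R}).
Variables (omega : R -> R) (p q r : R) (mu : {measure set (CnM R n) -> \bar R}).

Lemma Lq_measurableN (f : Cn R n -> R[i]) : Lq_measurable f -> Lq_measurable (fun z => - f z).
Proof.
move=> [f1 f2]; split.
  apply: (eq_measurable_fun (fun z : CnM R n => - cre (f z))); last exact: measurable_funN.
  by move=> z _; rewrite creN.
apply: (eq_measurable_fun (fun z : CnM R n => - cim (f z))); last exact: measurable_funN.
by move=> z _; rewrite cimN.
Qed.

Lemma Lq_intN (f : Cn R n -> R[i]) : Lq_int mu q (fun z => - f z) = Lq_int mu q f.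
Proof. by apply: eq_integral => z _; rewrite cabsN. Qed.

Lemma in_LqN (f : Cn R n -> R[i]) : in_Lq mu q f -> in_Lq mu q (fun z => - f z).
Proof. by move=> [mf fi]; split; [exact: Lq_measurableN | rewrite Lq_intN]. Qed.

Lemma bounded_opN (T : (Cn R n -> R[i]) -> Cn R n -> R[i]) : bounded_op V omega p mu q T ->
  bounded_op V omega p mu q (fun f z => - T f z).
Proof.
move=> [C CP]; exists C => f /CP[fq fn].
by split; [exact: in_LqN | rewrite /Lq_norm Lq_intN].
Qed.

Lemma compact_opN (T : (Cn R n -> R[i]) -> Cn R n -> R[i]) : compact_op V omega p mu q T ->
  compact_op V omega p mu q (fun f z => - T f z).
Proof.
move=> cT fs M hfs fsM; have [sigma [g [sS [hg cv]]]] := cT fs M hfs fsM.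
exists sigma, (fun z => - g z); split; first exact: sS.
split; first exact: (in_LqN hg).
have E : (fun k => Lq_norm mu q (fun z => - T (fs (sigma k)) z - - g z)) =
    (fun k => Lq_norm mu q (fun z => T (fs (sigma k)) z - g z)).
  apply/funext => k; rewrite /Lq_norm -(Lq_intN (fun z => T (fs (sigma k)) z - g z)).
  have Z : (fun z => - T (fs (sigma k)) z - - g z) = (fun z => - (T (fs (sigma k)) z - g z)).
    by apply/funext => z; exact: (esym (opprD (T (fs (sigma k)) z) (- g z))).
  exact: (congr1 (fun h => (Lq_int mu q h `^ q^-1)%E) Z).
exact: (eq_ind_r (fun w => w @ \oo --> 0%E) cv E).
Qed.

Lemma wcomp_diffC (u v : Cn R n -> R[i]) (phi psi : Cn R n -> Cn R n) :
  wcomp_diff v u psi phi = (fun f z => - wcomp_diff u v phi psi f z).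
Proof. by apply/funext => f; apply/funext => z; rewrite /wcomp_diff opprB. Qed.

Lemma is_pushforward_eq (w w' : Cn R n -> R) (phi : Cn R n -> Cn R n) nu :
  (forall z, ball_n z -> w z = w' z) -> is_pushforward mu w phi nu -> is_pushforward mu w' phi nu.
Proof.
move=> ww' nuE E mE; rewrite (nuE E mE); apply: eq_integral => z /set_mem[zB _].
by rewrite (ww' z zB).
Qed.

Lemma difference_weightC (u v : Cn R n -> R[i]) (phi psi : Cn R n -> Cn R n) z :
  holo_selfmap phi -> holo_selfmap psi -> ball_n z ->
  difference_weight q psi phi v u r z = (pseudohyp (phi z) (psi z) * cabs (v z)) `^ q +
    \1_[set z | pseudohyp (phi z) (psi z) < r] z * cabs (u z - v z) `^ q.
Proof.
move=> hphi hpsi zB; have C := pseudohypC (hphi.2 z zB) (hpsi.2 z zB).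
have I : \1_[set z | pseudohyp (psi z) (phi z) < r] z =
    \1_[set z | pseudohyp (phi z) (psi z) < r] z :> R.
  by apply: indic_eq; split; rewrite /= C.
have comb (x x' a i i' y y' : R) : x = x' -> i = i' -> y = y' ->
    (x' * a) `^ q + i * y `^ q = (x * a) `^ q + i' * y' `^ q by move=> -> -> ->.
exact: comb C I (cabsB_sym _ _).
Qed.

End Symmetry.

Theorem theorem4p3 (R : realType) (n : nat)
  (V : {measure set (CnM R n) -> \bar R}) (omega : R -> R)
  (p q r : R) (phi psi : Cn R n -> Cn R n) (u v : Cn R n -> R[i])
  (mu : {measure set (CnM R n) -> \bar R}) :
  (0 < n)%N -> normalized_volume V ->
  0 < p -> p <= q -> 0 < r < 1 ->
  radial_weight V omega -> Dclass omega ->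
  holo_selfmap phi -> holo_selfmap psi ->
  Lq_measurable u -> Lq_measurable v ->
  let rho := fun z => pseudohyp (phi z) (psi z) in
  let G := [set z | rho z < r] in
  let w_eta_u := fun z => (rho z * cabs (u z)) `^ q in
  let w_eta_v := fun z => (rho z * cabs (v z)) `^ q in
  let w_sigma := fun z => \1_G z * cabs (u z - v z) `^ q in
  (bounded_op V omega p mu q (wcomp_diff u v phi psi) ->
     (forall nu_phi : {measure set (CnM R n) -> \bar R},
        is_pushforward mu (fun z => w_eta_u z + w_sigma z) phi nu_phi ->
        carleson V omega p q nu_phi) /\
     (forall nu_psi : {measure set (CnM R n) -> \bar R},
        is_pushforward mu (fun z => w_eta_v z + w_sigma z) psi nu_psi ->
        carleson V omega p q nu_psi)) /\
  (compact_op V omega p mu q (wcomp_diff u v phi psi) ->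
     (forall nu_phi : {measure set (CnM R n) -> \bar R},
        is_pushforward mu (fun z => w_eta_u z + w_sigma z) phi nu_phi ->
        vanishing_carleson V omega p q nu_phi) /\
     (forall nu_psi : {measure set (CnM R n) -> \bar R},
        is_pushforward mu (fun z => w_eta_v z + w_sigma z) psi nu_psi ->
        vanishing_carleson V omega p q nu_psi)).
Proof.
move=> n0 HV p0 pq r01 Homega HD hphi hpsi hu hv rho G w_eta_u w_eta_v w_sigma.
(* The claims on [psi] are those on [phi] for the exchanged data. The weights then agree only on the
   ball, where [pseudohyp] is symmetric, which is enough because pushforwards integrate over the
   ball. *)
have swap nu : is_pushforward mu (fun z => w_eta_v z + w_sigma z) psi nu ->
    is_pushforward mu (difference_weight q psi phi v u r) psi nu.
  by apply: is_pushforward_eq => z zB; exact: (esym (difference_weightC q r u v hphi hpsi zB)).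
split=> [bT|cT]; split=> nu nuE.
- exact: (carleson_pushforward HV n0 Homega HD p0 pq hphi hpsi hu hv r01 nuE bT).
- apply: (carleson_pushforward HV n0 Homega HD p0 pq hpsi hphi hv hu r01 (swap nu nuE)).
  by rewrite wcomp_diffC; exact: bounded_opN.
- exact: (vanishing_carleson_pushforward HV n0 Homega HD p0 pq hphi hpsi hu hv r01 nuE cT).
- apply: (vanishing_carleson_pushforward HV n0 Homega HD p0 pq hpsi hphi hv hu r01 (swap nu nuE)).
  by rewrite wcomp_diffC; exact: compact_opN.
Qed.
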